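(* Let $a<0<b$ with $|a|<|b|$, and let $V^{1},V^{2}\in L^{1}(\mathbb{R})$ be compactly supported potentials such that, for each $j=1,2$, the convex hull of the support of $V^{j}$ is $[a,b]$. Let $\det S^{j}(k)=-\hat{X}^{j}(-k)/\hat{X}^{j}(k)$ be the scattering determinant of $V^{j}$, regarded as a meromorphic function of $k\in\mathbb{C}$. If $V^{1}(x)=V^{2}(x)$ for almost every $x\in[0,b]$ and $\det S^{1}(k)=\det S^{2}(k)$ identically in $k$, then $V^{1}(x)=V^{2}(x)$ for almost every $x\in[a,b]$.
   Context: For a potential $V\in L^{1}(\mathbb{R})$ such that the convex hull of its support is $[a,b]$, consider the Schrödinger operator $-\frac{d^{2}}{dx^{2}}+V(x)$ on $\mathbb{R}$. Let $A_{-}(x,y)$ be the distributional solution of the wave equation (with $x$ playing the role of time) $$\big(-\partial_{x}^{2}+\partial_{y}^{2}+V(x)\big)A_{-}(x,y)=0,\qquad A_{-}(x,y)=\delta(x-y)\ \text{ for } x\ll 0 .$$ For $x\ge b$ one has $\partial_{y}A_{-}(x,y)=X(y-x)+Y(y+x)$ with uniquely determined compactly supported distributions $X$, $Y$, where $X$ is supported in $[-2(b-a),0]$ and $Y$ in $[2a,2b]$. Define the entire functions $$\hat{X}(k)=\int_{-2(b-a)}^{0}X(x)e^{-ikx}\,dx,\qquad \hat{Y}(k)=\int_{2a}^{2b}Y(y)e^{-iky}\,dy,\qquad k\in\mathbb{C},$$ where the integrals are understood as distributional pairings. Equivalently, if $u(\cdot,k)$ is the solution of $-u''+Vu=k^{2}u$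 with $u(x,k)=e^{-ikx}$ for $x\le a$, then $ik\,u(x,k)=\hat{X}(k)e^{-ikx}+\hat{Y}(k)e^{ikx}$ for $x\ge b$. These functions satisfy $\hat{X}(k)\hat{X}(-k)=k^{2}+\hat{Y}(k)\hat{Y}(-k)$ on $\mathbb{C}$. The scattering matrix is $$S(k)=\begin{pmatrix}\frac{ik}{\hat{X}(k)} & \frac{\hat{Y}(k)}{\hat{X}(k)}\\[4pt] \frac{\hat{Y}(-k)}{\hat{X}(k)} & \frac{ik}{\hat{X}(k)}\end{pmatrix},$$ and its determinant is $\det S(k)=-\hat{X}(-k)/\hat{X}(k)$. The superscript $j$ in $\hat{X}^{j}$, $S^{j}$ denotes the objects associated with the potential $V^{j}$. *)

(* Defs.v *)
From HB Require Import structures.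
From mathcomp Require Import all_boot all_order all_algebra.
From mathcomp Require Import all_classical all_reals all_analysis.
From mathcomp Require Import complex.

Set Implicit Arguments.
Unset Strict Implicit.
Unset Printing Implicit Defensive.

Import Order.TTheory GRing.Theory Num.Theory.
Import numFieldNormedType.Exports.

Local Open Scope classical_set_scope.
Local Open Scope ring_scope.
Local Open Scope complex_scope.

Definition cexp (R : realType) (z : R[i]) : R[i] :=
  (expR (complex.Re z))%:C * (cos (complex.Im z) +i* sin (complex.Im z)).

(* [R[i]^o] carries the norm topology of the complex field, so this is the
   complex derivative. *)
Definition entire (R : realType) (F : R[i] -> R[i]) : Prop :=
  forall z : R[i], derivable (F : R[i]^o -> R[i]^o) z 1.

(* Potentials may be complex-valued; real ones are those with zero imaginary part. *)
Definition cintegrable (R : realType) (f : R -> R[i]) : Prop :=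
  (@lebesgue_measure R).-integrable setT (EFin \o (fun x => complex.Re (f x))) /\
  (@lebesgue_measure R).-integrable setT (EFin \o (fun x => complex.Im (f x))).

Definition cintegral (R : realType) (D : set R) (f : R -> R[i]) : R[i] :=
  (\int[@lebesgue_measure R]_(x in D) complex.Re (f x))%R +i*
  (\int[@lebesgue_measure R]_(x in D) complex.Im (f x))%R.

(* Elements of L^1 are classes modulo null sets, so the support is the essential
   one: the complement of the largest open set on which [V = 0] almost
   everywhere. *)
Definition ess_support (R : realType) (V : R -> R[i]) : set R :=
  [set x | forall e : R, 0 < e ->
     ~ {ae @lebesgue_measure R, forall t, ball x e t -> V t = 0}].

(* The convex subsets of the line are the intervals. *)
Definition convex_hull (R : realType) (A : set R) : set R :=
  smallest (@is_interval R) A.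

(* - u'' + V u = k^2 u for [V] in L^1: [u] is C^1 with derivative [u'], and [u']
   is the primitive of (V - k^2) u, i.e. [u'] is locally absolutely continuous
   and the equation holds almost everywhere. *)
Definition schrodinger_solution (R : realType) (V : R -> R[i]) (k : R[i])
    (u : R -> R[i]) : Prop :=
  exists u' : R -> R[i],
    (forall x : R, is_derive x (1 : R) (fun t => complex.Re (u t)) (complex.Re (u' x)) /\
                   is_derive x (1 : R) (fun t => complex.Im (u t)) (complex.Im (u' x))) /\
    (forall x y : R, x <= y ->
       u' y - u' x = cintegral `[x, y] (fun t => (V t - k ^+ 2) * u t)).

(* [X] and [Y] stand for the Fourier transforms \hat{X}, \hat{Y}; they are
   determined by the relation below for k != 0, and at k = 0 by continuity. *)
Definition scattering_functions (R : realType) (a b : R) (V : R -> R[i])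
    (X Y : R[i] -> R[i]) : Prop :=
  [/\ entire X, entire Y &
      forall k : R[i], exists u : R -> R[i],
        [/\ schrodinger_solution V k u,
            forall x : R, x <= a -> u x = cexp (- ('i%C * k * x%:C)) &
            forall x : R, b <= x ->
              'i%C * k * u x = X k * cexp (- ('i%C * k * x%:C))
                             + Y k * cexp ('i%C * k * x%:C)]].

Definition scattering_det (R : realType) (X : R[i] -> R[i]) (k : R[i]) : R[i] :=
  - X (- k) / X k.

(* Main.v *)
(** Put k = i z with z real and |z| large.  The solution equal to e^{zx} on the
    left of a is e^{zx} (1 + \int A(x,s) e^{-zs} ds) with a bounded kernel A
    supported in 0 <= s <= 2(x - a), so every quantity below is, up to
    exponentially small errors, a Laplace transform on the half-line, and no
    complex analysis is needed: Lerch's theorem replaces Paley-Wiener, and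
    Titchmarsh's convolution theorem is proved by real methods.

    Let u_j solve the equation for k = - i y, and abbreviate X_j(y) = X^j(iy).
    As the determinants agree, w = X_2(y) u_1 - X_1(y) u_2 is a multiple h(y)
    e^{yx} of a pure exponential to the right of b, and on [0,b], where
    V^1 = V^2 = V, it solves the common equation.  Solving from b down to 0
    bounds h(y) F(y), where F is the transform of the potential V(-x) on [-b,0]
    against that solution.  For phi = h / X_2 the product phi F decays so fast
    that the convolution of the functions representing phi and F vanishes on an
    interval of length related to b; by Titchmarsh's theorem one of them
    vanishes near the start of its support.  It cannot be F, since then V would
    vanish near b, against the hypothesis on the support; as |a| < |b|, the
    function psi representing phi therefore starts with a genuine gap.

    The Wronskian of u_1 and u_2 gives X_2(-y) phi(y) = - W(y) / 2, where W is
    the transform of V^2 - V^1 on [a,0] against u_1 u_2.  Since X_2(-y) is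
    y - c + (a transform of a bounded compactly supported function), beyond the
    support of the right-hand side this says psi'(t) = c psi(t) - \int g(r)
    psi(t + r) dr.  All iterates of this bounded operator vanish on the initial
    gap, and integrating n times from there shows psi = 0.  Then W decays
    faster than any function supported on [a,0] allows, whence V^1 = V^2. *)
Require Import Defs.
From mathcomp Require Import all_boot all_order all_algebra.
From mathcomp Require Import all_classical all_reals all_analysis.
From mathcomp Require Import complex.
From mathcomp Require Import measurable_realfun.
From mathcomp Require Import ring lra.

Set Implicit Arguments.
Unset Strict Implicit.
Unset Printing Implicit Defensive.

Import Order.TTheory GRing.Theory Num.Theory.
Import numFieldNormedType.Exports.

Local Open Scope classical_set_scope.
Local Open Scope ring_scope.
Local Open Scope complex_scope.

(** * Real and complex integrals *)

(** The gap has an explicit length. With S = -2a, one function [f] represents e^{-Sy} phi and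
    another, [kkq], represents e^{-2by} F / y. As h F grows at most like e^{-2ay}, up to powers of
    y, the product of the two transforms decays at rate S + 2b + 2a = 2b, so f(s) kkq(r) = 0 for s +
    r < 2b. Since V does not vanish near b, some r < a + b has kkq(r) nonzero; hence f vanishes for
    s < 2b - (a + b) = S + (a + b). The gap beyond S has length a + b, positive because |a| < |b|. A
    gap is needed because the final equation is of advanced type: psi'(t) involves later values of
    psi, so one cannot march forward from initial data, and a growth bound alone would not exclude
    exponentials e^{lt} with l = c - \int g(r) e^{lr} dr. On a gap all iterates vanish at once. A
    potential is never recovered by inverting its transform. The function representing the
    transform, compared at two times, yields a Volterra equation of the second kind for the
    potential itself, which suits L^1 data and is solved by absorption from the right end of the
    interval. *)

Section RealIntegral.
Context {R : realType}.
Notation mu := (@lebesgue_measure R).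
Notation RT := (measurableTypeR R).

Lemma ae_imp (P Q : R -> Prop) : {ae mu, forall x, P x} ->
  (forall x, P x -> Q x) -> {ae mu, forall x, Q x}.
Proof.
by move=> h PQ; apply: filterS h => //; exact: (ae_filter_ringOfSetsType mu).
Qed.

Lemma ae_imp2 (P1 P2 Q : R -> Prop) : {ae mu, forall x, P1 x} ->
  {ae mu, forall x, P2 x} ->
  (forall x, P1 x -> P2 x -> Q x) -> {ae mu, forall x, Q x}.
Proof.
by move=> h1 h2 PQ; apply: filterS2 h1 h2 => //; exact: (ae_filter_ringOfSetsType mu).
Qed.

Definition L1 (f : R -> R) := mu.-integrable setT (EFin \o f).
Definition rI (f : R -> R) : R := (\int[mu]_x f x)%R.

Lemma L1_meas f : L1 f -> measurable_fun setT (f : RT -> RT).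
Proof. by move=> /integrableP[/measurable_EFinP]. Qed.

Lemma L1D f g : L1 f -> L1 g -> L1 (fun x => f x + g x).
Proof. by move=> hf hg; have := integrableD measurableT hf hg. Qed.

Lemma L1Z a f : L1 f -> L1 (fun x => a * f x).
Proof. by move=> hf; have := integrableZl measurableT a hf. Qed.

Lemma L1N f : L1 f -> L1 (fun x => - f x).
Proof. by move=> /(L1Z (-1)); under eq_fun do rewrite mulN1r. Qed.

Lemma L1B f g : L1 f -> L1 g -> L1 (fun x => f x - g x).
Proof. by move=> hf /L1N; exact: L1D. Qed.

Lemma L1_le f g : measurable_fun setT (f : RT -> RT) -> L1 g ->
  (forall x, `|f x| <= g x) -> L1 f.
Proof.
move=> mf hg fg; apply: (le_integrable measurableT _ _ hg).
  exact/measurable_EFinP.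
move=> x _ /=; rewrite lee_fin; apply: (le_trans (fg x)).
exact: ler_norm.
Qed.

Lemma L1_norm f : L1 f -> L1 (fun x => `|f x|).
Proof. by move=> /integrable_norm. Qed.

Lemma L1_0 : L1 (fun _ => 0).
Proof. exact: integrable0. Qed.

Lemma L1_itv (u v c : R) : L1 (fun x => c * ((u <= x) && (x <= v))%:R).
Proof.
apply: L1Z; have [uv|vu] := leP u v; last first.
  rewrite (_ : (fun x => _) = (fun=> 0)); first exact: L1_0.
  apply/funext => x; case: andP => // -[ux xv].
  by move: (le_trans ux xv); rewrite leNgt vu.
have : mu.-integrable `[u, v] (EFin \o (fun _ : R => 1)).
  apply: continuous_compact_integrable; first exact: segment_compact.
  by apply: continuous_subspaceT => x; exact: cst_continuous.
rewrite integrable_mkcond//=; apply: eq_integrable => // x _ /=.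
by rewrite patchE mem_setE in_itv/=; case: ifPn.
Qed.

Lemma rID f g : L1 f -> L1 g -> rI (fun x => f x + g x) = rI f + rI g.
Proof. by move=> hf hg; rewrite /rI RintegralD. Qed.

Lemma rIZ a f : L1 f -> rI (fun x => a * f x) = a * rI f.
Proof. by move=> hf; rewrite /rI RintegralZl. Qed.

Lemma rIB f g : L1 f -> L1 g -> rI (fun x => f x - g x) = rI f - rI g.
Proof. by move=> hf hg; rewrite /rI RintegralB. Qed.

Lemma rI_le f g : L1 f -> L1 g -> (forall x, f x <= g x) -> rI f <= rI g.
Proof. by move=> hf hg fg; apply: le_Rintegral. Qed.

Lemma rI_ge0 f : (forall x, 0 <= f x) -> 0 <= rI f.
Proof. by move=> h; apply: Rintegral_ge0. Qed.

Lemma rI_norm f : L1 f -> `|rI f| <= rI (fun x => `|f x|).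
Proof. by move=> hf; apply: le_normr_Rintegral. Qed.

Lemma rI_EFin f : L1 f -> (rI f)%:E = (\int[mu]_x (f x)%:E)%E.
Proof. by move=> hf; rewrite /rI /Rintegral fineK//; exact: integrable_fin_num. Qed.

(** Tonelli's measurability statement concerns nonnegative integrands, so the majorant [w] is added
    to make the integrand nonnegative and its integral is subtracted afterwards. *)
Lemma rI_param_meas d (T : measurableType d) (F : T -> R -> R) (w : R -> R) :
  measurable_fun setT (fun p : T * RT => F p.1 p.2) -> L1 w ->
  (forall p x, `|F p x| <= w x) -> measurable_fun setT (fun p => rI (F p)).
Proof.
move=> mF hw Fw.
have mw : measurable_fun setT (w : RT -> RT) by exact: L1_meas.
have mFp p : L1 (F p).
  by apply: (L1_le _ hw) => //; exact: (measurableT_comp mF (measurable_pair1 p)).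
pose G (q : T * RT) := (F q.1 q.2 + w q.2)%:E.
have G0 q : (0 <= G q)%E.
  by rewrite lee_fin; have := Fw q.1 q.2; rewrite ler_norml => /andP[h _]; lra.
have mG : measurable_fun setT G.
  apply/measurable_EFinP; apply: measurable_funD => //.
  exact: measurableT_comp mw _.
have := @measurable_fun_fubini_tonelli_F _ _ T RT R mu G mG G0.
rewrite /fubini_F => H.
rewrite (_ : (fun p => rI (F p)) = (fun p => fine (\int[mu]_y G (p, y))%E - rI w)).
  by apply: measurable_funB => //; apply: measurableT_comp H.
apply/funext => p; rewrite -[fine _]/(rI (fun y => F p y + w y)) rID//; lra.
Qed.

(** The same shift turns Tonelli into Fubini: the theorem is applied to [F + v w], and both iterated
    integrals of the added product equal [rI v * rI w], so they cancel. *)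
Lemma rI_swap (F : R -> R -> R) (v w : R -> R) :
  measurable_fun setT (fun p : RT * RT => F p.1 p.2) -> L1 v -> L1 w ->
  (forall x t, `|F x t| <= v x * w t) -> (forall x, 0 <= v x) ->
  rI (fun x => rI (F x)) = rI (fun t => rI (fun x => F x t)).
Proof.
move=> mF hv hw Fvw v0.
have mv := L1_meas hv; have mw := L1_meas hw.
have LF x : L1 (F x).
  apply: (L1_le _ (L1Z (v x) hw)) => //.
  exact: (measurableT_comp mF (measurable_pair1 x)).
have LF' t : L1 (F^~ t).
  apply: (L1_le (g := fun x => w t * v x) _ (L1Z (w t) hv)) => [|x]; last by rewrite mulrC.
  exact: (measurableT_comp mF (measurable_pair2 t)).
have LvwL x : L1 (fun t => v x * w t) by exact: L1Z.
have LvwR t : L1 (fun x => v x * w t).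
  by under eq_fun do rewrite mulrC; exact: L1Z.
pose G (q : RT * RT) := (F q.1 q.2 + v q.1 * w q.2)%:E.
have G0 q : (0 <= G q)%E.
  by rewrite lee_fin; have := Fvw q.1 q.2; rewrite ler_norml => /andP[h _]; lra.
have mG : measurable_fun setT G.
  apply/measurable_EFinP; apply: measurable_funD => //.
  by apply: measurable_funM; [exact: measurableT_comp mv _|exact: measurableT_comp mw _].
have := @fubini_tonelli _ _ RT RT R mu mu G mG G0.
have K1 x : (\int[mu]_t G (x, t))%E = (rI (F x) + v x * rI w)%:E.
  by rewrite -rI_EFin/=; [rewrite rID// rIZ|exact: L1D].
have K2 t : (\int[mu]_x G (x, t))%E = (rI (F^~ t) + w t * rI v)%:E.
  rewrite -rI_EFin/=; [rewrite rID//; congr (_ + _)%:E|exact: L1D].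
  by under eq_fun do rewrite mulrC; rewrite rIZ.
have mF1 : measurable_fun setT ((fun x => rI (F x)) : RT -> RT).
  have : measurable_fun setT (fun x : RT => (rI (F x) + v x * rI w)%:E).
    rewrite (_ : (fun x => _%:E) = fubini_F mu G); last first.
      by apply/funext => x; rewrite -K1.
    exact: measurable_fun_fubini_tonelli_F G mG G0.
  move=> /measurable_EFinP h.
  rewrite (_ : (fun x => rI (F x)) = (fun x => (rI (F x) + v x * rI w) - v x * rI w)).
    by apply: measurable_funB => //; apply: measurable_funM.
  by apply/funext => x; rewrite addrK.
have mF2 : measurable_fun setT ((fun t => rI (F^~ t)) : RT -> RT).
  have : measurable_fun setT (fun t : RT => (rI (F^~ t) + w t * rI v)%:E).
    rewrite (_ : (fun t => _%:E) = fubini_G mu G); last first.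
      by apply/funext => x; rewrite -K2.
    exact: measurable_fun_fubini_tonelli_G G mG G0.
  move=> /measurable_EFinP h.
  rewrite (_ : (fun x => rI _) = (fun x => (rI (F^~ x) + w x * rI v) - w x * rI v)).
    by apply: measurable_funB => //; apply: measurable_funM.
  by apply/funext => x; rewrite addrK.
have L1F1 : L1 (fun x => rI (F x)).
  apply: (L1_le (g := fun x => rI w * v x) mF1); first exact: L1Z.
  move=> x; apply: le_trans (rI_norm (LF x)) _.
  by rewrite mulrC -rIZ//; apply: rI_le => //; exact: L1_norm.
have L1F2 : L1 (fun x => rI (F^~ x)).
  apply: (L1_le (g := fun x => rI v * w x) mF2); first exact: L1Z.
  move=> t; apply: le_trans (rI_norm (LF' t)) _.
  rewrite mulrC -rIZ//; apply: rI_le; [exact: L1_norm|exact: L1Z|].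
  by move=> x /=; rewrite mulrC.
move=> H; have {}H : (\int[mu]_x (rI (F x) + v x * rI w)%:E =
    \int[mu]_t (rI (F^~ t) + w t * rI v)%:E)%E.
  rewrite -(eq_integral _ _ (fun x _ => K1 x)) -(eq_integral _ _ (fun x _ => K2 x)).
  exact: H.
have LvW : L1 (fun x => v x * rI w) by under eq_fun do rewrite mulrC; exact: L1Z.
have LwV : L1 (fun x => w x * rI v) by under eq_fun do rewrite mulrC; exact: L1Z.
move: H; rewrite -(rI_EFin (L1D L1F1 LvW)) -(rI_EFin (L1D L1F2 LwV)) => -[].
rewrite (rID L1F1 LvW) (rID L1F2 LwV).
have -> : rI (fun x => v x * rI w) = rI w * rI v.
  by rewrite -(rIZ _ hv); congr rI; apply/funext => x; rewrite mulrC.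
have -> : rI (fun x => w x * rI v) = rI w * rI v.
  by rewrite [RHS]mulrC -(rIZ _ hw); congr rI; apply/funext => x; rewrite mulrC.
exact: addIr.
Qed.

(** The pushforward of Lebesgue measure under a translation or reflection has the right values on
    half-open intervals, and these determine the measure. Slopes 1 and -1 are the only ones used, so
    no Jacobian appears. *)
Lemma rI_affine (f : R -> R) (e t : R) : measurable_fun setT (f : RT -> RT) ->
  e = 1 \/ e = -1 -> L1 f ->
  L1 (fun x => f (e * x + t)) /\ rI (fun x => f (e * x + t)) = rI f.
Proof.
move=> mf he hf.
pose phi : RT -> RT := fun x => e * x + t.
have ee : e * e = 1 by case: he => ->; ring.
have mphi : measurable_fun setT phi.
  by apply: measurable_funD => //; apply: measurable_funM => //.
pose psi : RT -> RT := fun x => e * (x - t).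
have mpsi : measurable_fun setT psi.
  by apply: measurable_funM => //; apply: measurable_funB => //.
have phipsi : cancel psi phi by move=> x; rewrite /phi /psi mulrA ee mul1r subrK.
have psiphi : cancel phi psi by move=> x; rewrite /phi /psi addrK mulrA ee mul1r.
have E : forall S, measurable S -> mu S = pushforward mu phi S.
  apply: lebesgue_measure_unique => X [[u v] _ <-]/=.
  rewrite /pushforward.
  case: he => he.
    have -> : phi @^-1` `]u, v] = `]u - t, v - t]%classic.
      by apply/seteqP; split => x; rewrite /phi he /= !in_itv/=; lra.
    by rewrite !lebesgue_measure_itv/= !lte_fin ltrD2r; case: ifP => // _;
       rewrite -!EFinD; congr (_%:E); ring.
  (* A reflection exchanges the closed and the open end of the interval; only the length matters. *)
  have -> : phi @^-1` `]u, v] = `[t - v, t - u[%classic.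
    by apply/seteqP; split => x; rewrite /phi he /= !in_itv/=; lra.
  by rewrite !lebesgue_measure_itv/= !lte_fin ltrD2l ltrN2; case: ifP => // _;
     rewrite -!EFinD; congr (_%:E); ring.
have mfphi : measurable_fun setT (f \o phi) by exact: measurableT_comp.
have L : L1 (f \o phi).
  apply/integrableP; split; first exact/measurable_EFinP.
  move/integrableP : hf => [_]; apply: le_lt_trans.
  have /= <- := @ge0_integral_pushforward _ _ _ _ _ _ mphi mu setT (fun x => `|(f x)%:E|%E).
    rewrite le_eqVlt; apply/orP; left; apply/eqP; apply: eq_measure_integral.
    by move=> S mS _; move: (E S mS).
  - by [].
  - by apply/measurable_EFinP; apply: measurableT_comp.
  - by move=> x _.
split; first exact: L.
rewrite /rI /Rintegral; congr fine.
have /= := @integral_pushforward _ _ _ _ _ _ mphi mu setT (EFin \o f).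
move=> <- //; last exact/measurable_EFinP.
by apply: eq_measure_integral => S mS _; apply/esym; move: (E S mS).
Qed.

Lemma rI_ae (f g : R -> R) : L1 f -> L1 g -> {ae mu, forall x, f x = g x} -> rI f = rI g.
Proof.
move=> hf hg fg; rewrite /rI /Rintegral; congr fine.
apply: ae_eq_integral => //; [exact: (measurable_int mu hf)|exact: (measurable_int mu hg)|].
by apply: (@ae_imp _ (fun x => setT x -> (f x)%:E = (g x)%:E) fg) => x /= ->.
Qed.

Lemma rI_eq0 (f : R -> R) : L1 f -> (forall x, 0 <= f x) -> rI f = 0 ->
  {ae mu, forall x, f x = 0}.
Proof.
move=> hf f0 h.
have : (\int[mu]_x (f x)%:E = 0)%E by rewrite -rI_EFin// h.
move=> h0.
have : (\int[mu]_x `|(f x)%:E| = 0)%E.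
  by rewrite -h0; apply: eq_integral => x _; rewrite gee0_abs// lee_fin.
move/(ae_eq_integral_abs mu measurableT) => h1.
have : ae_eq mu setT (EFin \o f) (cst 0)%E.
  by apply/h1; exact: (measurable_int mu hf).
move=> h2; apply: (@ae_imp (fun x => setT x -> (f x)%:E = 0%E) _ h2) => x.
by move=> /(_ Logic.I)[].
Qed.

(* Indicator of [u,v]; it is [0] when [v < u]. *)
Definition ii (u v x : R) : R := ((u <= x) && (x <= v))%:R.

Lemma rI_ii (u v : R) f : rI (fun x => f x * ii u v x) = (\int[mu]_(x in `[u, v]) f x)%R.
Proof.
rewrite Rintegral_mkcond; congr rI; apply/funext => x.
by rewrite patchE mem_setE in_itv/= /ii; case: (_ && _); rewrite ?mulr1 ?mulr0.
Qed.

Lemma L1_ii (u v : R) f : measurable_fun setT (f : RT -> RT) ->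
  mu.-integrable `[u, v] (EFin \o f) <-> L1 (fun x => f x * ii u v x).
Proof.
move=> mf; rewrite integrable_mkcond//= /L1.
rewrite (_ : _ \_ _ = EFin \o (fun x => f x * ii u v x))//; apply/funext => x.
by rewrite /= patchE mem_setE in_itv/= /ii; case: (_ && _); rewrite ?mulr1 ?mulr0.
Qed.

Lemma meas_ler (d : measure_display) (T : measurableType d) (f g : T -> R) :
  measurable_fun setT f -> measurable_fun setT g ->
  measurable_fun setT (fun x => ((f x <= g x)%R)%:R : R).
Proof.
move=> mf mg.
rewrite (_ : (fun x => _) = (fun x => if (f x <= g x) then 1 else 0 : R)).
  apply: measurable_fun_ifT => //; exact: measurable_fun_ler.
by apply/funext => x; case: (_ <= _).
Qed.

Lemma meas_ii (d : measure_display) (T : measurableType d) (u v f : T -> R) :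
  measurable_fun setT u -> measurable_fun setT v -> measurable_fun setT f ->
  measurable_fun setT (fun x => ii (u x) (v x) (f x)).
Proof.
move=> mu_ mv mf.
rewrite (_ : (fun x => _) = (fun x => ((u x <= f x)%R)%:R * ((f x <= v x)%R)%:R)).
  by apply: measurable_funM; exact: meas_ler.
by apply/funext => x; rewrite /ii -natrM mulnb.
Qed.

Lemma L1_ii1 (u v : R) : L1 (ii u v).
Proof. by have := L1_itv u v 1; under eq_fun do rewrite mul1r. Qed.

Lemma ii_ge0 (u v x : R) : 0 <= ii u v x.
Proof. by rewrite /ii; case: (_ && _). Qed.

Lemma ii_le1 (u v x : R) : ii u v x <= 1.
Proof. by rewrite /ii; case: (_ && _). Qed.

Lemma rI_ii_exp (z u v : R) : z != 0 -> u <= v ->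
  rI (fun x => expR (- z * x) * ii u v x) = (expR (- z * u) - expR (- z * v)) / z.
Proof.
move=> z0; rewrite le_eqVlt => /predU1P[->|uv].
  by rewrite subrr mul0r rI_ii set_itv1 Rintegral_set1.
rewrite rI_ii.
pose F (x : R) := - expR (- z * x) / z.
have D x : is_derive x (1:R) F (expR (- z * x)).
  apply: is_derive_eq.
  by rewrite /GRing.scale/= mulr1; field.
have dF x : derivable F x 1 by [].
have := @continuous_FTC2 R (fun x => expR (- z * x)) F u v uv.
move=> H; rewrite /Rintegral H/=.
- by rewrite /F; field.
- apply: continuous_subspaceT => x.
  by apply: continuous_comp; [exact: mulrl_continuous|exact: continuous_expR].
- split => //; [apply: cvg_at_right_filter|apply: cvg_at_left_filter];
  by apply: differentiable_continuous; exact/derivable1_diffP.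
- by move=> x _; rewrite derive1E; apply: derive_val.
Qed.

Lemma rI_itv (u v : R) : u <= v -> rI (ii u v) = v - u.
Proof.
move=> uv; rewrite -[ii u v]/(fun x => ii u v x).
under eq_fun do rewrite -[ii u v _]mul1r.
rewrite rI_ii Rintegral_cst// mul1r.
rewrite -[RHS]/(fine (v - u)%:E); congr fine.
have : (@lebesgue_measure R `[u, v] = (v - u)%:E)%E.
  rewrite lebesgue_measure_itv/= lte_fin; case: ltP => [//|h].
  have -> : u = v by apply/eqP; rewrite eq_le uv h.
  by rewrite subrr.
exact.
Qed.

End RealIntegral.

Section RealIntegral.
Context {R : realType}.
Notation mu := (@lebesgue_measure R).
Notation RT := (measurableTypeR R).

Lemma ae_neq (u : R) : {ae mu, forall x, x <> u}.
Proof.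
exists [set u]; split; first exact: measurable_set1.
  exact: lebesgue_measure_set1.
by move=> x /=; apply: contra_notP.
Qed.

Lemma ae_all (P : nat -> R -> Prop) : (forall n, {ae mu, forall x, P n x}) ->
  {ae mu, forall x, forall n, P n x}.
Proof.
move=> h; exact: ae_foralln.
Qed.

Definition prim (f : R -> R) (x : R) := rI (fun t => f t * ((t <= x)%R)%:R).

Lemma L1_mul_bnd (f g : R -> R) (C : R) : L1 f -> measurable_fun setT (g : RT -> RT) ->
  (forall x, `|g x| <= C) -> L1 (fun x => f x * g x).
Proof.
move=> hf mg gC; apply: (L1_le (g := fun x => C * `|f x|)).
- by apply: measurable_funM => //; exact: L1_meas.
- by apply: L1Z; exact: L1_norm.
- by move=> x; rewrite normrM mulrC ler_wpM2r.
Qed.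

Lemma bool_norm1 (b : bool) : `|b%:R : R| <= 1 :> R.
Proof. by case: b; rewrite ?normr0 ?normr1. Qed.

Lemma L1_ler (f : R -> R) (x : R) : L1 f -> L1 (fun t => f t * ((t <= x)%R)%:R).
Proof.
move=> hf; apply: (L1_mul_bnd (C := 1) hf) => [|t]; last exact: bool_norm1.
exact: meas_ler.
Qed.

Lemma L1_mul_ii (f : R -> R) (u v : R) : L1 f -> L1 (fun t => f t * ii u v t).
Proof.
move=> hf; apply: (L1_mul_bnd (C := 1) hf) => [|t]; last exact: bool_norm1.
exact: meas_ii.
Qed.

Lemma primB (f : R -> R) (u v : R) : L1 f -> u <= v -> prim f v - prim f u = rI (fun t => f t * ii u v t).
Proof.
move=> hf uv; rewrite /prim -rIB; [|exact: L1_ler..].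
apply: rI_ae; [by apply: L1B; exact: L1_ler|exact: L1_mul_ii|].
apply: (ae_imp (ae_neq u)) => x xu.
rewrite -mulrBr; congr (_ * _); rewrite /ii.
case: (ltgtP x u) xu => // [xu|ux] _.
  by rewrite (le_trans (ltW xu) uv) subrr.
by rewrite subr0.
Qed.

Lemma prim_itv (f : R -> R) (x : R) : prim f x = (\int[mu]_(t in [set` `]-oo, x]]) f t)%R.
Proof.
rewrite /prim Rintegral_mkcond; congr rI; apply/funext => t.
by rewrite patchE mem_setE in_itv/=; case: (_ <= _); rewrite ?mulr1 ?mulr0.
Qed.

Lemma prim_deriv (f : R -> R) : L1 f ->
  {ae mu, forall x, derivable (prim f) x 1 /\ derive1 (prim f) x = f x}.
Proof.
move=> hf.
have := @FTC1Ny R f; rewrite (_ : (fun x => _) = prim f); last first.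
  by apply/funext => x; rewrite prim_itv.
apply; first by move=> y; apply: integrableS hf.
by apply: open_integrable_locally => //; exact: openT.
Qed.

(** The difference quotients of [prim f] are bounded by [c] near each point of the interval, and at
    almost every point they converge to [f x] by Lebesgue's differentiation theorem. *)
Lemma ae_bound (f : R -> R) (p q c : R) : L1 f ->
  (forall u v, p < u -> u <= v -> v < q -> `|rI (fun t => f t * ii u v t)| <= c * (v - u)) ->
  {ae mu, forall x, p < x -> x < q -> `|f x| <= c}.
Proof.
move=> hf H; apply: (ae_imp (prim_deriv hf)) => x [dx dfx] px xq.
have h : h^-1 *: (prim f (h + x) - prim f x) @[h --> 0^'] --> f x.
  move: dx; rewrite /derivable => /cvg_ex[l hl].
  rewrite -dfx derive1E /derive.
  move: (hl) => /cvg_lim -> //; move: hl.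
  by under eq_fun do rewrite /GRing.scale/= mulr1.
have hn : `|h^-1 *: (prim f (h + x) - prim f x)| @[h --> 0^'] --> `|f x| by exact: cvg_norm.
apply: (closed_cvg (fun y : R => y <= c)) hn; first exact: closed_le.
have e0 : 0 < Num.min (x - p) (q - x) by rewrite lt_min !subr_gt0 px xq.
near=> h0.
have h00 : h0 != 0 by near: h0; exact: nbhs_dnbhs_neq.
have hq : p < x + h0 < q.
  have : `|h0| < Num.min (x - p) (q - x) by near: h0; exact: dnbhs0_lt.
  rewrite lt_min !ltr_norml; lra.
case/andP: hq => hp hq.
rewrite /GRing.scale/= normrM normfV [h0 + x]addrC ler_pdivrMl ?normr_gt0// mulrC.
have [h1|h1] := leP 0 h0.
  by rewrite primB// ?lerDl// [`|h0|]ger0_norm//; apply: le_trans (H _ _ _ _ _) _ => //; lra.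
rewrite distrC primB//; last lra.
by rewrite [`|h0|]ltr0_norm//; apply: le_trans (H _ _ _ _ _) _ => //; lra.
Unshelve. all: by end_near. Qed.
End RealIntegral.

(** * Complex-valued integrals *)

Section ComplexIntegral.
Context {R : realType}.
Notation mu := (@lebesgue_measure R).
Notation RT := (measurableTypeR R).
Notation C := R[i].
Notation re := (@complex.Re R).
Notation im := (@complex.Im R).

Lemma ii_case (u v x : R) :
  [/\ ii u v x = 1, u <= x & x <= v] \/ (ii u v x = 0 /\ ~~ ((u <= x) && (x <= v))).
Proof.
by rewrite /ii; case: (boolP (_ && _)) => [/andP[ux xv]|h]; [left|right].
Qed.

(* A norm equivalent to the modulus, but additive in the real and imaginary
   parts, which is how complex integrals are defined here. *)
Definition n1 (z : C) : R := `|re z| + `|im z|.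

Lemma reD (x y : C) : re (x + y) = re x + re y. Proof. by case: x y => [? ?] [? ?]. Qed.
Lemma imD (x y : C) : im (x + y) = im x + im y. Proof. by case: x y => [? ?] [? ?]. Qed.
Lemma reN (x : C) : re (- x) = - re x. Proof. by case: x. Qed.
Lemma imN (x : C) : im (- x) = - im x. Proof. by case: x. Qed.
Lemma reB (x y : C) : re (x - y) = re x - re y. Proof. by rewrite reD reN. Qed.
Lemma imB (x y : C) : im (x - y) = im x - im y. Proof. by rewrite imD imN. Qed.
Lemma reM (x y : C) : re (x * y) = re x * re y - im x * im y. Proof. by case: x y => [? ?] [? ?]. Qed.
Lemma imM (x y : C) : im (x * y) = re x * im y + im x * re y. Proof. by case: x y => [? ?] [? ?]. Qed.
Lemma re_r (x : R) : re x%:C = x. Proof. by []. Qed.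
Lemma im_r (x : R) : im x%:C = 0. Proof. by []. Qed.
Lemma re1 : re (1 : C) = 1. Proof. by []. Qed.
Lemma im1 : im (1 : C) = 0. Proof. by []. Qed.
Lemma re0 : re (0 : C) = 0. Proof. by []. Qed.
Lemma im0 : im (0 : C) = 0. Proof. by []. Qed.
Definition reimE := (reD, imD, reN, imN, reM, imM, re_r, im_r, re1, im1, re0, im0).

Lemma Ceq (x y : C) : re x = re y -> im x = im y -> x = y.
Proof. by case: x y => [? ?] [? ?] /= -> ->. Qed.

Lemma n1_ge0 z : 0 <= n1 z. Proof. by rewrite addr_ge0. Qed.
Lemma n1_0 : n1 0 = 0. Proof. by rewrite /n1 !reimE normr0 addr0. Qed.
Lemma n1D x y : n1 (x + y) <= n1 x + n1 y.
Proof.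
rewrite /n1 reD imD; have := ler_normD (re x) (re y); have := ler_normD (im x) (im y).
lra.
Qed.
Lemma n1N x : n1 (- x) = n1 x. Proof. by rewrite /n1 reN imN !normrN. Qed.
Lemma n1B x y : n1 (x - y) <= n1 x + n1 y. Proof. by rewrite -(n1N y); exact: n1D. Qed.
Lemma n1M x y : n1 (x * y) <= n1 x * n1 y.
Proof.
rewrite /n1 reM imM.
have := ler_normB (re x * re y) (im x * im y); have := ler_normD (re x * im y) (im x * re y).
by rewrite !normrM; nra.
Qed.
Lemma n1_r (x : R) : n1 x%:C = `|x|. Proof. by rewrite /n1 re_r im_r normr0 addr0. Qed.
Lemma n1_1 : n1 1 = 1. Proof. by rewrite /n1 re1 im1 normr0 addr0 normr1. Qed.
Lemma n1Mr (x : C) (r : R) : n1 (x * r%:C) = n1 x * `|r|.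
Proof. by rewrite /n1 reM imM re_r im_r !mulr0 add0r subr0 !normrM mulrDl. Qed.
Lemma n1_eq0 x : n1 x <= 0 -> x = 0.
Proof.
rewrite /n1 => h; have := normr_ge0 (re x); have := normr_ge0 (im x) => h1 h2.
by apply: Ceq; apply/eqP; rewrite -normr_eq0; apply/eqP; rewrite /=; lra.
Qed.
Lemma n1_re x : `|re x| <= n1 x. Proof. by rewrite lerDl. Qed.
Lemma n1_im x : `|im x| <= n1 x. Proof. by rewrite lerDr. Qed.
(** Replaces the multiplicativity of the modulus. For z = a + ib one has a^2 + b^2 = |z^2| <= |a^2 -
    b^2| + 2|ab|, and the square of [n1] exceeds a^2 + b^2 by 2|ab| only. *)
Lemma n1_sq x : n1 x ^+ 2 <= 2 * n1 (x * x).
Proof.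
rewrite /n1 reM imM; set a := re x; set b := im x.
have h0 : a * b + b * a = 2 * (a * b) by ring.
rewrite h0 normrM [`|2|]ger0_norm//.
have h1 : a * a - b * b = (a + b) * (a - b) by ring.
have e : (`|a| + `|b|) ^+ 2 = a ^+ 2 + b ^+ 2 + 2 * `|a * b|.
  by rewrite sqrrD !real_normK ?num_real// normrM; ring.
have := normr_ge0 (a * b) => h3; have := normr_ge0 (a * a - b * b) => h4.
have h5 : `|a * a - b * b| ^+ 2 = (a * a - b * b) ^+ 2 by rewrite real_normK ?num_real.
have h6 : `|a * b| ^+ 2 = (a * b) ^+ 2 by rewrite real_normK ?num_real.
rewrite e.
suff : a ^+ 2 + b ^+ 2 <= `|a * a - b * b| + 2 * `|a * b| by lra.
rewrite -ler_sqr ?nnegrE; last 2 first.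
- by rewrite addr_ge0// sqr_ge0.
- by rewrite addr_ge0// mulr_ge0.
rewrite [leRHS]sqrrD h5 exprMn h6.
have := mulr_ge0 h4 h3; nra.
Qed.

Section cm.
Context d (T : measurableType d).
Definition cm (f : T -> C) := measurable_fun setT (re \o f) /\ measurable_fun setT (im \o f).

Lemma cm_cst c : cm (fun _ => c). Proof. by split; exact: measurable_cst. Qed.
Lemma cmD f g : cm f -> cm g -> cm (fun x => f x + g x).
Proof.
move=> [f1 f2] [g1 g2]; split.
  by rewrite (_ : _ \o _ = (re \o f) \+ (re \o g)); [exact: measurable_funD|apply/funext => x /=; rewrite reD].
by rewrite (_ : _ \o _ = (im \o f) \+ (im \o g)); [exact: measurable_funD|apply/funext => x /=; rewrite imD].
Qed.
Lemma cmN f : cm f -> cm (fun x => - f x).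
Proof.
move=> [f1 f2]; split.
  by rewrite (_ : _ \o _ = \- (re \o f)); [exact: measurableT_comp|apply/funext => x /=; rewrite reN].
by rewrite (_ : _ \o _ = \- (im \o f)); [exact: measurableT_comp|apply/funext => x /=; rewrite imN].
Qed.
Lemma cmB f g : cm f -> cm g -> cm (fun x => f x - g x).
Proof. by move=> hf /cmN; exact: cmD. Qed.
Lemma cmM f g : cm f -> cm g -> cm (fun x => f x * g x).
Proof.
move=> [f1 f2] [g1 g2]; split.
  rewrite (_ : _ \o _ = ((re \o f) \* (re \o g)) \- ((im \o f) \* (im \o g))).
    by apply: measurable_funB; exact: measurable_funM.
  by apply/funext => x /=; rewrite reM.
rewrite (_ : _ \o _ = ((re \o f) \* (im \o g)) \+ ((im \o f) \* (re \o g))).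
  by apply: measurable_funD; exact: measurable_funM.
by apply/funext => x /=; rewrite imM.
Qed.
Lemma cm_r (f : T -> R) : measurable_fun setT f -> cm (fun x => (f x)%:C).
Proof. by move=> mf; split; [exact: mf|exact: measurable_cst]. Qed.
End cm.

Lemma cm_comp d1 d2 (T1 : measurableType d1) (T2 : measurableType d2) (f : T2 -> C) (g : T1 -> T2) :
  cm f -> measurable_fun setT g -> cm (f \o g).
Proof. by move=> [f1 f2] mg; split; [exact: (measurableT_comp f1 mg)|exact: (measurableT_comp f2 mg)]. Qed.

Definition cL (f : RT -> C) := L1 (re \o f) /\ L1 (im \o f).
Definition cI (f : RT -> C) : C := rI (re \o f) +i* rI (im \o f).

Lemma cL_cm f : cL f -> cm f.
Proof. by move=> [f1 f2]; split; exact: L1_meas. Qed.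
Lemma cL_n1 f : cL f -> L1 (fun x => n1 (f x)).
Proof. by move=> [f1 f2]; apply: L1D; exact: L1_norm. Qed.
Lemma cL_le f (g : R -> R) : cm f -> L1 g -> (forall x, n1 (f x) <= g x) -> cL f.
Proof.
move=> [f1 f2] hg h; split.
  by apply: (L1_le _ hg) => // x; apply: le_trans (h x); exact: n1_re.
by apply: (L1_le _ hg) => // x; apply: le_trans (h x); exact: n1_im.
Qed.
Lemma cLD f g : cL f -> cL g -> cL (fun x => f x + g x).
Proof.
move=> hf hg; apply: (cL_le (cmD (cL_cm hf) (cL_cm hg)) (L1D (cL_n1 hf) (cL_n1 hg))) => x.
exact: n1D.
Qed.
Lemma cLN f : cL f -> cL (fun x => - f x).
Proof.
by move=> hf; apply: (cL_le (cmN (cL_cm hf)) (cL_n1 hf)) => x; rewrite n1N.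
Qed.
Lemma cLB f g : cL f -> cL g -> cL (fun x => f x - g x).
Proof. by move=> hf /cLN; exact: cLD. Qed.
Lemma cLM f g (K : R) : cL f -> cm g -> (forall x, n1 (g x) <= K) -> cL (fun x => f x * g x).
Proof.
move=> hf hg h; apply: (cL_le (cmM (cL_cm hf) hg) (L1Z K (cL_n1 hf))) => x.
by apply: le_trans (n1M _ _) _; rewrite mulrC ler_wpM2r// n1_ge0.
Qed.
Lemma cLZ c f : cL f -> cL (fun x => c * f x).
Proof.
move=> hf; under eq_fun do rewrite mulrC.
by apply: (cLM (K := n1 c)) => //; exact: cm_cst.
Qed.
Lemma cL0 : cL (fun _ => 0).
Proof. by split; exact: L1_0. Qed.

Lemma cID f g : cL f -> cL g -> cI (fun x => f x + g x) = cI f + cI g.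
Proof.
move=> [f1 f2] [g1 g2]; apply: Ceq; rewrite ?reD ?imD /=; rewrite -rID//;
  by congr rI; apply/funext => x /=; rewrite ?reD ?imD.
Qed.
Lemma cIZ c f : cL f -> cI (fun x => c * f x) = c * cI f.
Proof.
move=> [f1 f2]; apply: Ceq; rewrite ?reM ?imM /=.
  rewrite -(rIZ _ f1) -(rIZ _ f2) -(rIB (L1Z _ f1) (L1Z _ f2)).
  by congr rI; apply/funext => x /=; rewrite reM.
rewrite -(rIZ _ f1) -(rIZ _ f2) -(rID (L1Z _ f2) (L1Z _ f1)).
by congr rI; apply/funext => x /=; rewrite imM.
Qed.
Lemma cIZr c f : cL f -> cI (fun x => f x * c) = cI f * c.
Proof. by move=> hf; rewrite mulrC -cIZ//; congr cI; apply/funext => x; rewrite mulrC. Qed.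
Lemma cIN f : cL f -> cI (fun x => - f x) = - cI f.
Proof.
move=> hf; rewrite -mulN1r -cIZ//; congr cI; apply/funext => x; by rewrite mulN1r.
Qed.
Lemma cIB f g : cL f -> cL g -> cI (fun x => f x - g x) = cI f - cI g.
Proof. by move=> hf hg; rewrite cID ?cIN//; exact: cLN. Qed.
Lemma cI0 : cI (fun _ => 0) = 0.
Proof. by have := cIZ 0 cL0; under eq_fun do rewrite mul0r; rewrite mul0r. Qed.

Lemma cI_n1 f : cL f -> n1 (cI f) <= rI (fun x => n1 (f x)).
Proof.
move=> [f1 f2]; rewrite /n1/= rID; [|exact: L1_norm..].
by apply: lerD; exact: rI_norm.
Qed.

Lemma cI_le f (g : R -> R) : cm f -> L1 g -> (forall x, n1 (f x) <= g x) -> n1 (cI f) <= rI g.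
Proof.
move=> mf hg h; have hf := cL_le mf hg h.
by apply: le_trans (cI_n1 hf) _; apply: rI_le => //; exact: cL_n1.
Qed.

Lemma cI_ae f g : cL f -> cL g -> {ae mu, forall x, f x = g x} -> cI f = cI g.
Proof.
move=> [f1 f2] [g1 g2] h; apply: Ceq => /=; apply: rI_ae => //.
  by apply: (ae_imp h) => x /= ->.
by apply: (ae_imp h) => x /= ->.
Qed.

Lemma cI_eq0 f : cL f -> rI (fun x => n1 (f x)) = 0 -> {ae mu, forall x, f x = 0}.
Proof.
move=> hf h; have := rI_eq0 (cL_n1 hf) (fun x => n1_ge0 _) h.
by move=> H; apply: (ae_imp H) => x hx; apply: n1_eq0; rewrite hx.
Qed.

Lemma cI_swap (F : R -> R -> C) (v w : R -> R) :
  cm (fun p : RT * RT => F p.1 p.2) -> L1 v -> L1 w ->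
  (forall x t, n1 (F x t) <= v x * w t) -> (forall x, 0 <= v x) ->
  cI (fun x => cI (F x)) = cI (fun t => cI (fun x => F x t)).
Proof.
move=> [m1 m2] hv hw h v0; apply: Ceq => /=.
  by apply: (rI_swap (F := fun x t => re (F x t)) m1 hv hw) => // x t; apply: le_trans (h x t); exact: n1_re.
by apply: (rI_swap (F := fun x t => im (F x t)) m2 hv hw) => // x t; apply: le_trans (h x t); exact: n1_im.
Qed.

Lemma cI_param d (T : measurableType d) (F : T -> R -> C) (w : R -> R) :
  cm (fun p : T * RT => F p.1 p.2) -> L1 w ->
  (forall p x, n1 (F p x) <= w x) -> cm (fun p => cI (F p)).
Proof.
move=> [m1 m2] hw h; split => /=.
  by apply: (rI_param_meas (F := fun x t => re (F x t)) m1 hw) => x t; apply: le_trans (h x t); exact: n1_re.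
by apply: (rI_param_meas (F := fun x t => im (F x t)) m2 hw) => x t; apply: le_trans (h x t); exact: n1_im.
Qed.

Lemma cI_affine (f : RT -> C) (e t : R) : e = 1 \/ e = -1 -> cL f ->
  cL (fun x : RT => f (e * x + t)) /\ cI (fun x : RT => f (e * x + t)) = cI f.
Proof.
move=> he [f1 f2].
have [h1 h2] := rI_affine t (L1_meas f1) he f1.
have [h3 h4] := rI_affine t (L1_meas f2) he f2.
split; first by split.
by apply: Ceq => /=.
Qed.

Lemma cintegralE (u v : R) (f : R -> C) :
  cintegral `[u, v] f = cI (fun x : RT => f x * (ii u v x)%:C).
Proof.
apply: Ceq => /=; rewrite -rI_ii; congr rI; apply/funext => x /=;
by rewrite !reimE; ring.
Qed.

End ComplexIntegral.

(** * Laplace transforms on the half-line *)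

Section Decay.
Context {R : realType}.
Notation C := R[i].

(* [F y = O(e^{-c'y})] as [y -> +oo] for every [c' < c]: losing an epsilon in the
   rate makes the notion insensitive to polynomial factors. *)
Definition decay (F : R -> C) (c : R) :=
  forall c', c' < c -> exists K Y : R, forall y, Y <= y -> n1 (F y) <= K * expR (- c' * y).

Lemma decayP F c : decay F c <-> (forall c', c' < c -> exists K Y : R,
  [/\ 0 < K, 1 <= Y & forall y, Y <= y -> n1 (F y) <= K * expR (- c' * y)]).
Proof.
split=> h c' /h [K [Y H]]; last by case: H => _ _ H; exists K, Y.
exists (`|K| + 1), (Num.max 1 Y); split.
- by rewrite ltr_wpDl.
- by rewrite le_max lexx.
- move=> y; rewrite ge_max => /andP[y1 yY]; apply: le_trans (H y yY) _.
  by rewrite ler_pM2r ?expR_gt0//; have := ler_norm K; lra.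
Qed.

Lemma decay_le F c d : c <= d -> decay F d -> decay F c.
Proof. by move=> cd h c' c'c; apply: h; exact: lt_le_trans cd. Qed.

Lemma decay_sup F c : (forall c', c' < c -> decay F c') -> decay F c.
Proof.
move=> h c' c'c; have h1 : c' < (c' + c) / 2 by lra.
by apply: (h _ _ _ h1); lra.
Qed.

Lemma decay_near F G c Y0 : (forall y, Y0 <= y -> F y = G y) -> decay F c -> decay G c.
Proof.
move=> FG h c' /h [K [Y H]]; exists K, (Num.max Y0 Y) => y.
by rewrite ge_max => /andP[y1 y2]; rewrite -FG// H.
Qed.

Lemma decayD F G c : decay F c -> decay G c -> decay (fun y => F y + G y) c.
Proof.
move=> /decayP hF /decayP hG c' c'c.
have [K [Y [K0 Y1 H]]] := hF _ c'c; have [K' [Y' [K0' Y1' H']]] := hG _ c'c.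
exists (K + K'), (Num.max Y Y') => y; rewrite ge_max => /andP[y1 y2].
apply: le_trans (n1D _ _) _; rewrite mulrDl; exact: lerD (H _ _) (H' _ _).
Qed.

Lemma decayN F c : decay F c -> decay (fun y => - F y) c.
Proof. by move=> h c' /h [K [Y H]]; exists K, Y => y yY; rewrite n1N H. Qed.

Lemma decayB F G c : decay F c -> decay G c -> decay (fun y => F y - G y) c.
Proof. by move=> hF /decayN; exact: decayD. Qed.

Lemma decayM F G c d : decay F c -> decay G d -> decay (fun y => F y * G y) (c + d).
Proof.
move=> /decayP hF /decayP hG e he.
(* The slack between [e] and [c + d] is shared equally by the two factors. *)
pose h := (c + d - e) / 2.
have [K [Y [K0 Y1 H]]] := hF (c - h) ltac:(rewrite /h; lra).
have [K' [Y' [K0' Y1' H']]] := hG (d - h) ltac:(rewrite /h; lra).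
exists (K * K'), (Num.max Y Y') => y; rewrite ge_max => /andP[y1 y2].
apply: le_trans (n1M _ _) _.
have -> : - e * y = - (c - h) * y + - (d - h) * y by rewrite /h; field.
rewrite expRD mulrACA; apply: ler_pM; rewrite ?n1_ge0//; [exact: H|exact: H'].
Qed.

Lemma decay_bnd F (K Y : R) : (forall y, Y <= y -> n1 (F y) <= K) -> decay F 0.
Proof.
move=> h c' c'0; exists `|K|, (Num.max 0 Y) => y; rewrite ge_max => /andP[y0 yY].
apply: le_trans (h _ yY) _; apply: le_trans (ler_norm _) _.
rewrite ler_peMr//; apply: le_trans (expR_ge1Dx _); rewrite lerDl mulr_ge0//; lra.
Qed.

Lemma decay_cst k : decay (fun _ => k) 0.
Proof. exact: (@decay_bnd _ (n1 k) 0). Qed.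

(** The epsilon lost in [decay] pays for the polynomial factor: y <= e^{-c'y} / (-c') when c' <
    0. *)
Lemma decay_id : decay (fun y => y%:C) 0.
Proof.
move=> c' c'0; exists (- c')^-1, 0 => y y0.
rewrite n1_r ger0_norm// ler_pdivlMl; last lra.
apply: le_trans (expR_ge1Dx _); lra.
Qed.

Lemma decay_ex a : decay (fun y => (expR (- a * y))%:C) a.
Proof.
move=> c' c'a; exists 1, 0 => y y0; rewrite n1_r ger0_norm ?expR_ge0// mul1r ler_expR.
by nra.
Qed.

Lemma decay_inv : decay (fun y => (y^-1)%:C) 0.
Proof.
apply: (@decay_bnd _ 1 1) => y y1.
by rewrite n1_r ger0_norm ?invr_ge0 ?(le_trans _ y1)// invf_le1// (lt_le_trans _ y1).
Qed.

(** By [n1_sq] a bound on the square costs only a factor 2 under the root, so rates can be halved.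
    Estimates of squares in the proof of Titchmarsh's theorem rely on this. *)
Lemma decay_sq F c : decay (fun y => F y * F y) (2 * c) -> decay F c.
Proof.
move=> /decayP h c' c'c.
have [K [Y [K0 Y1 H]]] := h (2 * c') ltac:(lra).
exists (Num.sqrt (2 * K)), Y => y yY.
rewrite -ler_sqr ?nnegrE ?n1_ge0 ?mulr_ge0 ?sqrtr_ge0 ?expR_ge0//.
apply: le_trans (n1_sq _) _.
rewrite exprMn sqr_sqrtr; last by rewrite mulr_ge0// ltW.
rewrite expr2 -expRD.
have -> : - c' * y + - c' * y = - (2 * c') * y by ring.
by rewrite -(mulrA 2 K) ler_pM2l// H.
Qed.

Lemma decay_mono F G c : (exists K Y : R, forall y, Y <= y -> n1 (F y) <= K * n1 (G y)) ->
  decay G c -> decay F c.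
Proof.
move=> [K [Y H]] /decayP hG c' /hG [K' [Y' [K0 Y1 H']]].
exists (`|K| * K'), (Num.max Y Y') => y; rewrite ge_max => /andP[y1 y2].
apply: le_trans (H _ y1) _; apply: le_trans (ler_wpM2r (n1_ge0 _) (ler_norm K)) _.
by rewrite -mulrA ler_wpM2l// H'.
Qed.

End Decay.

Section Laplace.
Context {R : realType}.
Notation RT := (measurableTypeR R).
Notation C := R[i].

Implicit Types (f g : RT -> C) (F G : R -> C) (T y t c : R).

Definition nice (f : RT -> C) := [/\ cm f, (forall t, t < 0 -> f t = 0) &
  exists M K : R, [/\ 0 <= M, 0 <= K & forall t, n1 (f t) <= M * expR (K * t)]].

(** Cutting at [T] makes the integral finite at every real [y] whatever the growth of [f]; the tail
    lost for large [y] is of order e^{-Ty}, which [rep] ignores. *)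
Definition LT (T : R) (f : RT -> C) (y : R) : C :=
  cI (fun t : RT => f t * (expR (- y * t) * ii 0 T t)%:C).

(* [F] has the asymptotics of the Laplace transform of [f] truncated at [T]; only
   the values of [f] on [t < T] matter, up to null sets. *)
Definition rep T (F : R -> C) f := decay (fun y => F y - LT T f y) T.

Lemma nice_bnd f T : nice f -> exists2 M, 0 <= M & forall t, t <= T -> n1 (f t) <= M.
Proof.
move=> [_ _ [M [K [M0 K0 H]]]]; exists (M * expR (K * T)); first by rewrite mulr_ge0 ?expR_ge0.
by move=> t tT; apply: le_trans (H t) _; rewrite ler_wpM2l// ler_expR ler_wpM2l.
Qed.

Lemma niceP f : cm f -> (forall t, t < 0 -> f t = 0) ->
  (exists M K : R, forall t, 0 <= t -> n1 (f t) <= M * expR (K * t)) -> nice f.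
Proof.
move=> h1 h2 [M [K H]]; split => //; exists `|M|, `|K|; split => // t.
have [t0|t0] := ltP t 0; first by rewrite h2// n1_0 mulr_ge0 ?expR_ge0.
apply: le_trans (H t t0) _; apply: (@le_trans _ _ (`|M| * expR (K * t))).
  by rewrite ler_wpM2r ?expR_ge0 ?ler_norm.
by rewrite ler_wpM2l// ler_expR ler_wpM2r// ler_norm.
Qed.

Lemma nice_cm f : nice f -> cm f. Proof. by case. Qed.
Lemma nice_neg f t : nice f -> t < 0 -> f t = 0. Proof. by case=> _ h _; exact: h. Qed.

Lemma meas_expR d (T : measurableType d) (f : T -> R) : measurable_fun setT f ->
  measurable_fun setT (fun x => expR (f x)).
Proof. by move=> mf; exact: measurableT_comp. Qed.

Lemma cm_ker (y T : R) : cm (fun t : RT => (expR (- y * t) * ii 0 T t)%:C).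
Proof.
apply: cm_r; apply: measurable_funM; last exact: meas_ii.
by apply: meas_expR; apply: measurable_funM.
Qed.

Lemma LT_L f T y : nice f -> cL (fun t : RT => f t * (expR (- y * t) * ii 0 T t)%:C).
Proof.
move=> hf; have [M M0 H] := nice_bnd T hf.
apply: (cL_le (cmM (nice_cm hf) (cm_ker y T)) (L1Z (M * expR (`|y| * T)) (L1_ii1 0 T))) => t.
rewrite n1Mr; have [[-> t0 tT]|[-> _]] := ii_case 0 T t; last by rewrite !mulr0 normr0 mulr0.
rewrite !mulr1 ger0_norm ?expR_ge0//.
apply: ler_pM; rewrite ?n1_ge0 ?expR_ge0//; first exact: H.
rewrite ler_expR; apply: le_trans (ler_norm _) _; rewrite normrM normrN ler_wpM2l//.
by rewrite ger0_norm.
Qed.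

Lemma LTD f g T y : nice f -> nice g -> LT T (fun t => f t + g t) y = LT T f y + LT T g y.
Proof.
move=> hf hg; rewrite /LT -cID; [|exact: LT_L..].
by congr cI; apply/funext => t; rewrite mulrDl.
Qed.

Lemma LTZ k f T y : nice f -> LT T (fun t => k * f t) y = k * LT T f y.
Proof.
move=> hf; rewrite /LT -cIZ; [|exact: LT_L].
by congr cI; apply/funext => t; rewrite mulrA.
Qed.

Lemma niceD f g : nice f -> nice g -> nice (fun t => f t + g t).
Proof.
move=> [f1 f2 [M [K [M0 K0 H]]]] [g1 g2 [M' [K' [M0' K0' H']]]]; split.
- exact: cmD.
- by move=> t t0; rewrite f2// g2// addr0.
exists (M + M'), (K + K'); split; rewrite ?addr_ge0// => t.
have [t0|t0] := ltP t 0; first by rewrite f2// g2// addr0 n1_0 mulr_ge0 ?addr_ge0 ?expR_ge0.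
apply: le_trans (n1D _ _) _; rewrite mulrDl; apply: lerD.
  by apply: le_trans (H t) _; rewrite ler_wpM2l// ler_expR ler_wpM2r// lerDl.
by apply: le_trans (H' t) _; rewrite ler_wpM2l// ler_expR ler_wpM2r// lerDr.
Qed.

Lemma niceZ k f : nice f -> nice (fun t => k * f t).
Proof.
move=> [f1 f2 [M [K [M0 K0 H]]]]; split.
- by apply: cmM => //; exact: cm_cst.
- by move=> t t0; rewrite f2// mulr0.
exists (n1 k * M), K; split; rewrite ?mulr_ge0 ?n1_ge0// => t.
by apply: le_trans (n1M _ _) _; rewrite -mulrA ler_wpM2l ?n1_ge0.
Qed.

Lemma niceN f : nice f -> nice (fun t => - f t).
Proof.
move=> /(niceZ (-1)); rewrite (_ : (fun t => -1 * f t) = (fun t => - f t))//.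
by apply/funext => t; rewrite mulN1r.
Qed.

Lemma niceB f g : nice f -> nice g -> nice (fun t => f t - g t).
Proof. by move=> hf /niceN; exact: niceD. Qed.

Lemma nice_tM f : nice f -> nice (fun t => t%:C * f t).
Proof.
move=> [f1 f2 [M [K [M0 K0 H]]]]; split.
- by apply: cmM => //; apply: cm_r.
- by move=> t t0; rewrite f2// mulr0.
exists M, (K + 1); split; rewrite ?addr_ge0// => t.
have [t0|t0] := ltP t 0; first by rewrite f2// mulr0 n1_0 mulr_ge0 ?expR_ge0.
rewrite mulrC n1Mr ger0_norm// (mulrDl K 1 t) expRD mul1r mulrA; apply: ler_pM; rewrite ?n1_ge0//.
by apply: le_trans (expR_ge1Dx _); rewrite lerDr.
Qed.

Lemma repD T F G f g : nice f -> nice g -> rep T F f -> rep T G g ->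
  rep T (fun y => F y + G y) (fun t => f t + g t).
Proof.
move=> hf hg hF hG; apply: (@decay_near _ (fun y => F y - LT T f y + (G y - LT T g y)) _ _ 0).
  by move=> y _; rewrite LTD//; ring.
exact: decayD.
Qed.

Lemma repZ T k F f : nice f -> rep T F f ->
  rep T (fun y => k * F y) (fun t => k * f t).
Proof.
move=> hf hF; apply: (@decay_near _ (fun y => k * (F y - LT T f y)) _ _ 0).
  by move=> y _; rewrite LTZ//; ring.
by have := decayM (decay_cst k) hF; rewrite add0r.
Qed.

Lemma repB T F G f g : nice f -> nice g -> rep T F f -> rep T G g ->
  rep T (fun y => F y - G y) (fun t => f t - g t).
Proof.
move=> hf hg hF hG.
have := repD hf (niceZ (-1) hg) hF (repZ (-1) hg hG).
rewrite (_ : (fun y => F y + -1 * G y) = (fun y => F y - G y)); last first.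
  by apply/funext => t; rewrite mulN1r.
rewrite (_ : (fun t => f t + -1 * g t) = (fun t => f t - g t))//.
by apply/funext => t; rewrite mulN1r.
Qed.

Lemma rep_near T F G f Y0 : (forall y, Y0 <= y -> F y = G y) -> rep T F f -> rep T G f.
Proof.
by move=> FG; apply: (@decay_near _ _ _ _ Y0) => y yY; rewrite FG.
Qed.

Lemma LT_decay T f c : nice f -> (forall t, t < c -> f t = 0) -> decay (LT T f) c.
Proof.
move=> hf fc; have [M M0 H] := nice_bnd T hf.
suff h : forall y, 0 <= y -> n1 (LT T f y) <= M * rI (ii 0 T) * expR (- c * y).
  move=> c' c'c; exists (M * rI (ii 0 T)), 0 => y y0; apply: le_trans (h y y0) _.
  rewrite ler_wpM2l//; first by rewrite mulr_ge0// rI_ge0// => x; exact: ii_ge0.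
  by rewrite ler_expR; nra.
move=> y y0; rewrite mulrAC -rIZ; last exact: L1_ii1.
apply: cI_le; [exact: cL_cm (LT_L _ _ hf)|exact: L1Z (L1_ii1 _ _)|].
move=> t; have [tc|ct] := ltP t c.
  by rewrite fc// mul0r n1_0 !mulr_ge0 ?expR_ge0 ?ii_ge0.
rewrite n1Mr normrM [X in _ * (_ * X)]ger0_norm ?ii_ge0// mulrA.
have [[-> t0 tT]|[-> _]] := ii_case 0 T t; last by rewrite !mulr0.
rewrite !mulr1.
rewrite ger0_norm ?expR_ge0//; apply: ler_pM; rewrite ?n1_ge0 ?expR_ge0//; first exact: H.
by rewrite ler_expR; nra.
Qed.

Lemma LT_bdecay T f : nice f -> decay (LT T f) 0.
Proof. by move=> hf; apply: LT_decay => // t t0; exact: nice_neg. Qed.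

Lemma rep_decay T F f c : nice f -> c <= T -> (forall t, t < c -> f t = 0) -> rep T F f -> decay F c.
Proof.
move=> hf cT fc hF; apply: (@decay_near _ (fun y => (F y - LT T f y) + LT T f y) _ _ 0).
  by move=> y _; rewrite subrK.
by apply: decayD; [exact: decay_le hF|exact: LT_decay].
Qed.

Lemma rep_bdecay T F f : nice f -> 0 <= T -> rep T F f -> decay F 0.
Proof. by move=> hf T0; apply: rep_decay => // t t0; exact: nice_neg. Qed.

Lemma rep_LT T f : rep T (LT T f) f.
Proof.
apply: (@decay_near _ (fun=> 0) _ _ 0); first by move=> y _; rewrite subrr.
by move=> c' _; exists 0, 0 => y _; rewrite n1_0 mul0r.
Qed.

End Laplace.

(** * Convolution and products of transforms *)

Section Conv.
Context {R : realType}.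
Notation mu := (@lebesgue_measure R).
Notation RT := (measurableTypeR R).
Notation C := R[i].
Notation re := (@complex.Re R).
Notation im := (@complex.Im R).
Implicit Types (f g : RT -> C) (F G : R -> C) (T y t c : R).

Lemma cm_lim d (T : measurableType d) (h : nat -> T -> C) (f : T -> C) :
  (forall n, cm (h n)) ->
  (forall x, (fun n => re (h n x)) @ \oo --> re (f x)) ->
  (forall x, (fun n => im (h n x)) @ \oo --> im (f x)) -> cm f.
Proof.
move=> mh h1 h2; split.
  by apply: (@measurable_fun_cvg _ _ _ setT (fun n => re \o h n)) => [n|x _]; [case: (mh n)|exact: h1].
by apply: (@measurable_fun_cvg _ _ _ setT (fun n => im \o h n)) => [n|x _]; [case: (mh n)|exact: h2].
Qed.

Lemma rI_dct (h : nat -> R -> R) (f g : R -> R) :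
  (forall n, measurable_fun setT (h n : RT -> RT)) ->
  measurable_fun setT (f : RT -> RT) -> L1 g ->
  (forall n x, `|h n x| <= g x) ->
  {ae mu, forall x, (fun n => h n x) @ \oo --> f x} ->
  (fun n => rI (h n)) @ \oo --> rI f.
Proof.
move=> mh mf hg hb hc.
have Lh n : L1 (h n) by exact: (L1_le (mh n) hg).
have [] := @dominated_convergence _ _ _ mu setT measurableT (fun n x => (h n x)%:E) (EFin \o f) (EFin \o g).
- by move=> n; apply/measurable_EFinP; exact: mh.
- exact/measurable_EFinP.
- apply: (@ae_imp R _ (fun x => setT x -> (fun n => (h n x)%:E) @ \oo --> (f x)%:E) hc) => x hx _; apply: cvg_EFin; [exact: nearW|exact: hx].
- exact: hg.
- by apply: aeW => x n _; rewrite /= lee_fin.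
move=> Lf _ H.
have : (fun n => (rI (h n))%:E) @ \oo --> (rI f)%:E.
  rewrite rI_EFin//; move: H; apply: cvg_trans; apply: near_eq_cvg.
  by apply: nearW => n; rewrite /= rI_EFin.
by move=> /fine_cvg.
Qed.

Definition cc (f : R -> C) := continuous (re \o f) /\ continuous (im \o f).

Lemma rI_cont (f : R -> R -> R) :
  (forall l, measurable_fun setT (f l : RT -> RT)) ->
  (forall s, continuous (f^~ s)) ->
  (forall a, exists2 g, L1 g & forall l s, a - 1 < l -> l < a + 1 -> `|f l s| <= g s) ->
  continuous (fun l => rI (f l)).
Proof.
move=> mf cf hg a; have [g Lg H] := hg a.
have := @continuity_under_integral R _ RT mu f setT measurableT (a - 1) (a + 1).
move=> /(_ _ _ g); apply.
- by move=> l; rewrite /= in_itv/= => /andP[l1 l2]; apply: (L1_le (mf l) Lg) => s; exact: H.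
- by apply: aeW => s _ l _; exact: cf.
- exact: Lg.
- by move=> l; rewrite /= in_itv/= => /andP[l1 l2]; apply: aeW => s _; exact: H.
- by rewrite inE/= in_itv/=; lra.
Qed.

Lemma cI_cont (f : R -> R -> C) :
  (forall l, cm (f l : RT -> C)) ->
  (forall s, cc (f^~ s)) ->
  (forall a, exists2 g, L1 g & forall l s, a - 1 < l -> l < a + 1 -> n1 (f l s) <= g s) ->
  cc (fun l => cI (f l)).
Proof.
move=> mf cf hg; split.
  apply: (@rI_cont (fun l s => re (f l s))) => [l|s|a]; [by case: (mf l)|by case: (cf s)|].
  have [g Lg H] := hg a; exists g => // l s h1 h2; apply: le_trans (H l s h1 h2); exact: n1_re.
apply: (@rI_cont (fun l s => im (f l s))) => [l|s|a]; [by case: (mf l)|by case: (cf s)|].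
have [g Lg H] := hg a; exists g => // l s h1 h2; apply: le_trans (H l s h1 h2); exact: n1_im.
Qed.

Lemma cc_cst k : cc (fun _ => k).
Proof. by split; exact: cst_continuous. Qed.
Lemma ccD (f g : R -> C) : cc f -> cc g -> cc (fun t => f t + g t).
Proof.
move=> [f1 f2] [g1 g2]; split => t.
  rewrite (_ : _ \o _ = (re \o f) \+ (re \o g)); last by apply/funext => x /=; rewrite reD.
  by apply: cvgD; [exact: f1|exact: g1].
rewrite (_ : _ \o _ = (im \o f) \+ (im \o g)); last by apply/funext => x /=; rewrite imD.
by apply: cvgD; [exact: f2|exact: g2].
Qed.
Lemma ccM (f g : R -> C) : cc f -> cc g -> cc (fun t => f t * g t).
Proof.
move=> [f1 f2] [g1 g2]; split => t.
  rewrite (_ : _ \o _ = (re \o f) \* (re \o g) \- (im \o f) \* (im \o g)); last by apply/funext => x /=; rewrite reM.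
  by apply: cvgB; apply: cvgM; [exact: f1|exact: g1|exact: f2|exact: g2].
rewrite (_ : _ \o _ = (re \o f) \* (im \o g) \+ (im \o f) \* (re \o g)); last by apply/funext => x /=; rewrite imM.
by apply: cvgD; apply: cvgM; [exact: f1|exact: g2|exact: f2|exact: g1].
Qed.
Lemma cc_r (f : R -> R) : continuous f -> cc (fun t => (f t)%:C).
Proof. by move=> h; split; [exact: h|exact: cst_continuous]. Qed.
Lemma ccZ k (f : R -> C) : cc f -> cc (fun t => k * f t).
Proof. by move=> hf; apply: ccM => //; exact: cc_cst. Qed.
Lemma ccN (f : R -> C) : cc f -> cc (fun t => - f t).
Proof.
by move=> /(ccZ (-1)); rewrite (_ : (fun t => -1 * f t) = (fun t => - f t))//; apply/funext => t; rewrite mulN1r.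
Qed.
Lemma ccB (f g : R -> C) : cc f -> cc g -> cc (fun t => f t - g t).
Proof. by move=> hf /ccN; exact: ccD. Qed.
Lemma cc_comp (f : R -> C) (h : R -> R) : cc f -> continuous h -> cc (fun t => f (h t)).
Proof.
move=> [f1 f2] ch; split => t.
  by apply: (@continuous_comp _ _ _ h (re \o f)); [exact: ch|exact: f1].
by apply: (@continuous_comp _ _ _ h (im \o f)); [exact: ch|exact: f2].
Qed.
Lemma cc_cm (f : R -> C) : cc f -> cm (f : RT -> C).
Proof. by move=> [f1 f2]; split; exact: continuous_measurable_fun. Qed.

Definition cvl f g t : C := cI (fun s : RT => f (t - s) * g s).

Lemma cvl_bnd f g : nice f -> nice g -> exists M K : R, [/\ 0 <= M, 0 <= K &
  forall t s, n1 (f (t - s) * g s) <= M * expR (K * t) * ii 0 t s].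
Proof.
move=> [f1 f2 [M [K [M0 K0 H]]]] [g1 g2 [M' [K' [M0' K0' H']]]].
exists (M * M'), (K + K'); split; rewrite ?mulr_ge0 ?addr_ge0// => t s.
have [s0|s0] := ltP s 0.
  by rewrite g2// mulr0 n1_0 !mulr_ge0 ?expR_ge0 ?ii_ge0.
have [ts|st] := ltP t s.
  by rewrite f2 ?subr_lt0// mul0r n1_0 !mulr_ge0 ?expR_ge0 ?ii_ge0.
rewrite /ii s0 st mulr1; apply: le_trans (n1M _ _) _.
apply: le_trans (ler_pM (n1_ge0 _) (n1_ge0 _) (H _) (H' _)) _.
rewrite mulrACA -expRD ler_wpM2l ?mulr_ge0// ler_expR.
by rewrite mulrBr mulrDl; nra.
Qed.

Lemma cvl_cm2 f g : nice f -> nice g -> cm (fun p : RT * RT => f (p.1 - p.2) * g p.2).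
Proof.
move=> hf hg; apply: cmM.
  by apply: (cm_comp (nice_cm hf)); apply: measurable_funB.
by apply: (cm_comp (nice_cm hg)).
Qed.

Lemma cvl_cm1 f g t : nice f -> nice g -> cm (fun s : RT => f (t - s) * g s).
Proof.
by move=> hf hg; exact: (cm_comp (cvl_cm2 hf hg) (measurable_pair1 (t : RT))).
Qed.

Lemma cvl_L f g t : nice f -> nice g -> cL (fun s : RT => f (t - s) * g s).
Proof.
move=> hf hg; have [M [K [M0 K0 H]]] := cvl_bnd hf hg.
by apply: (cL_le (cvl_cm1 t hf hg) (L1Z (M * expR (K * t)) (L1_ii1 0 t))) => s; exact: H.
Qed.

Lemma cvl_neg f g t : nice f -> nice g -> t < 0 -> cvl f g t = 0.
Proof.
move=> hf hg t0; rewrite /cvl -[RHS]cI0; congr cI; apply/funext => s.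
have [s0|s0] := ltP s 0; first by rewrite (nice_neg hg s0) mulr0.
by rewrite (nice_neg hf) ?mul0r//; lra.
Qed.

Lemma cvl_nice f g : nice f -> nice g -> nice (cvl f g).
Proof.
move=> hf hg; have [M [K [M0 K0 H]]] := cvl_bnd hf hg.
apply: niceP; last 2 first.
- by move=> t; exact: cvl_neg.
- exists M, (K + 1) => t t0; rewrite mulrDl mul1r expRD mulrA.
  apply: le_trans (cI_le (cvl_cm1 t hf hg) (L1Z (M * expR (K * t)) (L1_ii1 0 t)) (H t)) _.
  rewrite rIZ; last exact: L1_ii1.
  rewrite rI_itv// subr0 ler_wpM2l ?mulr_ge0 ?expR_ge0//.
  by apply: le_trans (expR_ge1Dx _); rewrite lerDr.
(* The majorant of the integrand depends on [t], so measurability of parameter integrals applies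
   only after restricting to [t <= n]; at each [t] the restricted integrals are eventually constant
   in [n]. *)
apply: (@cm_lim _ _ (fun n t => cI (fun s : RT => f (t - s) * g s * ((t <= n%:R)%R%:R)%:C))) => [n|t|t].
- apply: (@cI_param _ _ _ (fun t s => f (t - s) * g s * ((t <= n%:R)%R%:R)%:C) (fun s => M * expR (K * n%:R) * ii 0 n%:R s)).
  + apply: cmM; first exact: cvl_cm2.
    by apply: cm_r; apply: meas_ler.
  + by apply: L1Z; exact: L1_ii1.
  + move=> t s; rewrite n1Mr; have [tn|_] := leP t n%:R; last first.
      by rewrite normr0 mulr0 !mulr_ge0 ?expR_ge0 ?ii_ge0.
    rewrite normr1 mulr1; apply: le_trans (H t s) _.
    apply: ler_pM; rewrite ?mulr_ge0 ?expR_ge0 ?ii_ge0//.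
      by rewrite ler_wpM2l// ler_expR ler_wpM2l.
    rewrite /ii; case: (0 <= s) => //=; case: (leP s t) => //= st.
    by rewrite (le_trans st tn).
- apply: cvg_near_cst; near=> n; congr re; congr cI; apply/funext => s.
  suff -> : (t <= n%:R) by rewrite mulr1.
  by near: n; exact: nbhs_infty_ger.
- apply: cvg_near_cst; near=> n; congr im; congr cI; apply/funext => s.
  suff -> : (t <= n%:R) by rewrite mulr1.
  by near: n; exact: nbhs_infty_ger.
Unshelve. all: by end_near. Qed.

Lemma cvl_cc f g : nice f -> nice g -> cc f -> cc (cvl f g).
Proof.
move=> hf hg cf; have [M [K [M0 K0 H]]] := cvl_bnd hf hg.
apply: cI_cont => [l|s|a].
- exact: cvl_cm1.
- apply: ccM; last exact: cc_cst.
  apply: (cc_comp cf) => t; apply: cvgB; [exact: cvg_id|exact: cvg_cst].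
- exists (fun s => M * expR (K * (a + 1)) * ii 0 (a + 1) s); first by apply: L1Z; exact: L1_ii1.
  move=> l s l1 l2; apply: le_trans (H l s) _.
  apply: ler_pM; rewrite ?mulr_ge0 ?expR_ge0 ?ii_ge0//.
    by rewrite ler_wpM2l// ler_expR ler_wpM2l// ltW.
  rewrite /ii; case: (0 <= s) => //=; case: (leP s l) => //= st.
  by rewrite (le_trans st (ltW l2)).
Qed.

Lemma ii_in (u v x : R) : u <= x -> x <= v -> ii u v x = 1.
Proof. by rewrite /ii => -> ->. Qed.

Lemma sum_bnd (T t s : R) : 0 <= s -> s <= T -> 0 <= t - s -> t - s <= T -> 0 <= t /\ t <= T + T.
Proof. by move=> *; split; lra. Qed.

Lemma ker_split (y t s T : R) : (expR (- y * t))%:C = (expR (- y * (t - s)))%:C * (expR (- y * s))%:C :> C.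
Proof. by rewrite -rmorphM -expRD; congr (expR _)%:C; ring. Qed.

(** The product of the truncated transforms is the transform over [0, 2T] of the convolution [D] of
    the truncated functions. On [0, T] this coincides with [cvl f g], and the part over [T, 2T] is
    O(e^{-Ty}). *)
Lemma LT_cvl T f g : nice f -> nice g -> 0 <= T ->
  decay (fun y => LT T f y * LT T g y - LT T (cvl f g) y) T.
Proof.
move=> hf hg T0.
have [M M0 Hf] := nice_bnd T hf; have [M' M0' Hg] := nice_bnd T hg.
pose fT (t : RT) := f t * (ii 0 T t)%:C.
pose gT (t : RT) := g t * (ii 0 T t)%:C.
have mfT : cm fT by apply: cmM; [exact: nice_cm|apply: cm_r; exact: meas_ii].
have mgT : cm gT by apply: cmM; [exact: nice_cm|apply: cm_r; exact: meas_ii].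
have bfT t : n1 (fT t) <= M * ii 0 T t.
  rewrite n1Mr ger0_norm ?ii_ge0//; have [[-> t0 tT]|[-> _]] := ii_case 0 T t; last by rewrite !mulr0.
  by rewrite !mulr1 Hf.
have bgT t : n1 (gT t) <= M' * ii 0 T t.
  rewrite n1Mr ger0_norm ?ii_ge0//; have [[-> t0 tT]|[-> _]] := ii_case 0 T t; last by rewrite !mulr0.
  by rewrite !mulr1 Hg.
pose D (t : RT) : C := cI (fun s : RT => fT (t - s) * gT s).
have Lconv t : cL (fun s : RT => fT (t - s) * gT s).
  apply: (@cL_le _ _ (fun s => M * M' * ii 0 T s)).
  - by apply: cmM => //; apply: (cm_comp mfT); apply: measurable_funB.
  - by apply: L1Z; exact: L1_ii1.
  - move=> s; apply: le_trans (n1M _ _) _; rewrite -mulrA; apply: ler_pM; rewrite ?n1_ge0//.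
    by apply: le_trans (bfT _) _; rewrite ler_piMr// ii_le1.
have mFF : cm (fun p : RT * RT => fT (p.1 - p.2) * gT p.2).
  apply: cmM; last exact: (cm_comp mgT).
  by apply: (cm_comp mfT); apply: measurable_funB.
have key y : 0 <= y -> LT T f y * LT T g y = cI (fun t : RT => (expR (- y * t))%:C * D t * (ii 0 (T + T) t)%:C).
  move=> y0.
  have LfT : cL (fun t : RT => fT t * (expR (- y * t))%:C).
    have := LT_L T y hf; rewrite (_ : (fun t => f t * _) = (fun t => fT t * (expR (- y * t))%:C))//.
    by apply/funext => t; rewrite /fT rmorphM; ring.
  have LgT : cL (fun t : RT => gT t * (expR (- y * t))%:C).
    have := LT_L T y hg; rewrite (_ : (fun t => g t * _) = (fun t => gT t * (expR (- y * t))%:C))//.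
    by apply/funext => t; rewrite /gT rmorphM; ring.
  have -> : LT T f y = cI (fun t : RT => fT t * (expR (- y * t))%:C).
    by congr cI; apply/funext => t; rewrite /fT rmorphM; ring.
  have -> : LT T g y = cI (fun t : RT => gT t * (expR (- y * t))%:C).
    by congr cI; apply/funext => t; rewrite /gT rmorphM; ring.
  rewrite -cIZ//.
  transitivity (cI (fun s : RT => cI (fun t : RT => (expR (- y * t))%:C * (fT (t - s) * gT s) * (ii 0 (T + T) t)%:C))).
    congr cI; apply/funext => s.
    have [_ <-] := cI_affine (- s) (or_introl (erefl 1)) LfT.
    have [LL _] := cI_affine (- s) (or_introl (erefl 1)) LfT.
    rewrite -cIZr//; congr cI; apply/funext => t; rewrite mul1r.
    rewrite (@ker_split y t s T) /fT /gT.
    have [[-> s0 sT]|[-> _]] := ii_case 0 T s; last by rewrite !(mulr0, mul0r).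
    have [[-> t0 tT]|[-> _]] := ii_case 0 T (t - s); last by rewrite !(mulr0, mul0r).
    have [p0 pT] := sum_bnd s0 sT t0 tT; rewrite (ii_in p0 pT) !mulr1.
    by rewrite mulrACA [LHS]mulrC.
  rewrite (@cI_swap _ (fun s t => (expR (- y * t))%:C * (fT (t - s) * gT s) * (ii 0 (T + T) t)%:C)
     (fun s => M' * ii 0 T s) (fun t => M * ii 0 (T + T) t)).
  - congr cI; apply/funext => t.
    by rewrite cIZr ?cIZ//; exact: cLZ.
  - apply: cmM; last by apply: cm_r; exact: meas_ii.
    apply: cmM; first by apply: cm_r; apply: meas_expR; apply: measurable_funM.
    apply: (cm_comp mFF (g := fun p : RT * RT => (p.2, p.1))); exact: measurable_swap.
  - by apply: L1Z; exact: L1_ii1.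
  - by apply: L1Z; exact: L1_ii1.
  - move=> s t; rewrite n1Mr [`|ii _ _ _|]ger0_norm ?ii_ge0// [leRHS]mulrA ler_wpM2r ?ii_ge0// mulrC.
    have [t0|t0] := ltP t 0.
      rewrite (_ : fT (t - s) * gT s = 0) ?mul0r ?n1_0 ?mulr_ge0 ?ii_ge0//.
      rewrite /fT /gT; have [[-> s0 sT]|[-> _]] := ii_case 0 T s; last by rewrite !mulr0.
      by rewrite (nice_neg hf) ?mul0r//; lra.
    rewrite n1Mr ger0_norm ?expR_ge0//; apply: (@le_trans _ _ (n1 (fT (t - s) * gT s))).
      by rewrite ler_piMr ?n1_ge0// -expR0 ler_expR; nra.
    apply: le_trans (n1M _ _) _; rewrite mulrC; apply: ler_pM; rewrite ?n1_ge0//.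
    by apply: le_trans (bfT _) _; rewrite ler_piMr// ii_le1.
  - by move=> s; rewrite mulr_ge0 ?ii_ge0.
have DE t : 0 <= t -> t <= T -> D t = cvl f g t.
  move=> t0 tT; congr cI; apply/funext => s; rewrite /fT /gT.
  have [s0|s0] := ltP s 0; first by rewrite (nice_neg hg s0) !(mul0r, mulr0).
  have [st|st] := ltP t s; first by rewrite (nice_neg hf) ?subr_lt0// !(mul0r).
  rewrite !ii_in ?mulr1 ?subr_ge0 ?(le_trans st tT)//.
  by rewrite (le_trans _ tT)// gerBl.
have mD : cm D.
  apply: (@cI_param _ _ _ (fun t s => fT (t - s) * gT s) (fun s => M * M' * ii 0 T s)) => //.
  - by apply: L1Z; exact: L1_ii1.
  - move=> t s; apply: le_trans (n1M _ _) _; rewrite -mulrA; apply: ler_pM; rewrite ?n1_ge0//.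
    by apply: le_trans (bfT _) _; rewrite ler_piMr// ii_le1.
pose B := M * M' * rI (ii 0 T).
have B0 : 0 <= B by rewrite !mulr_ge0// rI_ge0// => x; exact: ii_ge0.
have bD t : n1 (D t) <= B.
  rewrite /B -rIZ; last exact: L1_ii1.
  apply: cI_le; [exact: cL_cm (Lconv t)|by apply: L1Z; exact: L1_ii1|].
  move=> s; apply: le_trans (n1M _ _) _; rewrite -mulrA; apply: ler_pM; rewrite ?n1_ge0//.
  by apply: le_trans (bfT _) _; rewrite ler_piMr// ii_le1.
move=> c' c'T; exists (B * rI (ii 0 (T + T))), 0 => y y0.
have kk : n1 (LT T f y * LT T g y - LT T (cvl f g) y) <= B * rI (ii 0 (T + T)) * expR (- T * y).
  have mE : cm (fun t : RT => (expR (- y * t))%:C * D t * (ii 0 (T + T) t)%:C).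
    apply: cmM; last by apply: cm_r; exact: meas_ii.
    by apply: cmM => //; apply: cm_r; apply: meas_expR; apply: measurable_funM.
  have L2 : cL (fun t : RT => (expR (- y * t))%:C * D t * (ii 0 (T + T) t)%:C).
    apply: (@cL_le _ _ (fun t => B * ii 0 (T + T) t)) => //; first by apply: L1Z; exact: L1_ii1.
    move=> t; rewrite n1Mr [`|ii _ _ _|]ger0_norm ?ii_ge0//.
    have [[-> t0 tT]|[-> _]] := ii_case 0 (T + T) t; last by rewrite !mulr0.
    rewrite !mulr1 mulrC n1Mr ger0_norm ?expR_ge0// -[leRHS]mulr1.
    by apply: ler_pM; rewrite ?n1_ge0 ?expR_ge0// -expR0 ler_expR; nra.
  rewrite key// /LT -cIB//; last exact: LT_L (cvl_nice hf hg).
  rewrite mulrAC -rIZ; last exact: L1_ii1.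
  apply: cI_le; [|by apply: L1Z; exact: L1_ii1|].
    by apply: cmB => //; exact: cL_cm (LT_L _ _ (cvl_nice hf hg)).
  move=> t; have [[e1 t0 tT]|[e1 hh]] := ii_case 0 T t.
    rewrite -DE// e1 (ii_in t0); last by rewrite (le_trans tT)// lerDl.
    by rewrite !mulr1 mulrC subrr n1_0 mulr_ge0 ?expR_ge0.
  rewrite e1 !mulr0 subr0 n1Mr [`|ii _ _ _|]ger0_norm ?ii_ge0//.
  have [[-> t0 tT]|[-> _]] := ii_case 0 (T + T) t; last by rewrite !mulr0.
  rewrite !mulr1 mulrC n1Mr ger0_norm ?expR_ge0//; apply: ler_pM; rewrite ?n1_ge0 ?expR_ge0//.
  have tT' : T < t by move: hh; rewrite t0 /= -ltNge.
  by rewrite ler_expR; nra.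
apply: le_trans kk _; rewrite ler_wpM2l//.
  by rewrite mulr_ge0// rI_ge0// => x; exact: ii_ge0.
by rewrite ler_expR; nra.
Qed.

Lemma cvl_rep T F G f g : nice f -> nice g -> 0 <= T -> rep T F f -> rep T G g ->
  rep T (fun y => F y * G y) (cvl f g).
Proof.
move=> hf hg T0 hF hG.
apply: (@decay_near _ (fun y => (F y - LT T f y) * G y + LT T f y * (G y - LT T g y)
  + (LT T f y * LT T g y - LT T (cvl f g) y)) _ _ 0); first by move=> y _; ring.
have h1 := decayM (hF : decay _ T) (rep_bdecay hg T0 hG).
have h2 := decayM (LT_bdecay T hf) (hG : decay _ T).
rewrite addr0 in h1; rewrite add0r in h2.
by apply: decayD; [exact: decayD h1 h2|exact: LT_cvl].
Qed.

End Conv.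

(** * The theorems of Lerch and Titchmarsh *)

Section Lerch.
Context {R : realType}.
Notation mu := (@lebesgue_measure R).
Notation RT := (measurableTypeR R).
Notation C := R[i].
Notation re := (@complex.Re R).
Notation im := (@complex.Im R).
Implicit Types (f g : RT -> C) (F G : R -> C) (T y t c : R).

Lemma ae_cont (h : R -> R) (p q : R) : continuous h ->
  {ae mu, forall x, p < x -> x < q -> h x = 0} -> forall x, p < x -> x < q -> h x = 0.
Proof.
move=> ch [N [mN N0 HN]] x px xq; apply/eqP; apply: contraT => hx.
have h1 : \forall z \near x, h z != 0.
  have := ch x; move=> /(_ (fun z => z != 0)); apply.
  by apply: open_nbhs_nbhs; split => //; exact: open_neq.
have h2 : \forall z \near x, z \in `]p, q[ by apply: near_in_itvoo; rewrite in_itv/= px.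
have [e e0 he] : exists2 e : R, 0 < e & forall z, ball x e z -> h z != 0 /\ z \in `]p, q[.
  have /nbhs_ballP[e /= e0 he] : nbhs x (fun z => h z != 0 /\ z \in `]p, q[).
    by apply: filterS2 h1 h2 => z; split.
  by exists e.
have sub : ball x e `<=` N.
  move=> z /he[hz]; rewrite in_itv/= => /andP[pz zq]; apply: HN => /= H.
  by move/eqP : hz; apply; exact: H.
have : (mu (ball x e) <= mu N)%E.
  by apply: le_measure; rewrite ?inE//; exact: measurable_ball.
rewrite N0 [X in (X <= _)%E -> _](_ : _ = (e *+ 2)%:E); last first.
  exact: (lebesgue_measure_ball x (ltW e0)).
by rewrite lee_fin leNgt mulrn_wgt0.
Qed.

Lemma powN_le (x : R) N : 0 <= x -> x <= 1 -> (1 - x) ^+ N <= expR (- (N%:R * x)).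
Proof.
move=> x0 x1; rewrite -mulrN expRM_natl lerXn2r ?nnegrE ?expR_ge0 ?subr_ge0//.
exact: expR_ge1Dx.
Qed.

Lemma powN_ge (x : R) N : 0 <= x -> x <= 1 -> 1 - N%:R * x <= (1 - x) ^+ N.
Proof.
move=> x0 x1; elim: N => [|N IH]; first by rewrite mul0r subr0 expr0.
rewrite exprS -natr1; have : 0 <= (1 - x) ^+ N by rewrite exprn_ge0 ?subr_ge0.
have := ler_wpM2l (_ : 0 <= 1 - x) IH; rewrite subr_ge0 => /(_ x1).
have : 0 <= N%:R :> R by [].
nra.
Qed.

Lemma cvg_expN (r : R) : r < 0 -> (fun n : nat => expR (n%:R * r)) @ \oo --> (0 : R).
Proof.
move=> r0.
rewrite (_ : (fun n => _) = (fun n : nat => expR r ^+ n)).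
  by apply: cvg_expr; rewrite ger0_norm ?expR_ge0// expR_lt1.
by apply/funext => n; rewrite expRM_natl.
Qed.

Lemma cvg_expP (r : R) : 0 < r -> (fun n : nat => expR (- expR (n%:R * r))) @ \oo --> (0 : R).
Proof.
move=> r0; apply: (@squeeze_cvgr _ _ _ _ (fun=> 0) (fun n : nat => expR (n%:R * - r))).
- near=> n; rewrite expR_ge0/= ler_expR mulrN lerN2.
  by apply: le_trans (expR_ge1Dx _); rewrite lerDr.
- exact: cvg_cst.
- by apply: cvg_expN; rewrite oppr_lt0.
Unshelve. all: by end_near. Qed.

Lemma mulr_rCA (w : C) (u v : R) : w * (u * v)%:C = u%:C * (w * v%:C).
Proof. by rewrite rmorphM mulrCA. Qed.

(** The weights 1 - (1 - e^{-ns})^N with N close to e^{nt} tend to the indicator of s < t, because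
    (1 - x)^N is about e^{-Nx} and Nx is about e^{n(t-s)}. In the binomial expansion the constant
    term cancels the leading 1, so only the transform at n, 2n, 3n, ... enters, where the decay
    hypothesis is available once n is large. *)
Lemma lerch f T t c : nice f -> decay (LT T f) c -> t < c -> t <= T ->
  cI (fun s : RT => f s * (ii 0 t s)%:C) = 0.
Proof.
move=> hf hd tc tT.
(* With this choice N e^{-ns} tends to infinity for s < t and to 0 for s > t. *)
pose N n := Num.truncn (expR (n%:R * t)).
have N1 n : (N n)%:R <= expR (n%:R * t) by have /andP[] := truncn_itv (expR_ge0 (n%:R * t)).
have N2 n : expR (n%:R * t) <= (N n)%:R + 1.
  by have /andP[_ /ltW] := truncn_itv (expR_ge0 (n%:R * t)); rewrite -natr1.
pose x n s : R := expR (- n%:R * s).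
pose w n (s : RT) : R := (1 - (1 - x n s) ^+ N n) * ii 0 T s.
have x01 n s : 0 <= s -> 0 <= x n s /\ x n s <= 1.
  by move=> s0; rewrite expR_ge0; split => //; rewrite -expR0 ler_expR mulNr oppr_le0 mulr_ge0.
have w01 n s : `|w n s| <= ii 0 T s.
  rewrite /w; have [[-> s0 sT]|[-> _]] := ii_case 0 T s; last by rewrite mulr0 normr0.
  rewrite mulr1; have [h1 h2] := x01 n s s0.
  have : 0 <= (1 - x n s) ^+ N n by rewrite exprn_ge0 ?subr_ge0.
  have : (1 - x n s) ^+ N n <= 1 by rewrite exprn_ile1 ?subr_ge0// lerBlDr lerDl.
  by rewrite ler_norml; lra.
have mx n : measurable_fun setT (x n : RT -> RT) by apply: meas_expR; exact: measurable_funM.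
have mw n : measurable_fun setT (w n : RT -> RT).
  apply: measurable_funM; last exact: meas_ii.
  apply: (measurable_funB (measurable_cst _)); apply: measurable_funX.
  by apply: (measurable_funB (measurable_cst _)); exact: mx.
have cw s : s <> t -> (fun n => w n s) @ \oo --> ii 0 T s * ((s <= t)%R)%:R.
  move=> st; rewrite /w; have [[-> s0 sT]|[-> _]] := ii_case 0 T s; last first.
    by rewrite mul0r; under eq_fun do rewrite mulr0; exact: cvg_cst.
  rewrite mul1r; under eq_fun do rewrite mulr1.
  have E n : expR (n%:R * (t - s)) = expR (n%:R * t) * x n s.
    by rewrite /x -expRD; congr expR; ring.
  case: (ltgtP s t) st => // [st|ts] _.
    suff : (fun n => 1 - (1 - x n s) ^+ N n) @ \oo --> (1 - 0 : R) by rewrite subr0.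
    apply: cvgB; first exact: cvg_cst.
    have h := @cvg_expP (t - s) ltac:(lra).
    apply: (@squeeze_cvgr _ _ _ _ (fun=> 0) (fun n : nat => expR 1 * expR (- expR (n%:R * (t - s))))).
    - near=> n; have [h1 h2] := x01 n s s0.
      rewrite exprn_ge0 ?subr_ge0//=; apply: le_trans (powN_le _ h1 h2) _.
      rewrite -expRD ler_expR E; have := N2 n; nra.
    - exact: cvg_cst.
    - suff : (fun n : nat => expR 1 * expR (- expR (n%:R * (t - s)))) @ \oo --> (expR 1 * 0 : R) by rewrite mulr0.
      by apply: cvgM => //; exact: cvg_cst.
  have h := @cvg_expN (t - s) ltac:(lra).
  apply: (@squeeze_cvgr _ _ _ _ (fun=> 0) (fun n : nat => expR (n%:R * (t - s)))) => //.
  - near=> n; have [h1 h2] := x01 n s s0.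
    have := powN_ge (N n) h1 h2; have : (1 - x n s) ^+ N n <= 1 by rewrite exprn_ile1 ?subr_ge0// lerBlDr lerDl.
    rewrite E; have := N1 n; nra.
  - exact: cvg_cst.
have [M M0 HM] := nice_bnd T hf.
have [mf1 mf2] := nice_cm hf.
have bnd (p : C -> R) : (forall z, `|p z| <= n1 z) -> forall n s, `|p (f s) * w n s| <= M * ii 0 T s.
  move=> hp n s; rewrite normrM; have [[e s0 sT]|[e _]] := ii_case 0 T s.
    apply: ler_pM => //; first by apply: le_trans (hp _) _; exact: HM.
  by rewrite e mulr0 /w e mulr0 normr0 mulr0.
have L1M : L1 (fun s => M * ii 0 T s) by apply: L1Z; exact: L1_ii1.
have lim (p : C -> R) : (forall z, `|p z| <= n1 z) -> measurable_fun setT (p \o f : RT -> RT) ->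
    (fun n => rI (fun s => p (f s) * w n s)) @ \oo --> rI (fun s => p (f s) * (ii 0 T s * ((s <= t)%R)%:R)).
  move=> hp mp; apply: (@rI_dct R _ _ (fun s => M * ii 0 T s)) => //.
  - by move=> n; exact: (measurable_funM mp (mw n)).
  - by apply: (measurable_funM mp); apply: measurable_funM; [exact: meas_ii|exact: meas_ler].
  - exact: bnd.
  - by apply: (ae_imp (ae_neq t)) => s st; apply: cvgM; [exact: cvg_cst|exact: cw].
(* By the binomial formula the integrals against [w n] are finite combinations
   of Laplace transforms at integer points. *)
pose S n := \sum_(k < N n) ((- ((-1) ^+ k.+1 * ('C(N n, k.+1))%:R)) : R)%:C * LT T f (k.+1%:R * n%:R).
have SE n : cI (fun s : RT => f s * (w n s)%:C) = S n.
  have Lk k : cL (fun s : RT => f s * (expR (- (k%:R * n%:R) * s) * ii 0 T s)%:C) by exact: LT_L.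
  pose Gk k (s : RT) : C := f s * (expR (- (k.+1%:R * n%:R) * s) * ii 0 T s)%:C.
  have step (a : seq nat) (b : nat -> R) : let h (s : RT) := \sum_(k <- a) (b k)%:C * Gk k s in
      cL h /\ cI h = \sum_(k <- a) (b k)%:C * LT T f (k.+1%:R * n%:R).
    move=> h; elim: a @h => [|k a [IH1 IH2]] h.
      rewrite big_nil (_ : h = (fun=> 0)); first by split; [exact: cL0|exact: cI0].
      by apply/funext => s; rewrite /h big_nil.
    rewrite big_cons (_ : h = (fun s => (b k)%:C * Gk k s + \sum_(j <- a) (b j)%:C * Gk j s)); last first.
      by apply/funext => s; rewrite /h big_cons.
    split; first by apply: cLD => //; apply: cLZ; exact: Lk.
    by rewrite cID//; [rewrite cIZ ?IH2//; exact: Lk|apply: cLZ; exact: Lk].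
  rewrite /S -(big_mkord xpredT (fun k => (- ((-1) ^+ k.+1 * ('C(N n, k.+1))%:R) : R)%:C * LT T f (k.+1%:R * n%:R))).
  have [_ /= <-] := step (index_iota 0 (N n)) (fun k => - ((-1) ^+ k.+1 * ('C(N n, k.+1))%:R)).
  congr cI; apply/funext => s.
  have -> : w n s = \sum_(0 <= k < N n) (- ((-1) ^+ k.+1 * ('C(N n, k.+1))%:R)) * (expR (- (k.+1%:R * n%:R) * s) * ii 0 T s).
    rewrite /w exprDn big_ord_recl /= subn0 expr1n mul1r expr0 bin0 mulr1n opprD addNKr.
    rewrite big_mkord -sumrN mulr_suml; apply: eq_bigr => k _.
    rewrite expr1n mul1r -mulr_natr (exprNn (x n s)) /bump leq0n add1n.
    have -> : expR (- (k.+1%:R * n%:R) * s) = x n s ^+ k.+1.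
      by rewrite /x -expRM_natl; congr expR; ring.
    by move: ((-1) ^+ k.+1) (x n s ^+ k.+1) (('C(N n, k.+1))%:R : R) (ii 0 T s) => u v m i; ring.
  rewrite rmorph_sum mulr_sumr; apply: eq_bigr => k _.
  exact: mulr_rCA.
(* Bounding the transform at (k+1)n by K e^{-c'(k+1)n} and resumming the binomial formula gives K
   ((1 + e^{-c'n})^N - 1), at most K (exp(e^{n(t-c')}) - 1). This tends to 0 for any c' in ]t, c[;
   the midpoint is taken. *)
have S0 : (fun n => n1 (S n)) @ \oo --> (0 : R).
  move: hd => /decayP /(_ ((t + c) / 2) ltac:(lra)) [K [Y [K0 Y1 H]]].
  set c' := (t + c) / 2 in H.
  apply: (@squeeze_cvgr _ _ _ _ (fun=> 0) (fun n : nat => K * (expR (expR (n%:R * (t - c'))) - 1))).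
  - near=> n; rewrite n1_ge0/=.
    have nY : Y <= n%:R by near: n; exact: nbhs_infty_ger.
    apply: (@le_trans _ _ (K * ((1 + expR (- c' * n%:R)) ^+ N n - 1))).
      rewrite exprDn big_ord_recl /= subn0 expr1n mul1r expr0 bin0 mulr1n addrAC subrr add0r.
      rewrite mulr_sumr /S; elim/big_ind2 : _ => [|a a' b b' h h'|k _]; first by rewrite n1_0.
        by apply: le_trans (n1D _ _) _; exact: lerD.
      rewrite mulrC n1Mr normrN normrM normrX normrN normr1 expr1n mul1r normr_nat.
      rewrite /bump leq0n add1n expr1n mul1r -[X in K * X]mulr_natr [leRHS]mulrA ler_wpM2r//.
      have -> : expR (- c' * n%:R) ^+ k.+1 = expR (- c' * (k.+1%:R * n%:R)).
        by rewrite -expRM_natl; congr expR; ring.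
      by apply: H; apply: le_trans nY _; rewrite ler_peMl// ler1n.
    rewrite /= (ler_pM2l K0) lerD2r.
    have h : expR (n%:R * (t - c')) = expR (n%:R * t) * expR (- c' * n%:R) by rewrite -expRD; congr expR; ring.
    apply: (@le_trans _ _ (expR ((N n)%:R * expR (- c' * n%:R)))).
      rewrite expRM_natl lerXn2r ?nnegrE ?expR_ge0 ?addr_ge0 ?expR_ge0//.
      exact: expR_ge1Dx.
    by rewrite ler_expR h ler_wpM2r ?expR_ge0.
  - exact: cvg_cst.
  - suff : (fun n : nat => K * (expR (expR (n%:R * (t - c'))) - 1)) @ \oo --> (K * (expR 0 - 1) : R).
      by rewrite expR0 subrr mulr0.
    apply: cvgM; first exact: cvg_cst.
    apply: cvgB; last exact: cvg_cst.
    have hu : (fun n : nat => expR (n%:R * (t - c'))) @ \oo --> (0 : R).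
      by apply: cvg_expN; rewrite /c'; lra.
    exact: (cvg_comp _ _ hu (@continuous_expR R 0)).
have fin (p : C -> R) : (forall z, `|p z| <= n1 z) -> measurable_fun setT (p \o f : RT -> RT) ->
   (forall n, `|rI (fun s => p (f s) * w n s)| <= n1 (S n)) ->
   rI (fun s => p (f s) * ii 0 t s) = 0.
  move=> hp mp hS.
  have h0 : (fun n => rI (fun s => p (f s) * w n s)) @ \oo --> (0 : R).
    apply/norm_cvg0P; apply: (@squeeze_cvgr _ _ _ _ (fun=> 0) _ _ _ _ _ S0); last exact: cvg_cst.
    by near=> n; rewrite normr_ge0 hS.
  have := cvg_unique _ h0 (lim p hp mp) => /(_ (@Rhausdorff R)) e.
  rewrite [RHS]e {e}.
  congr rI; apply/funext => s; congr (_ * _).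
  rewrite /ii -natrM mulnb; suff -> : (0 <= s <= t) = ((0 <= s <= T) && (s <= t)) by [].
  by case: (leP s t) => st; rewrite ?andbF// (le_trans st tT) !andbT.
apply: Ceq => /=.
- transitivity (rI (fun s => re (f s) * ii 0 t s)).
    by congr rI; apply/funext => s /=; rewrite reM re_r im_r mulr0 subr0.
  apply: (fin (@complex.Re R)) => //; first exact: n1_re.
  move=> n; rewrite -SE; apply: le_trans (n1_re _) => /=.
  rewrite le_eqVlt; apply/orP; left; apply/eqP; congr `|rI _|; apply/funext => s /=.
  by rewrite reM re_r im_r mulr0 subr0.
- transitivity (rI (fun s => im (f s) * ii 0 t s)).
    by congr rI; apply/funext => s /=; rewrite imM re_r im_r mulr0 add0r.
  apply: (fin (@complex.Im R)) => //; first exact: n1_im.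
  move=> n; rewrite -SE; apply: le_trans (n1_im _) => /=.
  rewrite le_eqVlt; apply/orP; left; apply/eqP; congr `|rI _|; apply/funext => s /=.
  by rewrite imM re_r im_r mulr0 add0r.
Unshelve. all: by end_near. Qed.

End Lerch.

Section Titchmarsh.
Context {R : realType}.
Notation mu := (@lebesgue_measure R).
Notation RT := (measurableTypeR R).
Notation C := R[i].
Notation re := (@complex.Re R).
Notation im := (@complex.Im R).
Implicit Types (f g : RT -> C) (F G : R -> C) (T y t c : R).

(** The previous lemma annihilates all primitives below [c]; differentiation gives zero almost
    everywhere, and continuity gives zero everywhere. *)
Lemma lerch0 f T c : nice f -> cc f -> decay (LT T f) c -> c <= T -> forall t, t < c -> f t = 0.
Proof.
move=> hf [cf1 cf2] hd cT.
have L := LT_L T 0 hf.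
have LE : (fun t : RT => f t * (expR (- 0 * t) * ii 0 T t)%:C) = (fun t : RT => f t * (ii 0 T t)%:C).
  by apply/funext => t; rewrite oppr0 mul0r expR0 mul1r.
rewrite LE in L; have [L1f L2f] := L.
have key (p : C -> R) : continuous (p \o f : R -> R) -> p 0 = 0 ->
    (forall s, p (f s * (ii 0 T s)%:C) = p (f s) * ii 0 T s) ->
    L1 (fun s => p (f s * (ii 0 T s)%:C)) ->
    (forall t, t < c -> rI (fun s => p (f s) * ii 0 t s) = 0) ->
    forall t, t < c -> p (f t) = 0.
  move=> cp p0 pM Lp H t tc.
  have [t0|t0] := ltP t 0; first by rewrite (nice_neg hf t0).
  set h := fun s => p (f s * (ii 0 T s)%:C) in Lp.
  have pr v : v < c -> prim h v = 0.
    move=> vc; rewrite -[RHS](H v vc) /prim; congr rI; apply/funext => s.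
    rewrite /h pM -mulrA /ii -natrM mulnb.
    suff -> : ((0 <= s <= T) && (s <= v)) = (0 <= s <= v) by [].
    by case: (leP s v) => sv; rewrite ?andbF// (le_trans sv (le_trans (ltW vc) cT)) !andbT.
  have B := @ae_bound R h 0 c 0 Lp.
  have {}B : {ae mu, forall x, 0 < x -> x < c -> `|h x| <= 0}.
    apply: B => u v u0 uv vc; rewrite -primB// !pr//; first by rewrite subrr normr0 mul0r.
    exact: le_lt_trans vc.
  apply: (@ae_cont R (p \o f) (-1) c cp) => //; last lra.
  apply: (ae_imp2 B (ae_neq 0)) => x hx x0 xm xc /=.
  have [xn|xp] := ltP x 0; first by rewrite (nice_neg hf xn).
  have x0' : 0 < x by rewrite lt_neqAle xp andbT; apply/eqP => /esym.
  have := hx x0' xc; rewrite normr_le0 /h pM => /eqP.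
  by rewrite ii_in ?mulr1// (le_trans (ltW xc)).
have Z t : t < c -> cI (fun s : RT => f s * (ii 0 t s)%:C) = 0.
  by move=> tc; apply: (lerch hf hd tc); exact: le_trans (ltW tc) cT.
move=> t tc; apply: Ceq.
- apply: (key (@complex.Re R)) => // [s|s h]; first by rewrite reM re_r im_r mulr0 subr0.
  have /(congr1 re) /= e := Z s h; rewrite -[RHS]e.
  by congr rI; apply/funext => x /=; rewrite reM re_r im_r mulr0 subr0.
- apply: (key (@complex.Im R)) => // [s|s h]; first by rewrite imM re_r im_r mulr0 add0r.
  have /(congr1 im) /= e := Z s h; rewrite -[RHS]e.
  by congr rI; apply/funext => x /=; rewrite imM re_r im_r mulr0 add0r.
Qed.

Lemma lerch_rep f F T c : nice f -> cc f -> rep T F f -> decay F c -> c <= T ->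
  forall t, t < c -> f t = 0.
Proof.
move=> hf cf hr hd cT; apply: (@lerch0 f T) => //.
apply: (@decay_near _ (fun y => F y - (F y - LT T f y)) _ _ 0); first by move=> y _; ring.
by apply: decayB => //; exact: decay_le hr.
Qed.

(** Carries vanishing integrals to the limit by dominated convergence. Applied to the partial sums
    of the exponential series, it turns vanishing moments into a vanishing Laplace transform. *)
Lemma cI_dct0 (phi : RT -> C) (p : nat -> R -> R) (q w : R -> R) :
  cm phi -> L1 w -> (forall n, measurable_fun setT (p n : RT -> RT)) ->
  measurable_fun setT (q : RT -> RT) ->
  (forall n s, n1 (phi s) * `|p n s| <= w s) ->
  (forall s, n1 (phi s) != 0 -> (fun n => p n s) @ \oo --> q s) ->
  (forall n, cI (fun s : RT => phi s * (p n s)%:C) = 0) ->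
  cI (fun s : RT => phi s * (q s)%:C) = 0.
Proof.
move=> [m1 m2] Lw mp mq hb hc h0.
have key (pr : C -> R) : (forall z, `|pr z| <= n1 z) -> measurable_fun setT (pr \o phi : RT -> RT) ->
   (forall n, rI (fun s => pr (phi s) * p n s) = 0) -> rI (fun s => pr (phi s) * q s) = 0.
  move=> hp mpr hz.
  have : (fun n => rI (fun s => pr (phi s) * p n s)) @ \oo --> rI (fun s => pr (phi s) * q s).
    apply: (@rI_dct R _ _ w) => //.
    - by move=> n; exact: (measurable_funM mpr (mp n)).
    - exact: (measurable_funM mpr mq).
    - by move=> n s; rewrite normrM; apply: le_trans (hb n s); rewrite ler_wpM2r.
    - apply: aeW => s; have [/eqP e|ne] := boolP (n1 (phi s) == 0).
        have e0 : pr (phi s) = 0 by apply/eqP; rewrite -normr_le0 -e; exact: hp.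
        by rewrite e0 mul0r; under eq_fun do rewrite mul0r; exact: cvg_cst.
      by apply: cvgM; [exact: cvg_cst|exact: hc].
  under eq_fun do rewrite hz.
  by move=> h; apply/esym; apply: (cvg_unique _ (@cvg_cst _ 0 _ _ _) h); exact: Rhausdorff.
apply: Ceq => /=.
- transitivity (rI (fun s => re (phi s) * q s)).
    by congr rI; apply/funext => s /=; rewrite reM re_r im_r mulr0 subr0.
  apply: (key (@complex.Re R)) => //; first exact: n1_re.
  move=> n; have /(congr1 re) /= e := h0 n; rewrite -[RHS]e.
  by congr rI; apply/funext => s /=; rewrite reM re_r im_r mulr0 subr0.
- transitivity (rI (fun s => im (phi s) * q s)).
    by congr rI; apply/funext => s /=; rewrite imM re_r im_r mulr0 add0r.
  apply: (key (@complex.Im R)) => //; first exact: n1_im.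
  move=> n; have /(congr1 im) /= e := h0 n; rewrite -[RHS]e.
  by congr rI; apply/funext => s /=; rewrite imM re_r im_r mulr0 add0r.
Qed.

(* [tp f 1] acts as a derivation for the convolution [cvl]. *)
Definition tp f (i : nat) (t : RT) : C := (t ^+ i)%:C * f t.

Lemma tp0 f : tp f 0 = f.
Proof. by apply/funext => t; rewrite /tp expr0 mul1r. Qed.
Lemma tpS f i : tp f i.+1 = (fun t : RT => t%:C * tp f i t).
Proof. by apply/funext => t; rewrite /tp exprS rmorphM mulrA. Qed.
Lemma tp1 f i : tp (tp f i) 1 = tp f i.+1.
Proof. by apply/funext => t; rewrite /tp expr1 exprS rmorphM mulrA. Qed.
Lemma tp_nice f i : nice f -> nice (tp f i).
Proof. by move=> hf; elim: i => [|i IH]; [rewrite tp0|rewrite tpS; exact: nice_tM]. Qed.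
Lemma tp_cc f i : cc f -> cc (tp f i).
Proof.
move=> cf; elim: i => [|i IH]; first by rewrite tp0.
by rewrite tpS; apply: ccM => //; apply: cc_r => t; exact: cvg_id.
Qed.

Lemma cvl_t f g t : nice f -> nice g ->
  t%:C * cvl f g t = cvl (tp f 1) g t + cvl f (tp g 1) t.
Proof.
move=> hf hg; rewrite /cvl -cIZ; last exact: cvl_L.
rewrite -cID; [|by apply: cvl_L => //; exact: tp_nice..].
congr cI; apply/funext => s; rewrite /tp !expr1.
have -> : t%:C = (t - s)%:C + s%:C :> C by rewrite -rmorphD subrK.
by ring.
Qed.

(* Let [F_i, G_j] be the transforms of [t^i f, t^j g], and [m n] the best rate of
   decay common to the products [F_i G_j] with [i + j = n].  The derivative
   [F_(i+1) G_j + F_i G_(j+1)] of such a product decays at rate [m n], so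
     (F_i G_(j+1))^2 = F_i G_(j+1) (F_(i+1) G_j + F_i G_(j+1)) - F_i G_j F_(i+1) G_(j+1)
   gives [2 m (n+1) >= m n + min (m (n+1)) (m (n+2))].  A drop of [m] would thus
   repeat itself forever and make [m] negative; so [m] does not decrease, and
   [m 0 = T]. *)
Lemma titchmarsh_moment f g T : nice f -> nice g -> cc f -> cc g -> 0 <= T ->
  (forall t, t < T -> cvl f g t = 0) ->
  forall n t, t < T -> cvl f (tp g n) t = 0.
Proof.
move=> hf hg cf cg T0 H.
pose FF i := LT T (tp f i); pose GG i := LT T (tp g i).
pose D i j := decay (fun y => FF i y * GG j y).
have nf i : nice (tp f i) by exact: tp_nice.
have ng i : nice (tp g i) by exact: tp_nice.
have RC i j : rep T (fun y => FF i y * GG j y) (cvl (tp f i) (tp g j)).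
  by apply: cvl_rep => //; exact: rep_LT.
have D0 i j : D i j 0 by have := decayM (LT_bdecay T (nf i)) (LT_bdecay T (ng j)); rewrite addr0.
have DZ i j p : p <= T -> D i j p -> forall t, t < p -> cvl (tp f i) (tp g j) t = 0.
  move=> pT hD; apply: (lerch_rep (cvl_nice (nf i) (ng j)) _ (RC i j) hD pT).
  by apply: cvl_cc => //; exact: tp_cc.
have DS i j p : p <= T -> D i j p -> decay (fun y => FF i.+1 y * GG j y + FF i y * GG j.+1 y) p.
  move=> pT hD.
  have := repD (cvl_nice (nf i.+1) (ng j)) (cvl_nice (nf i) (ng j.+1)) (RC i.+1 j) (RC i j.+1).
  apply: rep_decay => //; first by apply: niceD; exact: cvl_nice.
  move=> t tp_; have := DZ _ _ _ pT hD t tp_.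
  by move=> e; have := cvl_t t (nf i) (ng j); rewrite e mulr0 !tp1 => /esym.
have ST i j p m q : p <= T -> D i j p -> D i j.+1 m -> D i.+1 j.+1 q ->
    D i j.+1 (Num.min (m + p) (p + q) / 2).
  move=> pT h1 h2 h3; apply: decay_sq.
  rewrite mulrC divfK//.
  apply: (@decay_near _ (fun y => (FF i y * GG j.+1 y) * (FF i.+1 y * GG j y + FF i y * GG j.+1 y)
     - (FF i y * GG j y) * (FF i.+1 y * GG j.+1 y)) _ _ 0); first by move=> y _; ring.
  apply: decayB.
    by apply: decay_le (decayM h2 (DS _ _ _ pT h1)); rewrite ge_min lexx.
  by apply: decay_le (decayM h1 h3); rewrite ge_min lexx orbT.
have ST' i j p m q : p <= T -> D i j p -> D i.+1 j m -> D i.+1 j.+1 q ->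
    D i.+1 j (Num.min (m + p) (p + q) / 2).
  move=> pT h1 h2 h3; apply: decay_sq.
  rewrite mulrC divfK//.
  apply: (@decay_near _ (fun y => (FF i.+1 y * GG j y) * (FF i.+1 y * GG j y + FF i y * GG j.+1 y)
     - (FF i y * GG j y) * (FF i.+1 y * GG j.+1 y)) _ _ 0); first by move=> y _; ring.
  apply: decayB.
    by apply: decay_le (decayM h2 (DS _ _ _ pT h1)); rewrite ge_min lexx.
  by apply: decay_le (decayM h1 h3); rewrite ge_min lexx orbT.
(* Rates above [T] are left out because the representations [RC] are accurate only up to rate [T];
   the cap also bounds the supremum. *)
pose Aset n : set R := [set c | 0 <= c <= T /\ forall i j, (i + j)%N = n -> D i j c].
pose m n := sup (Aset n).
have A0 n : Aset n 0.
  by rewrite /Aset /=; split; [rewrite lexx T0|move=> i j _; exact: D0].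
have hs n : has_sup (Aset n).
  split; first by exists 0.
  by exists T => c [/andP[]].
have m0 n : 0 <= m n by apply: (ub_le_sup (hs n).2); exact: A0.
have mT n : m n <= T by apply: ge_sup; [exists 0|move=> c [/andP[]]].
(* The supremum is itself an admissible rate, since [decay] at all smaller rates implies [decay] at
   the limiting one. *)
have mD n i j : (i + j)%N = n -> D i j (m n).
  move=> ijn; apply: decay_sup => c' c'm.
  have e0 : 0 < m n - c' by rewrite subr_gt0.
  have [c [_ hc]] := sup_adherent e0 (hs n).
  by rewrite -/(m n) subKr => cc'; exact: decay_le (ltW cc') (hc _ _ ijn).
have mstep n : Num.min (m n.+1 + m n) (m n + m n.+2) / 2 <= m n.+1.
  apply: (ub_le_sup (hs n.+1).2); split.
    rewrite divr_ge0 ?le_min ?addr_ge0//= ler_pdivrMr// ge_min.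
    by apply/orP; left; rewrite mulr2n mulrDr mulr1 lerD.
  (* [ST] raises the second index and so reaches every pair whose second index is positive; the
     remaining pair (n + 1, 0) is reached by [ST'], which raises the first index. *)
  move=> i [|j]; last first.
    rewrite addnS => -[ij]; apply: (ST i j _ _ _ (mT n)); apply: mD => //.
      by rewrite addnS ij.
    by rewrite addSn addnS ij.
  case: i => [//|i]; rewrite addn0 => -[ij]; apply: (ST' i 0%N _ _ _ (mT n)); apply: mD.
  - by rewrite addn0.
  - by rewrite addn0 ij.
  - by rewrite addn1 ij.
have mmono n : m n <= m n.+1.
  rewrite leNgt; apply/negP => lt.
  pose d := m n - m n.+1; have d0 : 0 < d by rewrite subr_gt0.
  (* In [mstep] the first branch of the minimum amounts to m(n+1) >= m(n), which a drop excludes;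
     the second gives m(n+1) - m(n+2) >= m(n) - m(n+1), so a drop of at least [d] is followed by
     another. *)
  have hk k : m (n + k).+1 <= m (n + k)%N - d /\ m (n + k)%N <= m n - k%:R * d.
    elim: k => [|k [IH1 IH2]]; first by rewrite addn0 mul0r subr0 /d subKr.
    rewrite addnS; split; last first.
      by apply: le_trans IH1 _; rewrite -natr1 mulrDl mul1r; clear -IH2; lra.
    have := mstep (n + k)%N; rewrite ler_pdivrMr// ge_min => /orP[h|h]; clear -h IH1 d0; lra.
  have [k kP] : exists k : nat, m n < k%:R * d.
    exists (Num.truncn (m n / d)).+1; rewrite -ltr_pdivrMr//.
    by have /andP[] := truncn_itv (divr_ge0 (m0 n) (ltW d0)).
  have [_ h] := hk k; have := m0 (n + k)%N; clear -h kP; lra.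
have mT' n : T <= m n.
  elim: n => [|n IH]; last exact: le_trans IH (mmono n).
  apply: (ub_le_sup (hs 0%N).2); split; first by rewrite T0 lexx.
  move=> i j /eqP; rewrite addn_eq0 => /andP[/eqP -> /eqP ->].
  rewrite /D /FF /GG !tp0.
  apply: (rep_decay (cvl_nice hf hg) (lexx T) H).
  by apply: cvl_rep => //; exact: rep_LT.
move=> n t tT.
have := DZ 0%N n T (lexx T) (decay_le (mT' n) (mD n 0%N n (add0n n))) t tT.
by rewrite tp0.
Qed.

Lemma exp_partial_bound (x : R) n : `|series (exp_coeff x) n| <= expR `|x|.
Proof.
apply: (@le_trans _ _ (series (exp_coeff `|x|) n)).
  rewrite /series/=; apply: le_trans (ler_norm_sum _ _ _) _; apply: ler_sum => i _.
  by rewrite /exp_coeff/= normrM normfV normrX normr_nat.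
rewrite /expR; apply: nondecreasing_cvgn_le; last exact: is_cvg_series_exp_coeff.
apply: nondecreasing_series => i _ _; rewrite /exp_coeff/= divr_ge0// exprn_ge0//.
Qed.

(* All moments of the continuous function [x |-> f (t - x) * g x] vanish for
   [t < T], so its Laplace transform and the function itself vanish. *)
Theorem titchmarsh f g T : nice f -> nice g -> cc f -> cc g -> 0 <= T ->
  (forall t, t < T -> cvl f g t = 0) ->
  forall r s, r + s < T -> f r * g s = 0.
Proof.
move=> hf hg cf cg T0 H r s rsT.
have HM := titchmarsh_moment hf hg cf cg T0 H.
pose t := r + s; pose phi (x : RT) : C := f (t - x) * g x.
have rE : r = t - s by rewrite /t addrK.
rewrite rE -/(phi s).
have [M [K [M0 K0 HB]]] := cvl_bnd hf hg.
have nphi : nice phi.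
  apply: niceP; first exact: cvl_cm1.
    by move=> x x0; rewrite /phi (nice_neg hg x0) mulr0.
  exists (M * expR (K * t)), 0 => x _; rewrite mul0r expR0 mulr1.
  by apply: le_trans (HB t x) _; rewrite ler_piMr ?ii_le1// mulr_ge0 ?expR_ge0.
have cphi : cc phi.
  apply: ccM => //; apply: (cc_comp cf) => x; apply: cvgB; [exact: cvg_cst|exact: cvg_id].
have phi0 x : t < x -> phi x = 0 by move=> tx; rewrite /phi (nice_neg hf) ?mul0r// subr_lt0.
have phi0' x : x < 0 -> phi x = 0 by move=> x0; rewrite /phi (nice_neg hg x0) mulr0.
have mom n : cI (fun x : RT => phi x * (x ^+ n)%:C) = 0.
  rewrite -(HM n t rsT); congr cI; apply/funext => x; rewrite /phi /tp.
  by rewrite -mulrA [g x * _]mulrC.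
have [t0|t0] := ltP t 0.
  have [s0|s0] := ltP s 0; first exact: phi0'.
  by apply: phi0; exact: lt_le_trans s0.
have LZ y : LT t phi y = 0.
  rewrite (_ : LT t phi y = cI (fun x : RT => phi x * (expR (- y * x))%:C)); last first.
    congr cI; apply/funext => x; have [[-> _ _]|[-> hx]] := ii_case 0 t x; first by rewrite mulr1.
    move: hx; rewrite negb_and -!ltNge => /orP[x0|tx]; first by rewrite phi0' ?mul0r.
    by rewrite phi0 ?mul0r.
  apply: (@cI_dct0 _ (fun n x => series (exp_coeff (- y * x)) n) _ (fun x => M * expR (K * t) * expR (`|y| * t) * ii 0 t x)).
  - exact: nice_cm.
  - by apply: L1Z; exact: L1_ii1.
  - move=> n; rewrite /series/=.
    apply: measurable_sum => k; rewrite /exp_coeff/=.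
    apply: measurable_funM => //; apply: measurable_funX; exact: measurable_funM.
  - by apply: meas_expR; exact: measurable_funM.
  - move=> n x; apply: (@le_trans _ _ (M * expR (K * t) * ii 0 t x * expR `|- y * x|)).
      by apply: ler_pM; rewrite ?n1_ge0//; [exact: HB|exact: exp_partial_bound].
    have [[-> x0 xt]|[-> _]] := ii_case 0 t x; last by rewrite !mulr0 mul0r.
    rewrite !mulr1 ler_wpM2l ?mulr_ge0 ?expR_ge0// ler_expR normrM normrN ler_wpM2l//.
    by rewrite ger0_norm.
  - move=> x _; exact: is_cvg_series_exp_coeff.
  - move=> n.
    pose h k (x : RT) : C := phi x * ((- y * x) ^+ k / k`!%:R)%:C.
    have hE k : h k = (fun x : RT => (((- y) ^+ k / k`!%:R)%:C) * (phi x * (x ^+ k)%:C)).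
      by apply/funext => x; rewrite /h exprMn [X in X%:C]mulrAC; exact: mulr_rCA.
    have Lk k : cL (fun x : RT => phi x * (x ^+ k)%:C).
      have := cvl_L t hf (tp_nice k hg).
      rewrite (_ : (fun x => f (t - x) * tp g k x) = (fun x : RT => phi x * (x ^+ k)%:C))//.
      by apply/funext => x; rewrite /phi /tp -mulrA [g x * _]mulrC.
    have Lh k : cL (h k) by rewrite hE; exact: cLZ.
    have h0 k : cI (h k) = 0 by rewrite hE cIZ// mom mulr0.
    pose H' m (x : RT) : C := phi x * (series (exp_coeff (- y * x)) m)%:C.
    suff [] : cL (H' n) /\ cI (H' n) = 0 by [].
    elim: n => [|n [IH1 IH2]].
      rewrite (_ : H' 0%N = (fun=> 0)); first by split; [exact: cL0|exact: cI0].
      by apply/funext => x; rewrite /H' /series/= big_geq// mulr0.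
    rewrite (_ : H' n.+1 = (fun x => H' n x + h n x)); last first.
      apply/funext => x; rewrite /H' /h -mulrDr -rmorphD; congr (_ * _%:C).
      by rewrite /series/= big_nat_recr.
    by split; [exact: cLD|rewrite cID// IH2 h0 addr0].
(* The cut must lie beyond [t] to cover the support of [phi], and beyond [s] for the conclusion to
   reach [phi s]. *)
apply: (@lerch0 phi (Num.max t s + 1) (Num.max t s + 1)) => //; last first.
  by rewrite (@le_lt_trans _ _ (Num.max t s))// ?le_max ?lexx ?orbT// ltrDl.
apply: (@decay_near _ (fun=> 0) _ _ 0).
  move=> y _; rewrite -(LZ y); congr cI; apply/funext => x.
  have [[e x0 xt]|[e hx]] := ii_case 0 t x.
    by rewrite e ii_in// (le_trans xt)// ler_wpDr// le_max lexx.
  rewrite e mulr0; have -> : phi x = 0; last by rewrite !mul0r.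
  by move: hx; rewrite negb_and -!ltNge => /orP[x0|tx]; [exact: phi0'|exact: phi0].
by move=> c' _; exists 0, 0 => y _; rewrite n1_0 mul0r.
Qed.

End Titchmarsh.

(** * A fixed-point theorem in a weighted supremum norm *)

Section Contraction.
Context {R : realType}.
Notation C := R[i].
Notation re := (@complex.Re R).
Notation im := (@complex.Im R).

(** With e_n = 2c / 2^n the sum of the remaining increments, u_n + e_n decreases and u_n - e_n
    increases. Monotone convergence gives a common limit, and the two bounds give the rate. *)
Lemma geom_cvg (u : nat -> R) (c : R) : 0 <= c ->
  (forall n, `|u n.+1 - u n| <= c / 2 ^+ n) ->
  exists l, u @ \oo --> l /\ forall n, `|l - u n| <= 2 * c / 2 ^+ n.
Proof.
move=> c0 H.
pose e n : R := 2 * c / 2 ^+ n.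
have e0 n : 0 <= e n by rewrite divr_ge0 ?mulr_ge0 ?exprn_ge0.
have eS n : e n - e n.+1 = c / 2 ^+ n.
  by rewrite /e exprS; field; rewrite expf_neq0.
have ce : e @ \oo --> (0 : R).
  suff : (fun n => 2 * c * (2^-1) ^+ n) @ \oo --> (2 * c * 0 : R).
    by rewrite mulr0; apply: cvg_trans; apply: near_eq_cvg; apply: nearW => n; rewrite /e exprVn.
  apply: cvgM; first exact: cvg_cst.
  by apply: cvg_expr; rewrite ger0_norm ?invr_ge0// invf_lt1// ltr1n.
pose v n := u n + e n; pose w n := u n - e n.
have dv : nonincreasing_seq v.
  apply/nonincreasing_seqP => n; have := H n; rewrite ler_norml -eS /v => /andP[h1 h2]; lra.
have iw : nondecreasing_seq w.
  apply/nondecreasing_seqP => n; have := H n; rewrite ler_norml -eS /w => /andP[h1 h2]; lra.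
have wv n m : w n <= v m.
  have [nm|mn] := leqP n m.
    by apply: le_trans (iw _ _ nm) _; rewrite /w /v; have := e0 m; lra.
  by apply: le_trans (dv _ _ (ltnW mn)); rewrite /w /v; have := e0 n; lra.
have cv : cvgn v.
  apply: nonincreasing_is_cvgn => //; exists (w 0%N) => _ [n _ <-]; exact: wv.
have cw : cvgn w.
  apply: nondecreasing_is_cvgn => //; exists (v 0%N) => _ [n _ <-]; exact: wv.
have cu : u @ \oo --> limn v.
  suff : (fun n => v n - e n) @ \oo --> (limn v - 0 : R).
    by rewrite subr0; apply: cvg_trans; apply: near_eq_cvg; apply: nearW => n; rewrite /v addrK.
  by apply: cvgB.
have lw : limn w = limn v.
  apply/cvg_lim; first exact: Rhausdorff.
  suff : (fun n => u n - e n) @ \oo --> (limn v - 0 : R) by rewrite subr0.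
  exact: cvgB.
exists (limn v); split => // n.
have h1 : limn v <= v n by exact: nonincreasing_cvgn_ge.
have h2 : w n <= limn v by rewrite -lw; exact: nondecreasing_cvgn_le.
by rewrite -/(e n) ler_norml; move: h1 h2; rewrite /v /w; lra.
Qed.

(** Picard iteration on functions bounded by multiples of [om], where [Op] halves the bound. Limits
    are taken pointwise, so that the solution is measurable and satisfies the equation at every
    point rather than almost everywhere. Additivity is required only for differences, which is what
    compares successive iterates. *)
Lemma contraction_solve d (T : measurableType d) (om : T -> R) (Op : (T -> C) -> T -> C)
    (f0 : T -> C) (C0 : R) : (forall p, 0 <= om p) -> 0 <= C0 ->
  cm f0 -> (forall p, n1 (f0 p) <= C0 * om p) ->
  (forall f B, cm f -> 0 <= B -> (forall p, n1 (f p) <= B * om p) ->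
     cm (Op f) /\ forall p, n1 (Op f p) <= B / 2 * om p) ->
  (forall f g B, cm f -> cm g -> (forall p, n1 (f p) <= B * om p) ->
     (forall p, n1 (g p) <= B * om p) ->
     forall p, Op (fun x => f x - g x) p = Op f p - Op g p) ->
  exists f, [/\ cm f, forall p, n1 (f p) <= 4 * C0 * om p & forall p, f p = f0 p + Op f p].
Proof.
move=> om0 C00 m0 b0 HOp Hadd.
pose S := fix S n := if n is n'.+1 then (fun p => f0 p + Op (S n') p) else f0.
have S_good n : cm (S n) /\ forall p, n1 (S n p) <= 2 * C0 * om p.
  elim: n => [|n [IH1 IH2]].
    split=> // p; apply: le_trans (b0 p) _.
    by have := mulr_ge0 C00 (om0 p); lra.
  have [h1 h2] := HOp _ _ IH1 (mulr_ge0 (ler0n _ 2) C00) IH2.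
  split; first exact: cmD.
  move=> p; apply: le_trans (n1D _ _) _; apply: le_trans (lerD (b0 p) (h2 p)) _.
  by rewrite le_eqVlt; apply/orP; left; apply/eqP; field.
have dS n p : n1 (S n.+1 p - S n p) <= C0 * om p / 2 ^+ n.
  rewrite mulrAC; elim: n p => [|n IH] p.
    rewrite expr0 divr1 /= addrAC subrr add0r.
    apply: le_trans ((HOp _ _ m0 C00 b0).2 p) _.
    by rewrite ler_wpM2r// ler_pdivrMr// ler_peMr// ler1n.
  have [g1 b1] := S_good n.+1; have [g2 b2] := S_good n.
  rewrite [S n.+2 p]/= [S n.+1 p]/= opprD addrACA subrr add0r.
  rewrite -(Hadd _ _ _ g1 g2 b1 b2 p).
  have := (HOp _ _ (cmB g1 g2) _ IH).2 p.
  rewrite divr_ge0 ?exprn_ge0// => /(_ isT) h.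
  by apply: le_trans h _; rewrite exprS invfM [2^-1 * _]mulrC [C0 * (_ * _)]mulrA.
pose cc_ p := C0 * om p.
have cc0 p : 0 <= cc_ p by rewrite mulr_ge0.
have lre p : exists l, (fun n => re (S n p)) @ \oo --> l /\ forall n, `|l - re (S n p)| <= 2 * cc_ p / 2 ^+ n.
  apply: geom_cvg => // n; apply: le_trans (dS n p).
  by rewrite -reB; exact: n1_re.
have lim_ p : exists l, (fun n => im (S n p)) @ \oo --> l /\ forall n, `|l - im (S n p)| <= 2 * cc_ p / 2 ^+ n.
  apply: geom_cvg => // n; apply: le_trans (dS n p).
  by rewrite -imB; exact: n1_im.
have [fr hr] := choice lre; have [fi hi] := choice lim_.
pose f p : C := fr p +i* fi p.
have fS n p : n1 (f p - S n p) <= 4 * C0 / 2 ^+ n * om p.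
  rewrite /n1 reB imB /=.
  apply: le_trans (lerD ((hr p).2 n) ((hi p).2 n)) _; rewrite /cc_.
  by rewrite le_eqVlt; apply/orP; left; apply/eqP; ring.
have mf : cm f.
  apply: (cm_lim (fun n => (S_good n).1)) => p; [exact: (hr p).1|exact: (hi p).1].
have bf p : n1 (f p) <= 5 * C0 * om p.
  rewrite -(subrK (S 0%N p) (f p)); apply: le_trans (n1D _ _) _.
  by apply: le_trans (lerD (fS 0%N p) (b0 p)) _; rewrite expr0 divr1; have := om0 p; nra.
have eqf p : f p = f0 p + Op f p.
  apply/subr0_eq/n1_eq0.
  have K n : n1 (f p - (f0 p + Op f p)) <= 8 * C0 * om p / 2 ^+ n.
    have -> : f p - (f0 p + Op f p) = (f p - S n.+1 p) - (Op f p - Op (S n) p) by rewrite /=; ring.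
    apply: le_trans (n1B _ _) _.
    have [g2 b2] := S_good n.
    have b2' p' : n1 (S n p') <= 5 * C0 * om p'.
      by apply: le_trans (b2 p') _; rewrite ler_wpM2r// ler_wpM2r// ler_nat.
    rewrite -(Hadd _ _ _ mf g2 bf b2' p).
    have h := (HOp _ (4 * C0 / 2 ^+ n) (cmB mf g2) _ (fS n)).2 p.
    apply: le_trans (lerD (fS n.+1 p) (h _)) _; first by rewrite divr_ge0 ?mulr_ge0 ?exprn_ge0.
    have e : (2 ^+ n)^-1 >= 0 :> R by rewrite invr_ge0 exprn_ge0.
    rewrite exprS invfM.
    have := mulr_ge0 C00 (om0 p); move: e; move: (2 ^+ n)^-1 => e e0 h0.
    have := mulr_ge0 e0 h0; nra.
  have lim0 : (fun n => 8 * C0 * om p / 2 ^+ n) @ \oo --> (0 : R).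
    suff : (fun n => 8 * C0 * om p * (2^-1) ^+ n) @ \oo --> (8 * C0 * om p * 0 : R).
      by rewrite mulr0; apply: cvg_trans; apply: near_eq_cvg; apply: nearW => n; rewrite exprVn.
    apply: cvgM; first exact: cvg_cst.
    by apply: cvg_expr; rewrite ger0_norm ?invr_ge0// invf_lt1// ltr1n.
  apply: (closed_cvg (fun y : R => n1 (f p - (f0 p + Op f p)) <= y)) lim0.
    exact: closed_ge.
  by apply: nearW.
exists f; split => // p.
have [_ h] := HOp _ _ mf (mulr_ge0 (ler0n _ 5) C00) bf.
rewrite eqf; apply: le_trans (n1D _ _) _; apply: le_trans (lerD (b0 p) (h p)) _.
have := mulr_ge0 C00 (om0 p); nra.
Qed.

End Contraction.

(** * The Volterra kernel *)

Section Kernel.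
Context {R : realType}.
Notation RT := (measurableTypeR R).
Notation C := R[i].
Notation im := (@complex.Im R).

(* With [m x = e^{-zx} u x], the equation [u'' = (q + z^2) u] for the solution
   equal to [e^{zx}] on the left of [c] is
   [m x = 1 + \int_c^x (1 - e^{-2z(x-t)}) / (2z) q t m t dt];
   [Mk A x z] is the candidate [m x = 1 + \int A x s e^{-zs} ds]. *)
Definition Ez (z r : R) : R := (1 - expR (- (2 * z * r))) / (2 * z).

Definition Mk (A : RT -> RT -> C) (x z : R) : C :=
  1 + cI (fun s : RT => A x s * (expR (- z * s))%:C).

Definition volterra_kernel (q : RT -> C) (c d : R) (A : RT -> RT -> C) :=
  [/\ cm (fun p : RT * RT => A p.1 p.2), (exists2 B, 0 <= B & forall x s, n1 (A x s) <= B),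
   (forall x s, ~~ ((c <= x <= d) && (0 <= s <= 2 * (x - c))) -> A x s = 0) &
   forall z x, z != 0 -> c <= x -> x <= d ->
     Mk A x z = 1 + cI (fun t : RT => q t * (Ez z (x - t) * ii c x t)%:C * Mk A t z)].

Lemma n1rM (r : R) (x : C) : n1 (r%:C * x) = `|r| * n1 x.
Proof. by rewrite mulrC n1Mr mulrC. Qed.

Lemma rCM (u v : R) : u%:C * v%:C = (u * v)%:C.
Proof. by rewrite rmorphM. Qed.

Lemma rI_0 : rI (fun=> 0 : R) = 0.
Proof.
have := rIZ 0 (@L1_0 R); rewrite [RHS]mul0r => e; rewrite -[RHS]e.
by congr rI; apply/funext => x; rewrite mul0r.
Qed.

Lemma rI_exp_bound (K s : R) : 0 < K -> rI (fun r => expR (K * r) * ii 0 s r) <= expR (K * s) / K.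
Proof.
move=> K0; have [s0|s0] := leP 0 s; last first.
  rewrite (_ : (fun r => _) = (fun=> 0)); first by rewrite rI_0 divr_ge0 ?expR_ge0 ?ltW.
  apply/funext => r; have [[_ r0 rs]|[-> _]] := ii_case 0 s r; last by rewrite mulr0.
  by have := lt_le_trans (le_lt_trans rs s0) r0; rewrite ltxx.
have := @rI_ii_exp R (- K) 0 s; rewrite oppr_eq0 (gt_eqF K0) opprK => -> //.
rewrite mulr0 expR0 invrN mulrN -mulNr opprB ler_pM2r ?invr_gt0//.
lra.
Qed.

(** [Ez z rho] is half the Laplace transform of the indicator of [0, 2 rho]. This is how the factor
    (1 - e^{-2z(x-t)}) / (2z) of the Volterra equation becomes a window in [s], independent of
    [z]. *)
Lemma expR_shift_int (z r rho : R) : z != 0 -> 0 <= rho ->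
  rI (fun s => expR (- z * s) * ii 0 (2 * rho) (s - r)) = expR (- z * r) * (2 * Ez z rho).
Proof.
move=> z0 rho0.
have L : L1 (fun s => expR (- z * s) * ii 0 (2 * rho) s).
  apply/L1_ii; first by apply: meas_expR; exact: measurable_funM.
  apply: continuous_compact_integrable; first exact: segment_compact.
  apply: continuous_subspaceT => x.
  by apply: continuous_comp; [exact: mulrl_continuous|exact: continuous_expR].
have [_ h] := rI_affine (- r) (L1_meas (L1Z (expR (- z * r)) L)) (or_introl erefl) (L1Z (expR (- z * r)) L).
rewrite (_ : rI (fun s => expR (- z * s) * ii 0 (2 * rho) (s - r)) =
  rI (fun x => expR (- z * r) * (expR (- z * (1 * x - r)) * ii 0 (2 * rho) (1 * x - r)))); last first.
  congr rI; apply/funext => s; rewrite mul1r mulrA -expRD; congr (expR _ * _); ring.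
rewrite h rIZ// rI_ii_exp//; last by rewrite mulr_ge0.
congr (_ * _); rewrite /Ez mulr0 expR0.
have -> : - (2 * z * rho) = - z * (2 * rho) by ring.
by field.
Qed.

Lemma exp_L1 (z r rho : R) : L1 (fun s => expR (- z * s) * ii 0 rho (s - r)).
Proof.
have L : L1 (fun s => expR (- z * s) * ii 0 rho s).
  apply/L1_ii; first by apply: meas_expR; exact: measurable_funM.
  apply: continuous_compact_integrable; first exact: segment_compact.
  apply: continuous_subspaceT => x.
  by apply: continuous_comp; [exact: mulrl_continuous|exact: continuous_expR].
have [h _] := rI_affine (- r) (L1_meas (L1Z (expR (- z * r)) L)) (or_introl erefl) (L1Z (expR (- z * r)) L).
move: h; rewrite (_ : (fun x => _) = (fun s => expR (- z * s) * ii 0 rho (s - r)))//.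
by apply/funext => s; rewrite mul1r mulrA -expRD; congr (expR _ * _); ring.
Qed.

Lemma cI_r (f : R -> R) : cI (fun x : RT => (f x)%:C) = (rI f)%:C.
Proof.
apply: Ceq => //=; have /= := @cI0 R; move=> /(congr1 im) /=.
by rewrite /comp /=.
Qed.

Lemma cL_r (f : R -> R) : L1 f -> cL (fun x : RT => (f x)%:C).
Proof. by move=> h; split; [exact: h|exact: L1_0]. Qed.

Lemma window_len (c d x : R) : x <= d -> 2 * (x - c) <= 2 * (d - c).
Proof. by move=> h; lra. Qed.
Lemma window_shift_le (c t x r s : R) : r <= 2 * (t - c) -> s - r <= 2 * (x - t) -> s <= 2 * (x - c).
Proof. by move=> h1 h2; lra. Qed.
Lemma window_shift_ge0 (r s : R) : 0 <= s - r -> 0 <= r -> 0 <= s.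
Proof. by move=> h1 h2; lra. Qed.

Section construction.
Variables (q : RT -> C) (c d : R).
Hypotheses (cd : c <= d) (Lq : cL q).
Let L := 2 * (d - c).
Let N := rI (fun x => n1 (q x)).
(** Rate of the weight e^{Ks}: in [Op] the inner integral over r <= s gains 1/K and the outer one
    costs [N], so that the factor N / K is below 1 and the prefactor 1/2 makes [Op] a
    contraction. *)
Let K := N + 1.
Let chi (p : RT * RT) : R := ii c d p.1 * ii 0 (2 * (p.1 - c)) p.2.
(** In terms of the kernel the Volterra equation reads A(x,s) = 1/2 \int_c^x q(t)
    1[0 <= s <= 2(x-t)] dt + 1/2 \int_c^x q(t) \int A(t,r) 1[0 <= s-r <= 2(x-t)] dr dt. [f0] and
    [Op] are the two terms, cut by [chi] to the triangle where the kernel lives. *)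
Let F0 (p : RT * RT) (t : RT) : C := q t * (ii c p.1 t * ii 0 (2 * (p.1 - t)) p.2)%:C.
Let J (f : RT * RT -> C) (p : (RT * RT) * RT) (r : RT) : C :=
  f (p.2, r) * (ii 0 (2 * (p.1.1 - p.2)) (p.1.2 - r) * ii 0 L r)%:C.
Let F1 f (p : RT * RT) (t : RT) : C := q t * (ii c p.1 t)%:C * cI (J f (p, t)).
Let f0 p : C := (2^-1 * chi p)%:C * cI (F0 p).
Let Op f p : C := (2^-1 * chi p)%:C * cI (F1 f p).

Let N0 : 0 <= N. Proof. by apply: rI_ge0 => x; exact: n1_ge0. Qed.
Let K0 : 0 < K. Proof. by rewrite ltr_wpDl. Qed.
Let L0 : 0 <= L. Proof. by rewrite mulr_ge0// subr_ge0. Qed.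

Let m_chi : measurable_fun setT chi.
Proof.
apply: measurable_funM; first exact: meas_ii.
apply: meas_ii => //; apply: measurable_funM => //; exact: measurable_funB.
Qed.

Let m_half : cm (fun p : RT * RT => (2^-1 * chi p)%:C).
Proof. by apply: cm_r; exact: measurable_funM. Qed.

Let m_F0 : cm (fun p : (RT * RT) * RT => F0 p.1 p.2).
Proof.
apply: cmM; first exact: (cm_comp (cL_cm Lq)).
apply: cm_r; apply: measurable_funM.
  by apply: meas_ii => //; apply: measurableT_comp.
apply: meas_ii => //; last by apply: measurableT_comp.
by apply: measurable_funM => //; apply: measurable_funB => //; apply: measurableT_comp.
Qed.

Let b_F0 p t : n1 (F0 p t) <= n1 (q t).
Proof.
rewrite n1Mr ger0_norm ?mulr_ge0 ?ii_ge0// ler_piMr ?n1_ge0//.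
by rewrite mulr_ile1 ?ii_ge0 ?ii_le1.
Qed.

Let m_J f : cm f -> cm (fun p : ((RT * RT) * RT) * RT => J f p.1 p.2).
Proof.
move=> mf; apply: cmM.
  apply: (cm_comp mf (g := fun p : ((RT * RT) * RT) * RT => (p.1.2, p.2))).
  by apply: measurable_fun_pair => //; apply: measurableT_comp.
apply: cm_r; apply: measurable_funM; last exact: meas_ii.
have h1 : measurable_fun setT (fun p : ((RT * RT) * RT) * RT => p.1.2) by exact: measurableT_comp.
have h0 : measurable_fun setT (fun p : ((RT * RT) * RT) * RT => p.1.1) by exact: measurableT_comp.
apply: meas_ii => //.
  by apply: measurable_funM => //; apply: measurable_funB => //; apply: measurableT_comp h0.
by apply: measurable_funB => //; apply: measurableT_comp h0.
Qed.

Let om (p : RT * RT) : R := expR (K * p.2).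

Let b_J f B p r : (forall p, n1 (f p) <= B * om p) -> 0 <= B ->
  n1 (J f p r) <= B * expR (K * L) * ii 0 L r /\ n1 (J f p r) <= B * (expR (K * r) * ii 0 p.1.2 r).
Proof.
move=> hf B0; rewrite n1Mr ger0_norm ?mulr_ge0 ?ii_ge0//.
have [[-> r0 rL]|[-> _]] := ii_case 0 L r; last first.
  by rewrite !mulr0; split; rewrite ?mulr_ge0 ?expR_ge0 ?ii_ge0.
have [[-> s0 sT]|[-> _]] := ii_case 0 (2 * (p.1.1 - p.2)) (p.1.2 - r); last first.
  by rewrite mul0r !mulr0; split; rewrite ?mulr_ge0 ?expR_ge0 ?ii_ge0.
rewrite !mulr1; have h := hf (p.2, r); split.
  by apply: le_trans h _; rewrite ler_wpM2l// ler_expR ler_wpM2l// ltW.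
by rewrite ii_in ?mulr1// -subr_ge0.
Qed.

Let m_cJ f B : cm f -> (forall p, n1 (f p) <= B * om p) -> 0 <= B ->
  cm (fun p : (RT * RT) * RT => cI (J f p)) /\
  (forall p, n1 (cI (J f p)) <= B * (expR (K * p.1.2) / K)) /\ (forall p, cL (J f p)).
Proof.
move=> mf bf B0.
have mJ1 p : cm (J f p) by exact: (cm_comp (m_J mf) (measurable_pair1 (p : (RT * RT) * RT))).
have LL : L1 (fun r => B * expR (K * L) * ii 0 L r) by apply: L1Z; exact: L1_ii1.
have LJ p : cL (J f p) by apply: (cL_le (mJ1 p) LL) => r; exact: (b_J p r bf B0).1.
split; last split => // p.
  apply: (@cI_param _ _ _ (fun p r => J f p r) (fun r => B * expR (K * L) * ii 0 L r)) => //.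
    exact: m_J.
  by move=> p r; exact: (b_J p r bf B0).1.
have L2 : L1 (fun r => expR (K * r) * ii 0 p.1.2 r).
  by have := exp_L1 (- K) 0 p.1.2; rewrite opprK; under eq_fun do rewrite subr0.
apply: (@le_trans _ _ (rI (fun r => B * (expR (K * r) * ii 0 p.1.2 r)))).
  apply: (cI_le (mJ1 p)); first exact: L1Z.
  by move=> r; exact: (b_J p r bf B0).2.
by rewrite rIZ// ler_wpM2l// rI_exp_bound.
Qed.

Let F1_good f B : cm f -> (forall p, n1 (f p) <= B * om p) -> 0 <= B ->
  [/\ cm (fun p : (RT * RT) * RT => F1 f p.1 p.2),
   (forall p t, n1 (F1 f p t) <= B * (expR (K * p.2) / K) * n1 (q t)) &
   forall p, cL (F1 f p)].
Proof.
move=> mf bf B0; have [h1 [h2 h3]] := m_cJ mf bf B0.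
have m1 : cm (fun p : (RT * RT) * RT => F1 f p.1 p.2).
  apply: cmM.
    apply: cmM; first exact: (cm_comp (cL_cm Lq)).
    by apply: cm_r; apply: meas_ii => //; apply: measurableT_comp.
  have E : (fun x : (RT * RT) * RT => cI (J f (x.1, x.2))) = (fun p => cI (J f p)).
    by apply/funext => -[].
  by rewrite E.
have b1 p t : n1 (F1 f p t) <= B * (expR (K * p.2) / K) * n1 (q t).
  apply: le_trans (n1M _ _) _; rewrite [leLHS]mulrC; apply: ler_pM; rewrite ?n1_ge0//.
  by rewrite n1Mr ger0_norm ?ii_ge0// ler_piMr ?n1_ge0// ii_le1.
split => // p; apply: (@cL_le _ _ (fun t => B * (expR (K * p.2) / K) * n1 (q t))) => //.
  exact: (cm_comp m1 (measurable_pair1 (p : RT * RT))).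
by apply: L1Z; exact: cL_n1.
Qed.

Let chi_le p : `|2^-1 * chi p| <= 2^-1.
Proof.
rewrite ger0_norm ?mulr_ge0 ?invr_ge0 ?ii_ge0// ler_piMr ?invr_ge0//.
by rewrite mulr_ile1 ?ii_ge0 ?ii_le1.
Qed.

Let chi_case p : chi p = 0 \/ [/\ chi p = 1, c <= p.1, p.1 <= d, 0 <= p.2 & p.2 <= 2 * (p.1 - c)].
Proof.
rewrite /chi; have [[-> h1 h2]|[-> _]] := ii_case c d p.1; last by left; rewrite mul0r.
have [[-> h3 h4]|[-> _]] := ii_case 0 (2 * (p.1 - c)) p.2; last by left; rewrite mulr0.
by right; rewrite mulr1.
Qed.

(** The kernel is constructed without reference to [z], as a fixed point; taking transforms in [s]
    and exchanging integrals then yields the equation for every real z other than 0, which is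
    legitimate because each [A x] is bounded with bounded support. *)
Lemma kernel_exists : exists A, volterra_kernel q c d A.
Proof.
have om0 p : 0 <= om p by exact: expR_ge0.
have LF0 p : cL (F0 p).
  apply: (cL_le _ (cL_n1 Lq)) => [|t]; last exact: b_F0.
  exact: (cm_comp m_F0 (measurable_pair1 (p : RT * RT))).
have mf0 : cm f0.
  by apply: cmM => //; apply: (@cI_param _ _ _ F0 (fun t => n1 (q t))) => //; exact: cL_n1.
have bF0 p : n1 (cI (F0 p)) <= N.
  by apply: cI_le; [exact: cL_cm|exact: cL_n1|exact: b_F0].
have bf0 p : n1 (f0 p) <= N * om p.
  rewrite /f0 n1rM; have [->|[-> h1 h2 h3 h4]] := chi_case p.
    by rewrite mulr0 normr0 mul0r mulr_ge0.
  rewrite mulr1 ger0_norm ?invr_ge0//; apply: (@le_trans _ _ N).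
    apply: le_trans (ler_wpM2l _ (bF0 p)) _; rewrite ?invr_ge0//.
    by rewrite ler_piMl// invf_le1// ler1n.
  by rewrite ler_peMr// /om -expR0 ler_expR mulr_ge0// ltW.
have HOp f B : cm f -> 0 <= B -> (forall p, n1 (f p) <= B * om p) ->
     cm (Op f) /\ forall p, n1 (Op f p) <= B / 2 * om p.
  move=> mf B0 bf; have [h1 h2 h3] := F1_good mf bf B0.
  split.
    apply: cmM => //.
    (* The majorant grows with the second coordinate, hence the cut at [p.2 <= n] before passing to
       the limit. *)
    apply: (@cm_lim _ _ _ (fun n p => cI (F1 f p) * ((p.2 <= n%:R)%R%:R)%:C)) => [n|p|p].
    - rewrite (_ : (fun p => _) = (fun p => cI (fun t => F1 f p t * ((p.2 <= n%:R)%R%:R)%:C))); last first.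
        by apply/funext => p; rewrite cIZr.
      apply: (@cI_param _ _ _ (fun p t => F1 f p t * ((p.2 <= n%:R)%R%:R)%:C) (fun t => B * (expR (K * n%:R) / K) * n1 (q t))).
      + apply: cmM; first exact: h1.
        apply: cm_r; apply: meas_ler; last exact: measurable_cst.
        exact: (measurableT_comp measurable_snd measurable_fst).
      + by apply: L1Z; exact: cL_n1.
      + move=> p t; rewrite n1Mr; case: (leP p.2 n%:R) => pn; last first.
          rewrite normr0 mulr0; apply: mulr_ge0; last exact: n1_ge0.
          by apply: mulr_ge0 => //; rewrite divr_ge0 ?expR_ge0// ltW.
        rewrite normr1 mulr1; apply: le_trans (h2 p t) _; rewrite ler_wpM2r ?n1_ge0// ler_wpM2l//.
        by rewrite ler_pM2r ?invr_gt0// ler_expR ler_pM2l.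
    - apply: cvg_near_cst; near=> n.
      have pn : p.2 <= n%:R by near: n; exact: nbhs_infty_ger.
      by rewrite pn mulr1.
    - apply: cvg_near_cst; near=> n.
      have pn : p.2 <= n%:R by near: n; exact: nbhs_infty_ger.
      by rewrite pn mulr1.
  move=> p; rewrite /Op n1rM.
  have b1 : n1 (cI (F1 f p)) <= B * (expR (K * p.2) / K) * N.
    rewrite /N -(rIZ _ (cL_n1 Lq)); apply: cI_le; [exact: (cL_cm (h3 p))| |exact: h2].
    by apply: L1Z; exact: (cL_n1 Lq).
  apply: le_trans (ler_pM _ (n1_ge0 _) (chi_le p) b1) _ => //.
  rewrite [B / 2]mulrC -!mulrA ler_wpM2l ?invr_ge0// ler_wpM2l// -/(om p) ler_piMr//.
  by rewrite ler_pdivrMl// mulr1 lerDl.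
have Hadd f g B : cm f -> cm g -> (forall p, n1 (f p) <= B * om p) ->
     (forall p, n1 (g p) <= B * om p) ->
     forall p, Op (fun x => f x - g x) p = Op f p - Op g p.
  move=> mf mg bf bg p.
  have B0 : 0 <= B by have := le_trans (n1_ge0 _) (bf p); rewrite pmulr_lge0// expR_gt0.
  have [_ _ h3] := F1_good mf bf B0; have [_ _ h3'] := F1_good mg bg B0.
  have [_ [_ l1]] := m_cJ mf bf B0; have [_ [_ l2]] := m_cJ mg bg B0.
  rewrite /Op -mulrBr -cIB//; congr (_ * cI _); apply/funext => t.
  rewrite /F1 -mulrBr -cIB//; congr (_ * cI _); apply/funext => r.
  by rewrite /J mulrBl.
have [G [mG bG eG]] := contraction_solve om0 N0 mf0 bf0 HOp Hadd.
have G0 p : chi p = 0 -> G p = 0 by move=> h; rewrite eG /f0 /Op h mulr0 !mul0r addr0.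
pose BG := 4 * N * expR (K * L).
have BG0 : 0 <= BG by rewrite !mulr_ge0 ?expR_ge0.
have bG' p : n1 (G p) <= BG.
  have [h|[_ h1 h2 h3 h4]] := chi_case p; first by rewrite G0// n1_0.
  apply: le_trans (bG p) _; rewrite ler_wpM2l ?mulr_ge0// ler_expR ler_pM2l//.
  by apply: le_trans h4 _; exact: window_len.
exists (fun x s => G (x, s)); split.
- rewrite (_ : (fun p => _) = G)//; by apply/funext => -[].
- by exists BG.
- by move=> x s h; apply: G0; rewrite /chi/= /ii -natrM mulnb (negbTE h).
move=> z x z0 cx xd.
have N40 : 0 <= 4 * N by rewrite mulr_ge0.
have [mJG [bJG LJG]] := m_cJ mG bG N40.
have [mF1 bF1 LF1] := F1_good mG bG N40.
pose e (s : R) : R := expR (- z * s).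
have me : measurable_fun setT (e : RT -> RT) by apply: meas_expR; exact: measurable_funM.
pose EL := expR (`|z| * L).
have eL s : 0 <= s -> s <= L -> e s <= EL.
  move=> s0 sL; rewrite ler_expR; apply: le_trans (ler_norm _) _.
  by rewrite normrM normrN ler_wpM2l// ger0_norm.
have Ge_b t s : n1 (G (t, s) * (e s)%:C) <= BG * EL * ii 0 L s.
  rewrite n1Mr ger0_norm ?expR_ge0//.
  have [h|[_ h1 h2 h3 h4]] := chi_case (t, s); first by rewrite G0// n1_0 mul0r !mulr_ge0 ?expR_ge0 ?ii_ge0.
  have sL : s <= L by apply: le_trans h4 _; exact: window_len.
  by rewrite ii_in// mulr1; apply: ler_pM; rewrite ?n1_ge0 ?expR_ge0//; exact: eL.
have LG t : cL (fun s : RT => G (t, s) * (e s)%:C).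
  apply: (@cL_le _ _ (fun s => BG * EL * ii 0 L s)).
  - by apply: cmM; [exact: (cm_comp mG (measurable_pair1 (t : RT)))|exact: cm_r].
  - by apply: L1Z; exact: L1_ii1.
  - exact: Ge_b.
pose Mt t := cI (fun s : RT => G (t, s) * (e s)%:C).
have xc_le : 2 * (x - c) <= L by exact: window_len.
have winE s t : c <= t -> t <= x -> 0 <= s -> s <= 2 * (x - t) -> chi (x, s) = 1.
  move=> ct tx s0 st; rewrite /chi/= !ii_in ?mulr1//.
  by apply: le_trans st _; rewrite ler_pM2l// lerB.
(* The transform of the inhomogeneous term: integrating the window in [s] produces [Ez]. *)
have P1 : cI (fun s : RT => f0 (x, s) * (e s)%:C) =
    cI (fun t : RT => q t * (Ez z (x - t) * ii c x t)%:C).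
  pose H (s t : R) : C := q t * (ii 0 L s * e s * (2^-1 * ii c x t * ii 0 (2 * (x - t)) s))%:C.
  transitivity (cI (fun s : RT => cI (H s))).
    congr cI; apply/funext => s; rewrite /f0 mulrAC -cIZ//; congr cI; apply/funext => t.
    rewrite /F0 /H /= [LHS]mulrC -[LHS]mulrA; congr (_ * _); rewrite !rCM; congr (_%:C).
    have [[-> ct tx]|[-> _]] := ii_case c x t; last by rewrite !(mulr0, mul0r).
    have [[-> s0 st]|[-> _]] := ii_case 0 (2 * (x - t)) s; last by rewrite !(mulr0, mul0r).
    rewrite (winE s t)// ii_in//; last by apply: le_trans st _; apply: le_trans _ xc_le; rewrite ler_pM2l// lerB.
    by rewrite !mulr1 !mul1r mulrC.
  rewrite (@cI_swap R H (fun s => EL * ii 0 L s) (fun t => n1 (q t))).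
  - congr cI; apply/funext => t; rewrite /H.
    have Lw : L1 (fun s => e s * ii 0 (2 * (x - t)) (s - 0)) by exact: exp_L1.
    have Lw' : L1 (fun s => ii 0 L s * e s * (2^-1 * ii c x t * ii 0 (2 * (x - t)) s)).
      have := L1Z (2^-1 * ii c x t) (L1_mul_ii 0 L Lw).
      rewrite (_ : (fun x0 => _) = (fun s => ii 0 L s * e s * (2^-1 * ii c x t * ii 0 (2 * (x - t)) s)))//.
      by apply/funext => s; rewrite subr0; ring.
    rewrite cIZ; last exact: cL_r.
    rewrite cI_r; congr (_ * _%:C).
    have [[e1 ct tx]|[e1 _]] := ii_case c x t; last first.
      rewrite e1 [RHS]mulr0; transitivity (rI (fun=> 0 : R)); last exact: rI_0.
      by congr rI; apply/funext => s; rewrite !(mulr0, mul0r).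
    have -> : Ez z (x - t) * ii c x t = 2^-1 * (expR (- z * 0) * (2 * Ez z (x - t))).
      by rewrite e1 mulr0 expR0; field.
    rewrite -(expR_shift_int 0 z0) ?subr_ge0// -(rIZ _ Lw).
    congr rI; apply/funext => s; rewrite e1 subr0.
    have [[-> s0 st]|[-> _]] := ii_case 0 (2 * (x - t)) s; last by rewrite !(mulr0, mul0r).
    rewrite ii_in//; last by apply: le_trans st _; apply: le_trans _ xc_le; rewrite ler_pM2l// lerB.
    by rewrite !mulr1 mul1r mulrC.
  - apply: cmM; first exact: (cm_comp (cL_cm Lq)).
    apply: cm_r; apply: measurable_funM.
      by apply: measurable_funM; [exact: meas_ii|exact: measurableT_comp].
    apply: measurable_funM; first by apply: measurable_funM => //; exact: meas_ii.
    apply: meas_ii => //; apply: measurable_funM => //; exact: measurable_funB.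
  - by apply: L1Z; exact: L1_ii1.
  - exact: cL_n1.
  - move=> s t; rewrite /H n1Mr mulrC ler_wpM2r ?n1_ge0//.
    have [[-> s0 sL]|[-> _]] := ii_case 0 L s; last by rewrite !mul0r normr0 mulr0.
    rewrite mul1r mulr1 ger0_norm; last by rewrite !mulr_ge0 ?expR_ge0 ?invr_ge0 ?ii_ge0.
    rewrite -[leRHS]mulr1; apply: ler_pM; rewrite ?expR_ge0 ?mulr_ge0 ?invr_ge0 ?ii_ge0//; first exact: eL.
    rewrite mulr_ile1 ?mulr_ge0 ?invr_ge0 ?ii_ge0 ?ii_le1// mulr_ile1 ?invr_ge0 ?ii_ge0 ?ii_le1//.
    by rewrite invf_le1// ler1n.
  - by move=> s; rewrite mulr_ge0 ?expR_ge0 ?ii_ge0.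
have GJ (s t r : R) : c <= t -> t <= x -> J G ((x, s), t) r != 0 -> [/\ 0 <= s, s <= 2 * (x - c) & s <= L].
  move=> ct tx; rewrite /J /=.
  have [h|[_ /= h1 h2 r0 rt]] := chi_case (t, r); first by rewrite G0// mul0r eqxx.
  have [[_ s0 st] _|[-> _]] := ii_case 0 (2 * (x - t)) (s - r); last by rewrite mul0r mulr0 eqxx.
  have sx : s <= 2 * (x - c) by exact: window_shift_le rt st.
  split => //; last exact: le_trans sx xc_le.
  exact: window_shift_ge0 s0 r0.
have cJ0 (s t : R) : c <= t -> t <= x -> ~~ (0 <= s <= 2 * (x - c)) -> cI (J G ((x, s), t)) = 0.
  move=> ct tx hs; rewrite -[RHS]cI0; congr cI; apply/funext => r; apply/eqP.
  by apply: contraNT hs => /(GJ s t r ct tx)[-> -> _].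
(* The transform of the iterated term: for fixed [t] and [r] the shifted window gives 2 e^{-zr} Ez,
   and the sum over [r] rebuilds the transform of [A t]. *)
have P2 : cI (fun s : RT => Op G (x, s) * (e s)%:C) =
    cI (fun t : RT => q t * (Ez z (x - t) * ii c x t)%:C * Mt t).
  pose H (s t : R) : C := q t * (2^-1 * ii c x t)%:C * ((e s * ii 0 L s)%:C * cI (J G ((x, s), t))).
  transitivity (cI (fun s : RT => cI (H s))).
    congr cI; apply/funext => s; rewrite /Op mulrAC -cIZ//; congr cI; apply/funext => t.
    rewrite /F1 /H /=; have [[-> ct tx]|[-> _]] := ii_case c x t; last by rewrite !(mulr0, mul0r).
    have [hs|hs] := boolP (0 <= s <= 2 * (x - c)); last first.
      by rewrite (cJ0 s t)// !mulr0.
    have /andP[s0 sx] := hs.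
    rewrite /chi /= !ii_in//; last exact: le_trans sx xc_le.
    by rewrite !mulr1; move: (q t) (cI _) (2^-1)%:C (e s)%:C => a1 a2 a3 a4; ring.
  rewrite (@cI_swap R H (fun s => EL * (4 * N * (expR (K * L) / K)) * ii 0 L s) (fun t => n1 (q t))).
  - congr cI; apply/funext => t; rewrite /H.
    have [[e1 ct tx]|[e1 _]] := ii_case c x t; last first.
      rewrite e1 !mulr0 mul0r -[RHS]cI0; congr cI; apply/funext => s; by rewrite mul0r.
    pose H2 (s r : R) : C := (e s * ii 0 L s)%:C * J G ((x, s), t) r.
    have H2b s r : n1 (H2 s r) <= (EL * ii 0 L s) * (BG * ii 0 L r).
      rewrite /H2 n1rM ger0_norm ?mulr_ge0 ?expR_ge0 ?ii_ge0//; apply: ler_pM; rewrite ?n1_ge0 ?mulr_ge0 ?expR_ge0 ?ii_ge0//.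
        have [[-> s0 sL]|[-> _]] := ii_case 0 L s; last by rewrite !mulr0.
        by rewrite !mulr1; exact: eL.
      exact: (b_J ((x, s), t) r bG N40).1.
    have H2m : cm (fun p : RT * RT => H2 p.1 p.2).
      apply: cmM.
        apply: cm_r; apply: measurable_funM; first exact: measurableT_comp.
        exact: meas_ii.
      have h1 : measurable_fun setT (fun p : RT * RT => ((((x : RT), p.1), (t : RT)), p.2)).
        apply: measurable_fun_pair => //; apply: measurable_fun_pair => //.
        exact: measurable_fun_pair.
      exact: (cm_comp (m_J mG) h1).
    have H2r s : cL (H2 s).
      apply: (@cL_le _ _ (fun r => EL * ii 0 L s * (BG * ii 0 L r))) => //.
        exact: (cm_comp H2m (measurable_pair1 (s : RT))).
      by apply: L1Z; apply: L1Z; exact: L1_ii1.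
    have H2s r : cL (H2 ^~ r).
      apply: (@cL_le _ _ (fun s => (BG * ii 0 L r) * (EL * ii 0 L s))) => //.
      - exact: (cm_comp H2m (measurable_pair2 (r : RT))).
      - by apply: L1Z; apply: L1Z; exact: L1_ii1.
      - by move=> s; rewrite mulrC.
    have E1 : cI (fun s : RT => (e s * ii 0 L s)%:C * cI (J G ((x, s), t))) = cI (fun s : RT => cI (H2 s)).
      by congr cI; apply/funext => s; rewrite cIZ.
    have E2 : cI (fun s : RT => cI (H2 s)) = (2 * Ez z (x - t))%:C * Mt t.
      rewrite (@cI_swap R H2 (fun s => EL * ii 0 L s) (fun r => BG * ii 0 L r)); last 5 first.
      - exact: H2m.
      - by apply: L1Z; exact: L1_ii1.
      - by apply: L1Z; exact: L1_ii1.
      - exact: H2b.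
      - by move=> s; rewrite mulr_ge0 ?expR_ge0 ?ii_ge0.
      rewrite /Mt -(cIZ _ (LG t)); congr cI; apply/funext => r.
      have [h|[_ /= h1 h2 r0 rt]] := chi_case (t, r).
        rewrite (G0 _ h) mul0r mulr0; transitivity (cI (fun=> 0 : C)); last exact: cI0.
        by congr cI; apply/funext => s; rewrite /H2 /J /= (G0 _ h) mul0r mulr0.
      have rL : r <= L by apply: le_trans rt _; apply: le_trans _ xc_le; rewrite ler_pM2l// lerB.
      have Lw : L1 (fun s => e s * ii 0 (2 * (x - t)) (s - r)) by exact: exp_L1.
      transitivity (cI (fun s : RT => G (t, r) * (e s * ii 0 (2 * (x - t)) (s - r))%:C)).
        congr cI; apply/funext => s; rewrite /H2 /J /= (ii_in r0 rL) mulr1.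
        have [[-> s0 st]|[-> _]] := ii_case 0 (2 * (x - t)) (s - r); last by rewrite !(mulr0, mul0r).
        rewrite ii_in; first by rewrite !mulr1 mulrC.
          exact: window_shift_ge0 s0 r0.
        by apply: le_trans _ xc_le; exact: window_shift_le rt st.
      rewrite cIZ; last exact: cL_r.
      by rewrite cI_r expR_shift_int ?subr_ge0// -/(e r) [RHS]mulrCA rCM [e r * _]mulrC.
    have LcJ : cL (fun s : RT => (e s * ii 0 L s)%:C * cI (J G ((x, s), t))).
      have eH : (fun s : RT => (e s * ii 0 L s)%:C * cI (J G ((x, s), t))) = (fun s : RT => cI (H2 s)).
        by apply/funext => s; rewrite -(cIZ _ (LJG _)).
      rewrite eH; apply: (@cL_le _ _ (fun s => (BG * rI (ii 0 L)) * (EL * ii 0 L s))).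
      - apply: (@cI_param _ _ _ H2 (fun r => EL * (BG * ii 0 L r))); first exact: H2m.
          by apply: L1Z; apply: L1Z; exact: L1_ii1.
        move=> s r; apply: le_trans (H2b s r) _; rewrite ler_wpM2r//.
          by rewrite mulr_ge0 ?ii_ge0.
        by rewrite ler_piMr ?ii_le1 ?expR_ge0.
      - by apply: L1Z; apply: L1Z; exact: L1_ii1.
      - move=> s; rewrite [leRHS]mulrC -(rIZ BG (L1_ii1 0 L)) -(rIZ _ (L1Z BG (L1_ii1 0 L))).
        apply: cI_le; [exact: cL_cm (H2r s)| |by move=> r; exact: H2b].
        by apply: L1Z; apply: L1Z; exact: L1_ii1.
    rewrite (cIZ _ LcJ).
    rewrite E1 E2 e1 !mulr1 -[LHS]mulrA -[RHS]mulrA; congr (_ * _).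
    by rewrite mulrA rCM; congr (_%:C * _); field.
  - apply: cmM.
      apply: cmM; first exact: (cm_comp (cL_cm Lq)).
      apply: cm_r; apply: measurable_funM; first exact: measurable_cst.
      exact: meas_ii.
    apply: cmM.
      apply: cm_r; apply: measurable_funM; first exact: measurableT_comp.
      exact: meas_ii.
    have h1 : measurable_fun setT (fun p : RT * RT => (((x : RT), p.1), p.2)).
      by apply: measurable_fun_pair => //; exact: measurable_fun_pair.
    have E : (fun p : RT * RT => cI (J G ((x, p.1), p.2))) = (fun p : RT * RT => cI (J G (((x : RT), p.1), p.2))) by [].
    rewrite E; exact: (cm_comp mJG h1).
  - by apply: L1Z; exact: L1_ii1.
  - exact: cL_n1.
  - move=> s t; rewrite /H; apply: le_trans (n1M _ _) _; rewrite mulrC.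
    apply: ler_pM; rewrite ?n1_ge0//; last first.
      rewrite n1Mr ler_piMr ?n1_ge0// ger0_norm ?mulr_ge0 ?invr_ge0 ?ii_ge0//.
      by rewrite mulr_ile1 ?invr_ge0 ?ii_ge0 ?ii_le1// invf_le1// ler1n.
    rewrite n1rM; have [[-> s0 sL]|[-> _]] := ii_case 0 L s; last first.
      by rewrite !mulr0 normr0 mul0r.
    rewrite !mulr1 ger0_norm ?expR_ge0//; apply: ler_pM; rewrite ?expR_ge0 ?n1_ge0//; first exact: eL.
    apply: le_trans (bJG _) _ => /=; rewrite ler_wpM2l// ler_pM2r ?invr_gt0// ler_expR.
    by rewrite ler_wpM2l// ltW.
  - move=> s; rewrite !mulr_ge0 ?expR_ge0 ?ii_ge0 ?invr_ge0//; exact: ltW.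
have bMt t : n1 (Mt t) <= BG * EL * rI (ii 0 L).
  rewrite -(rIZ _ (L1_ii1 0 L)); apply: (cI_le (cL_cm (LG t))); last exact: Ge_b.
  by apply: L1Z; exact: L1_ii1.
have mMt : cm (Mt : RT -> C).
  apply: (@cI_param _ _ _ (fun t s => G (t, s) * (e s)%:C) (fun s => BG * EL * ii 0 L s)).
  - apply: cmM.
      rewrite (_ : (fun p : RT * RT => G (p.1, p.2)) = G)//; by apply/funext => -[].
    by apply: cm_r; exact: measurableT_comp.
  - by apply: L1Z; exact: L1_ii1.
  - exact: Ge_b.
have Lt1 : cL (fun t : RT => q t * (Ez z (x - t) * ii c x t)%:C).
  have me' : measurable_fun setT (fun t : RT => Ez z (x - t) : RT).
    apply: measurable_funM => //; apply: measurable_funB => //.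
    by apply: measurableT_comp => //; apply: measurableT_comp => //; apply: measurable_funM => //; apply: measurable_funB.
  apply: (@cL_le _ _ (fun t => (1 + EL) / (2 * `|z|) * n1 (q t))).
  - apply: cmM; first exact: cL_cm.
    by apply: cm_r; apply: measurable_funM => //; exact: meas_ii.
  - by apply: L1Z; exact: cL_n1.
  - move=> t; rewrite n1Mr mulrC ler_wpM2r ?n1_ge0//.
    have [[-> ct tx]|[-> _]] := ii_case c x t; last first.
      by rewrite mulr0 normr0 divr_ge0 ?addr_ge0 ?expR_ge0 ?mulr_ge0.
    rewrite mulr1 /Ez normrM normfV normrM [`|2|]ger0_norm// ler_pM2r; last first.
      by rewrite invr_gt0 mulr_gt0// normr_gt0.
    apply: le_trans (ler_normB _ _) _; rewrite normr1 lerD2l ger0_norm ?expR_ge0//.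
    have -> : - (2 * z * (x - t)) = - z * (2 * (x - t)) by ring.
    apply: eL; first by rewrite mulr_ge0// subr_ge0.
    by apply: le_trans _ xc_le; rewrite ler_pM2l// lerB.
have Lt2 : cL (fun t : RT => q t * (Ez z (x - t) * ii c x t)%:C * Mt t).
  apply: (@cL_le _ _ (fun t => BG * EL * rI (ii 0 L) * n1 (q t * (Ez z (x - t) * ii c x t)%:C))).
  - by apply: cmM => //; exact: cL_cm.
  - by apply: L1Z; exact: cL_n1.
  - by move=> t; apply: le_trans (n1M _ _) _; rewrite mulrC ler_wpM2r ?n1_ge0.
have Lf0 : cL (fun s : RT => f0 (x, s) * (e s)%:C).
  apply: (@cL_le _ _ (fun s => N * expR (K * L) * EL * ii 0 L s)).
  - by apply: cmM; [exact: (cm_comp mf0 (measurable_pair1 (x : RT)))|exact: cm_r].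
  - by apply: L1Z; exact: L1_ii1.
  - move=> s; rewrite n1Mr ger0_norm ?expR_ge0//.
    have [h|[_ h1 h2 h3 h4]] := chi_case (x, s).
      by rewrite /f0 h mulr0 mul0r n1_0 mul0r !mulr_ge0 ?expR_ge0 ?ii_ge0.
    have sL : s <= L by apply: le_trans h4 _; exact: window_len.
    rewrite ii_in// mulr1; apply: ler_pM; rewrite ?n1_ge0 ?expR_ge0//; last exact: eL.
    by apply: le_trans (bf0 _) _; rewrite ler_wpM2l// ler_expR ler_pM2l.
have eOp s : Op G (x, s) * (e s)%:C = G (x, s) * (e s)%:C - f0 (x, s) * (e s)%:C.
  by rewrite -mulrBl [G (x, s)]eG addrC addKr.
have LOp : cL (fun s : RT => Op G (x, s) * (e s)%:C).
  rewrite (_ : (fun s => _) = (fun s : RT => G (x, s) * (e s)%:C - f0 (x, s) * (e s)%:C)).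
    exact: cLB.
  by apply/funext => s; exact: eOp.
have eM t : Mk (fun x s => G (x, s)) t z = 1 + Mt t by [].
rewrite eM; congr (1 + _).
transitivity (cI (fun t : RT => q t * (Ez z (x - t) * ii c x t)%:C + q t * (Ez z (x - t) * ii c x t)%:C * Mt t)).
  rewrite (cID Lt1 Lt2) -P1 -P2 -(cID Lf0 LOp) /Mt; congr cI; apply/funext => s.
  by rewrite eOp addrC subrK.
by congr cI; apply/funext => t; rewrite eM mulrDr mulr1.
Unshelve. all: by end_near. Qed.
End construction.
End Kernel.

(** * Solutions of the Schrödinger equation *)

Section AbsCont.
Context {R : realType}.
Notation mu := (@lebesgue_measure R).
Notation RT := (measurableTypeR R).
Notation C := R[i].
Notation re := (@complex.Re R).
Notation im := (@complex.Im R).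

(** Indicators of intervals with a moving end jump at one point, so continuity at each parameter is
    asked only for almost every [s]. Continuity being sequential, dominated convergence applies. *)
Lemma rI_cont_ae (f : R -> R -> R) (g : R -> R) :
  (forall l, measurable_fun setT (f l : RT -> RT)) -> L1 g ->
  (forall a, {ae mu, forall s, f l s @[l --> a] --> f a s}) ->
  (forall l s, `|f l s| <= g s) ->
  continuous (fun l => rI (f l)).
Proof.
move=> mf Lg cf fg a; apply/left_right_continuousP; split.
  apply/cvg_at_leftP => u [_ ua]; apply: (@rI_dct _ (fun n s => f (u n) s) (f a) g) => //.
  by apply: (ae_imp (cf a)) => s hs; exact: (cvg_comp u _ ua hs).
apply/cvg_at_rightP => u [_ ua]; apply: (@rI_dct _ (fun n s => f (u n) s) (f a) g) => //.
by apply: (ae_imp (cf a)) => s hs; exact: (cvg_comp u _ ua hs).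
Qed.

Definition cca (f : R -> C) (a : R) := re (f l) @[l --> a] --> re (f a) /\ im (f l) @[l --> a] --> im (f a).

Lemma cI_cont_ae (f : R -> R -> C) (g : R -> R) :
  (forall l, cm (f l : RT -> C)) -> L1 g ->
  (forall a, {ae mu, forall s, cca (f^~ s) a}) ->
  (forall l s, n1 (f l s) <= g s) -> cc (fun l => cI (f l)).
Proof.
move=> mf Lg cf fg; split.
  apply: (@rI_cont_ae (fun l s => re (f l s)) g) => [l||a|l s] //.
  - by case: (mf l).
  - by apply: (ae_imp (cf a)) => s [].
  - by apply: le_trans (n1_re _) _; exact: fg.
apply: (@rI_cont_ae (fun l s => im (f l s)) g) => [l||a|l s] //.
- by case: (mf l).
- by apply: (ae_imp (cf a)) => s [].
- by apply: le_trans (n1_im _) _; exact: fg.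
Qed.

Lemma cvg_ler (p a : R) : p <> a -> ((p <= l)%R%:R : R) @[l --> a] --> ((p <= a)%R%:R : R).
Proof.
move=> pa; apply: cvg_near_cst; have [h|h] := leP p a.
  have h' : p < a by rewrite lt_neqAle h andbT; exact/eqP.
  near=> l; have : p < l by near: l; exact: lt_nbhsr.
  by move=> /ltW ->.
near=> l; have : l < p by near: l; exact: lt_nbhsl.
by rewrite ltNge => /negbTE ->.
Unshelve. all: by end_near. Qed.

Lemma ler_split (s t : R) : s <> t -> (t <= s)%R%:R + (s <= t)%R%:R = 1 :> R.
Proof. by move=> st; case: (ltgtP s t) => [_|_|/st]; rewrite ?addr0 ?add0r. Qed.

(* [F] is absolutely continuous on [c,d] with density [f]. *)
Definition ac (c d : R) (F f : R -> C) :=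
  cL (fun t : RT => f t * (ii c d t)%:C) /\
  forall x y, c <= x -> x <= y -> y <= d -> F y - F x = cI (fun t : RT => f t * (ii x y t)%:C).

Lemma ii_sub (c d x y t : R) : c <= x -> y <= d -> ii c d t * ii x y t = ii x y t.
Proof.
move=> cx yd; have [[-> xt ty]|[-> _]] := ii_case x y t; last by rewrite mulr0.
by rewrite ii_in ?mulr1//; [exact: le_trans cx xt|exact: le_trans ty yd].
Qed.

Lemma cm_ii (x y : R) : cm (fun t : RT => (ii x y t)%:C).
Proof. by apply: cm_r; exact: meas_ii. Qed.

Lemma n1_ii (x y t : R) : n1 (ii x y t)%:C <= 1.
Proof. by rewrite n1_r ger0_norm ?ii_ge0 ?ii_le1. Qed.

Lemma ii_subC (c d x y t : R) : c <= x -> y <= d -> (ii c d t)%:C * (ii x y t)%:C = (ii x y t)%:C :> C.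
Proof. by move=> cx yd; rewrite rCM ii_sub. Qed.

Lemma cL_ii (f : RT -> C) (x y : R) : cL f -> cL (fun t : RT => f t * (ii x y t)%:C).
Proof. by move=> Lf; apply: (cLM Lf (cm_ii x y)) => t; exact: n1_ii. Qed.

Lemma cL_sub (f : RT -> C) (c d x y : R) : c <= x -> y <= d ->
  cL (fun t : RT => f t * (ii c d t)%:C) -> cL (fun t : RT => f t * (ii x y t)%:C).
Proof.
move=> cx yd /(cL_ii x y); rewrite (_ : (fun t => _) = (fun t : RT => f t * (ii x y t)%:C))//.
by apply/funext => t; rewrite -mulrA ii_subC.
Qed.

Lemma ac_L c d F f x y : ac c d F f -> c <= x -> y <= d -> cL (fun t : RT => f t * (ii x y t)%:C).
Proof. by move=> [Lf _] cx yd; exact: cL_sub Lf. Qed.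

Lemma ac_bnd c d F f : ac c d F f -> c <= d -> exists2 B, 0 <= B & forall x, c <= x -> x <= d -> n1 (F x) <= B.
Proof.
move=> h cd; exists (n1 (F c) + rI (fun t => n1 (f t * (ii c d t)%:C))).
  by rewrite addr_ge0 ?n1_ge0// rI_ge0// => t; exact: n1_ge0.
move=> x cx xd; rewrite -[F x](subrK (F c)) addrC; apply: le_trans (n1D _ _) _; rewrite lerD2l.
rewrite h.2//; apply: cI_le; [exact: cL_cm (ac_L h _ _)|exact: cL_n1 h.1|].
move=> t; rewrite -(@ii_subC c d c x t)// mulrA n1Mr ler_piMr ?n1_ge0//.
by rewrite ger0_norm ?ii_ge0 ?ii_le1.
Qed.

Lemma cc_prim (f : RT -> C) (c : R) : cL f -> cc (fun x => cI (fun t : RT => f t * (ii c x t)%:C)).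
Proof.
move=> Lf; apply: (@cI_cont_ae (fun x t => f t * (ii c x t)%:C) (fun t => n1 (f t))).
- by move=> l; apply: cL_cm; exact: cL_ii.
- exact: cL_n1.
- move=> a; apply: (ae_imp (ae_neq a)) => t ta.
  have h : ii c l t @[l --> a] --> ii c a t.
    rewrite /ii; case: (c <= t) => /=; last exact: cvg_cst.
    exact: cvg_ler.
  split; rewrite ?reM ?imM/=.
    by rewrite (_ : (fun l => _) = (fun l => re (f t) * ii c l t - im (f t) * 0)); [
      apply: cvgB; [apply: cvgM; [exact: cvg_cst|]|exact: cvg_cst]|apply/funext => l; rewrite reM].
  by rewrite (_ : (fun l => _) = (fun l => re (f t) * 0 + im (f t) * ii c l t)); [
      apply: cvgD; [exact: cvg_cst|apply: cvgM; [exact: cvg_cst|]]|apply/funext => l; rewrite imM].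
- by move=> l t; rewrite n1Mr ler_piMr ?n1_ge0// ger0_norm ?ii_ge0 ?ii_le1.
Qed.

Lemma ac_cont c d F f : ac c d F f -> exists2 G, cc G & forall x, c <= x -> x <= d -> F x = G x.
Proof.
move=> h; exists (fun x => F c + cI (fun t : RT => (f t * (ii c d t)%:C) * (ii c x t)%:C)).
  by apply: ccD; [exact: cc_cst|exact: cc_prim h.1].
move=> x cx xd; rewrite (_ : (fun t : RT => _) = (fun t : RT => f t * (ii c x t)%:C)).
  by rewrite -h.2// addrC subrK.
by apply/funext => t; rewrite -mulrA ii_subC.
Qed.

Lemma ac_cm c d F f : ac c d F f -> cm (fun t : RT => F t * (ii c d t)%:C).
Proof.
move=> /ac_cont[G cG FG]; rewrite (_ : (fun t => _) = (fun t : RT => G t * (ii c d t)%:C)).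
  by apply: cmM; [exact: cc_cm|exact: cm_ii].
apply/funext => t; have [[-> ct td]|[-> _]] := ii_case c d t; last by rewrite !mulr0.
by rewrite FG.
Qed.

Lemma acLM c d F f (g : RT -> C) : c <= d -> ac c d F f -> cL (fun t : RT => g t * (ii c d t)%:C) ->
  cL (fun t : RT => g t * F t * (ii c d t)%:C).
Proof.
move=> cd h Lg; have [B B0 hB] := ac_bnd h cd.
rewrite (_ : (fun t => _) = (fun t : RT => (g t * (ii c d t)%:C) * (F t * (ii c d t)%:C))).
  apply: (@cLM _ _ _ B) => //; first exact: ac_cm h.
  move=> t; rewrite n1Mr; have [[-> ct td]|[-> _]] := ii_case c d t; last by rewrite normr0 mulr0.
  by rewrite normr1 mulr1 hB.
apply/funext => t; have [[-> _ _]|[-> _]] := ii_case c d t; last by rewrite !mulr0.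
by rewrite !mulr1.
Qed.

(** Integration by parts through Fubini: (F y - F x)(G y - G x) is the integral of f(s) g(t) over a
    square, which the diagonal, a null set on each line, splits into two triangles; these are the
    integrals of f (G - G x) and g (F - F x). *)
Lemma acM c d F f G g : c <= d -> ac c d F f -> ac c d G g ->
  ac c d (fun x => F x * G x) (fun x => f x * G x + g x * F x).
Proof.
move=> cd hF hG.
have L1' := acLM cd hG hF.1; have L2' := acLM cd hF hG.1.
have E t : (f t * G t + g t * F t) * (ii c d t)%:C = f t * G t * (ii c d t)%:C + g t * F t * (ii c d t)%:C.
  by rewrite mulrDl.
split; first by rewrite (_ : (fun t => _) = (fun t : RT => f t * G t * (ii c d t)%:C + g t * F t * (ii c d t)%:C)); [exact: cLD|apply/funext => t].
move=> x y cx xy yd.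
pose fx (t : RT) := f t * (ii x y t)%:C; pose gx (t : RT) := g t * (ii x y t)%:C.
have Lf : cL fx by exact: ac_L hF cx yd.
have Lg : cL gx by exact: ac_L hG cx yd.
pose le (s t : R) : C := ((s <= t)%R%:R : R)%:C.
have mle : cm (fun p : RT * RT => le p.1 p.2) by apply: cm_r; exact: meas_ler.
have nle s t : n1 (le s t) <= 1 by rewrite n1_r; exact: bool_norm1.
pose H (s t : R) : C := fx s * (gx t * le t s).
have mH : cm (fun p : RT * RT => H p.1 p.2).
  apply: cmM; first exact: (cm_comp (cL_cm Lf)).
  apply: cmM; first exact: (cm_comp (cL_cm Lg)).
  by apply: cm_r; exact: meas_ler.
have bH s t : n1 (H s t) <= n1 (fx s) * n1 (gx t).
  apply: le_trans (n1M _ _) _; apply: ler_wpM2l; first exact: n1_ge0.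
  by apply: le_trans (n1M _ _) _; rewrite ler_piMr ?n1_ge0.
have leL (h : RT -> C) s : cL h -> cL (fun t : RT => h t * le t s).
  move=> Lh; apply: (cLM (K := 1) Lh) => // ; first exact: (cm_comp mle (measurable_pair2 (s : RT))).
have leL' (h : RT -> C) s : cL h -> cL (fun t : RT => h t * le s t).
  move=> Lh; apply: (cLM (K := 1) Lh) => // ; first exact: (cm_comp mle (measurable_pair1 (s : RT))).
have A1 s : fx s * (G s - G x) = cI (H s).
  rewrite /fx; have [[-> xs sy]|[e _]] := ii_case x y s; last first.
    rewrite e mulr0 mul0r; transitivity (cI (fun=> 0 : C)); first by rewrite cI0.
    by congr cI; apply/funext => t; rewrite /H /fx e mulr0 mul0r.
  rewrite (hG.2 x s cx xs (le_trans sy yd)) -cIZ; last exact: ac_L hG cx (le_trans sy yd).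
  congr cI; apply/funext => t; rewrite /H /fx (ii_in xs sy); congr (_ * _).
  rewrite /gx -mulrA rCM; congr (_ * _%:C); rewrite /ii; case: (leP t s) => ts.
    by rewrite (le_trans ts sy) !andbT mulr1.
  by rewrite andbF mulr0.
have A2 t : gx t * (F t - F x) = cI (fun s : RT => gx t * (fx s * le s t)).
  rewrite /gx; have [[-> xs sy]|[e _]] := ii_case x y t; last first.
    rewrite e mulr0 mul0r; transitivity (cI (fun=> 0 : C)); first by rewrite cI0.
    by congr cI; apply/funext => s; rewrite mul0r.
  rewrite (hF.2 x t cx xs (le_trans sy yd)) -cIZ; last exact: ac_L hF cx (le_trans sy yd).
  congr cI; apply/funext => s; congr (_ * _).
  rewrite /fx -mulrA rCM; congr (_ * _%:C); rewrite /ii; case: (leP s t) => ts.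
    by rewrite (le_trans ts sy) !andbT mulr1.
  by rewrite andbF mulr0.
have LH1 : cL (fun s : RT => cI (H s)).
  rewrite (_ : (fun s => _) = (fun s : RT => fx s * G s - fx s * G x)); last first.
    by apply/funext => s; rewrite -A1 mulrBr.
  apply: cLB; last by under eq_fun do rewrite mulrC; exact: cLZ.
  rewrite (_ : (fun s => _) = (fun t : RT => f t * G t * (ii x y t)%:C)); last by apply/funext => t; rewrite /fx mulrAC.
  exact: cL_sub L1'.
have LH2 : cL (fun t : RT => cI (fun s : RT => gx t * (fx s * le s t))).
  rewrite (_ : (fun s => _) = (fun t : RT => gx t * F t - gx t * F x)); last first.
    by apply/funext => s; rewrite -A2 mulrBr.
  apply: cLB; last by under eq_fun do rewrite mulrC; exact: cLZ.
  rewrite (_ : (fun s => _) = (fun t : RT => g t * F t * (ii x y t)%:C)); last by apply/funext => t; rewrite /gx mulrAC.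
  exact: cL_sub L2'.
have K1 : cI (fun s : RT => cI (H s)) = cI (fun t : RT => cI (fun s : RT => gx t * (fx s * le t s))).
  rewrite (@cI_swap R H _ _ mH (cL_n1 Lf) (cL_n1 Lg) bH (fun s => n1_ge0 _)).
  by congr cI; apply/funext => t; congr cI; apply/funext => s; exact: mulrCA.
have K2 : cI (fun s : RT => cI (H s)) + cI (fun t : RT => cI (fun s : RT => gx t * (fx s * le s t))) = (F y - F x) * (G y - G x).
  have LH1' : cL (fun t : RT => cI (fun s : RT => gx t * (fx s * le t s))).
    rewrite (_ : (fun t => _) = (fun t : RT => gx t * cI (fun s : RT => fx s * le t s))); last first.
      by apply/funext => t; rewrite (cIZ _ (leL' _ t Lf)).
    apply: (cLM (K := rI (fun s => n1 (fx s))) Lg).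
      apply: (@cI_param _ _ _ (fun t s => fx s * le t s) (fun s => n1 (fx s))).
      - by apply: cmM; [exact: (cm_comp (cL_cm Lf))|exact: mle].
      - exact: cL_n1.
      - by move=> t s; apply: le_trans (n1M _ _) _; rewrite ler_piMr ?n1_ge0.
    move=> t; apply: cI_le; [exact: cL_cm (leL' _ _ Lf)|exact: cL_n1|].
    by move=> s; apply: le_trans (n1M _ _) _; rewrite ler_piMr ?n1_ge0.
  rewrite K1 -(cID LH1' LH2).
  transitivity (cI (fun t : RT => gx t * (F y - F x))).
    congr cI; apply/funext => t; rewrite -(cID (cLZ _ (leL' _ t Lf)) (cLZ _ (leL _ t Lf))).
    rewrite (hF.2 x y cx xy yd) -(cIZ _ Lf); apply: cI_ae.
    - exact: (cLD (cLZ _ (leL' _ t Lf)) (cLZ _ (leL _ t Lf))).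
    - exact: (cLZ _ Lf).
    - apply: (ae_imp (ae_neq t)) => s st; rewrite -mulrDr -mulrDr; congr (_ * _).
      rewrite -[RHS]mulr1; congr (_ * _); rewrite /le -rmorphD; exact: (congr1 (fun r : R => r%:C) (ler_split st)).
  by rewrite (cIZr _ Lg) mulrC (hG.2 x y cx xy yd).
transitivity (cI (fun t : RT => G x * fx t + F x * gx t + (cI (H t) + cI (fun s : RT => gx t * (fx s * le s t))))).
  rewrite (cID (cLD (cLZ _ Lf) (cLZ _ Lg)) (cLD LH1 LH2)) (cID LH1 LH2) K2.
  rewrite (cID (cLZ _ Lf) (cLZ _ Lg)) (cIZ _ Lf) (cIZ _ Lg) -(hF.2 x y cx xy yd) -(hG.2 x y cx xy yd).
  by move: (F x) (F y) (G x) (G y) => a1 a2 a3 a4; ring.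
congr cI; apply/funext => t; rewrite -A1 -A2 /fx /gx.
by move: (F x) (F t) (G x) (G t) (f t) (g t) (ii x y t)%:C => a1 a2 a3 a4 a5 a6 a7; ring.
Qed.
End AbsCont.

Section ODE.
Context {R : realType}.
Notation RT := (measurableTypeR R).
Notation C := R[i].
Notation re := (@complex.Re R).
Notation im := (@complex.Im R).

Implicit Types (c d x y : R) (F G f g : RT -> C).

Lemma ac_ext c d (F G f g : RT -> C) : (forall x, c <= x -> x <= d -> F x = G x) ->
  (forall x, c <= x -> x <= d -> f x = g x) -> ac c d F f -> ac c d G g.
Proof.
move=> FG fg [Lf h].
have E x y : c <= x -> y <= d -> (fun t : RT => f t * (ii x y t)%:C) = (fun t : RT => g t * (ii x y t)%:C).
  move=> cx yd; apply/funext => t; have [[-> xt ty]|[-> _]] := ii_case x y t; last by rewrite !mulr0.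
  by rewrite (fg t (le_trans cx xt) (le_trans ty yd)).
split; first by rewrite -E.
move=> x y cx xy yd; have cy := le_trans cx xy; have xd := le_trans xy yd.
by rewrite -(FG _ cy yd) -(FG _ cx xd) (h _ _ cx xy yd) E.
Qed.

Lemma acD c d F f G g : ac c d F f -> ac c d G g -> ac c d (fun x => F x + G x) (fun x => f x + g x).
Proof.
move=> hF hG.
have E x y : (fun t : RT => (f t + g t) * (ii x y t)%:C) = (fun t : RT => f t * (ii x y t)%:C + g t * (ii x y t)%:C).
  by apply/funext => t; rewrite mulrDl.
split; first by rewrite E; exact: (cLD hF.1 hG.1).
move=> x y cx xy yd; rewrite E (cID (ac_L hF cx yd) (ac_L hG cx yd)) -(hF.2 _ _ cx xy yd) -(hG.2 _ _ cx xy yd).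
by rewrite opprD addrACA.
Qed.

Lemma acZ c d k F f : ac c d F f -> ac c d (fun x => k * F x) (fun x => k * f x).
Proof.
move=> hF.
have E x y : (fun t : RT => (k * f t) * (ii x y t)%:C) = (fun t : RT => k * (f t * (ii x y t)%:C)).
  by apply/funext => t; rewrite mulrA.
split; first by rewrite E; exact: (cLZ _ hF.1).
by move=> x y cx xy yd; rewrite E (cIZ _ (ac_L hF cx yd)) -(hF.2 _ _ cx xy yd) mulrBr.
Qed.

Lemma acB c d F f G g : ac c d F f -> ac c d G g -> ac c d (fun x => F x - G x) (fun x => f x - g x).
Proof.
by move=> hF hG; apply: ac_ext (acD hF (acZ (-1) hG)) => x _ _; rewrite mulN1r.
Qed.

Lemma L1_exp (s u v : R) : L1 (fun t => expR (s * t) * ii u v t).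
Proof.
apply/L1_ii; first by apply: meas_expR; exact: measurable_funM.
apply: continuous_compact_integrable; first exact: segment_compact.
apply: continuous_subspaceT => x.
by apply: continuous_comp; [exact: mulrl_continuous|exact: continuous_expR].
Qed.

Lemma ac_exp c d (s : R) : s != 0 ->
  ac c d (fun x => (expR (s * x))%:C) (fun x => (s * expR (s * x))%:C).
Proof.
move=> s0.
have E x y : (fun t : RT => (s * expR (s * t))%:C * (ii x y t)%:C) = (fun t : RT => (s * (expR (s * t) * ii x y t))%:C).
  by apply/funext => t; rewrite rCM mulrA.
split; first by rewrite E; apply: cL_r; apply: L1Z; exact: L1_exp.
move=> x y cx xy yd; rewrite E cI_r (rIZ _ (L1_exp s x y)).
have := @rI_ii_exp _ (- s) x y; rewrite oppr_eq0 opprK => -> //.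
have -> : s * ((expR (s * x) - expR (s * y)) / - s) = expR (s * y) - expR (s * x) by field.
by apply: Ceq; rewrite !reimE ?subrr.
Qed.

Lemma ftc_r (F f : R -> R) x y : x <= y -> (forall t, is_derive t (1:R) F (f t)) -> continuous f ->
  L1 (fun t => f t * ii x y t) /\ F y - F x = rI (fun t => f t * ii x y t).
Proof.
move=> + dF cf; rewrite le_eqVlt => /predU1P[->|xy].
  split.
    apply/L1_ii; first exact: continuous_measurable_fun.
    by apply: continuous_compact_integrable; [exact: segment_compact|exact: continuous_subspaceT].
  by rewrite rI_ii set_itv1 Rintegral_set1 subrr.
have Li : L1 (fun t => f t * ii x y t).
  apply/L1_ii; first exact: continuous_measurable_fun.
  by apply: continuous_compact_integrable; [exact: segment_compact|exact: continuous_subspaceT].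
split=> //.
have cF t : {for t, continuous F} by apply: differentiable_continuous; apply/derivable1_diffP; case: (dF t).
have := @continuous_FTC2 R f F x y xy (continuous_subspaceT cf).
rewrite rI_ii /Rintegral => -> //.
- split; [|exact: (cvg_at_right_filter (cF x))|exact: (cvg_at_left_filter (cF y))].
  by move=> t _; case: (dF t).
- by move=> t _; rewrite derive1E; case: (dF t).
Qed.

Lemma ac_derive c d (u u' : R -> C) : c <= d ->
  (forall x, is_derive x (1:R) (fun t => re (u t)) (re (u' x)) /\
             is_derive x (1:R) (fun t => im (u t)) (im (u' x))) -> cc u' -> ac c d u u'.
Proof.
move=> cd du [c1 c2].
have H x y : x <= y -> cL (fun t : RT => u' t * (ii x y t)%:C) /\ u y - u x = cI (fun t : RT => u' t * (ii x y t)%:C).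
  move=> xy.
  have [l1 e1] := ftc_r xy (fun t => (du t).1) c1; have [l2 e2] := ftc_r xy (fun t => (du t).2) c2.
  have E1 : re \o (fun t : RT => u' t * (ii x y t)%:C) = (fun t => (re \o u') t * ii x y t).
    by apply/funext => t; rewrite /= reM im_r re_r mulr0 subr0.
  have E2 : im \o (fun t : RT => u' t * (ii x y t)%:C) = (fun t => (im \o u') t * ii x y t).
    by apply/funext => t; rewrite /= imM im_r re_r mulr0 add0r.
  split; first by split; rewrite ?E1 ?E2.
  by apply: Ceq; rewrite ?reB ?imB /cI ?E1 ?E2.
by split=> [|x y _ xy _]; [exact: (H _ _ cd).1|exact: (H _ _ xy).2].
Qed.

Lemma cc_loc (F : R -> C) : (forall a, exists2 G, cc G & forall x, a - 1 <= x -> x <= a + 1 -> F x = G x) -> cc F.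
Proof.
move=> H.
have N (a : R) : \forall x \near a, a - 1 <= x /\ x <= a + 1.
  near=> x; split; apply: ltW.
    by near: x; apply: lt_nbhsr; rewrite ltrBlDr ltrDl.
  by near: x; apply: lt_nbhsl; rewrite ltrDl.
split=> a; have [G [G1 G2] FG] := H a.
- have e : F a = G a by apply: FG; rewrite ?gerBl ?lerDl.
  rewrite /continuous_at /= e; apply: cvg_trans (G1 a); apply: near_eq_cvg.
  by apply: filterS (N a) => x [h1 h2]; rewrite /= FG.
- have e : F a = G a by apply: FG; rewrite ?gerBl ?lerDl.
  rewrite /continuous_at /= e; apply: cvg_trans (G2 a); apply: near_eq_cvg.
  by apply: filterS (N a) => x [h1 h2]; rewrite /= FG.
Unshelve. all: by end_near. Qed.

Lemma ac_cc (F f : RT -> C) : (forall c d, c <= d -> ac c d F f) -> cc F.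
Proof.
move=> h; apply: cc_loc => a; have [|G cG FG] := @ac_cont _ (a - 1) (a + 1) F f.
  by apply: h; rewrite lerD2l -subr_ge0 opprK addr_ge0.
by exists G.
Qed.

(** Needed at the ends [a] and [b], where a solution is known in closed form on one side only: being
    differentiable there, it inherits the slope from that side. *)
Lemma one_sided (f g : R -> R) (x f' g' : R) (s : bool) :
  is_derive x (1:R) f f' -> is_derive x (1:R) g g' ->
  (forall t, (if s then t <= x else x <= t) -> f t = g t) -> f' = g'.
Proof.
move=> df dg fg.
have [dD e] : is_derive x (1:R) (f - g) (f' - g') by exact: is_deriveB.
apply/eqP; rewrite -subr_eq0 -e.
have H : h^-1 *: ((f - g) (h *: (1:R) + x) - (f - g) x) @[h --> 0^'] --> 'D_1 (f - g) x by exact: dD.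
have D0 t : (if s then t <= x else x <= t) -> (f - g) t = 0.
  by move=> /fg h; rewrite /GRing.add /= /GRing.opp /= h; exact: subrr.
have Dx : (f - g) x = 0 by apply: D0; case: (s); exact: lexx.
case: s fg D0 => fg D0.
- apply/eqP; apply: (cvg_unique _ (cvg_dnbhs_at_left H)); first exact: norm_hausdorff.
  apply: cvg_near_cst; near=> h; rewrite Dx D0 ?subr0 ?scaler0//.
  rewrite /GRing.scale /= mulr1 gerDr; apply: ltW; near: h; exact: nbhs_left_lt.
- apply/eqP; apply: (cvg_unique _ (cvg_dnbhs_at_right H)); first exact: norm_hausdorff.
  apply: cvg_near_cst; near=> h; rewrite Dx D0 ?subr0 ?scaler0//.
  rewrite /GRing.scale /= mulr1 lerDr; apply: ltW; near: h; exact: nbhs_right_gt.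
Unshelve. all: by end_near. Qed.

End ODE.

(** * From the differential equation to the Volterra equation *)

Section Solutions.
Context {R : realType}.
Notation RT := (measurableTypeR R).
Notation C := R[i].
Notation re := (@complex.Re R).
Notation im := (@complex.Im R).
Implicit Types (c d x y z : R) (u : RT -> C) (q : RT -> C).

Lemma rCB (v w : R) : (v - w)%:C = v%:C - w%:C :> C.
Proof. by apply: Ceq; rewrite !reimE ?subrr. Qed.

Lemma rC1 : (1 : R)%:C = 1 :> C. Proof. by []. Qed.

Definition sol q z c d u (u' : RT -> C) :=
  ac c d u u' /\ ac c d u' (fun t => (q t + (z ^+ 2)%:C) * u t).

Lemma cc_bnd u c d : c <= d -> cc u -> exists2 B, 0 <= B & forall x, c <= x -> x <= d -> n1 (u x) <= B.
Proof.
move=> cd [u1 u2].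
have H (f : R -> R) : continuous f -> exists B, forall x, c <= x -> x <= d -> `|f x| <= B.
  move=> cf; have [|x0 _ hx] := @EVT_max R (fun x => `|f x|) c d cd.
    by apply: continuous_subspaceT => x; apply: continuous_comp; [exact: cf|exact: norm_continuous].
  by exists `|f x0| => x cx xd; apply: hx; rewrite in_itv/= cx.
have [B1 h1] := H _ u1; have [B2 h2] := H _ u2.
exists (B1 + B2); last by move=> x cx xd; apply: lerD; [exact: h1|exact: h2].
by apply: addr_ge0; [apply: le_trans (h1 c _ _)|apply: le_trans (h2 c _ _)].
Qed.

Lemma cm_bndL (f g : RT -> C) B c d : cL (fun t : RT => f t * (ii c d t)%:C) -> cm g ->
  (forall x, c <= x -> x <= d -> n1 (g x) <= B) -> cL (fun t : RT => f t * g t * (ii c d t)%:C).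
Proof.
move=> Lf mg bg.
rewrite (_ : (fun t : RT => _) = (fun t : RT => (f t * (ii c d t)%:C) * (g t * (ii c d t)%:C))).
  apply: (cLM (K := Num.max B 0) Lf); first by apply: cmM => //; exact: cm_ii.
  move=> t; rewrite n1Mr; have [[-> ct td]|[-> _]] := ii_case c d t; last by rewrite normr0 mulr0 le_max lexx orbT.
  by rewrite normr1 mulr1 le_max bg.
apply/funext => t; have [[-> _ _]|[-> _]] := ii_case c d t; last by rewrite !mulr0.
by rewrite !mulr1.
Qed.

Lemma sqr_iz (z : R) (v : C) : v - ('i%C * z%:C) ^+ 2 = v + (z ^+ 2)%:C.
Proof. by rewrite exprMn sqr_i mulN1r opprK rmorphXn. Qed.

Lemma schrod_sol (V u : RT -> C) z : cL V -> schrodinger_solution V ('i%C * z%:C) u ->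
  exists u' : RT -> C, (forall c d, c <= d -> sol V z c d u u') /\
   (forall x, is_derive x (1:R) (fun t => re (u t)) (re (u' x)) /\
             is_derive x (1:R) (fun t => im (u t)) (im (u' x))).
Proof.
move=> LV [u' [du hu']]; exists u'; split=> //.
have cu : cc u.
  by split=> x; [have [[h _] _] := du x|have [_ [h _]] := du x];
    apply: differentiable_continuous; apply/derivable1_diffP.
have A2 c d : c <= d -> ac c d u' (fun t => (V t + (z ^+ 2)%:C) * u t).
  move=> cd; split.
    have [B B0 hB] := cc_bnd cd cu.
    apply: (cm_bndL _ (cc_cm cu) hB).
    rewrite (_ : (fun t : RT => _) = (fun t : RT => V t * (ii c d t)%:C + (z ^+ 2)%:C * (ii c d t)%:C)); last first.
      by apply/funext => t; rewrite mulrDl.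
    by apply: cLD; [exact: cL_ii|apply: cLZ; apply: cL_r; exact: L1_ii1].
  move=> x y _ xy _; rewrite hu'// cintegralE; congr cI; apply/funext => t.
  by rewrite sqr_iz.
have cu' : cc u' by apply: ac_cc => c d; exact: A2.
by move=> c d cd; split; [exact: ac_derive|exact: A2].
Qed.

(** The operator D^2 - z^2 factors as (D + s)(D - s) when s^2 = z^2, and e^{sx} is the integrating
    factor of the outer one: the derivative of e^{sx}(u' - su) is e^{sx} q u. Both signs of [s] are
    used throughout. *)
Lemma sol_E q z s c d u u' : c <= d -> s != 0 -> s ^+ 2 = z ^+ 2 -> sol q z c d u u' ->
  cL (fun t : RT => q t * u t * (expR (s * t) * ii c d t)%:C) /\
  forall x, c <= x -> x <= d ->
  (expR (s * x))%:C * (u' x - s%:C * u x) - (expR (s * c))%:C * (u' c - s%:C * u c) =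
  cI (fun t : RT => q t * u t * (expR (s * t) * ii c x t)%:C).
Proof.
move=> cd s0 sz [h1 h2].
have h := acM cd (ac_exp c d s0) (acB h2 (acZ s%:C h1)).
have E v w : (fun t : RT => ((s * expR (s * t))%:C * (u' t - s%:C * u t) +
    ((q t + (z ^+ 2)%:C) * u t - s%:C * u' t) * (expR (s * t))%:C) * (ii v w t)%:C) =
  (fun t : RT => q t * u t * (expR (s * t) * ii v w t)%:C).
  apply/funext => t; rewrite -sz expr2 -!rCM.
  by move: (s%:C) (expR _)%:C (u' t) (u t) (q t) (ii _ _ _)%:C => a1 a2 a3 a4 a5 a6; ring.
split; first by rewrite -E; exact: h.1.
by move=> x cx xd; rewrite -E -h.2.
Qed.

(** Eliminates u'(x) between the two cases of [sol_E]. Here [w] is z, [E] is e^{-2zx}, [ep] and [en]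
    are e^{zx} and e^{-zx}, [ec] is e^{-zc}, and [ux], [uc], [vx] are u(x), u(c), u'(x). *)
Lemma variation_of_constants (E ep en ec ux uc vx w : C) : E * ep = en ->
  (w + w) * (ux * en) = (w + w) * (uc * ec) +
   ((en * (vx - - w * ux) - ec * (w * uc - - w * uc)) - E * (ep * (vx - w * ux))).
Proof. by move=> <-; ring. Qed.

(** Combine [sol_E] for s = z and s = -z. The initial condition annihilates the boundary term at [c]
    for s = z and leaves 2z u(c) for s = -z. *)
Lemma sol_volt q z c d u u' : c <= d -> z != 0 -> sol q z c d u u' -> u' c = z%:C * u c ->
  forall x, c <= x -> x <= d ->
  u x * (expR (- (z * x)))%:C = u c * (expR (- (z * c)))%:C +
    cI (fun t : RT => q t * (Ez z (x - t) * ii c x t)%:C * (u t * (expR (- (z * t)))%:C)).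
Proof.
move=> cd z0 hs ic x cx xd.
have [L1' E1] := sol_E cd z0 erefl hs.
have nz0 : - z != 0 by rewrite oppr_eq0.
have [L2' E2] := sol_E cd nz0 (sqrrN z) hs.
move: (E1 x cx xd); rewrite ic subrr mulr0 subr0 => e1.
move: (E2 x cx xd); rewrite ic => e2.
have Lp (s : R) : cL (fun t : RT => q t * u t * (expR (s * t) * ii c d t)%:C) ->
   cL (fun t : RT => q t * u t * (expR (s * t) * ii c x t)%:C).
  move=> Ls; rewrite (_ : (fun t => _) = (fun t : RT => (q t * u t * (expR (s * t))%:C) * (ii c x t)%:C)).
    apply: (cL_sub (lexx c) xd); move: Ls; congr cL; apply/funext => t.
    by rewrite -rCM mulrA.
  by apply/funext => t; rewrite -rCM mulrA.
have z2 : (2 * z)%:C != 0 :> C by rewrite (inj_eq (@complexI R)) mulf_neq0.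
apply: (mulfI z2).
have EI : (2 * z)%:C * cI (fun t : RT => q t * (Ez z (x - t) * ii c x t)%:C * (u t * (expR (- (z * t)))%:C)) =
  cI (fun t : RT => q t * u t * (expR (- z * t) * ii c x t)%:C) -
  (expR (- (2 * z * x)))%:C * cI (fun t : RT => q t * u t * (expR (z * t) * ii c x t)%:C).
  rewrite -(cIZ _ (Lp _ L1')) -(cIB (Lp _ L2') (cLZ _ (Lp _ L1'))).
  rewrite (_ : (fun t : RT => q t * (Ez z (x - t) * ii c x t)%:C * (u t * (expR (- (z * t)))%:C)) =
    (fun t : RT => ((2 * z)^-1)%:C * (q t * u t * (expR (- z * t) * ii c x t)%:C - (expR (- (2 * z * x)))%:C * (q t * u t * (expR (z * t) * ii c x t)%:C)))).
    rewrite (cIZ _ (cLB (Lp _ L2') (cLZ _ (Lp _ L1')))) mulrA rCM divff ?mulf_neq0//.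
    by rewrite mul1r.
  apply/funext => t; rewrite /Ez.
  have -> : expR (- (2 * z * (x - t))) = expR (- (2 * z * x)) * (expR (z * t) * expR (z * t)).
    by rewrite -!expRD; congr expR; ring.
  have e3 : expR (z * t) * expR (- z * t) = 1 by rewrite -expRD mulNr subrr expR0.
  have e4 : (expR (z * t))%:C * (expR (- z * t))%:C = 1 :> C by rewrite rCM e3.
  rewrite -(mulNr z t) [_ / (2 * z)]mulrC -!rCM rCB rC1 -!rCM.
  move: e4; move: (q t) (u t) (expR (z * t))%:C (expR (- z * t))%:C (expR (- (2 * z * x)))%:C (ii _ _ _)%:C ((2 * z)^-1)%:C => a1 a2 a3 a4 a5 a6 a7 e4.
  transitivity (a7 * (a1 * a2 * (a4 * a6)) - a7 * (a5 * (a1 * a2 * (a3 * (a3 * a4) * a6)))); first by ring.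
  by rewrite e4; ring.
rewrite mulrDr EI -e1 -e2.
have e3 (w : R) : (expR (z * w))%:C * (expR (- z * w))%:C = 1 :> C.
  by rewrite rCM -expRD mulNr subrr expR0.
have e5 : (expR (- (2 * z * x)))%:C * (expR (z * x))%:C = (expR (- z * x))%:C :> C.
  by rewrite rCM -expRD; congr (expR _)%:C; ring.
have e8 : (2 * z)%:C = z%:C + z%:C :> C by apply: Ceq; rewrite !reimE ?addr0// mulrDl mul1r.
have e9 : (- z)%:C = - z%:C :> C by apply: Ceq; rewrite !reimE ?oppr0.
rewrite -(mulNr z x) -(mulNr z c) e8 e9; exact: variation_of_constants.
Qed.

End Solutions.

(** * Expressing solutions through the kernel *)

Section Uniqueness.
Context {R : realType}.
Notation RT := (measurableTypeR R).
Notation C := R[i].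
Implicit Types (c d x y z : R) (u : RT -> C) (q : RT -> C) (A : RT -> RT -> C).

(* Gronwall by absorption: an a priori bound of the right shape improves to one
   with a constant independent of it. *)
Lemma weight_contr c d (D : R -> C) (w : R -> R) (C0 K0 : R) : 0 <= C0 -> 0 <= K0 ->
  (forall x, c <= x -> x <= d -> n1 (D x) <= K0 * w x) ->
  (forall K, 0 <= K -> (forall x, c <= x -> x <= d -> n1 (D x) <= K * w x) ->
     forall x, c <= x -> x <= d -> n1 (D x) <= (C0 + K / 2) * w x) ->
  forall x, c <= x -> x <= d -> n1 (D x) <= 2 * C0 * w x.
Proof.
move=> C00 K00 h0 hK x cx xd.
have Hn n : forall x, c <= x -> x <= d -> n1 (D x) <= (2 * C0 + K0 / 2 ^+ n) * w x.
  elim: n => [|n IH] t ct td.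
    have w0 : 0 <= w t \/ w t < 0 by case: (leP 0 (w t)); [left|right].
    rewrite expr0 divr1; case: w0 => w0.
      by apply: le_trans (h0 t ct td) _; rewrite ler_wpM2r// lerDr mulr_ge0.
    have := le_trans (n1_ge0 (D t)) (hK K0 K00 h0 t ct td); rewrite nmulr_lge0// => hh.
    have := le_trans (n1_ge0 (D t)) (h0 t ct td); rewrite nmulr_lge0// => hh'.
    have K0e : K0 = 0 by apply/eqP; rewrite eq_le hh' K00.
    by move: hh (h0 t ct td); rewrite K0e mul0r !addr0 => hC; have -> : C0 = 0 by [apply/eqP; rewrite eq_le hC C00]; rewrite !(mulr0, mul0r).
  have := hK (2 * C0 + K0 / 2 ^+ n) _ IH t ct td; rewrite (_ : C0 + _ / 2 = 2 * C0 + K0 / 2 ^+ n.+1).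
    by apply; rewrite addr_ge0 ?mulr_ge0// invr_ge0 exprn_ge0.
  by rewrite exprS; field; rewrite expf_neq0.
have cv : (fun n : nat => (2 * C0 + K0 / 2 ^+ n) * w x) @ \oo --> (2 * C0 + 0) * w x.
  apply: cvgM; last exact: cvg_cst.
  apply: cvgD; first exact: cvg_cst.
  rewrite (_ : (fun n => _) = (fun n : nat => K0 * 2^-1 ^+ n)); last by apply/funext => n; rewrite exprVn.
  have -> : (0 : R) = K0 * 0 by rewrite mulr0.
  apply: cvgM; first exact: cvg_cst.
  by apply: cvg_expr; rewrite ger0_norm ?invr_ge0// invf_lt1// ltr1n.
rewrite -[2 * C0]addr0; apply: (closed_cvg (fun y : R => n1 (D x) <= y)) cv; first exact: closed_ge.
by apply: nearW => n; exact: Hn.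
Qed.

(* Bounded kernels with [A x] supported in [0, S + 2x] for [c <= x <= d]; besides
   the Volterra kernel this covers the kernel of a product of two solutions. *)
Definition bk c d (S : R) A :=
  [/\ cm (fun p : RT * RT => A p.1 p.2), (exists2 B, 0 <= B & forall x s, n1 (A x s) <= B) &
   forall x s, ~~ ((c <= x <= d) && (0 <= s <= S + 2 * x)) -> A x s = 0].

Lemma kernel_bk q c d A : volterra_kernel q c d A -> bk c d (- (2 * c)) A.
Proof.
case=> h1 h2 h3 _; split=> // x s h; apply: h3; move: h.
by rewrite addrC -mulrBr.
Qed.

Section bk.
Variables (c d S : R) (A : RT -> RT -> C).
Hypothesis hA : bk c d S A.

Lemma bk_zero x s : ~~ (0 <= s <= S + 2 * x) -> A x s = 0.
Proof. by case: hA => _ _ h hs; apply: h; rewrite (negbTE hs) andbF. Qed.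

Lemma bk_bnd : exists2 B, 0 <= B & forall x s, n1 (A x s) <= B * ii 0 (S + 2 * x) s * ii c d x.
Proof.
case: hA => _ [B B0 hB] h; exists B => // x s.
have [E|] := boolP ((c <= x <= d) && (0 <= s <= S + 2 * x)); last by move=> E; rewrite (h x s E) n1_0 !mulr_ge0 ?ii_ge0.
by case/andP: E => /andP[a1 a2] /andP[a3 a4]; rewrite !ii_in// !mulr1.
Qed.

Lemma bk_exp : exists2 B, 0 <= B & forall x s z, n1 (A x s * (expR (- z * s))%:C) <=
   B * expR (`|z| * (S + 2 * x)) * ii 0 (S + 2 * d) s * ii c d x.
Proof.
have [B B0 hB] := bk_bnd; exists B => // x s z.
rewrite n1Mr ger0_norm ?expR_ge0//.
have hBs := hB x s; move: hBs.
have [[-> cx xd]|[-> _]] := ii_case c d x; last first.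
  rewrite !mulr0 => /n1_eq0 ->; by rewrite n1_0 mul0r.
have [[-> s0 sS]|[-> _]] := ii_case 0 (S + 2 * x) s; last first.
  by rewrite mulr0 mul0r => /n1_eq0 ->; rewrite n1_0 mul0r !mulr_ge0 ?expR_ge0 ?ii_ge0.
rewrite !mulr1 => h; rewrite ii_in//; last by apply: le_trans sS _; rewrite lerD2l ler_pM2l.
rewrite mulr1; apply: ler_pM; rewrite ?n1_ge0 ?expR_ge0// ler_expR.
apply: le_trans (ler_norm _) _; rewrite normrM normrN (ger0_norm s0).
by rewrite ler_wpM2l.
Qed.

Lemma bk_L x z : cL (fun s : RT => A x s * (expR (- z * s))%:C).
Proof.
have [B B0 hB] := bk_exp.
apply: (cL_le (g := fun s => (B * expR (`|z| * (S + 2 * x)) * ii c d x) * ii 0 (S + 2 * d) s)).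
- apply: cmM; first by case: hA => h _ _; exact: (cm_comp h (measurable_pair1 (x : RT))).
  by apply: cm_r; apply: meas_expR; exact: measurable_funM.
- by apply: L1Z; exact: L1_ii1.
- by move=> s; rewrite -[leRHS]mulrA [ii c d x * _]mulrC [leRHS]mulrA; exact: hB.
Qed.

Lemma Mk_bnd : exists2 B, 0 <= B & forall x z, 0 <= S + 2 * x ->
  n1 (Mk A x z) <= B * expR (`|z| * (S + 2 * x)).
Proof.
have [B B0 hB] := bk_exp; exists (1 + B * rI (ii 0 (S + 2 * d))).
  by rewrite addr_ge0// mulr_ge0// rI_ge0// => t; exact: ii_ge0.
move=> x z x0; rewrite mulrDl mul1r; apply: le_trans (n1D _ _) _; apply: lerD.
  by rewrite n1_1 -[leLHS]expR0 ler_expR mulr_ge0.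
rewrite mulrAC -(rIZ _ (L1_ii1 0 (S + 2 * d))).
apply: cI_le; [exact: (cL_cm (bk_L x z))|by apply: L1Z; exact: L1_ii1|].
move=> s; apply: le_trans (hB x s z) _; rewrite ler_piMr ?ii_le1//.
by rewrite !mulr_ge0 ?expR_ge0 ?ii_ge0.
Qed.

Lemma Mk_cm z : cm (fun x : RT => Mk A x z).
Proof.
apply: cmD; first exact: cm_cst.
have [B B0 hB] := bk_exp.
apply: (@cI_param _ _ _ (fun x s => A x s * (expR (- z * s))%:C) (fun s => (B * expR (`|z| * (S + 2 * d))) * ii 0 (S + 2 * d) s)).
- apply: cmM; first by case: hA.
  by apply: cm_r; apply: meas_expR; exact: measurable_funM.
- by apply: L1Z; exact: L1_ii1.
- move=> x s; apply: le_trans (hB x s z) _.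
  have [[-> cx xd]|[-> _]] := ii_case c d x; last by rewrite mulr0 !mulr_ge0 ?expR_ge0 ?ii_ge0.
  rewrite mulr1 ler_wpM2r ?ii_ge0// ler_wpM2l// ler_expR ler_wpM2l// lerD2l ler_pM2l//.
Qed.
End bk.

(** One bound for both signs: the exponent |z| - z is 0 for z > 0 and 2|z| for z < 0, where [Ez]
    genuinely grows. *)
Lemma Ez_bnd (z r : R) : z != 0 -> 0 <= r -> `|Ez z r| <= expR ((`|z| - z) * r) / (2 * `|z|).
Proof.
move=> z0 r0; rewrite /Ez normrM normfV normrM [`|2|]ger0_norm// ler_pM2r ?invr_gt0 ?mulr_gt0 ?normr_gt0//.
have e0 := expR_gt0 (- (2 * z * r)).
have [zp|zn] := leP 0 z.
  rewrite (ger0_norm zp) subrr mul0r expR0 ler_norml; apply/andP; split; last by rewrite gerBl ltW.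
  have : expR (- (2 * z * r)) <= 1 by rewrite -expR0 ler_expR oppr_le0 !mulr_ge0.
  by move: e0; move: (expR _) => e; lra.
rewrite (ltr0_norm zn) (_ : (- z - z) * r = - (2 * z * r)); last by ring.
have : 1 <= expR (- (2 * z * r)).
  by rewrite -[leLHS]expR0 ler_expR oppr_ge0 mulr_le0_ge0// mulr_ge0_le0// ltW.
by move: e0; move: (expR _) => e e0 e1; rewrite ler0_norm; lra.
Qed.

Lemma Ez_L q z c x : cL q -> z != 0 ->
  cL (fun t : RT => q t * (Ez z (x - t) * ii c x t)%:C).
Proof.
move=> Lq z0.
have me' : measurable_fun setT (fun t : RT => Ez z (x - t) : RT).
  apply: measurable_funM => //; apply: measurable_funB => //.
  by apply: measurableT_comp => //; apply: measurableT_comp => //; apply: measurable_funM => //; apply: measurable_funB.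
pose B := expR ((`|z| - z) * (x - c)) / (2 * `|z|).
apply: (cLM (K := B) Lq); first by apply: cm_r; apply: measurable_funM => //; exact: meas_ii.
move=> t; rewrite n1_r; have [[-> ct tx]|[-> _]] := ii_case c x t; last first.
  by rewrite mulr0 normr0 divr_ge0 ?expR_ge0 ?mulr_ge0.
rewrite mulr1; apply: le_trans (Ez_bnd z0 _) _; first by rewrite subr_ge0.
rewrite ler_pM2r ?invr_gt0 ?mulr_gt0 ?normr_gt0// ler_expR ler_wpM2l//.
  by rewrite subr_ge0 ler_norm.
by rewrite lerB.
Qed.

(** The difference [D] of the two candidates solves the homogeneous Volterra equation. In a suitable
    weight its operator has norm at most ||q|| / (2|z|), which is at most 1/2 by the lower bound on
    |z|, so [weight_contr] forces D = 0. *)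
Lemma sol_M q z c d A u u' : c <= d -> cL q -> volterra_kernel q c d A -> z != 0 ->
  rI (fun x => n1 (q x)) <= `|z| -> sol q z c d u u' -> u' c = z%:C * u c ->
  forall x, c <= x -> x <= d -> u x = u c * (expR (z * (x - c)))%:C * Mk A x z.
Proof.
move=> cd Lq kA z0 zN hs ic.
have hA := kernel_bk kA.
have [B B0 hB] := Mk_bnd hA.
have mM := Mk_cm hA z.
have eM : forall x, c <= x -> x <= d -> Mk A x z = 1 + cI (fun t : RT => q t * (Ez z (x - t) * ii c x t)%:C * Mk A t z).
  by move=> x; case: kA => _ _ _; apply.
pose m (x : R) : C := u x * (expR (- (z * x)))%:C.
have hm := sol_volt cd z0 hs ic.
have Lz (x : R) : cL (fun t : RT => q t * (Ez z (x - t) * ii c x t)%:C) by exact: Ez_L.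
have [G cG FG] := ac_cont hs.1.
have cm1 : cm (fun t : RT => G t * (expR (- (z * t)))%:C).
  apply: cmM; first exact: cc_cm.
  by apply: cm_r; apply: meas_expR; apply: measurableT_comp => //; exact: measurable_funM.
have [BG BG0 hBG] := cc_bnd cd cG.
pose bm := BG * expR (`|z| * (`|c| + `|d|)).
have hbm x : c <= x -> x <= d -> n1 (G x * (expR (- (z * x)))%:C) <= bm.
  move=> cx xd; rewrite n1Mr ger0_norm ?expR_ge0//; apply: ler_pM; rewrite ?n1_ge0 ?expR_ge0 ?hBG// ler_expR.
  apply: le_trans (ler_norm _) _; rewrite normrN normrM ler_wpM2l// ler_norml.
  have h1 := ler_norm d; have h2 := ler_norm (- c); move: h2; rewrite normrN => h2.
  by apply/andP; split; [have := normr_ge0 d|have := normr_ge0 c]; lra.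
have Lm x : c <= x -> x <= d -> cL (fun t : RT => q t * (Ez z (x - t) * ii c x t)%:C * m t).
  move=> cx xd.
  have := cm_bndL (cL_ii c x (Lz x)) cm1 (fun t ct tx => hbm t ct (le_trans tx xd)).
  congr cL; apply/funext => t; have [[-> ct tx]|[-> _]] := ii_case c x t; last by rewrite !(mulr0, mul0r).
  by rewrite rC1 !mulr1 /m (FG t ct (le_trans tx xd)).
pose BM := B * expR (`|z| * (- (2 * c) + 2 * d)).
have hBM x : c <= x -> x <= d -> n1 (Mk A x z) <= BM.
  move=> cx xd; have x0 : 0 <= - (2 * c) + 2 * x by rewrite addrC -mulrBr mulr_ge0// subr_ge0.
  by apply: le_trans (hB x z x0) _; rewrite ler_wpM2l// ler_expR ler_wpM2l// lerD2l ler_pM2l.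
have LM x : c <= x -> x <= d -> cL (fun t : RT => q t * (Ez z (x - t) * ii c x t)%:C * Mk A t z).
  move=> cx xd.
  have := cm_bndL (cL_ii c x (Lz x)) mM (fun t ct tx => hBM t ct (le_trans tx xd)).
  congr cL; apply/funext => t; have [[-> ct tx]|[-> _]] := ii_case c x t; last by rewrite !(mulr0, mul0r).
  by rewrite rC1 !mulr1.
pose D (x : R) : C := m x - m c * Mk A x z.
have eD x : c <= x -> x <= d -> D x = cI (fun t : RT => q t * (Ez z (x - t) * ii c x t)%:C * D t).
  move=> cx xd; rewrite /D {1}/m hm// eM// -/(m c) mulrDr mulr1 opprD addrACA subrr add0r.
  rewrite -(cIZ _ (LM x cx xd)) -(cIB (Lm x cx xd) (cLZ _ (LM x cx xd))); congr cI; apply/funext => t.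
  by rewrite /m; move: (q t) (_%:C) (u t * _) (u c * _) (Mk A t z) => a1 a2 a3 a4 a5; ring.
have LD x : c <= x -> x <= d -> cL (fun t : RT => q t * (Ez z (x - t) * ii c x t)%:C * D t).
  move=> cx xd; have := cLB (Lm x cx xd) (cLZ (m c) (LM x cx xd)); congr cL; apply/funext => t.
  by rewrite /D; move: (q t) (_%:C) (m t) (m c) (Mk A t z) => a1 a2 a3 a4 a5; ring.
(* This weight absorbs the growth of [Ez] for negative [z], since the exponents over [c, t] and
   [t, x] add up to that over [c, x]. *)
pose w x := expR ((`|z| - z) * (x - c)).
have w1 x : c <= x -> 1 <= w x.
  by move=> cx; rewrite -[leLHS]expR0 ler_expR mulr_ge0 ?subr_ge0// ler_norm.
pose K0 := bm + n1 (m c) * BM.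
have K00 : 0 <= K0 by rewrite addr_ge0 ?mulr_ge0 ?n1_ge0 ?expR_ge0.
have bD x : c <= x -> x <= d -> n1 (D x) <= K0 * w x.
  move=> cx xd; apply: (@le_trans _ _ K0); last by rewrite ler_peMr// w1.
  apply: le_trans (n1B _ _) _; apply: lerD; first by rewrite /m (FG _ cx xd); exact: hbm.
  by apply: le_trans (n1M _ _) _; rewrite ler_wpM2l ?n1_ge0// hBM.
have step K : 0 <= K -> (forall x, c <= x -> x <= d -> n1 (D x) <= K * w x) ->
   forall x, c <= x -> x <= d -> n1 (D x) <= (0 + K / 2) * w x.
  move=> KK hK x cx xd; rewrite add0r eD//.
  have N0 : 0 <= rI (fun x => n1 (q x)) by apply: rI_ge0 => t; exact: n1_ge0.
  apply: (@le_trans _ _ (rI (fun t => (K * w x / (2 * `|z|)) * n1 (q t)))).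
    apply: (cI_le (cL_cm (LD x cx xd))); first by apply: L1Z; exact: cL_n1.
    move=> t; apply: le_trans (n1M _ _) _; rewrite n1Mr.
    have [[-> ct tx]|[-> _]] := ii_case c x t; last first.
      by rewrite mulr0 normr0 mulr0 mul0r !mulr_ge0 ?n1_ge0 ?invr_ge0 ?expR_ge0 ?mulr_ge0.
    rewrite mulr1 -[leLHS]mulrA [leRHS]mulrC; apply: ler_wpM2l; first exact: n1_ge0.
    have td : t <= d := le_trans tx xd.
    apply: le_trans (ler_pM _ (n1_ge0 _) (Ez_bnd z0 _) (hK t ct td)) _; rewrite ?subr_ge0//.
    rewrite mulrAC ler_pM2r ?invr_gt0 ?mulr_gt0 ?normr_gt0// mulrCA ler_wpM2l//.
    by rewrite /w -expRD ler_expR; have -> : (`|z| - z) * (x - t) + (`|z| - z) * (t - c) = (`|z| - z) * (x - c) by ring.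
  rewrite rIZ; last exact: cL_n1.
  have -> : K * w x / (2 * `|z|) * rI (fun x => n1 (q x)) = (K / 2 * w x) * (rI (fun x => n1 (q x)) / `|z|).
    by field; rewrite normr_eq0.
  rewrite ler_piMr ?mulr_ge0 ?expR_ge0//.
  by rewrite ler_pdivrMr ?normr_gt0// mul1r.
move=> x cx xd.
have := weight_contr (lexx 0) K00 bD step cx xd; rewrite mulr0 mul0r => /n1_eq0 /eqP; rewrite subr_eq0 /m => /eqP e.
have E1 : (expR (- (z * x)))%:C * (expR (z * x))%:C = 1 :> C by rewrite rCM -expRD addrC subrr expR0.
rewrite -[u x]mulr1 -E1 mulrA e.
have -> : expR (z * (x - c)) = expR (- (z * c)) * expR (z * x) by rewrite -expRD; congr expR; ring.
rewrite -rCM; move: (Mk A x z) (u c) (expR (z * x))%:C (expR _)%:C => a1 a2 a3 a4; ring.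
Qed.

End Uniqueness.

(** * Potentials integrated against solutions *)

Section KernelTransform.
Context {R : realType}.
Notation RT := (measurableTypeR R).
Notation C := R[i].
Notation re := (@complex.Re R).
Notation im := (@complex.Im R).
Implicit Types (x y t s T : R).

(** For a step at p <= T the truncation loses exactly the tail e^{-yT} / y; for p > T it loses all
    of e^{-yp} / y, which is smaller. *)
Lemma exp_window (y p T : R) : 0 < y -> 0 <= p ->
  let E := rI (fun t => expR (- y * t) * ii 0 T t * ((p <= t)%R%:R)) in
  L1 (fun t => expR (- y * t) * ii 0 T t * ((p <= t)%R%:R)) /\
  `|expR (- y * p) / y - E| <= expR (- y * T) / y.
Proof.
move=> y0 p0 /=; have e : (fun t => expR (- y * t) * ii 0 T t * ((p <= t)%R%:R)) = (fun t => expR (- y * t) * ii p T t).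
  apply/funext => t; rewrite -mulrA; congr (_ * _); rewrite /ii -natrM mulnb; congr (nat_of_bool _)%:R.
  by apply/idP/idP => [/andP[/andP[_ ->] ->]//|/andP[h ->]]; rewrite h (le_trans p0 h).
rewrite e; split; first exact: L1_exp.
have y1 : y != 0 by rewrite gt_eqF.
have [pT|pT] := leP p T.
  rewrite (rI_ii_exp y1 pT) -mulrBl opprB addrC subrK ger0_norm// divr_ge0 ?expR_ge0//; exact: ltW.
have -> : rI (fun t => expR (- y * t) * ii p T t) = 0.
  transitivity (rI (fun=> 0 : R)); last exact: rI_0.
  congr rI; apply/funext => t; have [[_ h1 h2]|[-> _]] := ii_case p T t; last by rewrite mulr0.
  by have := lt_le_trans (lt_le_trans pT h1) h2; rewrite ltxx.
rewrite subr0 ger0_norm ?divr_ge0 ?expR_ge0//; last exact: ltW.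
by rewrite ler_pM2r ?invr_gt0// ler_expR ler_nM2l ?oppr_lt0// ltW.
Qed.

(* [kap S A x] has Laplace transform [e^{-(S+2x)y} (1 + \int A x s e^{ys} ds) / y],
   so that [kk v c d S A] represents [e^{-Sy} / y * Fv v c d A y]. *)
Definition kap S (A : RT -> RT -> C) (x t : R) : C :=
  ((S + 2 * x <= t)%R%:R : R)%:C + cI (fun s : RT => A x s * ((S + 2 * x - s <= t)%R%:R : R)%:C).

Definition kk (v : RT -> C) c d S A (t : RT) : C := cI (fun x : RT => v x * (ii c d x)%:C * kap S A x t).

Definition Fv (v : RT -> C) c d A (y : R) : C :=
  cI (fun x : RT => v x * (ii c d x * expR (- (2 * y * x)))%:C * Mk A x (- y)).

Section kap.
Variables (c d S : R) (A : RT -> RT -> C) (v : RT -> C).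
Hypotheses (hA : bk c d S A) (Sc : 0 <= S + 2 * c) (Lv : cL v).

Lemma bk_bnd_wide : exists2 B, 0 <= B & forall x s, n1 (A x s) <= B * ii 0 (S + 2 * d) s.
Proof.
have [B B0 hB] := bk_bnd hA; exists B => // x s; apply: le_trans (hB x s) _.
have [[-> cx xd]|[-> _]] := ii_case c d x; last by rewrite mulr0 mulr_ge0// ii_ge0.
rewrite mulr1 ler_wpM2l//; have [[-> s0 sS]|[-> _]] := ii_case 0 (S + 2 * x) s; last exact: ii_ge0.
by rewrite ii_in//; apply: le_trans sS _; rewrite lerD2l ler_pM2l.
Qed.

Lemma bk_cm : cm (fun p : RT * RT => A p.1 p.2). Proof. by case: hA. Qed.

Lemma bk_cL x : cL (A x).
Proof.
have [B B0 hB] := bk_bnd_wide; apply: (cL_le (g := fun s => B * ii 0 (S + 2 * d) s)).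
- exact: (cm_comp bk_cm (measurable_pair1 (x : RT))).
- by apply: L1Z; exact: L1_ii1.
- exact: hB.
Qed.

Lemma kapA_L x t : cL (fun s : RT => A x s * ((S + 2 * x - s <= t)%R%:R : R)%:C).
Proof.
apply: (cLM (K := 1) (bk_cL x)); last by move=> s; rewrite n1_r; exact: bool_norm1.
by apply: cm_r; apply: meas_ler => //; exact: measurable_funB.
Qed.

Lemma kap_bnd : exists2 B, 0 <= B & forall x t, n1 (kap S A x t) <= B.
Proof.
have [B B0 hB] := bk_bnd_wide; exists (1 + rI (fun s => B * ii 0 (S + 2 * d) s)).
  by rewrite addr_ge0// rI_ge0// => s; rewrite mulr_ge0// ii_ge0.
move=> x t; apply: le_trans (n1D _ _) _; apply: lerD; first by rewrite n1_r; exact: bool_norm1.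
apply: cI_le; [exact: cL_cm (kapA_L x t)|by apply: L1Z; exact: L1_ii1|].
by move=> s; rewrite n1Mr; apply: le_trans _ (hB x s); rewrite ler_piMr ?n1_ge0//; exact: bool_norm1.
Qed.

Lemma kap_cm : cm (fun p : RT * RT => kap S A p.1 p.2).
Proof.
have mS : measurable_fun setT (fun p : RT * RT => S + 2 * p.1 : R).
  by apply: measurable_funD => //; exact: measurable_funM.
apply: cmD; first by apply: cm_r; exact: meas_ler.
have [B B0 hB] := bk_bnd_wide.
apply: (@cI_param _ _ _ (fun (p : RT * RT) s => A p.1 s * ((S + 2 * p.1 - s <= p.2)%R%:R : R)%:C) (fun s => B * ii 0 (S + 2 * d) s)).
- apply: cmM.
    have h : measurable_fun setT (fun p : (RT * RT) * RT => (p.1.1, p.2)).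
      by apply: measurable_fun_pair => //; exact: measurableT_comp.
    exact: (cm_comp bk_cm h).
  apply: cm_r; apply: meas_ler; last exact: measurableT_comp.
  by apply: measurable_funB => //; exact: (measurableT_comp mS measurable_fst).
- by apply: L1Z; exact: L1_ii1.
- by move=> p s; rewrite n1Mr; apply: le_trans _ (hB p.1 s); rewrite ler_piMr ?n1_ge0//; exact: bool_norm1.
Qed.

(** The support of [A x] ends at [S + 2 * x], so every jump time S + 2x - s is nonnegative. *)
Lemma kap_neg x t : c <= x -> t < 0 -> kap S A x t = 0.
Proof.
move=> cx t0.
have x0 : 0 <= S + 2 * x by apply: le_trans Sc _; rewrite lerD2l ler_pM2l.
rewrite /kap (_ : (S + 2 * x <= t)%R = false) ?add0r; last by apply/negbTE; rewrite -ltNge (lt_le_trans t0).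
transitivity (cI (fun=> 0 : C)); last exact: cI0.
congr cI; apply/funext => s; have [/andP[s0 sS]|h] := boolP (0 <= s <= S + 2 * x); last by rewrite (bk_zero hA h) mul0r.
rewrite (_ : (S + 2 * x - s <= t)%R = false) ?mulr0//.
by apply/negbTE; rewrite -ltNge (lt_le_trans t0)// subr_ge0.
Qed.

Lemma kk_L t : cL (fun x : RT => v x * (ii c d x)%:C * kap S A x t).
Proof.
have [B B0 hB] := kap_bnd.
apply: (cLM (K := B) (cL_ii c d Lv)); last by move=> x; exact: hB.
exact: (cm_comp kap_cm (measurable_pair2 (t : RT))).
Qed.

Lemma kk_bnd_pt : exists2 B, 0 <= B & forall x t, n1 (v x * (ii c d x)%:C * kap S A x t) <= B * n1 (v x).
Proof.
have [B B0 hB] := kap_bnd; exists B => // x t.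
apply: le_trans (n1M _ _) _; rewrite mulrC; apply: ler_pM; rewrite ?n1_ge0//.
by rewrite n1Mr ler_piMr ?n1_ge0// ger0_norm ?ii_ge0 ?ii_le1.
Qed.

Lemma kk_cm2 : cm (fun p : RT * RT => v p.2 * (ii c d p.2)%:C * kap S A p.2 p.1).
Proof.
apply: cmM; first exact: (cm_comp (cL_cm (cL_ii c d Lv))).
have h : measurable_fun setT (fun p : RT * RT => (p.2, p.1)) by exact: measurable_fun_pair.
exact: (cm_comp kap_cm h).
Qed.

Lemma kk_nice : nice (kk v c d S A).
Proof.
have [B B0 hB] := kk_bnd_pt.
split.
- apply: (@cI_param _ _ _ (fun t x => v x * (ii c d x)%:C * kap S A x t) (fun x => B * n1 (v x))).
  + exact: kk_cm2.
  + by apply: L1Z; exact: cL_n1.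
  + by move=> t x; exact: hB.
- move=> t t0; transitivity (cI (fun=> 0 : C)); last exact: cI0.
  congr cI; apply/funext => x; have [[-> cx xd]|[-> _]] := ii_case c d x; last by rewrite mulr0 mul0r.
  by rewrite kap_neg// mulr0.
- exists (rI (fun x => B * n1 (v x))), 0; split=> //.
    by apply: rI_ge0 => x; rewrite mulr_ge0 ?n1_ge0.
  move=> t; rewrite mul0r expR0 mulr1; apply: (cI_le (cL_cm (kk_L t))) => [|x]; last exact: hB.
  by apply: L1Z; exact: cL_n1.
Qed.

Lemma ccaM (f g : R -> C) (a : R) : cca f a -> cca g a -> cca (fun t => f t * g t) a.
Proof.
move=> [f1 f2] [g1 g2]; split.
  rewrite (_ : (fun l => _) = (fun l => re (f l) * re (g l) - im (f l) * im (g l))); last by apply/funext => l; rewrite reM.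
  by rewrite reM; apply: cvgB; exact: cvgM.
rewrite (_ : (fun l => _) = (fun l => re (f l) * im (g l) + im (f l) * re (g l))); last by apply/funext => l; rewrite imM.
by rewrite imM; apply: cvgD; exact: cvgM.
Qed.

Lemma ccaD (f g : R -> C) (a : R) : cca f a -> cca g a -> cca (fun t => f t + g t) a.
Proof.
move=> [f1 f2] [g1 g2]; split.
  rewrite (_ : (fun l => _) = (fun l => re (f l) + re (g l))); last by apply/funext => l; rewrite reD.
  by rewrite reD; exact: cvgD.
rewrite (_ : (fun l => _) = (fun l => im (f l) + im (g l))); last by apply/funext => l; rewrite imD.
by rewrite imD; exact: cvgD.
Qed.

Lemma cca_r (f : R -> R) (a : R) : f l @[l --> a] --> f a -> cca (fun t => (f t)%:C) a.
Proof. by move=> h; split; [exact: h|exact: cvg_cst]. Qed.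

Lemma cca_cst k (a : R) : cca (fun _ => k) a.
Proof. by split; exact: cvg_cst. Qed.

Lemma cc_cca (f : R -> C) (a : R) : cc f -> cca f a.
Proof. by move=> [h1 h2]; split; [exact: h1|exact: h2]. Qed.

Lemma kapA_cc x : cc (fun t => cI (fun s : RT => A x s * ((S + 2 * x - s <= t)%R%:R : R)%:C)).
Proof.
apply: (@cI_cont_ae _ (fun t s => A x s * ((S + 2 * x - s <= t)%R%:R : R)%:C) (fun s => n1 (A x s))).
- by move=> t; exact: cL_cm (kapA_L x t).
- exact: cL_n1 (bk_cL x).
- move=> a; apply: (ae_imp (ae_neq (S + 2 * x - a))) => s sa.
  apply: ccaM; first exact: cca_cst.
  apply: cca_r; apply: cvg_ler => e; apply: sa; rewrite -e; ring.
- by move=> t s; rewrite n1Mr ler_piMr ?n1_ge0//; exact: bool_norm1.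
Qed.

(** The step functions in [kap] jump in [t], but at times moving with [x], so integration in [x]
    smooths them. Continuity is what [lerch_rep] and [titchmarsh] require. *)
Lemma kk_cc : cc (kk v c d S A).
Proof.
have [B B0 hB] := kk_bnd_pt.
apply: (@cI_cont_ae _ (fun t x => v x * (ii c d x)%:C * kap S A x t) (fun x => B * n1 (v x))).
- by move=> t; exact: cL_cm (kk_L t).
- by apply: L1Z; exact: cL_n1.
- move=> a; apply: (ae_imp (ae_neq ((a - S) / 2))) => x xa.
  apply: ccaM; first exact: cca_cst.
  apply: ccaD; last by apply: cc_cca; exact: kapA_cc.
  apply: cca_r; apply: cvg_ler => e; apply: xa; by rewrite -e; field.
- by move=> t x; exact: hB.
Qed.

Definition lamE T y x : C :=
  (rI (fun t => expR (- y * t) * ii 0 T t * ((S + 2 * x <= t)%R%:R)))%:C +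
  cI (fun s : RT => A x s * (rI (fun t => expR (- y * t) * ii 0 T t * ((S + 2 * x - s <= t)%R%:R)))%:C).

Lemma kap_LT T y x : cI (fun t : RT => kap S A x t * (expR (- y * t) * ii 0 T t)%:C) = lamE T y x.
Proof.
have e0 t : 0 <= expR (- y * t) * ii 0 T t by rewrite mulr_ge0 ?expR_ge0 ?ii_ge0.
have Lp p : L1 (fun t => expR (- y * t) * ii 0 T t * ((p <= t)%R%:R)).
  by apply: (L1_mul_bnd (C := 1) (L1_exp (- y) 0 T)) => [|t]; [exact: meas_ler|exact: bool_norm1].
pose H (t s : R) : C := A x s * (expR (- y * t) * ii 0 T t * ((S + 2 * x - s <= t)%R%:R))%:C.
have mH : cm (fun p : RT * RT => H p.1 p.2).
  apply: cmM; first exact: (cm_comp (cm_comp bk_cm (measurable_pair1 (x : RT))) measurable_snd).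
  apply: cm_r; apply: measurable_funM.
    apply: measurable_funM; last exact: meas_ii.
    by apply: meas_expR; exact: measurable_funM.
  by apply: meas_ler => //; exact: measurable_funB.
have [B B0 hB] := bk_bnd_wide.
have bH t s : n1 (H t s) <= (expR (- y * t) * ii 0 T t) * (B * ii 0 (S + 2 * d) s).
  rewrite n1Mr mulrC; apply: ler_pM; rewrite ?n1_ge0 ?hB//.
  by rewrite normrM (ger0_norm (e0 t)) ler_piMr//; exact: bool_norm1.
have LB : L1 (fun s => B * ii 0 (S + 2 * d) s) by apply: L1Z; exact: L1_ii1.
have eH t : cI (H t) = cI (fun s : RT => A x s * ((S + 2 * x - s <= t)%R%:R : R)%:C) * (expR (- y * t) * ii 0 T t)%:C.
  rewrite -(cIZr _ (kapA_L x t)); congr cI; apply/funext => s; rewrite /H -[RHS]mulrA rCM; congr (_ * _%:C).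
  by rewrite mulrC.
have LH : cL (fun t : RT => cI (H t)).
  apply: (cL_le (g := fun t => rI (fun s => B * ii 0 (S + 2 * d) s) * (expR (- y * t) * ii 0 T t))).
  - rewrite (_ : (fun t => _) = (fun t : RT => cI (fun s : RT => A x s * ((S + 2 * x - s <= t)%R%:R : R)%:C) * (expR (- y * t) * ii 0 T t)%:C)); last by apply/funext => t; exact: eH.
    apply: cmM; last exact: cm_ker.
    exact: cc_cm (kapA_cc x).
  - by apply: L1Z; exact: L1_exp.
  - move=> t; rewrite mulrC -(rIZ _ LB); apply: cI_le; [|by apply: L1Z|exact: bH].
    exact: (cm_comp mH (measurable_pair1 (t : RT))).
transitivity (cI (fun t : RT => (expR (- y * t) * ii 0 T t * ((S + 2 * x <= t)%R%:R))%:C + cI (H t))).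
  by congr cI; apply/funext => t; rewrite /kap mulrDl eH rCM; congr (_%:C + _); rewrite mulrC.
rewrite (cID (cL_r (Lp _)) LH) cI_r; congr (_ + _).
rewrite (@cI_swap R H _ _ mH (L1_exp (- y) 0 T) LB bH e0); congr cI; apply/funext => s.
rewrite /H cIZ; last by apply: cL_r; exact: Lp.
by rewrite cI_r.
Qed.

Lemma kk_LT T y : LT T (kk v c d S A) y = cI (fun x : RT => v x * (ii c d x)%:C * lamE T y x).
Proof.
have e0 t : 0 <= expR (- y * t) * ii 0 T t by rewrite mulr_ge0 ?expR_ge0 ?ii_ge0.
have [B B0 hB] := kk_bnd_pt.
pose H (t x : R) : C := v x * (ii c d x)%:C * kap S A x t * (expR (- y * t) * ii 0 T t)%:C.
have mH : cm (fun p : RT * RT => H p.1 p.2).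
  by apply: cmM; [exact: kk_cm2|exact: (cm_comp (cm_ker y T))].
have bH t x : n1 (H t x) <= (expR (- y * t) * ii 0 T t) * (B * n1 (v x)).
  by rewrite n1Mr mulrC (ger0_norm (e0 t)) ler_wpM2l.
have LB : L1 (fun x => B * n1 (v x)) by apply: L1Z; exact: cL_n1.
transitivity (cI (fun t : RT => cI (H t))).
  by congr cI; apply/funext => t; rewrite /H -(cIZr _ (kk_L t)).
rewrite (@cI_swap R H _ _ mH (L1_exp (- y) 0 T) LB bH e0); congr cI; apply/funext => x.
rewrite -kap_LT -cIZ; first by congr cI; apply/funext => t; rewrite /H !mulrA.
have [Bk Bk0 hBk] := kap_bnd.
apply: (cL_le (g := fun t => Bk * (expR (- y * t) * ii 0 T t))).
- by apply: cmM; [exact: (cm_comp kap_cm (measurable_pair1 (x : RT)))|exact: cm_ker].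
- by apply: L1Z; exact: L1_exp.
- by move=> t; rewrite n1Mr (ger0_norm (e0 t)) ler_wpM2r.
Qed.

End kap.
End KernelTransform.

Section KernelRep.
Context {R : realType}.
Notation RT := (measurableTypeR R).
Notation C := R[i].
Implicit Types (x y t s T : R).

Section kap.
Variables (c d S : R) (A : RT -> RT -> C) (v : RT -> C).
Hypotheses (hA : bk c d S A) (Sc : 0 <= S + 2 * c) (Lv : cL v).

(** Both terms superpose steps at nonnegative times, each with a truncation error of at most e^{-yT}
    / y by [exp_window]; the kernel has bounded mass, so the errors sum uniformly in [x]. *)
Lemma lamE_close : exists2 B, 0 <= B & forall T x y, c <= x -> 0 < y ->
  n1 ((expR (- y * (S + 2 * x)) / y)%:C * Mk A x (- y) - lamE S A T y x) <= B * (expR (- y * T) / y).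
Proof.
have [B B0 hB] := bk_bnd_wide hA; exists (1 + rI (fun s => B * ii 0 (S + 2 * d) s)).
  by rewrite addr_ge0// rI_ge0// => s; rewrite mulr_ge0// ii_ge0.
move=> T x y cx y0.
have x0 : 0 <= S + 2 * x by apply: le_trans Sc _; rewrite lerD2l ler_pM2l.
pose E p := rI (fun t => expR (- y * t) * ii 0 T t * ((p <= t)%R%:R)).
have hE p : 0 <= p -> `|expR (- y * p) / y - E p| <= expR (- y * T) / y.
  by move=> p0; exact: (exp_window T y0 p0).2.
have LB : L1 (fun s => B * ii 0 (S + 2 * d) s) by apply: L1Z; exact: L1_ii1.
have ET0 : 0 <= expR (- y * T) / y by rewrite divr_ge0 ?expR_ge0// ltW.
pose G (s : RT) : C := A x s * (expR (- y * (S + 2 * x - s)) / y - E (S + 2 * x - s))%:C.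
have G0 s : n1 (G s) <= (expR (- y * T) / y) * (B * ii 0 (S + 2 * d) s).
  rewrite n1Mr mulrC; have [/andP[s0 sS]|h] := boolP (0 <= s <= S + 2 * x); last first.
    by rewrite (bk_zero hA h) n1_0 mulr0; apply: mulr_ge0 => //; rewrite mulr_ge0// ii_ge0.
  by apply: ler_pM; rewrite ?n1_ge0 ?hB ?hE// subr_ge0.
have mE : measurable_fun setT (fun s : RT => E (S + 2 * x - s) : R).
  apply: (@rI_param_meas _ _ _ (fun s t => expR (- y * t) * ii 0 T t * ((S + 2 * x - s <= t)%R%:R)) (fun t => expR (- y * t) * ii 0 T t)).
  - apply: measurable_funM; last by apply: meas_ler => //; exact: measurable_funB.
    apply: measurable_funM; last exact: meas_ii.
    by apply: meas_expR; exact: measurable_funM.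
  - exact: L1_exp.
  - move=> s t; rewrite normrM ger0_norm ?mulr_ge0 ?expR_ge0 ?ii_ge0// ler_piMr ?mulr_ge0 ?expR_ge0 ?ii_ge0//.
    exact: bool_norm1.
have mA : cm (A x : RT -> C) := cL_cm (bk_cL hA x).
have LG : cL G.
  apply: (cL_le _ (L1Z _ LB) G0).
  apply: cmM => //; apply: cm_r; apply: measurable_funB => //.
  apply: measurable_funM => //; apply: meas_expR; apply: measurable_funM => //; exact: measurable_funB.
have LA := bk_L hA x (- y).
have L2 : cL (fun s : RT => A x s * (E (S + 2 * x - s))%:C).
  apply: (cLM (K := rI (fun t => expR (- y * t) * ii 0 T t)) (bk_cL hA x)); first exact: cm_r.
  move=> s; rewrite n1_r ger0_norm; last by apply: rI_ge0 => t; rewrite !mulr_ge0 ?expR_ge0 ?ii_ge0.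
  apply: rI_le; [exact: (L1_mul_bnd (C := 1) (L1_exp _ _ _) (meas_ler _ _) (fun t => bool_norm1 _))|exact: L1_exp|].
  by move=> t; rewrite ler_piMr ?mulr_ge0 ?expR_ge0 ?ii_ge0//; exact: le_trans (ler_norm _) (bool_norm1 _).
have -> : (expR (- y * (S + 2 * x)) / y)%:C * Mk A x (- y) - lamE S A T y x =
  (expR (- y * (S + 2 * x)) / y - E (S + 2 * x))%:C + cI G.
  rewrite /Mk mulrDr mulr1 /lamE -/(E _) opprD addrACA rCB; congr (_ + _).
  rewrite -(cIZ _ LA) -(cIB (cLZ _ LA) L2); congr cI; apply/funext => s.
  rewrite /G rCB mulrBr; congr (_ - _); rewrite mulrCA rCM; congr (_ * _%:C).
  by rewrite mulrAC -expRD; congr (expR _ / _); ring.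
rewrite [leRHS]mulrDl mul1r; apply: le_trans (n1D _ _) _; apply: lerD; first by rewrite n1_r hE.
rewrite [leRHS]mulrC -(rIZ _ LB); apply: cI_le; [exact: cL_cm|exact: L1Z|exact: G0].
Qed.

Lemma Fv_L y : cL (fun x : RT => v x * (ii c d x * expR (- (2 * y * x)))%:C * Mk A x (- y)).
Proof.
have [B B0 hB] := Mk_bnd hA.
pose K := expR (`|y| * (`|S| + 2 * (`|c| + `|d|))).
have Kx (w : R) x : c <= x -> x <= d -> w <= `|y| * (`|S| + 2 * `|x|) -> expR w <= K.
  move=> cx xd h; rewrite ler_expR; apply: le_trans h _; rewrite ler_wpM2l// lerD2l ler_pM2l// ler_norml.
  have h1 := ler_norm d; have h2 := ler_norm (- c); move: h2; rewrite normrN => h2.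
  by apply/andP; split; [have := normr_ge0 d|have := normr_ge0 c]; lra.
pose g (x : RT) : C := (ii c d x * expR (- (2 * y * x)))%:C * Mk A x (- y).
have -> : (fun x : RT => v x * (ii c d x * expR (- (2 * y * x)))%:C * Mk A x (- y)) = (fun x : RT => v x * g x).
  by apply/funext => x; rewrite /g mulrA.
apply: (cLM (K := K * (B * K)) Lv).
  apply: cmM; last exact: Mk_cm hA _.
  apply: cm_r; apply: measurable_funM; first exact: meas_ii.
  by apply: meas_expR; apply: measurableT_comp => //; exact: measurable_funM.
move=> x; apply: le_trans (n1M _ _) _; rewrite n1_r.
have [[-> cx xd]|[-> _]] := ii_case c d x; last by rewrite mul0r normr0 mul0r !mulr_ge0 ?expR_ge0.
have x0 : 0 <= S + 2 * x by apply: le_trans Sc _; rewrite lerD2l ler_pM2l.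
rewrite mul1r ger0_norm ?expR_ge0//; apply: ler_pM; rewrite ?expR_ge0 ?n1_ge0//.
  apply: (Kx _ x) => //; apply: le_trans (ler_norm _) _.
  by rewrite normrN !normrM [`|2|]ger0_norm// -mulrA mulrCA ler_wpM2l// lerDr.
apply: le_trans (hB x _ x0) _; rewrite ler_wpM2l//; apply: (Kx _ x) => //.
rewrite normrN ler_wpM2l//; apply: lerD; first exact: ler_norm.
by rewrite ler_pM2l// ler_norm.
Qed.

Lemma kk_rep T : rep T (fun y => (expR (- S * y) / y)%:C * Fv v c d A y) (kk v c d S A).
Proof.
have [B B0 hB] := lamE_close.
have LN : L1 (fun x => n1 (v x)) := cL_n1 Lv.
pose K := B * rI (fun x => n1 (v x)).
have K0 : 0 <= K by rewrite mulr_ge0// rI_ge0// => x; exact: n1_ge0.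
move=> c' c'T; exists K, 1 => y y1.
have y0 : 0 < y by exact: lt_le_trans ltr01 y1.
apply: (@le_trans _ _ (K * (expR (- y * T) / y))); last first.
  rewrite ler_wpM2l//; apply: (@le_trans _ _ (expR (- y * T))).
    by rewrite ler_pdivrMr// ler_peMr// expR_ge0.
  by rewrite ler_expR !mulNr lerN2 mulrC ler_pM2l// ltW.
rewrite (kk_LT hA Lv).
pose H (x : RT) : C := v x * (ii c d x)%:C * ((expR (- y * (S + 2 * x)) / y)%:C * Mk A x (- y)).
have eH : (fun x : RT => (expR (- S * y) / y)%:C * (v x * (ii c d x * expR (- (2 * y * x)))%:C * Mk A x (- y))) = H.
  apply/funext => x; rewrite /H -!rCM.
  have -> : expR (- y * (S + 2 * x)) = expR (- S * y) * expR (- (2 * y * x)) by rewrite -expRD; congr expR; ring.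
  rewrite -!rCM; move: (v x) (Mk _ _ _) (_%:C) (_%:C) (_%:C) (_%:C) => a1 a2 a3 a4 a5 a6; ring.
have LH : cL H by rewrite -eH; apply: cLZ; exact: Fv_L.
have e1 : (expR (- S * y) / y)%:C * Fv v c d A y = cI H.
  by rewrite /Fv -(cIZ _ (Fv_L y)) eH.
have [Bk Bk0 hBk] := kap_bnd hA.
have LE : cL (fun x : RT => v x * (ii c d x)%:C * lamE S A T y x).
  have [E1 E2] := exp_window T y0 (lexx 0).
  apply: (cLM (K := Bk * rI (fun t => expR (- y * t) * ii 0 T t)) (cL_ii c d Lv)).
    have -> : lamE S A T y = (fun x : RT => cI (fun t : RT => kap S A x t * (expR (- y * t) * ii 0 T t)%:C)).
      by apply/funext => x; rewrite (kap_LT hA).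
    apply: (@cI_param _ _ _ (fun x t => kap S A x t * (expR (- y * t) * ii 0 T t)%:C) (fun t => Bk * (expR (- y * t) * ii 0 T t))).
    - by apply: cmM; [exact: (kap_cm hA)|exact: (cm_comp (cm_ker y T))].
    - by apply: L1Z; exact: L1_exp.
    - by move=> x t; rewrite n1Mr ger0_norm ?mulr_ge0 ?expR_ge0 ?ii_ge0// ler_wpM2r ?mulr_ge0 ?expR_ge0 ?ii_ge0.
  move=> x; rewrite -(kap_LT hA) -(rIZ _ (L1_exp _ _ _)); apply: cI_le.
  - by apply: cmM; [exact: (cm_comp (kap_cm hA) (measurable_pair1 (x : RT)))|exact: cm_ker].
  - by apply: L1Z; exact: L1_exp.
  - by move=> t; rewrite n1Mr ger0_norm ?mulr_ge0 ?expR_ge0 ?ii_ge0// ler_wpM2r ?mulr_ge0 ?expR_ge0 ?ii_ge0.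
rewrite e1 -(cIB LH LE) /K mulrAC -(rIZ _ LN).
apply: cI_le; [exact: cL_cm (cLB LH LE)|exact: L1Z|].
move=> x; rewrite /H -mulrBr; apply: le_trans (n1M _ _) _; rewrite n1Mr mulrC.
have [[-> cx xd]|[-> _]] := ii_case c d x; last first.
  by rewrite normr0 !mulr0 !mulr_ge0 ?n1_ge0 ?expR_ge0 ?invr_ge0 ?(ltW y0).
rewrite normr1 mulr1 ler_wpM2r ?n1_ge0//; exact: hB.
Qed.
End kap.
End KernelRep.

(** * A potential with a rapidly decaying transform vanishes *)

Section Uniqueness.
Context {R : realType}.
Notation mu := (@lebesgue_measure R).
Notation RT := (measurableTypeR R).
Notation C := R[i].
Notation re := (@complex.Re R).
Notation im := (@complex.Im R).
Implicit Types (x y t s T : R).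

Lemma decay_scale (F : R -> C) (S c : R) : decay F c ->
  decay (fun y => (expR (- S * y) / y)%:C * F y) (S + c).
Proof.
move=> h; have := decayM (decayM (@decay_ex R S) (@decay_inv R)) h; rewrite addr0.
by apply: (decay_near (Y0 := 0)) => y _; rewrite rCM.
Qed.

Lemma rI_le_ae (f g : R -> R) : L1 f -> L1 g -> {ae mu, forall x, f x <= g x} -> rI f <= rI g.
Proof.
move=> Lf Lg fg; rewrite -subr_ge0 -rIB//.
have L := L1B Lg Lf.
have -> : rI (fun x => g x - f x) = rI (fun x => `|g x - f x|).
  apply: rI_ae => //; first exact: L1_norm.
  by apply: (ae_imp fg) => x h; rewrite ger0_norm// subr_ge0.
by apply: rI_ge0 => x.
Qed.

Lemma window_bnd (p q : R) : p <= q ->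
  L1 (fun s => `|(s < q)%R%:R - (s < p)%R%:R : R|) /\
  rI (fun s => `|(s < q)%R%:R - (s < p)%R%:R : R|) <= q - p.
Proof.
move=> pq; have H s : `|(s < q)%R%:R - (s < p)%R%:R : R| <= ii p q s.
  rewrite /ii; case: (ltP s q) => h1; case: (ltP s p) => h2; rewrite ?subrr ?subr0 ?normr0 ?normr1 ?(ltW h1) ?h2//=.
  by have := lt_le_trans (lt_le_trans h2 pq) h1; rewrite ltxx.
have L : L1 (fun s => `|(s < q)%R%:R - (s < p)%R%:R : R|).
  apply: (L1_le _ (L1_ii1 p q)) => [|x]; last by rewrite normr_id.
  apply: measurableT_comp => //.
  have m (r : R) : measurable_fun setT (fun s : RT => (s < r)%R%:R : R).
    rewrite (_ : (fun s => _) = (fun s : RT => 1 - (r <= s)%R%:R)); last first.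
      by apply/funext => s; rewrite ltNge; case: (_ <= _); rewrite ?subrr ?subr0.
    by apply: measurable_funB => //; exact: meas_ler.
  by apply: measurable_funB.
split=> //; rewrite -(rI_itv pq); apply: rI_le => //; exact: L1_ii1.
Qed.

Lemma window_lipschitz (B t1 t2 x : R) : 0 <= B -> t1 <= t2 ->
  B * (2 * (x - t1) - 2 * (x - t2)) <= (2 * B + 1) * (t2 - t1).
Proof.
move=> B0 h; have -> : B * (2 * (x - t1) - 2 * (x - t2)) = 2 * B * (t2 - t1) by ring.
by rewrite ler_wpM2r ?subr_ge0// lerDl.
Qed.

Lemma absorb_half (B i l : R) : i <= 2 * (B * i) * l -> 0 <= i -> B * l <= 4^-1 -> i <= 0.
Proof.
move=> h1 h2 h3; have : 2 * (B * i) * l <= 2^-1 * i.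
  by rewrite (_ : 2 * (B * i) * l = 2 * (B * l) * i) ?ler_wpM2r//; [lra|ring].
lra.
Qed.

Section U.
Variables (c d S : R) (A : RT -> RT -> C) (v : RT -> C).
Hypotheses (hA : bk c d S A) (Sc : 0 <= S + 2 * c) (cd : c <= d) (Lv : cL v).
Hypothesis hF : decay (Fv v c d A) (2 * d).

(** The part of kap(S + 2d) - kap(S + 2 tau) that comes from the kernel; the other part is the
    indicator of x > tau. *)
Let beta (tau x : R) : C := cI (fun s : RT => A x s * ((s < 2 * (x - tau))%R%:R : R)%:C).

Let Ab_L tau x : cL (fun s : RT => A x s * ((s < 2 * (x - tau))%R%:R : R)%:C).
Proof.
apply: (cLM (K := 1) (bk_cL hA x)); last by move=> s; rewrite n1_r; exact: bool_norm1.
apply: cm_r; rewrite (_ : (fun s => _) = (fun s : RT => 1 - (2 * (x - tau) <= s)%R%:R)); last first.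
  by apply/funext => s; rewrite ltNge; case: (_ <= _); rewrite ?subrr ?subr0.
by apply: measurable_funB => //; exact: meas_ler.
Qed.

Let beta0 tau x : x <= tau -> beta tau x = 0.
Proof.
move=> xt; transitivity (cI (fun=> 0 : C)); last exact: cI0.
congr cI; apply/funext => s; have [/andP[s0 sS]|h] := boolP (0 <= s <= S + 2 * x); last by rewrite (bk_zero hA h) mul0r.
rewrite (_ : (s < 2 * (x - tau))%R = false) ?mulr0//; apply/negbTE; rewrite -leNgt.
by apply: le_trans _ s0; rewrite pmulr_rle0// subr_le0.
Qed.

(** Moving [tau] shifts the end of a window in [s] at speed 2, and the kernel is bounded. *)
Let beta_lip : exists2 B, 0 < B & forall t1 t2 x, t1 <= t2 -> n1 (beta t1 x - beta t2 x) <= B * (t2 - t1).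
Proof.
have [B B0 hB] := bk_bnd_wide hA; exists (2 * B + 1); first by rewrite ltr_wpDl// mulr_ge0.
move=> t1 t2 x t12.
have q : 2 * (x - t2) <= 2 * (x - t1) by rewrite ler_pM2l// lerB.
have [Lw hw] := window_bnd q.
have L := cLB (Ab_L t1 x) (Ab_L t2 x).
rewrite /beta -(cIB (Ab_L t1 x) (Ab_L t2 x)).
apply: (@le_trans _ _ (B * (2 * (x - t1) - 2 * (x - t2)))).
  apply: le_trans _ (ler_wpM2l B0 hw); rewrite -(rIZ _ Lw).
  apply: (cI_le (cL_cm L)); first exact: L1Z.
  move=> s; rewrite -mulrBr -rCB n1Mr ler_wpM2r//.
  by apply: le_trans (hB x s) _; rewrite ler_piMr// ii_le1.
exact: window_lipschitz.
Qed.

(** By [hF] the transform represented by [kk] decays at rate S + 2d, so Lerch's theorem applies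
    strictly below that time; the endpoint, used in [main_id], follows by continuity. *)
Let kk0 t : t <= S + 2 * d -> kk v c d S A t = 0.
Proof.
have hT : 0 <= S + 2 * d by apply: le_trans Sc _; rewrite lerD2l ler_pM2l.
have H := lerch_rep (kk_nice hA Sc Lv) (kk_cc hA Lv) (kk_rep hA Sc Lv (T := S + 2 * d)) (decay_scale (S := S) hF) (lexx _).
rewrite le_eqVlt => /predU1P[->|/H//].
have [c1 c2] := kk_cc hA Lv.
have Z (f : R -> R) : continuous f -> (forall t, t < S + 2 * d -> f t = 0) -> f (S + 2 * d) = 0.
  move=> cf f0; have := cvg_at_left_filter (cf (S + 2 * d)) => h.
  apply: (cvg_unique _ h); first exact: norm_hausdorff.
  apply: cvg_near_cst; near=> s; apply: f0; near: s; exact: nbhs_left_lt.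
by apply: Ceq; [exact: (Z _ c1 (fun s hs => congr1 re (H s hs)))|exact: (Z _ c2 (fun s hs => congr1 im (H s hs)))].
Unshelve. all: by end_near. Qed.

Let gtL tau : cL (fun x : RT => v x * (ii c d x)%:C * ((tau < x)%R%:R : R)%:C).
Proof.
apply: (cLM (K := 1) (cL_ii c d Lv)); last by move=> s; rewrite n1_r; exact: bool_norm1.
apply: cm_r; rewrite (_ : (fun s => _) = (fun s : RT => 1 - (s <= tau)%R%:R)); last first.
  by apply/funext => s; rewrite ltNge; case: (_ <= _); rewrite ?subrr ?subr0.
by apply: measurable_funB => //; exact: meas_ler.
Qed.

(** Both [kk (S + 2 * d)] and [kk (S + 2 * tau)] vanish. Their difference expresses the integral of
    [v] over ]tau, d] through that of [v * beta tau], where [beta tau x] is 0 for x <= tau: an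
    equation of the second kind, solved from [d] downwards. *)
Let main_id tau : tau <= d ->
  cL (fun x : RT => v x * (ii c d x)%:C * beta tau x) /\
  cI (fun x : RT => v x * (ii c d x)%:C * ((tau < x)%R%:R : R)%:C) = - cI (fun x : RT => v x * (ii c d x)%:C * beta tau x).
Proof.
move=> td.
have L1' := kk_L hA Lv (S + 2 * d); have L2' := kk_L hA Lv (S + 2 * tau).
have E x : v x * (ii c d x)%:C * kap S A x (S + 2 * d) - v x * (ii c d x)%:C * kap S A x (S + 2 * tau) =
  v x * (ii c d x)%:C * ((tau < x)%R%:R : R)%:C + v x * (ii c d x)%:C * beta tau x.
  rewrite -mulrBr -mulrDr; have [[-> cx xd]|[-> _]] := ii_case c d x; last by rewrite !mulr0 !mul0r.
  congr (_ * _); rewrite /kap opprD addrACA -rCB; congr (_ + _).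
    congr (_%:C); rewrite !lerD2l !ler_pM2l// xd ltNge; case: (x <= tau); first by rewrite subrr.
    by rewrite subr0.
  rewrite -(cIB (kapA_L hA _ _) (kapA_L hA _ _)) /beta; congr cI; apply/funext => s.
  rewrite -mulrBr -rCB; have [/andP[s0 sS]|h] := boolP (0 <= s <= S + 2 * x); last by rewrite (bk_zero hA h) !mul0r.
  congr (_ * _%:C).
  have -> : (S + 2 * x - s <= S + 2 * d)%R = true.
    by rewrite -addrA lerD2l; apply: le_trans (_ : 2 * x <= _); rewrite ?gerBl// ler_pM2l.
  have -> : (S + 2 * x - s <= S + 2 * tau)%R = ~~ (s < 2 * (x - tau))%R.
    by rewrite -leNgt -addrA lerD2l lerBlDr -lerBlDl mulrBr.
  by case: (s < _); rewrite ?subr0 ?subrr.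
have Lb : cL (fun x : RT => v x * (ii c d x)%:C * beta tau x).
  have := cLB (cLB L1' L2') (gtL tau); congr cL; apply/funext => x.
  by rewrite E addrC addKr.
split=> //; apply/eqP; rewrite -subr_eq0 opprK -(cID (gtL tau) Lb).
have <- : cI (fun x : RT => v x * (ii c d x)%:C * kap S A x (S + 2 * d) - v x * (ii c d x)%:C * kap S A x (S + 2 * tau)) = 
  cI (fun x : RT => v x * (ii c d x)%:C * ((tau < x)%R%:R : R)%:C + v x * (ii c d x)%:C * beta tau x).
  by congr cI; apply/funext => x; exact: E.
rewrite (cIB L1' L2') -/(kk v c d S A (S + 2 * d)) -/(kk v c d S A (S + 2 * tau)) !kk0 ?subrr//.
by rewrite lerD2l ler_pM2l.
Qed.

Let nv_L p q : L1 (fun x => n1 (v x) * ii p q x).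
Proof. exact: L1_mul_ii (cL_n1 Lv). Qed.

Let I p := rI (fun x => n1 (v x) * ii p d x).

Let I_ge0 p : 0 <= I p.
Proof. by apply: rI_ge0 => x; rewrite mulr_ge0 ?n1_ge0 ?ii_ge0. Qed.

(** Differences of [main_id] in [tau]: the Lipschitz bound on [beta] makes the integral of [v] over
    a short interval proportional to its length, hence bounds [v] itself almost everywhere. *)
Let incr : exists2 B, 0 < B & forall p t1 t2, c <= p -> p <= t1 -> t1 <= t2 -> t2 <= d ->
  n1 (cI (fun x : RT => v x * (ii t1 t2 x)%:C)) <= B * I p * (t2 - t1).
Proof.
have [B B0 hB] := beta_lip; exists B => // p t1 t2 cp pt1 t12 t2d.
have t1d : t1 <= d := le_trans t12 t2d.
have ct1 : c <= t1 := le_trans cp pt1.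
have [L1' e1] := main_id t1d; have [L2' e2] := main_id t2d.
have -> : cI (fun x : RT => v x * (ii t1 t2 x)%:C) = cI (fun x : RT => v x * (ii c d x)%:C * ((t1 < x)%R%:R : R)%:C - v x * (ii c d x)%:C * ((t2 < x)%R%:R : R)%:C).
  apply: cI_ae; [exact: cL_ii|exact: cLB|].
  apply: (ae_imp (ae_neq t1)) => x xt1; rewrite -mulrBr -rCB -mulrA rCM; congr (_ * _%:C).
  have [[-> cx xd]|[e h]] := ii_case c d x.
    rewrite mul1r /ii; have -> : (t1 < x) = (t1 <= x) by rewrite lt_neqAle eq_sym; move/eqP: xt1 => ->.
    rewrite ltNge; case: (leP t1 x) => /= h1; case: (leP x t2) => h2; rewrite ?subr0 ?subrr//.
    by have := lt_le_trans (lt_trans h2 h1) t12; rewrite ltxx.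
  rewrite e mul0r; have [[_ h1 h2]|[-> _]] // := ii_case t1 t2 x.
  by move: h; rewrite (le_trans ct1 h1) (le_trans h2 t2d).
rewrite (cIB (gtL t1) (gtL t2)) e1 e2 opprK addrC -(cIB L2' L1') -n1N -cIN; last exact: cLB.
rewrite mulrAC -(rIZ _ (nv_L p d)).
apply: cI_le; [by apply: cL_cm; apply: cLN; exact: cLB|exact: L1Z|].
move=> x; rewrite n1N -mulrBr; apply: le_trans (n1M _ _) _; rewrite n1Mr.
have [[-> cx xd]|[-> _]] := ii_case c d x; last first.
  by rewrite normr0 mulr0 mul0r !mulr_ge0 ?n1_ge0 ?ii_ge0 ?subr_ge0 ?(ltW B0).
rewrite normr1 mulr1 mulrC; have [px|xp] := leP p x.
  by rewrite ii_in// mulr1 ler_wpM2r ?n1_ge0// -n1N opprB hB.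
have xt1 : x <= t1 by apply: le_trans (ltW xp) pt1.
rewrite !beta0 ?subrr ?n1_0 ?mul0r ?mulr_ge0 ?n1_ge0 ?ii_ge0 ?subr_ge0 ?(ltW B0)//.
exact: le_trans xt1 t12.
Qed.

Let step : exists2 del, 0 < del & forall tau p, c <= p -> p <= tau -> tau <= p + del -> tau <= d ->
  I tau = 0 -> I p = 0.
Proof.
(* The real and imaginary parts together give n1 v <= 2 B I(p) on [p, tau], so a length of at most 1
   / (4B) yields I(p) <= I(p) / 2. *)
have [B B0 hB] := incr; exists (4 * B)^-1; first by rewrite invr_gt0 mulr_gt0.
move=> tau p cp pt tp td It.
have key (f : R -> R) : L1 f -> (forall u w, p < u -> u <= w -> w < d -> `|rI (fun t => f t * ii u w t)| <= B * I p * (w - u)) ->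
  {ae mu, forall x, p < x -> x < d -> `|f x| <= B * I p} by exact: ae_bound.
have [Lr Li] := Lv.
have h u w : p < u -> u <= w -> w < d -> n1 (cI (fun x : RT => v x * (ii u w x)%:C)) <= B * I p * (w - u).
  by move=> pu uw wd; apply: (hB p) => //; exact: ltW.
have e1 u w : rI (fun t => re (v t) * ii u w t) = re (cI (fun x : RT => v x * (ii u w x)%:C)).
  by congr rI; apply/funext => t; rewrite /= reM im_r mulr0 subr0.
have e2 u w : rI (fun t => im (v t) * ii u w t) = im (cI (fun x : RT => v x * (ii u w x)%:C)).
  by congr rI; apply/funext => t; rewrite /= imM im_r mulr0 add0r.
have a1 : {ae mu, forall x, p < x -> x < d -> `|re (v x)| <= B * I p}.
  by apply: (key (re \o v) Lr) => u w pu uw wd; rewrite /= e1; apply: le_trans (n1_re _) (h u w pu uw wd).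
have a2 : {ae mu, forall x, p < x -> x < d -> `|im (v x)| <= B * I p}.
  by apply: (key (im \o v) Li) => u w pu uw wd; rewrite /= e2; apply: le_trans (n1_im _) (h u w pu uw wd).
have hle : I p <= rI (fun x => n1 (v x) * ii tau d x + 2 * (B * I p) * ii p tau x).
  apply: rI_le_ae; [exact: nv_L|by apply: L1D; [exact: nv_L|apply: L1Z; exact: L1_ii1]|].
  apply: (ae_imp2 (ae_imp2 (ae_neq p) (ae_neq d) (fun x a b => conj a b)) (ae_imp2 a1 a2 (fun x a b => conj a b))).
  move=> x [xp xd] [b1 b2].
  have [[-> px xd']|[-> _]] := ii_case p d x; last first.
    by rewrite mulr0 addr_ge0// !mulr_ge0 ?n1_ge0 ?ii_ge0// ltW.
  have [tx|xt] := leP tau x.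
    by rewrite (ii_in tx xd') mulr1 lerDl !mulr_ge0 ?n1_ge0 ?ii_ge0// ltW.
  rewrite mulr1 (ii_in px (ltW xt)) mulr1.
  have px1 : p < x by rewrite lt_neqAle px andbT eq_sym; exact/eqP.
  have xd1 : x < d by rewrite lt_neqAle xd' andbT; exact/eqP.
  apply: (@le_trans _ _ (B * I p + B * I p)); first by apply: lerD; [exact: b1|exact: b2].
  by rewrite -mulr2n -[_ *+ 2]mulr_natl lerDr mulr_ge0 ?n1_ge0 ?ii_ge0.
move: hle; rewrite (rID (nv_L tau d) (L1Z _ (L1_ii1 p tau))) -/(I tau) It add0r (rIZ _ (L1_ii1 p tau)) (rI_itv pt) => hle.
have Bd : B * (tau - p) <= 4^-1.
  have : tau - p <= (4 * B)^-1 by rewrite lerBlDl.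
  move=> h1; apply: le_trans (ler_wpM2l (ltW B0) h1) _.
  by rewrite le_eqVlt; apply/orP; left; apply/eqP; field; rewrite gt_eqF.
by apply/eqP; rewrite eq_le I_ge0 andbT; exact: absorb_half hle (I_ge0 p) Bd.
Qed.

(** The length gained in [step] does not depend on the position, so finitely many steps lead from
    [d] down to [c]. *)
Lemma U_unique : {ae mu, forall x, c <= x -> x <= d -> v x = 0}.
Proof.
have [del d0 hs] := step.
have In n : I (Num.max c (d - n%:R * del)) = 0.
  elim: n => [|n IH].
    by rewrite mul0r subr0 max_r// /I rI_ii set_itv1 Rintegral_set1.
  apply: (hs (Num.max c (d - n%:R * del))) => //.
  - by rewrite le_max lexx.
  - by rewrite ge_max le_max lexx /= le_max lerB ?orbT// ler_wpM2r ?ler_nat// ltW.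
  - rewrite ge_max; apply/andP; split.
      by apply: le_trans (_ : c + 0 <= _); [rewrite addr0|apply: lerD; [rewrite le_max lexx|exact: ltW]].
    apply: le_trans (_ : (d - n.+1%:R * del) + del <= _); last by rewrite lerD2r le_max lexx orbT.
    by rewrite -natr1 mulrDl mul1r opprD addrA subrK.
  - by rewrite ge_max cd gerBl mulr_ge0// ltW.
have Ic : I c = 0.
  have [n hn] : exists n : nat, d - c < n%:R * del.
    have h0 : 0 <= (d - c) / del by rewrite divr_ge0 ?subr_ge0// ltW.
    exists (Num.truncn ((d - c) / del)).+1; rewrite -ltr_pdivrMr//.
    by have /andP[] := truncn_itv h0.
  have := In n; rewrite max_l// lerBlDl -lerBlDr; exact: ltW.
have L : cL (fun x : RT => v x * (ii c d x)%:C) by exact: cL_ii.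
have := cI_eq0 L; rewrite (_ : (fun x => n1 (v x * (ii c d x)%:C)) = (fun x => n1 (v x) * ii c d x)); last first.
  by apply/funext => x; rewrite n1Mr ger0_norm// ii_ge0.
move=> /(_ Ic) h; apply: (ae_imp h) => x hx cx xd.
by move: hx; rewrite ii_in// mulr1.
Qed.
End U.
End Uniqueness.

(** * The scattering function X *)

Section Scattering.
Context {R : realType}.
Notation RT := (measurableTypeR R).
Notation C := R[i].
Notation re := (@complex.Re R).
Notation im := (@complex.Im R).
Implicit Types (x y t s z : R).

Lemma cexp_r (r : R) : cexp (r%:C : C) = (expR r)%:C.
Proof. by rewrite /cexp re_r im_r cos0 sin0; apply: Ceq; rewrite !reimE /= ?mulr1 ?mulr0 ?subr0 ?addr0. Qed.

Lemma cexp_iz z x : cexp (- ('i%C * ('i%C * z%:C) * x%:C) : C) = (expR (z * x))%:C.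
Proof.
rewrite -cexp_r; congr cexp; rewrite mulrA -expr2 sqr_i mulN1r mulNr opprK.
by rewrite rCM.
Qed.

Lemma cexp_izN z x : cexp ('i%C * ('i%C * z%:C) * x%:C : C) = (expR (- (z * x)))%:C.
Proof.
by rewrite -cexp_r; congr cexp; rewrite mulrA -expr2 sqr_i mulN1r mulNr rCM; apply: Ceq; rewrite !reimE ?oppr0.
Qed.

Lemma one_sidedC (f g f' g' : R -> C) x (s : bool) :
  is_derive x (1:R) (fun t => re (f t)) (re (f' x)) -> is_derive x (1:R) (fun t => im (f t)) (im (f' x)) ->
  is_derive x (1:R) (fun t => re (g t)) (re (g' x)) -> is_derive x (1:R) (fun t => im (g t)) (im (g' x)) ->
  (forall t, (if s then t <= x else x <= t) -> f t = g t) -> f' x = g' x.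
Proof.
move=> f1 f2 g1 g2 fg; apply: Ceq.
  by apply: (one_sided f1 g1 (s := s)) => t /fg ->.
by apply: (one_sided f2 g2 (s := s)) => t /fg ->.
Qed.

Lemma derive_exp z x : is_derive x (1:R) (fun t => expR (z * t)) (z * expR (z * x)).
Proof.
apply: is_derive_eq.
by rewrite /GRing.scale/= mulr1 mulrC.
Qed.

Lemma derive_cexp (k : C) z x :
  is_derive x (1:R) (fun t => re (k * (expR (z * t))%:C)) (re (k * (z * expR (z * x))%:C)) /\
  is_derive x (1:R) (fun t => im (k * (expR (z * t))%:C)) (im (k * (z * expR (z * x))%:C)).
Proof.
split.
  rewrite (_ : (fun t => _) = (fun t => re k *: expR (z * t))); last first.
    by apply/funext => t; rewrite reM im_r re_r mulr0 subr0.
  rewrite reM im_r re_r mulr0 subr0; apply: is_deriveZ; exact: derive_exp.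
rewrite (_ : (fun t => _) = (fun t => im k *: expR (z * t))); last first.
  by apply/funext => t; rewrite imM im_r re_r mulr0 add0r.
rewrite imM im_r re_r mulr0 add0r; apply: is_deriveZ; exact: derive_exp.
Qed.

Section potential.
Variables (a b : R) (V : RT -> C) (X Y : C -> C).
Hypotheses (ab : a < b) (LV : cL V) (XY : scattering_functions a b V X Y).
Let Xr z := X ('i%C * z%:C).
Let Yr z := Y ('i%C * z%:C).

(** For k = iz one has ik = -z, which accounts for the minus signs and makes all exponentials real.
    The derivatives at [a] and [b] are obtained from the outer side, where the solution is
    explicit. *)
Lemma scat_sol z : z != 0 -> exists u u' : RT -> C,
  [/\ (forall c d, c <= d -> sol V z c d u u'), (forall x, x <= a -> u x = (expR (z * x))%:C),
      u' a = z%:C * u a,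
      (forall x, b <= x -> z%:C * u x = - (Xr z * (expR (z * x))%:C + Yr z * (expR (- z * x))%:C)) &
      u' b = - (Xr z * (expR (z * b))%:C - Yr z * (expR (- z * b))%:C)].
Proof.
move=> z0; have [_ _ /(_ ('i%C * z%:C))[u [su ua ub]]] := XY.
have [u' [hs du]] := schrod_sol LV su.
have ua' x : x <= a -> u x = (expR (z * x))%:C by move=> xa; rewrite ua// cexp_iz.
have zc : z%:C != 0 :> C by rewrite (inj_eq (@complexI R)).
have ub' x : b <= x -> z%:C * u x = - (Xr z * (expR (z * x))%:C + Yr z * (expR (- z * x))%:C).
  have e : 'i%C * ('i%C * z%:C) = - z%:C by rewrite mulrA -expr2 sqr_i mulN1r.
  by move=> bx; have := ub x bx; rewrite cexp_iz cexp_izN e mulNr => h; rewrite mulNr -h opprK.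
exists u, u'; split=> //.
- have [d1 d2] := du a; have [e1 e2] := derive_cexp 1 z a.
  transitivity ((1 : C) * (z * expR (z * a))%:C).
    apply: (@one_sidedC u (fun t => 1 * (expR (z * t))%:C) u' (fun x => 1 * (z * expR (z * x))%:C) a true d1 d2 e1 e2).
    by move=> t ta; rewrite mul1r ua'.
  by rewrite mul1r ua'// rCM.
- have [d1 d2] := du b.
  have [e1 e2] := derive_cexp (- Xr z / z%:C) z b; have [f1 f2] := derive_cexp (- Yr z / z%:C) (- z) b.
  transitivity (- Xr z / z%:C * (z * expR (z * b))%:C + - Yr z / z%:C * (- z * expR (- z * b))%:C).
    apply: (@one_sidedC u (fun t => - Xr z / z%:C * (expR (z * t))%:C + - Yr z / z%:C * (expR (- z * t))%:C) u' (fun x => - Xr z / z%:C * (z * expR (z * x))%:C + - Yr z / z%:C * (- z * expR (- z * x))%:C) b false d1 d2).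
    + rewrite (_ : (fun t => _) = (fun t => re (- Xr z / z%:C * (expR (z * t))%:C) + re (- Yr z / z%:C * (expR (- z * t))%:C))); last by apply/funext => t; rewrite reD.
      by rewrite reD; exact: is_deriveD.
    + rewrite (_ : (fun t => _) = (fun t => im (- Xr z / z%:C * (expR (z * t))%:C) + im (- Yr z / z%:C * (expR (- z * t))%:C))); last by apply/funext => t; rewrite imD.
      by rewrite imD; exact: is_deriveD.
    + move=> t bt; apply: (mulfI zc); rewrite ub'//.
      by move: (Xr z) (Yr z) (expR _)%:C (expR _)%:C z%:C zc => a1 a2 a3 a4 a5 h5; field.
  rewrite -!rCM (_ : (- z)%:C = - z%:C); last by apply: Ceq; rewrite !reimE ?oppr0.
  by move: (Xr z) (Yr z) (expR _)%:C (expR _)%:C z%:C zc => a1 a2 a3 a4 a5 h5; field.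
Qed.

Variable A : RT -> RT -> C.
Hypothesis kA : volterra_kernel V a b A.

Definition scat_u z (u u' : RT -> C) :=
  [/\ (forall c d, c <= d -> sol V z c d u u'), (forall x, x <= a -> u x = (expR (z * x))%:C),
      u' a = z%:C * u a,
      (forall x, b <= x -> z%:C * u x = - (Xr z * (expR (z * x))%:C + Yr z * (expR (- z * x))%:C)) &
      u' b = - (Xr z * (expR (z * b))%:C - Yr z * (expR (- z * b))%:C)].

Lemma scat_M z u u' : z != 0 -> rI (fun x => n1 (V x)) <= `|z| -> scat_u z u u' ->
  forall x, a <= x -> x <= b -> u x = (expR (z * x))%:C * Mk A x z.
Proof.
move=> z0 zN [h1 h2 h3 _ _] x ax xb.
rewrite (sol_M (ltW ab) LV kA z0 zN (h1 _ _ (ltW ab)) h3 ax xb) h2// rCM -expRD.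
by congr ((expR _)%:C * _); ring.
Qed.

(** At [b] the combination e^{zx}(u' - zu) of [sol_E] isolates 2Y, and at [a] it is 0. *)
Lemma scat_Y z u u' : z != 0 -> rI (fun x => n1 (V x)) <= `|z| -> scat_u z u u' ->
  2 * Yr z = cI (fun x : RT => V x * (ii a b x * expR (2 * z * x))%:C * Mk A x z).
Proof.
move=> z0 zN hu; have hM := scat_M z0 zN hu; case: hu => h1 h2 h3 h4 h5.
have [_ /(_ b (ltW ab) (lexx b))] := sol_E (ltW ab) z0 erefl (h1 _ _ (ltW ab)).
rewrite h3 subrr mulr0 subr0 h4// h5 => e.
transitivity ((expR (z * b))%:C * (expR (- z * b))%:C * (2 * Yr z)).
  by rewrite rCM -expRD mulNr subrr expR0 mul1r.
move: e; rewrite (_ : (fun t : RT => V t * u t * _) = (fun x : RT => V x * (ii a b x * expR (2 * z * x))%:C * Mk A x z)).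
  by move=> <-; move: (Xr z) (Yr z) (expR _)%:C (expR _)%:C => a1 a2 a3 a4; ring.
apply/funext => t; have [[-> ta tb]|[-> _]] := ii_case a b t; last by rewrite mulr0 mul0r !mulr0 mul0r.
rewrite hM// mulr1 mul1r (_ : expR (2 * z * t) = expR (z * t) * expR (z * t)); last by rewrite -expRD; congr expR; ring.
by rewrite -rCM; move: (V t) (Mk _ _ _) (expR _)%:C => a1 a2 a3; ring.
Qed.

(** At [b] the combination e^{-zx}(u' + zu) isolates -2X; at [a] it equals 2z, the source of the
    leading term. *)
Lemma scat_X z u u' : z != 0 -> rI (fun x => n1 (V x)) <= `|z| -> scat_u z u u' ->
  2 * Xr z = - (2 * z%:C) - cI (fun x : RT => V x * (ii a b x)%:C * Mk A x z).
Proof.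
move=> z0 zN hu; have hM := scat_M z0 zN hu; case: hu => h1 h2 h3 h4 h5.
have nz0 : - z != 0 by rewrite oppr_eq0.
have [_ /(_ b (ltW ab) (lexx b))] := sol_E (ltW ab) nz0 (sqrrN z) (h1 _ _ (ltW ab)).
rewrite h3 (h2 a)//.
have zN' : (- z)%:C = - z%:C :> C by apply: Ceq; rewrite !reimE ?oppr0.
rewrite zN' !mulNr !opprK h4// h5 !mulNr.
rewrite (_ : (fun t : RT => V t * u t * _) = (fun x : RT => V x * (ii a b x)%:C * Mk A x z)); last first.
  apply/funext => t; have [[-> ta tb]|[-> _]] := ii_case a b t; last by rewrite !mulr0 mul0r.
  rewrite hM// mulr1; have e : (expR (z * t))%:C * (expR (- (z * t)))%:C = 1 :> C by rewrite rCM -expRD subrr expR0.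
  rewrite rC1 !mulr1 ?mulNr; transitivity (V t * Mk A t z * ((expR (z * t))%:C * (expR (- (z * t)))%:C)).
    by move: (V t) (Mk _ _ _) (expR _)%:C (expR _)%:C => a1 a2 a3 a4; ring.
  by rewrite e mulr1.
move=> e.
have e1 x : (expR (- (z * x)))%:C * (expR (z * x))%:C = 1 :> C by rewrite rCM -expRD addrC subrr expR0.
rewrite -e; have -> : - (2 * z%:C) = - (2 * z%:C) * ((expR (- (z * a)))%:C * (expR (z * a))%:C) by rewrite e1 mulr1.
transitivity (2 * Xr z * ((expR (- (z * b)))%:C * (expR (z * b))%:C)); first by rewrite e1 mulr1.
move: (Xr z) (Yr z) (expR (z * b))%:C (expR (- (z * b)))%:C (expR (z * a))%:C (expR (- (z * a)))%:C z%:C => a1 a2 a3 a4 a5 a6 a7.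
by ring.
Qed.

(* The coefficients in [X (i z) = - z - jc + \int jg s e^{-zs} ds]. *)
Definition jg (s : RT) : C := - (2^-1 * cI (fun x : RT => V x * (ii a b x)%:C * A x s)).
Definition jc : C := 2^-1 * cI (fun x : RT => V x * (ii a b x)%:C).

Lemma jg_L s : cL (fun x : RT => V x * (ii a b x)%:C * A x s).
Proof.
have [h [B B0 hB] _ _] := kA.
apply: (cLM (K := B) (cL_ii a b LV)) => //; exact: (cm_comp h (measurable_pair2 (s : RT))).
Qed.

Lemma jg_cm : cm jg.
Proof.
have [h [B B0 hB] _ _] := kA.
apply: cmN; apply: cmM; first exact: cm_cst.
apply: (@cI_param _ _ _ (fun s x => V x * (ii a b x)%:C * A x s) (fun x => B * n1 (V x))).
- apply: cmM; first exact: (cm_comp (cL_cm (cL_ii a b LV))).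
  have hs : measurable_fun setT (fun p : RT * RT => (p.2, p.1)) by exact: measurable_fun_pair.
  exact: (cm_comp h hs).
- by apply: L1Z; exact: cL_n1.
- move=> s x; apply: le_trans (n1M _ _) _; rewrite mulrC; apply: ler_pM; rewrite ?n1_ge0//.
  by rewrite n1Mr ler_piMr ?n1_ge0// ger0_norm ?ii_ge0 ?ii_le1.
Qed.

Lemma jg_bnd : exists2 B, 0 <= B & forall s, n1 (jg s) <= B * ii 0 (2 * (b - a)) s.
Proof.
have [h [B B0 hB] h0 _] := kA; exists (B * rI (fun x => n1 (V x))).
  by rewrite mulr_ge0// rI_ge0// => x; exact: n1_ge0.
have NB s : n1 (jg s) <= B * rI (fun x => n1 (V x)).
  rewrite n1N (_ : 2^-1 = (2^-1)%:C :> C); last by rewrite (fmorphV (real_complex R)) rmorph_nat.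
  rewrite n1rM ger0_norm ?invr_ge0//; apply: (@le_trans _ _ (1 * n1 (cI (fun x : RT => V x * (ii a b x)%:C * A x s)))).
    by rewrite ler_wpM2r ?n1_ge0// invf_le1// ler1n.
  rewrite mul1r -(rIZ _ (cL_n1 LV)); apply: (cI_le (cL_cm (jg_L s))); first by apply: L1Z; exact: cL_n1.
  move=> x; apply: le_trans (n1M _ _) _; rewrite mulrC; apply: ler_pM; rewrite ?n1_ge0//.
  by rewrite n1Mr ler_piMr ?n1_ge0// ger0_norm ?ii_ge0 ?ii_le1.
move=> s; have [[-> s0 sL]|[-> hs]] := ii_case 0 (2 * (b - a)) s; first by rewrite mulr1.
rewrite mulr0 /jg (_ : cI _ = 0) ?mulr0 ?n1N ?n1_0//.
transitivity (cI (fun=> 0 : C)); last exact: cI0.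
congr cI; apply/funext => x; rewrite h0 ?mulr0//; apply: contra hs => /andP[/andP[ax xb] /andP[s0 sx]].
rewrite s0 /=; apply: le_trans sx _; rewrite ler_pM2l// lerB//.
Qed.

Lemma jg_eL z : cL (fun s : RT => jg s * (expR (- z * s))%:C).
Proof.
have [B B0 hB] := jg_bnd; apply: (cL_le (g := fun s => B * (expR (- z * s) * ii 0 (2 * (b - a)) s))).
- by apply: cmM; [exact: jg_cm|apply: cm_r; apply: meas_expR; exact: measurable_funM].
- by apply: L1Z; exact: L1_exp.
- by move=> s; rewrite n1Mr ger0_norm ?expR_ge0// [expR _ * ii _ _ _]mulrC mulrA ler_wpM2r ?expR_ge0.
Qed.

Lemma scat_Xg z : z != 0 -> rI (fun x => n1 (V x)) <= `|z| ->
  Xr z = - z%:C - jc + cI (fun s : RT => jg s * (expR (- z * s))%:C).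
Proof.
move=> z0 zN; have [u [u' hu]] := scat_sol z0.
have two : (2 : C) != 0 by rewrite pnatr_eq0.
apply: (mulfI two); rewrite (scat_X z0 zN hu).
have [h [B B0 hB] h0 _] := kA.
have hbk := kernel_bk kA.
pose H (s x : R) : C := V x * (ii a b x)%:C * A x s * (expR (- z * s))%:C.
have [Be Be0 hBe] := bk_exp hbk.
have mH : cm (fun p : RT * RT => H p.1 p.2).
  apply: cmM.
    apply: cmM; first exact: (cm_comp (cL_cm (cL_ii a b LV))).
    have hs : measurable_fun setT (fun p : RT * RT => (p.2, p.1)) by exact: measurable_fun_pair.
    exact: (cm_comp h hs).
  by apply: cm_r; apply: meas_expR; apply: measurable_funM.
pose L := - (2 * a) + 2 * b.
pose K := Be * expR (`|z| * L).
have K0 : 0 <= K by rewrite mulr_ge0 ?expR_ge0.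
have bH s x : n1 (H s x) <= ii 0 L s * (K * n1 (V x)).
  have -> : H s x = V x * ((ii a b x)%:C * (A x s * (expR (- z * s))%:C)) by rewrite /H !mulrA.
  apply: le_trans (n1M _ _) _.
  have -> : ii 0 L s * (K * n1 (V x)) = n1 (V x) * (K * ii 0 L s) by ring.
  apply: ler_wpM2l; first exact: n1_ge0.
  rewrite n1rM; have [[-> ax xb]|[-> _]] := ii_case a b x; last by rewrite normr0 mul0r mulr_ge0 ?ii_ge0.
  rewrite normr1 mul1r; apply: le_trans (hBe x s z) _; rewrite (ii_in ax xb) mulr1.
  apply: ler_wpM2r; first exact: ii_ge0.
  rewrite /K; apply: (ler_wpM2l Be0); rewrite ler_expR; apply: ler_wpM2l; first exact: normr_ge0.
  by rewrite lerD2l ler_pM2l.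
have LK : L1 (fun x => K * n1 (V x)) by apply: L1Z; exact: cL_n1.
have S1 := @cI_swap R H _ _ mH (L1_ii1 0 L) LK bH (fun s => ii_ge0 0 L s).
have e1 : cI (fun s : RT => cI (H s)) = - (2 * cI (fun s : RT => jg s * (expR (- z * s))%:C)).
  rewrite -(cIZ _ (jg_eL z)) -(cIN (cLZ _ (jg_eL z))); congr cI; apply/funext => s.
  rewrite /H (cIZr _ (jg_L s)) /jg; by move: (cI _) (expR _)%:C => a1 a2; field.
have LVM : cL (fun x : RT => V x * (ii a b x)%:C * cI (fun s : RT => A x s * (expR (- z * s))%:C)).
  apply: (cLM (K := K * rI (ii 0 L)) (cL_ii a b LV)).
    have := cmB (Mk_cm hbk z) (cm_cst _ 1); congr cm; apply/funext => x.
    by rewrite /Mk addrC addKr.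
  move=> x; rewrite -(rIZ _ (L1_ii1 0 L)); apply: (cI_le (cL_cm (bk_L hbk x z))); first by apply: L1Z; exact: L1_ii1.
  move=> s1; apply: le_trans (hBe x s1 z) _.
  have [[-> ax xb]|[-> _]] := ii_case a b x; last by rewrite mulr0; apply: mulr_ge0; [exact: K0|exact: ii_ge0].
  rewrite mulr1; apply: ler_wpM2r; first exact: ii_ge0.
  rewrite /K; apply: (ler_wpM2l Be0); rewrite ler_expR; apply: ler_wpM2l; first exact: normr_ge0.
  by rewrite lerD2l ler_pM2l.
have -> : cI (fun x : RT => V x * (ii a b x)%:C * Mk A x z) = 2 * jc + cI (fun s : RT => cI (H s)).
  rewrite S1 (_ : 2 * jc = cI (fun x : RT => V x * (ii a b x)%:C)); last by rewrite /jc mulVKf.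
  have -> : cI (fun t : RT => cI (fun x : RT => H x t)) = cI (fun x : RT => V x * (ii a b x)%:C * cI (fun s : RT => A x s * (expR (- z * s))%:C)).
    by congr cI; apply/funext => x; rewrite -(cIZ _ (bk_L hbk x z)); congr cI; apply/funext => s; rewrite /H !mulrA.
  rewrite -(cID (cL_ii a b LV) LVM); congr cI; apply/funext => x.
  by rewrite /Mk mulrDr mulr1.
rewrite e1; move: jc (cI _) z%:C => a1 a2 a3; ring.
Qed.

End potential.
End Scattering.

(** * Inverting X within the class of transforms *)

Section Resolvent.
Context {R : realType}.
Notation RT := (measurableTypeR R).
Notation C := R[i].
Implicit Types (x y t s T : R).

Lemma sqrD_le (p q : R) : (p + q) ^+ 2 <= 2 * (p ^+ 2 + q ^+ 2).
Proof.
rewrite -subr_ge0 (_ : _ - _ = (p - q) ^+ 2) ?sqr_ge0//; ring.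
Qed.

Lemma n1_inv (w : C) : n1 w^-1 <= 2 / n1 w.
Proof.
case: w => a b; rewrite /n1 /=.
set n2 := a ^+ 2 + b ^+ 2; have n20 : 0 <= n2 by rewrite addr_ge0 ?sqr_ge0.
rewrite normrN !normrM !normfV (ger0_norm n20) -mulrDl.
have [->|h] := eqVneq (`|a| + `|b|) 0; first by rewrite mul0r invr0 mulr0.
have n0 : 0 < `|a| + `|b| by rewrite lt_neqAle eq_sym h addr_ge0.
have n2p : 0 < n2.
  rewrite lt_neqAle n20 andbT eq_sym; apply: contra h => /eqP e.
  have : a ^+ 2 == 0 by rewrite eq_le sqr_ge0 andbT -e lerDl sqr_ge0.
  have : b ^+ 2 == 0 by rewrite eq_le sqr_ge0 andbT -e lerDr sqr_ge0.
  by rewrite !sqrf_eq0 => /eqP -> /eqP ->; rewrite normr0 addr0.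
rewrite ler_pdivrMr// [leRHS]mulrAC ler_pdivlMr// /n2.
by rewrite -(real_normK (num_real a)) -(real_normK (num_real b)) -expr2 sqrD_le.
Qed.

Definition heaviside (t : RT) : C := ((0 <= t)%R%:R : R)%:C.

Lemma heaviside_nice : nice heaviside.
Proof.
split.
- by apply: cm_r; exact: meas_ler.
- by move=> t t0; rewrite /heaviside leNgt t0.
- exists 1, 0; split=> // t; rewrite mul0r expR0 mulr1 n1_r; exact: bool_norm1.
Qed.

Lemma heaviside_rep T : 0 <= T -> rep T (fun y => (y^-1)%:C) heaviside.
Proof.
move=> T0 c' c'T; exists 1, 1 => y y1.
have y0 : 0 < y := lt_le_trans ltr01 y1.
have -> : LT T heaviside y = ((1 - expR (- y * T)) / y)%:C.
  rewrite /LT (_ : (fun t : RT => _) = (fun t : RT => (expR (- y * t) * ii 0 T t)%:C)).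
    by rewrite cI_r rI_ii_exp ?gt_eqF// mulr0 expR0.
  apply/funext => t; rewrite /heaviside rCM; congr (_%:C).
  by have [[-> t0 _]|[-> _]] := ii_case 0 T t; rewrite ?mulr0// t0 mul1r.
rewrite -rCB n1_r (_ : y^-1 - (1 - expR (- y * T)) / y = expR (- y * T) / y); last by field; rewrite gt_eqF.
rewrite mul1r ger0_norm ?divr_ge0 ?expR_ge0 ?(ltW y0)//.
apply: (@le_trans _ _ (expR (- y * T))); first by rewrite ler_pdivrMr// ler_peMr// expR_ge0.
by rewrite ler_expR !mulNr lerN2 mulrC ler_pM2l// ltW.
Qed.

Lemma nice_pos (f : RT -> C) (M K : R) : cm f -> (forall t, n1 (f t) <= M * expR (K * t)) ->
  nice (fun t => heaviside t * f t).
Proof.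
move=> mf bf; apply: niceP.
- by apply: cmM => //; exact: nice_cm heaviside_nice.
- by move=> t t0; rewrite (nice_neg heaviside_nice t0) mul0r.
- exists M, K => t t0; rewrite /heaviside t0 mul1r; exact: bf.
Qed.

(** A renewal equation, solved by contraction. On the side of transforms it says r = -1/(y(1 - Q)),
    which is how a reciprocal is represented. *)
Lemma resolvent (Q : RT -> C) : nice Q -> exists2 r, nice r & forall t, r t = - heaviside t + cvl Q r t.
Proof.
move=> nQ; have [mQ zQ [M [K1 [M0 K10 bQ]]]] := nQ.
(* In the weight e^{Kt}, convolution with [Q] has norm at most M / (K - K1) = M / (2M + 1), which is
   below 1/2. *)
pose K := K1 + (2 * M + 1).
have K0 : 0 < 2 * M + 1 by rewrite ltr_wpDl// mulr_ge0.
pose om (t : RT) := expR (K * t) * ((0 <= t)%R%:R).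
have om0 t : 0 <= om t by rewrite mulr_ge0 ?expR_ge0.
pose pos (f : RT -> C) : RT -> C := fun t => heaviside t * f t.
have npos f B : cm f -> (forall t, n1 (f t) <= B * om t) -> nice (pos f).
  move=> mf bf; have B0 : 0 <= B.
    have := le_trans (n1_ge0 _) (bf 0); rewrite /om lexx mulr0 expR0 mulr1 mulr1 //.
  apply: (@nice_pos f B K) => // t; apply: le_trans (bf t) _; rewrite ler_wpM2l// ler_piMr ?expR_ge0//.
  exact: le_trans (ler_norm _) (bool_norm1 _).
have [||||r [mr br er]] := @contraction_solve R _ RT om (fun f => cvl Q (pos f)) (fun t => - heaviside t) 1 om0 ler01.
- by apply: cmN; exact: nice_cm heaviside_nice.
- move=> t; rewrite n1N n1_r mul1r /om; have [t0|t0] := leP 0 t; last by rewrite normr0 mulr0.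
  by rewrite normr1 mulr1 -expR0 ler_expR mulr_ge0// addr_ge0// ltW.
- move=> f B mf B0 bf; have nf := npos f B mf bf.
  split; first exact: nice_cm (cvl_nice nQ nf).
  move=> t; have [t0|t0] := leP 0 t; last by rewrite cvl_neg// n1_0 mulr_ge0// divr_ge0.
  rewrite /om t0 mulr1.
  have Lw : L1 (fun s => expR ((2 * M + 1) * s) * ii 0 t s) by exact: L1_exp.
  apply: (@le_trans _ _ (rI (fun s => (M * B * expR (K1 * t)) * (expR ((2 * M + 1) * s) * ii 0 t s)))).
    apply: (cI_le (cvl_cm1 t nQ nf)); first exact: L1Z.
    move=> s; have [s0|s0] := ltP s 0.
      by rewrite (nice_neg nf s0) mulr0 n1_0 !mulr_ge0 ?expR_ge0 ?ii_ge0.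
    have [st|ts] := leP s t; last by rewrite (nice_neg nQ) ?subr_lt0// mul0r n1_0 !mulr_ge0 ?expR_ge0 ?ii_ge0.
    rewrite ii_in// mulr1; apply: le_trans (n1M _ _) _.
    have := bf s; rewrite /om s0 mulr1 => h.
    have h' : n1 (pos f s) <= B * expR (K * s) by rewrite /pos /heaviside s0 mul1r.
    apply: le_trans (ler_pM (n1_ge0 _) (n1_ge0 _) (bQ _) h') _.
    rewrite (_ : M * expR (K1 * (t - s)) * (B * expR (K * s)) = M * B * (expR (K1 * (t - s)) * expR (K * s))); last by ring.
    rewrite -[leRHS]mulrA -!expRD ler_wpM2l ?mulr_ge0// ler_expR.
    by rewrite (_ : K1 * (t - s) + K * s = K1 * t + (2 * M + 1) * s)// /K; ring.
  rewrite (rIZ _ Lw); apply: le_trans (ler_wpM2l _ (rI_exp_bound t K0)) _; first by rewrite !mulr_ge0 ?expR_ge0.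
  rewrite (_ : _ * (expR _ / _) = (M / (2 * M + 1)) * (B * (expR (K1 * t) * expR ((2 * M + 1) * t)))); last by field; rewrite gt_eqF.
  rewrite -expRD -mulrDl -/K [leRHS](_ : _ = 2^-1 * (B * expR (K * t))); last by rewrite mulrA [2^-1 * B]mulrC.
  apply: ler_wpM2r; first by rewrite mulr_ge0 ?expR_ge0.
  by rewrite ler_pdivrMr// mulrDr mulrA mulVf// mul1r mulr1 lerDl.
- move=> f h B mf mh bf bh t; have nf := npos f B mf bf; have nh := npos h B mh bh.
  rewrite /cvl -(cIB (cvl_L t nQ nf) (cvl_L t nQ nh)); congr cI; apply/funext => s.
  by rewrite /pos !mulrBr.
have rn t : t < 0 -> r t = 0.
  move=> t0; apply: n1_eq0; apply: le_trans (br t) _.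
  by rewrite /om [0 <= t]leNgt t0 mulr0 mulr0.
have pr : pos r = r.
  apply/funext => t; rewrite /pos /heaviside; have [t0|t0] := leP 0 t; first by rewrite mul1r.
  by rewrite rn// mulr0.
have nr : nice r.
  apply: niceP => //; exists (4 * 1), K => t t0; apply: le_trans (br t) _.
  by rewrite /om t0 !mulr1.
by exists r => // t; rewrite {1}er pr.
Qed.

Definition gh (g : RT -> C) (y : R) : C := cI (fun s : RT => g s * (expR (- y * s))%:C).

Section X.
Variables (X : R -> C) (c0 : C) (g : RT -> C) (B L N : R).
Hypotheses (mg : cm g) (B0 : 0 <= B) (L0 : 0 <= L) (bg : forall s, n1 (g s) <= B * ii 0 L s).
Hypothesis hX : forall y, N <= y -> X y = - y%:C - c0 + gh g y.

Lemma g_zero s : ~~ ((0 <= s) && (s <= L)) -> g s = 0.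
Proof.
move=> h; apply: n1_eq0; apply: le_trans (bg s) _.
by rewrite /ii (negbTE h) mulr0.
Qed.

Lemma g_nice : nice g.
Proof.
split=> //; first by move=> t t0; apply: g_zero; rewrite leNgt t0.
exists B, 0; split=> // t; rewrite mul0r expR0; apply: le_trans (bg t) _.
by rewrite ler_wpM2l// ii_le1.
Qed.

Lemma gh_LT T y : L <= T -> gh g y = LT T g y.
Proof.
move=> LT'; congr cI; apply/funext => s; have [/andP[s0 sL]|h] := boolP ((0 <= s) && (s <= L)).
  by rewrite ii_in ?mulr1//; exact: le_trans sL LT'.
by rewrite g_zero// !mul0r.
Qed.

Lemma gh_rep T : L <= T -> rep T (gh g) g.
Proof. by move=> h; apply: (rep_near (Y0 := 0) _ (@rep_LT _ T g)) => y _; rewrite (gh_LT _ h). Qed.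

Lemma gh_bnd : exists2 K, 0 <= K & forall y, 0 <= y -> n1 (gh g y) <= K.
Proof.
exists (rI (fun s => B * ii 0 L s)); first by apply: rI_ge0 => s; rewrite mulr_ge0// ii_ge0.
move=> y y0; apply: cI_le; first by apply: cmM => //; apply: cm_r; apply: meas_expR; exact: measurable_funM.
  by apply: L1Z; exact: L1_ii1.
move=> s; have [h|h] := boolP ((0 <= s) && (s <= L)); last first.
  by rewrite g_zero// mul0r n1_0 mulr_ge0// ii_ge0.
rewrite n1Mr ger0_norm ?expR_ge0//; apply: le_trans _ (bg s); rewrite ler_piMr ?n1_ge0//.
by rewrite -expR0 ler_expR mulNr oppr_le0 mulr_ge0//; case/andP: h.
Qed.

Lemma X_low : exists2 Y, 1 <= Y & forall y, Y <= y -> y / 2 <= n1 (X y).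
Proof.
have [K K0 hK] := gh_bnd; exists (Num.max N (2 * (n1 c0 + K) + 1)).
  by rewrite le_max; apply/orP; right; rewrite lerDr mulr_ge0// addr_ge0 ?n1_ge0.
move=> y; rewrite ge_max => /andP[yN yK].
have y0 : 0 <= y by apply: le_trans yK; rewrite addr_ge0// mulr_ge0// addr_ge0 ?n1_ge0.
have h1 : y <= n1 (X y) + n1 c0 + n1 (gh g y).
  have e : n1 (y%:C : C) = y by rewrite n1_r ger0_norm.
  rewrite -[leLHS]e.
  rewrite [in leLHS](_ : y%:C = - X y + (- c0 + gh g y)); last by rewrite (hX yN); move: c0 (gh g y) y%:C => a1 a2 a3; ring.
  have b1 := n1D (- X y) (- c0 + gh g y); have b2 := n1D (- c0) (gh g y).
  rewrite !n1N in b1 b2; apply: le_trans b1 _; rewrite -[leRHS]addrA.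
  by apply: lerD; [exact: lexx|exact: b2].
have := hK y y0; move: h1 yK (n1_ge0 c0) (n1_ge0 (gh g y)); move: (n1 (X y)) (n1 c0) (n1 (gh g y)) => p q r; lra.
Qed.

Lemma X_neq0 : exists Y, forall y, Y <= y -> X y != 0.
Proof.
have [Y Y1 hY] := X_low; exists Y => y Yy; apply/eqP => e; have := hY y Yy.
by rewrite e n1_0 leNgt divr_gt0// (lt_le_trans ltr01 (le_trans Y1 Yy)).
Qed.

Lemma X_inv_bnd : decay (fun y => y%:C * (X y)^-1) 0.
Proof.
have [Y Y1 hY] := X_low; apply: (decay_bnd (K := 4) (Y := Y)) => y Yy.
have y0 : 0 < y := lt_le_trans ltr01 (le_trans Y1 Yy).
have h := hY y Yy; have n0 : 0 < n1 (X y) by apply: lt_le_trans h; rewrite divr_gt0.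
rewrite n1rM (ger0_norm (ltW y0)); apply: le_trans (ler_wpM2l (ltW y0) (n1_inv _)) _.
by rewrite mulrA ler_pdivrMr//; move: h; move: (n1 (X y)) => p; lra.
Qed.

Lemma X_inv_decay : decay (fun y => (X y)^-1) 0.
Proof.
have := decayM (@decay_inv R) X_inv_bnd; rewrite addr0.
apply: (decay_near (Y0 := 1)) => y y1; rewrite mulrA rCM mulVf ?mul1r//.
by rewrite gt_eqF// (lt_le_trans ltr01).
Qed.

Lemma X_decay : decay X 0.
Proof.
have := decayD (decayB (decayN (@decay_id R)) (decay_cst c0)) (@LT_bdecay R L g g_nice).
apply: (decay_near (Y0 := N)) => y yN; rewrite hX// (gh_LT _ (lexx L))//.
Qed.

(** Choose [Q] with transform 1 + X / y, which is (-c0 + gh g) / y and so contains no constant. Then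
    -1/(y(1 - Q)) is 1/X. *)
Lemma X_inv_rep : exists2 r, nice r & forall T, L <= T -> rep T (fun y => (X y)^-1) r.
Proof.
pose Q := (fun t : RT => - c0 * heaviside t + cvl heaviside g t).
have nQ : nice Q by apply: niceD; [exact: niceZ heaviside_nice|exact: cvl_nice heaviside_nice g_nice].
have [r nr er] := resolvent nQ; exists r => // T LT'.
have T0 : 0 <= T := le_trans L0 LT'.
have rQ : rep T (fun y => - c0 * (y^-1)%:C + (y^-1)%:C * gh g y) Q.
  apply: repD; [exact: niceZ heaviside_nice|exact: cvl_nice heaviside_nice g_nice| |].
    by apply: (repZ (- c0) heaviside_nice); exact: heaviside_rep.
  by apply: (cvl_rep heaviside_nice g_nice T0); [exact: heaviside_rep|exact: gh_rep].
have rr := repD (niceZ (-1) heaviside_nice) (cvl_nice nQ nr) (repZ (-1) heaviside_nice (heaviside_rep T0)) (cvl_rep nQ nr T0 rQ (@rep_LT _ T r)).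
have hr : (fun t : RT => -1 * heaviside t + cvl Q r t) = r by apply/funext => t; rewrite mulN1r -er.
rewrite hr in rr.
have [Y hY] := X_neq0.
have := decayM (X_inv_bnd) (decayN rr); rewrite add0r; apply: (decay_near (Y0 := Num.max (Num.max 1 N) Y)) => y.
rewrite !ge_max => /andP[/andP[y1 yN] yY]; have X0 := hY y yY.
have y0 : y%:C != 0 :> C by rewrite (inj_eq (@complexI R)) gt_eqF// (lt_le_trans ltr01 y1).
rewrite (_ : (y^-1)%:C = (y%:C)^-1); last by rewrite (fmorphV (real_complex R)).
have -> : - c0 * y%:C^-1 + y%:C^-1 * gh g y = 1 + X y / y%:C.
  rewrite hX//; move: (gh g y) y%:C y0 => a1 a2 h2; field; exact: h2.
move: (X y) y%:C X0 y0 (LT T r y) => a1 a2 h1 h2 a3; field; rewrite h1 h2 //.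
Qed.

End X.
End Resolvent.

(** * Reflection, Wronskian, and products of kernels *)

Section Transforms.
Context {R : realType}.
Notation mu := (@lebesgue_measure R).
Notation RT := (measurableTypeR R).
Notation C := R[i].
Implicit Types (c d x y t s z : R) (F f u w q : RT -> C).

Lemma ii_opp (c d x : R) : ii (- d) (- c) (- x) = ii c d x.
Proof. by rewrite /ii !lerN2 andbC. Qed.

Lemma cI_opp f : cL f -> cL (fun x : RT => f (- x)) /\ cI (fun x : RT => f (- x)) = cI f.
Proof.
move=> Lf; have [h1 h2] := cI_affine 0 (or_intror (erefl (-1 : R))) Lf.
have E : (fun x : RT => f (-1 * x + 0)) = (fun x : RT => f (- x)) by apply/funext => x; rewrite mulN1r addr0.
by rewrite E in h1 h2.
Qed.

Lemma ac_mirror c d F f : ac c d F f -> ac (- d) (- c) (fun x => F (- x)) (fun x => - f (- x)).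
Proof.
move=> h.
have E x y : (fun t : RT => - f (- t) * (ii (- y) (- x) t)%:C) = (fun t : RT => - (f (- t) * (ii x y (- t))%:C)).
  by apply/funext => t; rewrite mulNr -(ii_opp x y) opprK.
split; first by rewrite E; exact: (cLN (cI_opp h.1).1).
move=> x y dx xy yc.
have yc' : c <= - y by rewrite lerNr.
have dx' : - x <= d by rewrite lerNl.
have yx : - y <= - x by rewrite lerN2.
have L := ac_L h yc' dx'.
rewrite -[ii x y]/(ii x y) -{2}[x]opprK -{2}[y]opprK E.
rewrite (cIN (cI_opp L).1) (cI_opp L).2 -(h.2 _ _ yc' yx dx').
by rewrite opprB.
Qed.

(** The kernel solves from left to right; reflection lets the same results solve from [b] down to
    0. *)
Lemma sol_mirror q z c d u u' : sol q z c d u u' ->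
  sol (fun x => q (- x)) z (- d) (- c) (fun x => u (- x)) (fun x => - u' (- x)).
Proof.
move=> [h1 h2]; split; first exact: ac_mirror.
apply: ac_ext (acZ (-1) (ac_mirror h2)) => x _ _; first by rewrite mulN1r.
by rewrite mulN1r opprK.
Qed.

Lemma sol_lin q z c d u u' w w' k l : sol q z c d u u' -> sol q z c d w w' ->
  sol q z c d (fun x => k * u x - l * w x) (fun x => k * u' x - l * w' x).
Proof.
move=> [h1 h2] [g1 g2]; split; first exact: acB (acZ k h1) (acZ l g1).
apply: ac_ext (acB (acZ k h2) (acZ l g2)) => x _ _ //.
by move: (q x) _%:C (u x) (w x) => a1 a2 a3 a4; ring.
Qed.

Lemma ac_ae c d F f g : cL (fun t : RT => g t * (ii c d t)%:C) ->
  {ae mu, forall x, c <= x -> x <= d -> f x = g x} -> ac c d F f -> ac c d F g.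
Proof.
move=> Lg fg h; split=> // x y cx xy yd; rewrite (h.2 x y cx xy yd).
apply: cI_ae; [exact: ac_L h cx yd|exact: cL_sub Lg|].
apply: (ae_imp fg) => t ft; have [[-> xt ty]|[-> _]] := ii_case x y t; last by rewrite !mulr0.
by rewrite ft// ?(le_trans cx xt)// (le_trans ty yd).
Qed.

Lemma sol_ae q1 q2 z c d u u' : c <= d -> cL q2 -> {ae mu, forall x, c <= x -> x <= d -> q1 x = q2 x} ->
  sol q1 z c d u u' -> sol q2 z c d u u'.
Proof.
move=> cd L2 qq [h1 h2]; split=> //.
apply: ac_ae h2.
  apply: (acLM cd h1 (g := fun t => q2 t + (z ^+ 2)%:C)).
  rewrite (_ : (fun t : RT => _) = (fun t : RT => q2 t * (ii c d t)%:C + (z ^+ 2)%:C * (ii c d t)%:C)); last first.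
    by apply/funext => t; rewrite mulrDl.
  by apply: cLD; [exact: cL_ii|apply: cLZ; apply: cL_r; exact: L1_ii1].
by apply: (ae_imp qq) => x h cx xd; rewrite h.
Qed.

Lemma wronskian q1 q2 z c d u u' w w' : c <= d -> sol q1 z c d u u' -> sol q2 z c d w w' ->
  (u' d * w d - u d * w' d) - (u' c * w c - u c * w' c) =
  cI (fun t : RT => (q1 t - q2 t) * (u t * w t) * (ii c d t)%:C).
Proof.
move=> cd [h1 h2] [g1 g2].
have := (acB (acM cd h2 g1) (acM cd h1 g2)).2 c d (lexx c) cd (lexx d) => ->.
congr cI; apply/funext => t; congr (_ * _).
by move: (q1 t) (q2 t) (_%:C) (u t) (w t) (u' t) (w' t) => a1 a2 a3 a4 a5 a6 a7; ring.
Qed.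

Section product.
Variables (a b : R) (A1 A2 : RT -> RT -> C).
Hypotheses (h1 : bk a b (- (2 * a)) A1) (h2 : bk a b (- (2 * a)) A2).

Let cut (x : R) : C := (ii a 0 x)%:C.
Let conv2 x s : C := cI (fun r : RT => A1 x (s - r) * A2 x r).
(* [1 + \int prodk x s e^{-zs} ds] is the product of the corresponding factors for
   [A1] and [A2], for [a <= x <= 0]. *)
Definition prodk (x s : RT) : C := cut x * (A1 x s + A2 x s + conv2 x s).

Let Lmax := - (2 * a) + 2 * b.

Let bnds : exists2 B, 0 <= B & (forall x s, n1 (A1 x s) <= B * ii 0 Lmax s) /\ (forall x s, n1 (A2 x s) <= B * ii 0 Lmax s).
Proof.
have [B1 B10 hB1] := bk_bnd_wide h1; have [B2 B20 hB2] := bk_bnd_wide h2.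
exists (Num.max B1 B2); first by rewrite le_max B10.
by split=> x s; [apply: le_trans (hB1 x s) _|apply: le_trans (hB2 x s) _];
  rewrite ler_wpM2r ?ii_ge0// le_max lexx ?orbT.
Qed.

Let H3 (p : (RT * RT)) (r : RT) : C := A1 p.1 (p.2 - r) * A2 p.1 r.

Let mH3 : cm (fun p : (RT * RT) * RT => H3 p.1 p.2).
Proof.
have m1 : cm (fun p : RT * RT => A1 p.1 p.2) by case: h1.
have m2 : cm (fun p : RT * RT => A2 p.1 p.2) by case: h2.
apply: cmM.
  have h : measurable_fun setT (fun p : (RT * RT) * RT => (p.1.1, p.1.2 - p.2)).
    apply: measurable_fun_pair; first exact: measurableT_comp.
    by apply: measurable_funB => //; exact: measurableT_comp.
  exact: (cm_comp m1 h).
have h : measurable_fun setT (fun p : (RT * RT) * RT => (p.1.1, p.2)).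
  by apply: measurable_fun_pair => //; exact: measurableT_comp.
exact: (cm_comp m2 h).
Qed.

Let bH3 : exists2 B, 0 <= B & forall p r, n1 (H3 p r) <= B * ii 0 Lmax r.
Proof.
have [B B0 [hB1 hB2]] := bnds; exists (B * B); first by rewrite mulr_ge0.
move=> p r; apply: le_trans (n1M _ _) _; rewrite -mulrA.
apply: ler_pM; rewrite ?n1_ge0//; apply: le_trans (hB1 _ _) _.
by rewrite ler_piMr// ii_le1.
Qed.

Let mconv2 : cm (fun p : RT * RT => conv2 p.1 p.2).
Proof.
have [B B0 hB] := bH3.
apply: (@cI_param _ _ _ H3 (fun r => B * ii 0 Lmax r)) => //.
by apply: L1Z; exact: L1_ii1.
Qed.

Let LH3 x s : cL (fun r : RT => A1 x (s - r) * A2 x r).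
Proof.
have [B B0 hB] := bH3; apply: (cL_le (g := fun r => B * ii 0 Lmax r)).
- exact: (cm_comp mH3 (measurable_pair1 ((x, s) : RT * RT))).
- by apply: L1Z; exact: L1_ii1.
- by move=> r; exact: (hB (x, s)).
Qed.

(** The convolution of two kernels lives on 0 <= s <= 4(x - a). As x <= 0, this is inside 0 <= s <=
    -4a + 2x, the slope 2 that [bk] demands; hence the cut at 0 and the constant -4a. *)
Lemma prodk_bk : bk a 0 (- (4 * a)) prodk.
Proof.
have [B B0 [hB1 hB2]] := bnds; have [B3 B30 hB3] := bH3.
split.
- apply: cmM; first by apply: cm_r; apply: meas_ii.
  by apply: cmD => //; apply: cmD; [case: h1|case: h2].
- exists (B + B + B3 * rI (ii 0 Lmax)).
    by rewrite !addr_ge0// mulr_ge0// rI_ge0// => r; exact: ii_ge0.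
  move=> x s; rewrite /prodk n1rM ger0_norm ?ii_ge0//; apply: (@le_trans _ _ (1 * n1 (A1 x s + A2 x s + conv2 x s))).
    by rewrite ler_wpM2r ?n1_ge0 ?ii_le1.
  rewrite mul1r; apply: le_trans (n1D _ _) _; apply: lerD.
    apply: le_trans (n1D _ _) _; apply: lerD; [apply: le_trans (hB1 x s) _|apply: le_trans (hB2 x s) _];
      by rewrite ler_piMr// ii_le1.
  rewrite -(rIZ _ (L1_ii1 0 Lmax)); apply: (cI_le (cL_cm (LH3 x s))); first by apply: L1Z; exact: L1_ii1.
  by move=> r; exact: (hB3 (x, s)).
- move=> x s; rewrite /prodk /cut; have [[_ ax x0]|[-> _]] := ii_case a 0 x; last by rewrite mul0r.
  rewrite ax x0 /= => hs.
  have K1 (A : RT -> RT -> C) : bk a b (- (2 * a)) A -> A x s = 0.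
    move=> hA; apply: (bk_zero hA); apply: contra hs => /andP[-> sx] /=.
    by apply: le_trans sx _; lra.
  rewrite (K1 _ h1) (K1 _ h2) !add0r (_ : conv2 x s = 0) ?mulr0//.
  transitivity (cI (fun=> 0 : C)); last exact: cI0.
  congr cI; apply/funext => r.
  have [/andP[r0 rx]|h] := boolP (0 <= r <= - (2 * a) + 2 * x); last by rewrite (bk_zero h2 h) mulr0.
  rewrite (bk_zero h1) ?mul0r//; apply: contra hs => /andP[s0 sx].
  by apply/andP; split; lra.
Qed.

(** Expanding (1 + p)(1 + q) = 1 + p + q + pq, where pq is the transform of the convolution in
    [s]. *)
Lemma prodk_Mk x z : a <= x -> x <= 0 -> Mk prodk x z = Mk A1 x z * Mk A2 x z.
Proof.
move=> ax x0; have [B B0 [hB1 hB2]] := bnds.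
have c1 : cut x = 1 by rewrite /cut ii_in.
have L1' := bk_L h1 x z; have L2' := bk_L h2 x z.
pose H (s r : R) : C := A1 x (s - r) * A2 x r * (expR (- z * s))%:C.
pose E := expR (`|z| * (Lmax + Lmax)).
have BE0 : 0 <= B * B * E by rewrite !mulr_ge0 ?expR_ge0.
have mH : cm (fun p : RT * RT => H p.1 p.2).
  apply: cmM; last by apply: cm_r; apply: meas_expR; exact: measurable_funM.
  have hm : measurable_fun setT (fun p : RT * RT => (((x : RT), p.1), p.2)).
    by apply: measurable_fun_pair => //; exact: measurable_fun_pair.
  exact: (cm_comp mH3 hm).
have bH s r : n1 (H s r) <= ii 0 (Lmax + Lmax) s * (B * B * E * ii 0 Lmax r).
  rewrite n1Mr ger0_norm ?expR_ge0//.
  have hb : n1 (A1 x (s - r) * A2 x r) <= (B * ii 0 Lmax (s - r)) * (B * ii 0 Lmax r).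
    by apply: le_trans (n1M _ _) _; apply: ler_pM; rewrite ?n1_ge0.
  apply: le_trans (ler_wpM2r (expR_ge0 _) hb) _.
  have [[-> r0 rL]|[-> _]] := ii_case 0 Lmax r; last by rewrite !(mulr0, mul0r).
  have [[-> s0 sL]|[-> _]] := ii_case 0 Lmax (s - r); last first.
    by rewrite !(mulr0, mul0r); apply: mulr_ge0; [exact: ii_ge0|rewrite mulr1; exact: BE0].
  have sp : 0 <= s by move: r0 s0; lra.
  have sm : s <= Lmax + Lmax by move: rL sL; lra.
  rewrite ii_in// !mulr1 mul1r ler_wpM2l ?mulr_ge0// ler_expR; apply: le_trans (ler_norm _) _.
  by rewrite normrM normrN (ger0_norm sp) ler_wpM2l.
have LB : L1 (fun r => B * B * E * ii 0 Lmax r) by apply: L1Z; exact: L1_ii1.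
have S1 := cI_swap mH (L1_ii1 0 (Lmax + Lmax)) LB bH (fun s => ii_ge0 _ _ s).
have eH s : conv2 x s * (expR (- z * s))%:C = cI (H s) by rewrite /conv2 -(cIZr _ (LH3 x s)).
have LH : cL (fun s : RT => cI (H s)).
  apply: (cL_le (g := fun s => rI (fun r => B * B * E * ii 0 Lmax r) * ii 0 (Lmax + Lmax) s)).
  - apply: (@cI_param _ _ _ H (fun r => B * B * E * ii 0 Lmax r)); [exact: mH|exact: LB|].
    move=> s r; apply: le_trans (bH s r) _; apply: ler_piMl; last exact: ii_le1.
    by apply: (mulr_ge0 BE0); exact: ii_ge0.
  - by apply: L1Z; exact: L1_ii1.
  - move=> s; rewrite mulrC -(rIZ _ LB); apply: cI_le; [exact: (cm_comp mH (measurable_pair1 (s : RT)))|exact: (L1Z _ LB)|exact: bH].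
have P : cI (fun s : RT => cI (H s)) = cI (fun s : RT => A1 x s * (expR (- z * s))%:C) * cI (fun s : RT => A2 x s * (expR (- z * s))%:C).
  rewrite S1 -(cIZ _ L2'); congr cI; apply/funext => r.
  have [l1 l2] := cI_affine (- r) (or_introl (erefl (1 : R))) L1'.
  rewrite -l2 -(cIZr _ l1); congr cI; apply/funext => s; rewrite /H mul1r.
  have -> : (expR (- z * s))%:C = (expR (- z * (s - r)))%:C * (expR (- z * r))%:C :> C.
    by rewrite rCM -expRD; congr (expR _)%:C; ring.
  by move: (A1 _ _) (A2 _ _) _%:C _%:C => p1 p2 p3 p4; ring.
rewrite /Mk (_ : cI (fun s : RT => prodk x s * (expR (- z * s))%:C) =
  cI (fun s : RT => A1 x s * (expR (- z * s))%:C) + cI (fun s : RT => A2 x s * (expR (- z * s))%:C) + cI (fun s : RT => cI (H s))).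
  by rewrite P; move: (cI _) (cI _) => p1 p2; ring.
rewrite -(cID L1' L2') -(cID (cLD L1' L2') LH); congr cI; apply/funext => s.
by rewrite -eH /prodk c1 mul1r !mulrDl.
Qed.

End product.
End Transforms.

(** * The uniqueness argument *)

Section Omega.
Context {R : realType}.
Notation mu := (@lebesgue_measure R).
Notation RT := (measurableTypeR R).
Notation C := R[i].
Implicit Types (x y t s : R).

Lemma bk_cut (c e d S : R) (A : RT -> RT -> C) : d <= e -> bk c e S A ->
  bk c d S (fun x s => (ii c d x)%:C * A x s).
Proof.
move=> de [m [B B0 hB] h]; split.
- by apply: cmM => //; apply: cm_r; exact: meas_ii.
- exists B => // x s; rewrite n1rM ger0_norm ?ii_ge0//; apply: le_trans (hB x s).
  by rewrite ler_piMl ?n1_ge0 ?ii_le1.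
- move=> x s; have [[-> cx xd]|[-> _]] := ii_case c d x; last by rewrite mul0r.
  by rewrite cx xd /= => hs; rewrite h ?mulr0// (negbTE hs) andbF.
Qed.

Lemma Fv_cut (v : RT -> C) (c d : R) (A : RT -> RT -> C) y :
  Fv v c d (fun x s => (ii c d x)%:C * A x s) y = Fv v c d A y.
Proof.
congr cI; apply/funext => x; have [[-> cx xd]|[-> _]] := ii_case c d x; last by rewrite !mul0r mulr0 !mul0r.
by congr (_ * _); congr (1 + cI _); apply/funext => s; rewrite ii_in// rC1 mul1r.
Qed.

Section omega.
Variables (c d e : R) (q : RT -> C) (A : RT -> RT -> C).
Hypotheses (d0 : 0 < d) (de : c + d <= e) (Lq : cL q) (kA : volterra_kernel q c e A).
Hypothesis hG : decay (fun y => (expR (2 * c * y))%:C * Fv q c e A y) (2 * d).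

Let ce : c <= e. Proof. by apply: le_trans de; rewrite lerDl ltW. Qed.
Let hA : bk c e (- (2 * c)) A. Proof. exact: kernel_bk kA. Qed.
(** Normalised so as to be bounded for y >= 0: the growth of [Mk A x (- y)] is at most
    e^{2y(x-c)}. *)
Let m y x : C := (expR (- (2 * y * (x - c))))%:C * Mk A x (- y).

Let Sc0 : 0 <= - (2 * c) + 2 * c. Proof. by rewrite addrC subrr. Qed.

Let mG y : (expR (2 * c * y))%:C * Fv q c e A y = cI (fun x : RT => q x * (ii c e x)%:C * m y x).
Proof.
rewrite /Fv -(cIZ _ (Fv_L hA Sc0 Lq y)); congr cI; apply/funext => x.
rewrite /m -!rCM (_ : expR (- (2 * y * (x - c))) = expR (2 * c * y) * expR (- (2 * y * x))); last first.
  by rewrite -expRD; congr expR; ring.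
by rewrite -!rCM; move: (q x) _%:C (expR _)%:C (expR _)%:C (Mk _ _ _) => a1 a2 a3 a4 a5; ring.
Qed.

Let m_cm y : cm (m y : RT -> C).
Proof.
apply: cmM; last exact: Mk_cm hA _.
apply: cm_r; apply: meas_expR; apply: measurableT_comp => //; apply: measurable_funM => //.
exact: measurable_funB.
Qed.

Let m_bnd : exists2 B, 0 <= B & forall y x, 0 <= y -> c <= x -> n1 (m y x) <= B.
Proof.
have [B B0 hB] := Mk_bnd hA; exists B => // y x y0 cx.
have x0 : 0 <= - (2 * c) + 2 * x by rewrite addrC -mulrBr mulr_ge0// subr_ge0.
rewrite /m n1rM ger0_norm ?expR_ge0//; apply: le_trans (ler_wpM2l (expR_ge0 _) (hB x (- y) x0)) _.
rewrite mulrCA -expRD normrN (ger0_norm y0) (_ : - (2 * y * (x - c)) + _ = 0) ?expR0 ?mulr1//; ring.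
Qed.

(** Kernel of the Volterra equation rewritten as an equation on all of [c, e]: 1 for t > x and
    e^{-2y(x-t)} for t < x. *)
Let Q y x t : R := (ii c e t - ii c x t) + ii c x t * expR (- (2 * y * (x - t))).

Let Q_ge0 y x t : x <= e -> 0 <= Q y x t.
Proof.
move=> xe; rewrite /Q addr_ge0 ?mulr_ge0 ?ii_ge0 ?expR_ge0// subr_ge0.
have [[-> ct tx]|[-> _]] := ii_case c x t; last exact: ii_ge0.
by rewrite ii_in// (le_trans tx xe).
Qed.

Let Q_le2 y x t : 0 <= y -> x <= e -> Q y x t <= 2.
Proof.
move=> y0 xe; rewrite /Q; have [[-> ct tx]|[-> _]] := ii_case c x t; last first.
  by rewrite mul0r addr0 subr0; apply: le_trans (ii_le1 _ _ _) _; rewrite ler1n.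
have h : expR (- (2 * y * (x - t))) <= 1.
  by rewrite -expR0 ler_expR oppr_le0 !mulr_ge0// subr_ge0.
by rewrite mul1r; have := ii_le1 c e t; move: (ii _ _ _) h => p h; lra.
Qed.

(** In the Volterra equation for [m] the factor 1 - e^{-2y(x-t)} on [c, x] is replaced by 1 on
    [c, e] minus [Q]. The full integral of [q * m] so split off is exactly the quantity that [hG]
    makes small. *)
Let m_eq y x : 0 < y -> c <= x -> x <= e ->
  cL (fun t : RT => q t * ((Q y x t)%:C * (m y t * (ii c e t)%:C))) /\
  m y x = (expR (- (2 * y * (x - c))))%:C + ((2 * y)^-1)%:C * (cI (fun t : RT => q t * (ii c e t)%:C * m y t) -
    cI (fun t : RT => q t * ((Q y x t)%:C * (m y t * (ii c e t)%:C)))).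
Proof.
move=> y0 cx xe; have y0' : y != 0 by rewrite gt_eqF.
have ny0 : - y != 0 by rewrite oppr_eq0.
have [B B0 hB] := m_bnd.
have b1 t : n1 (m y t * (ii c e t)%:C) <= B.
  rewrite n1Mr; have [[-> ct te]|[-> _]] := ii_case c e t; last by rewrite normr0 mulr0.
  by rewrite normr1 mulr1 hB// ltW.
have mQ : measurable_fun setT (Q y x : RT -> RT).
  apply: measurable_funD; first by apply: measurable_funB; exact: meas_ii.
  apply: measurable_funM; first exact: meas_ii.
  apply: meas_expR; apply: measurableT_comp => //; apply: measurable_funM => //.
  exact: measurable_funB.
have Lm : cL (fun t : RT => q t * (ii c e t)%:C * m y t).
  rewrite (_ : (fun t => _) = (fun t : RT => q t * (m y t * (ii c e t)%:C))).
    by apply: (cLM (K := B) Lq) => //; apply: cmM => //; exact: cm_ii.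
  by apply/funext => t; rewrite -mulrA [_%:C * _]mulrC.
have LQ : cL (fun t : RT => q t * ((Q y x t)%:C * (m y t * (ii c e t)%:C))).
  apply: (cLM (K := 2 * B) Lq).
    by apply: cmM; [exact: cm_r|apply: cmM => //; exact: cm_ii].
  move=> t; rewrite n1rM ger0_norm ?Q_ge0//; apply: ler_pM; rewrite ?Q_ge0 ?n1_ge0//.
  by rewrite Q_le2// ltW.
split=> //.
have := kA; case=> _ _ _ /(_ (- y) x ny0 cx xe) eM.
have LE := Ez_L c x Lq ny0.
have LEM : cL (fun t : RT => q t * (Ez (- y) (x - t) * ii c x t)%:C * Mk A t (- y)).
  have [BM BM0 hBM] := Mk_bnd hA.
  have hM t : c <= t -> t <= x -> n1 (Mk A t (- y)) <= BM * expR (y * (- (2 * c) + 2 * x)).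
    move=> ct tx; apply: le_trans (hBM t (- y) _) _; first by rewrite addrC -mulrBr mulr_ge0// subr_ge0.
    by rewrite normrN (gtr0_norm y0) ler_wpM2l// ler_expR ler_pM2l// lerD2l ler_pM2l.
  have := cm_bndL (cL_ii c x LE) (Mk_cm hA (- y)) hM; congr cL; apply/funext => t.
  have [[-> ct tx]|[-> _]] := ii_case c x t; last by rewrite !(mulr0, mul0r).
  by rewrite rC1 !mulr1.
rewrite -(cIB Lm LQ) {1}/m eM mulrDr mulr1 -(cIZ _ LEM) -(cIZ _ (cLB Lm LQ)); congr (_ + cI _); apply/funext => t.
have [[et ct tx]|[et hn]] := ii_case c x t; last first.
  rewrite /Q et mulr0 mulr0 mul0r mulr0 subr0 mul0r addr0.
  have [[-> _ _]|[-> _]] := ii_case c e t; last by rewrite !(mul0r, mulr0) subrr mulr0.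
  by rewrite rC1 !mulr1 mul1r subrr mulr0.
have te : t <= e := le_trans tx xe.
rewrite /Q et (ii_in ct te) subrr add0r mul1r !mulr1 ?rC1 ?mulr1 /m.
have -> : Ez (- y) (x - t) = (2 * y)^-1 * (expR (2 * y * (x - t)) - 1).
  by rewrite /Ez (_ : - (2 * - y * (x - t)) = 2 * y * (x - t)); [field|ring].
have e1 : expR (- (2 * y * (x - c))) * expR (2 * y * (x - t)) = expR (- (2 * y * (t - c))).
  by rewrite -expRD; congr expR; ring.
have e2 : expR (- (2 * y * (x - t))) * expR (- (2 * y * (t - c))) = expR (- (2 * y * (x - c))).
  by rewrite -expRD; congr expR; ring.
transitivity (((2 * y)^-1)%:C * (q t * ((expR (- (2 * y * (x - c))) * expR (2 * y * (x - t)) - expR (- (2 * y * (x - c))))%:C * Mk A t (- y)))).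
  rewrite -rCM rCB rCB rC1 -rCM; move: (q t) (Mk _ _ _) _%:C _%:C _%:C => a1 a2 a3 a4 a5; ring.
rewrite e1 rCB -e2 -rCM; move: (q t) (Mk _ _ _) _%:C _%:C _%:C => a1 a2 a3 a4 a5; ring.
Qed.

(** Free solution plus the size of the forcing term; [Qw] states that this shape is stable under
    [Q]. *)
Let w (c' y x : R) : R := expR (- (2 * y * (x - c))) + expR (- c' * y).

Let w_ge0 c' y x : 0 <= w c' y x. Proof. by rewrite addr_ge0 ?expR_ge0. Qed.

Let Qw c' y x t : 0 <= y -> c <= x -> c <= t -> t <= e -> Q y x t * w c' y t <= w c' y x.
Proof.
move=> y0 cx ct te; rewrite /Q (ii_in ct te).
have [[-> _ tx]|[-> h]] := ii_case c x t.
  rewrite subrr add0r mul1r /w mulrDr -expRD; apply: lerD.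
    by rewrite ler_expR le_eqVlt (_ : _ + _ = - (2 * y * (x - c))) ?eqxx//; ring.
  by rewrite ler_piMl ?expR_ge0// -expR0 ler_expR oppr_le0 !mulr_ge0// subr_ge0.
rewrite mul0r addr0 subr0 mul1r lerD2r ler_expR lerN2 ler_wpM2l ?mulr_ge0// lerB//.
by apply: ltW; rewrite ltNge; apply: contra h => h; rewrite ct h.
Qed.

Let N := rI (fun x => n1 (q x)).
Let N0 : 0 <= N. Proof. by apply: rI_ge0 => x; exact: n1_ge0. Qed.

Let m_decay c' : c' < 2 * d -> exists K Y, forall y, Y <= y ->
  [/\ 0 < y, 0 <= K, n1 (cI (fun t : RT => q t * (ii c e t)%:C * m y t)) <= K * expR (- c' * y) &
   forall x, c <= x -> x <= e -> n1 (m y x) <= K * w c' y x].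
Proof.
move=> c'd; have [K1 [Y1 [K10 Y11 h1]]] := (decayP _ _).1 hG c' c'd.
(* With y > N the operator in [m_eq] has norm at most N / (2y) <= 1/2 in the weight [w];
   [weight_contr] then doubles the constant 1 + K1 of the inhomogeneous terms. *)
exists (2 * (1 + K1)), (Num.max Y1 (N + 1)) => y; rewrite ge_max => /andP[yY yN].
have y1 : 1 <= y by apply: le_trans Y11 yY.
have y0 : 0 < y by exact: lt_le_trans ltr01 y1.
have hGy : n1 (cI (fun t : RT => q t * (ii c e t)%:C * m y t)) <= K1 * expR (- c' * y).
  by rewrite -mG; exact: h1.
have [B B0 hB] := m_bnd.
split => //.
- by rewrite mulr_ge0// addr_ge0// ltW.
- by apply: le_trans hGy _; rewrite ler_wpM2r ?expR_ge0//; move: K10; lra.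
have C0 : 0 <= 1 + K1 by rewrite addr_ge0// ltW.
have w0 : 0 < expR (- c' * y) by exact: expR_gt0.
have K00 : 0 <= B / expR (- c' * y) by rewrite divr_ge0// ltW.
apply: (weight_contr C0 K00).
  move=> x cx xe; apply: le_trans (hB y x (ltW y0) cx) _.
  rewrite /w mulrDr -[leLHS]add0r; apply: lerD; first by rewrite mulr_ge0 ?expR_ge0.
  by rewrite divfK ?gt_eqF.
move=> K KK hK x cx xe; have [LQ ->] := m_eq y0 cx xe.
have bI : n1 (cI (fun t : RT => q t * ((Q y x t)%:C * (m y t * (ii c e t)%:C)))) <= K * w c' y x * N.
  rewrite -(rIZ _ (cL_n1 Lq)); apply: (cI_le (cL_cm LQ)); first by apply: L1Z; exact: cL_n1.
  move=> t; apply: le_trans (n1M _ _) _; rewrite mulrC ler_wpM2r ?n1_ge0//.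
  rewrite n1rM ger0_norm ?Q_ge0// n1Mr.
  have [[-> ct te]|[-> _]] := ii_case c e t; last by rewrite normr0 !mulr0 mulr_ge0.
  rewrite normr1 mulr1; apply: le_trans (ler_wpM2l (Q_ge0 _ _ xe) (hK t ct te)) _.
  by rewrite mulrCA ler_wpM2l// Qw// ltW.
apply: le_trans (n1D _ _) _; rewrite n1_r ger0_norm ?expR_ge0// n1rM ger0_norm; last by rewrite invr_ge0 mulr_ge0// ltW.
have b2 := le_trans (n1B _ _) (lerD hGy bI).
apply: le_trans (lerD (lexx _) (ler_wpM2l _ b2)) _; first by rewrite invr_ge0 mulr_ge0// ltW.
have wE : expR (- (2 * y * (x - c))) + expR (- c' * y) = w c' y x by [].
have hi : (2 * y)^-1 <= 1 by rewrite invf_le1 ?mulr_gt0//; move: y1; lra.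
have hN : (2 * y)^-1 * N <= 2^-1.
  by rewrite invfM -mulrA ler_piMr// ler_pdivrMl// mulr1; apply: le_trans yN; rewrite lerDl.
rewrite [leRHS]mulrDl [(_ + _) * w _ _ _]mulrDl mul1r [(2 * y)^-1 * _]mulrDr addrA; apply: lerD.
  apply: lerD; first by rewrite -wE lerDl ltW.
  apply: (@le_trans _ _ (K1 * expR (- c' * y))); first by rewrite ler_piMl// mulr_ge0// ltW.
  by rewrite ler_wpM2l// ?(ltW K10)// -wE lerDr expR_ge0.
rewrite (_ : _ * (K * w c' y x * N) = ((2 * y)^-1 * N) * (K * w c' y x)); last by ring.
by rewrite [K / 2 * _]mulrAC [K * _ / 2]mulrC ler_wpM2r// mulr_ge0.
Qed.

(** [U_unique] needs decay matched to the right end of the interval, whereas [hG] has only the rate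
    belonging to [c, c + d] for an integral over [c, e]. By [m_decay] the solution is as small as
    e^{-c'y} beyond c + d, so the integral over [c + d, e] may be dropped and [U_unique] applies on
    [c, c + d]. *)
Lemma near_zero : {ae mu, forall x, c <= x -> x <= c + d -> q x = 0}.
Proof.
have cd : c <= c + d by rewrite lerDl ltW.
apply: (@U_unique R c (c + d) (- (2 * c)) _ q (bk_cut de hA)) => //.
have key : decay (fun y => (expR (2 * c * y))%:C * Fv q c (c + d) A y) (2 * d).
  move=> c' c'd; have [K [Y hK]] := m_decay c'd.
  exists (K + K * N * 2), Y => y Yy; have [y0 K0 h1 h2] := hK y Yy.
  have [B B0 hB] := m_bnd.
  have L2 p : p <= e -> cL (fun t : RT => q t * (ii c p t)%:C * m y t).
    move=> pe; have := @cm_bndL R q (m y) B c p (cL_ii c p Lq) (m_cm y) (fun x cx _ => hB y x (ltW y0) cx).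
    by congr cL; apply/funext => t; rewrite mulrAC.
  have -> : (expR (2 * c * y))%:C * Fv q c (c + d) A y = cI (fun x : RT => q x * (ii c (c + d) x)%:C * m y x).
    rewrite -(@Fv_cut q c (c + d)) /Fv -(cIZ _ (Fv_L (bk_cut de hA) Sc0 Lq y)); congr cI; apply/funext => x.
    have [[-> cx xd]|[-> _]] := ii_case c (c + d) x; last by rewrite !mul0r !mulr0 !mul0r mulr0.
    have -> : Mk (fun x0 s => (ii c (c + d) x0)%:C * A x0 s) x (- y) = Mk A x (- y).
      by congr (1 + cI _); apply/funext => s; rewrite ii_in// rC1 mul1r.
    rewrite /m (_ : expR (- (2 * y * (x - c))) = expR (2 * c * y) * expR (- (2 * y * x))); last first.
      by rewrite -expRD; congr expR; ring.
    by rewrite mul1r -!rCM; move: (q x) (expR _)%:C (expR _)%:C (Mk _ _ _) => a1 a3 a4 a5; ring.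
  rewrite -[X in n1 X](subKr (cI (fun t : RT => q t * (ii c e t)%:C * m y t))).
  rewrite mulrDl; apply: le_trans (n1B _ _) _; apply: lerD; first exact: h1.
  rewrite -(cIB (L2 e (lexx e)) (L2 (c + d) de)).
  rewrite (_ : K * N * 2 * expR (- c' * y) = (K * (2 * expR (- c' * y))) * N); last by ring.
  rewrite -(rIZ _ (cL_n1 Lq)); apply: cI_le.
  - exact: cL_cm (cLB (L2 e (lexx e)) (L2 (c + d) de)).
  - by apply: L1Z; exact: cL_n1.
  move=> t; rewrite -mulrBl -mulrBr -rCB mulrAC n1Mr [n1 (q t * _)]/(n1 _).
  apply: le_trans (ler_wpM2r (normr_ge0 _) (n1M _ _)) _.
  have [[-> ct te]|[-> h]] := ii_case c e t; last first.
    have -> : ii c (c + d) t = 0.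
      have [[_ g1 g2]|[-> _]] // := ii_case c (c + d) t.
      by move: h; rewrite g1 (le_trans g2 de).
    by rewrite subrr normr0 mulr0 !mulr_ge0 ?n1_ge0 ?expR_ge0.
  have [[-> _ _]|[-> h]] := ii_case c (c + d) t.
    by rewrite subrr normr0 mulr0 !mulr_ge0 ?n1_ge0 ?expR_ge0.
  rewrite subr0 normr1 mulr1 mulrC ler_wpM2r ?n1_ge0//; apply: le_trans (h2 t ct te) _.
  rewrite ler_wpM2l// /w (_ : 2 * expR (- c' * y) = expR (- c' * y) + expR (- c' * y)); last by rewrite mulr_natl mulr2n.
  rewrite lerD2r ler_expR mulNr lerN2.
  have td : c + d < t by rewrite ltNge; apply: contra h => h; rewrite ct h.
  apply: (@le_trans _ _ (2 * d * y)); first by rewrite ler_wpM2r// ltW.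
  rewrite mulrAC ler_wpM2l ?mulr_ge0// ?(ltW y0)//; rewrite lerBrDl; exact: ltW.
have := decayM (@decay_ex R (2 * c)) key; rewrite -mulrDr.
apply: (decay_near (Y0 := 0)) => y _; rewrite mulrA rCM -expRD (@Fv_cut q c (c + d)).
by rewrite mulNr addNr expR0 mul1r.
Qed.

End omega.
End Omega.

(** * A functional differential equation of advanced type *)

Section Ladder.
Context {R : realType}.
Notation mu := (@lebesgue_measure R).
Notation RT := (measurableTypeR R).
Notation C := R[i].
Notation re := (@complex.Re R).
Notation im := (@complex.Im R).
Implicit Types (x y t s : R) (f : RT -> C).

Lemma cc_int_zero f (p q : R) : cc f -> (forall s t, p < s -> s <= t -> t < q -> cI (fun r : RT => f r * (ii s t r)%:C) = 0) ->
  forall t, p < t -> t < q -> f t = 0.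
Proof.
move=> [f1 f2] h t pt tq.
have K (h0 : R -> R) : continuous h0 -> (forall s u, p < s -> s <= u -> u < q -> rI (fun r => h0 r * ii s u r) = 0) -> h0 t = 0.
  move=> ch hh; apply: (ae_cont ch (p := p) (q := q)) => //.
  have Lh : L1 (fun r => h0 r * ii p q r).
    apply/L1_ii; first exact: continuous_measurable_fun.
    by apply: continuous_compact_integrable; [exact: segment_compact|exact: continuous_subspaceT].
  have hb : {ae mu, forall x, p < x -> x < q -> `|h0 x * ii p q x| <= 0}.
    apply: ae_bound => // s u ps su uq; rewrite mul0r.
    rewrite (_ : (fun t => _) = (fun r => h0 r * ii s u r)) ?hh ?normr0//.
    by apply/funext => r; rewrite -mulrA ii_sub// ltW.
  apply: (ae_imp hb) => x hx px xq; have := hx px xq.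
  by rewrite ii_in ?(ltW px) ?(ltW xq)// mulr1 normr_le0 => /eqP.
apply: Ceq; [apply: (K _ f1) => s u ps su uq|apply: (K _ f2) => s u ps su uq].
  have := congr1 re (h s u ps su uq); rewrite /= => <-; congr rI; apply/funext => r.
  by rewrite /= reM im_r re_r mulr0 subr0.
have := congr1 im (h s u ps su uq); rewrite /= => <-; congr rI; apply/funext => r.
by rewrite /= imM im_r re_r mulr0 add0r.
Qed.

Section Lam.
Variables (c0 : C) (g : RT -> C) (B L K : R).
Hypotheses (mg : cm g) (B0 : 0 <= B) (bg : forall s, n1 (g s) <= B * ii 0 L s) (K0 : 0 <= K).

(** The right-hand side of f' = c0 f - \int g(r) f(. + r) dr. It looks ahead by at most [L], hence
    preserves growth of order e^{Kt} and acts boundedly there, with norm [Cn] at most. *)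
Definition Lam f (t : RT) : C := c0 * f t - cI (fun r : RT => g r * f (t + r)).

Let good f M := cc f /\ forall t, n1 (f t) <= M * expR (K * t).

Let Lam_dom f M t r : good f M -> 0 <= M -> n1 (g r * f (t + r)) <= (M * expR (K * t)) * (B * expR (K * L) * ii 0 L r).
Proof.
move=> [_ bf] M0; apply: le_trans (n1M _ _) _.
have := bg r; have [[-> r0 rL]|[-> _]] := ii_case 0 L r; last first.
  by rewrite !mulr0 => /n1_eq0 ->; rewrite n1_0 mul0r.
rewrite !mulr1 => hb; rewrite mulrC; apply: le_trans (ler_pM (n1_ge0 _) (n1_ge0 _) (bf _) hb) _.
rewrite -[leLHS]mulrA [leRHS](_ : _ = M * (expR (K * t) * expR (K * L) * B)); last by ring.
by rewrite ler_wpM2l// ler_wpM2r// -expRD ler_expR mulrDr lerD2l ler_wpM2l.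
Qed.

Let Lam_L f M t : good f M -> 0 <= M -> cL (fun r : RT => g r * f (t + r)).
Proof.
move=> hf M0; apply: (cL_le (g := fun r => (M * expR (K * t)) * (B * expR (K * L) * ii 0 L r))).
- apply: cmM => //; apply: cc_cm; apply: (cc_comp hf.1) => x.
  by apply: cvgD; [exact: cvg_cst|exact: cvg_id].
- by do 2 apply: L1Z; exact: L1_ii1.
- by move=> r; exact: Lam_dom.
Qed.

Let Cn := n1 c0 + rI (fun r => B * expR (K * L) * ii 0 L r) + 1.

Let Cn1 : 1 <= Cn.
Proof.
by rewrite lerDr addr_ge0 ?n1_ge0// rI_ge0// => r; rewrite !mulr_ge0 ?expR_ge0 ?ii_ge0.
Qed.

Let Lam_good f M : good f M -> 0 <= M -> good (Lam f) (Cn * M).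
Proof.
move=> hf M0; have LB : L1 (fun r => B * expR (K * L) * ii 0 L r) by apply: L1Z; exact: L1_ii1.
split.
  apply: ccB; first exact: ccZ hf.1.
  apply: (cI_cont (f := fun t r => g r * f (t + r))).
  - by move=> t; exact: cL_cm (Lam_L t hf M0).
  - move=> r; apply: ccM; first exact: cc_cst.
    by apply: (cc_comp hf.1) => x; apply: cvgD; [exact: cvg_id|exact: cvg_cst].
  - move=> a; exists (fun r => (M * expR (K * (a + 1))) * (B * expR (K * L) * ii 0 L r)); first exact: L1Z.
    move=> t r _ ta; apply: le_trans (Lam_dom t r hf M0) _; apply: ler_wpM2r.
      by rewrite !mulr_ge0 ?expR_ge0 ?ii_ge0.
    by rewrite ler_wpM2l// ler_expR ler_wpM2l// ltW.
move=> t; apply: le_trans (n1B _ _) _.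
have E0 : 0 <= M * expR (K * t) by rewrite mulr_ge0 ?expR_ge0.
rewrite -mulrA /Cn [leRHS]mulrDl; apply: (@le_trans _ _ ((n1 c0 + rI (fun r => B * expR (K * L) * ii 0 L r)) * (M * expR (K * t)))); last first.
  by rewrite mul1r lerDl.
rewrite mulrDl; apply: lerD.
  by apply: le_trans (n1M _ _) _; rewrite ler_wpM2l ?n1_ge0//; exact: hf.2.
rewrite [leRHS]mulrC -(rIZ _ LB); apply: (cI_le (cL_cm (Lam_L t hf M0))); first exact: L1Z.
by move=> r; exact: Lam_dom.
Qed.

Let rel f := forall s t, 0 <= s -> s <= t -> f t - f s = cI (fun r : RT => Lam f r * (ii s t r)%:C).

Let good_Lii f M s t : good f M -> s <= t -> cL (fun r : RT => f r * (ii s t r)%:C).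
Proof.
move=> [cf bf] st; have [Bf Bf0 hBf] := cc_bnd st cf.
have h1 : cL (fun r : RT => (1 : C) * (ii s t r)%:C).
  by rewrite (_ : (fun r => _) = (fun r : RT => (ii s t r)%:C)); [exact: cL_r (L1_ii1 s t)|apply/funext => r; rewrite mul1r].
have := cm_bndL (f := fun=> 1) h1 (cc_cm cf) hBf; congr cL; apply/funext => r; by rewrite mul1r.
Qed.

(** [Lam] commutes with translations and so with integration. Only times s + r >= 0 are involved, as
    [g] vanishes for negative r. *)
Let Lam_rel f M : good f M -> 0 <= M -> rel f -> rel (Lam f).
Proof.
move=> hf M0 hr s t s0 st.
have hL := Lam_good hf M0.
have CM : 0 <= Cn * M by rewrite mulr_ge0// (le_trans ler01 Cn1).
pose h := Lam f.
have Lst : cL (fun r : RT => h r * (ii s t r)%:C) by exact: good_Lii hL st.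
pose H (r tau : R) : C := g r * (h (tau + r) * (ii s t tau)%:C).
have mh : cm h by exact: cc_cm hL.1.
have mH : cm (fun p : RT * RT => H p.1 p.2).
  apply: cmM; first exact: (cm_comp mg).
  apply: cmM; last by apply: cm_r; exact: meas_ii.
  have hm : measurable_fun setT (fun p : RT * RT => p.2 + p.1 : RT) by exact: measurable_funD.
  exact: (cm_comp mh hm).
pose D := Cn * M * expR (K * t).
have D0 : 0 <= D by rewrite /D; apply: mulr_ge0; [exact: CM|exact: expR_ge0].
have bH r tau : n1 (H r tau) <= (B * expR (K * L) * ii 0 L r) * (D * ii s t tau).
  rewrite /H mulrA n1Mr ger0_norm ?ii_ge0//.
  have [[-> s1 t1]|[-> _]] := ii_case s t tau; last by rewrite !mulr0.
  rewrite !mulr1 [leRHS]mulrC; apply: le_trans (Lam_dom tau r hL CM) _.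
  apply: ler_wpM2r; first by rewrite !mulr_ge0 ?expR_ge0 ?ii_ge0.
  by rewrite /D; apply: ler_wpM2l => //; rewrite ler_expR; apply: ler_wpM2l.
have LB : L1 (fun r => B * expR (K * L) * ii 0 L r) by apply: L1Z; exact: L1_ii1.
have LD : L1 (fun tau => D * ii s t tau) by apply: L1Z; exact: L1_ii1.
have B1 r : 0 <= B * expR (K * L) * ii 0 L r by rewrite !mulr_ge0 ?expR_ge0 ?ii_ge0.
have S1 := cI_swap mH LB LD bH B1.
have E1 : cI (fun r : RT => g r * f (t + r)) - cI (fun r : RT => g r * f (s + r)) = cI (fun r : RT => cI (H r)).
  rewrite -(cIB (Lam_L t hf M0) (Lam_L s hf M0)); congr cI; apply/funext => r.
  rewrite -mulrBr; have [h0|h0] := boolP ((0 <= r) && (r <= L)); last first.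
    have gr : g r = 0 by apply: n1_eq0; apply: le_trans (bg r) _; rewrite /ii (negbTE h0) mulr0.
    rewrite gr mul0r; transitivity (cI (fun=> 0 : C)); first by rewrite cI0.
    by congr cI; apply/funext => tau; rewrite /H gr mul0r.
  have /andP[r0 rL] := h0.
  have srt : s + r <= t + r by rewrite lerD2r.
  rewrite (hr (s + r) (t + r) (addr_ge0 s0 r0) srt).
  have [l1 l2] := cI_affine r (or_introl (erefl (1 : R))) (good_Lii hL srt).
  rewrite -l2 -(cIZ _ l1); congr cI; apply/funext => tau; rewrite /H mul1r; congr (_ * (_ * _%:C)).
  by rewrite /ii !lerD2r.
have LH : cL (fun tau : RT => cI (fun r : RT => H r tau)).
  apply: (cL_le (g := fun tau => rI (fun r => B * expR (K * L) * ii 0 L r) * (D * ii s t tau))).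
  - rewrite (_ : (fun tau => _) = (fun tau : RT => cI (fun r : RT => g r * h (tau + r)) * (ii s t tau)%:C)); last first.
      by apply/funext => tau; rewrite -(cIZr _ (Lam_L tau hL CM)); congr cI; apply/funext => r; rewrite /H mulrA.
    apply: cmM; last exact: cm_ii.
    have := cmB (cmM (cm_cst _ c0) mh) (cc_cm (Lam_good hL CM).1); congr cm; apply/funext => tau.
    by rewrite /Lam -/h opprB addrC subrK.
  - exact: (L1Z _ LD).
  - move=> tau; rewrite mulrC -(rIZ _ LB); apply: cI_le.
    + exact: (cm_comp mH (measurable_pair2 (tau : RT))).
    + exact: (L1Z _ LB).
    + by move=> r; rewrite mulrC; exact: bH.
have -> : Lam f t - Lam f s = c0 * (f t - f s) - (cI (fun r : RT => g r * f (t + r)) - cI (fun r : RT => g r * f (s + r))).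
  by rewrite /Lam; move: (cI _) (cI _) (f t) (f s) => p1 p2 p3 p4; ring.
rewrite E1 S1 (hr s t s0 st) -(cIZ _ Lst) -(cIB (cLZ _ Lst) LH); congr cI; apply/funext => tau.
have -> : Lam (Lam f) tau = c0 * h tau - cI (fun r : RT => g r * h (tau + r)) by [].
rewrite [RHS]mulrBl -[X in _ = X - _]mulrA; congr (_ - _).
rewrite -(cIZr _ (Lam_L tau hL CM)); congr cI; apply/funext => r; by rewrite /H mulrA.
Qed.

(* Every iterate [F n] of [Lam] vanishes on the initial interval, so [F n] is the
   integral of [F n.+1] from [del / 2]; [m] such steps gain [2^-m] in a norm with
   exponential weight, against the growth [Cn^n] of the iterates. *)
Lemma ladder f M (del : R) : 0 < del -> 0 <= M -> cc f -> (forall t, n1 (f t) <= M * expR (K * t)) ->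
  (forall s t, 0 <= s -> s <= t -> f t - f s = cI (fun r : RT => Lam f r * (ii s t r)%:C)) ->
  (forall t, 0 <= t -> t < del -> f t = 0) -> forall t, 0 <= t -> f t = 0.
Proof.
move=> d0 M0 cf bf hr hz.
have C0 : 0 <= Cn := le_trans ler01 Cn1.
pose F n := iter n Lam f.
have FS n : F n.+1 = Lam (F n) by [].
have HF n : good (F n) (Cn ^+ n * M) /\ rel (F n).
  elim: n => [|n [IH1 IH2]]; first by rewrite expr0 mul1r.
  have Mn : 0 <= Cn ^+ n * M by rewrite mulr_ge0 ?exprn_ge0.
  by rewrite FS exprS -mulrA; split; [exact: Lam_good|exact: Lam_rel IH1 Mn IH2].
have Z n t : 0 < t -> t < del -> F n t = 0.
  elim: n t => [|n IH] t t0 td; first by apply: hz => //; exact: ltW.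
  apply: (cc_int_zero (HF n.+1).1.1 (p := 0) (q := del)) => // s u s0 su ud.
  rewrite FS -((HF n).2 s u (ltW s0) su) (IH u (lt_le_trans s0 su) ud).
  by rewrite (IH s s0 (le_lt_trans su ud)) subrr.
(* The iterates are shown to vanish on the open interval ]0, del[ only, so integration starts at an
   interior point. *)
pose p := del / 2.
have p0 : 0 < p by rewrite divr_gt0.
have pd : p < del by rewrite /p; move: d0; lra.
move=> T T0; have [Tp|pT] := ltP T p; first by apply: hz => //; exact: lt_trans Tp pd.
pose D := M * expR (K * T).
have D0 : 0 <= D by rewrite mulr_ge0 ?expR_ge0.
have Cp : 0 < Cn := lt_le_trans ltr01 Cn1.
(* The rate 2 Cn makes one integration gain 1 / (2 Cn), which pays the factor Cn of the next iterate
   and leaves 1/2. *)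
have H m : forall n t, p <= t -> t <= T -> n1 (F n t) <= Cn ^+ n * D * 2^-1 ^+ m * expR (2 * Cn * t).
  elim: m => [|m IH] n t pt tT.
    have t0 : 0 <= t := le_trans (ltW p0) pt.
    rewrite expr0 mulr1; apply: (@le_trans _ _ (Cn ^+ n * D)).
      apply: le_trans ((HF n).1.2 t) _; rewrite -mulrA; apply: ler_wpM2l; first by rewrite exprn_ge0.
      by rewrite /D; apply: ler_wpM2l => //; rewrite ler_expR; apply: ler_wpM2l.
    rewrite ler_peMr//; first by apply: mulr_ge0; rewrite ?exprn_ge0.
    by rewrite -[leLHS]expR0 ler_expR !mulr_ge0.
  have e : F n t = cI (fun r : RT => F n.+1 r * (ii p t r)%:C).
    by rewrite FS -(HF n).2 ?(ltW p0)// (Z n p p0 pd) subr0.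
  have Le : L1 (fun r => expR (2 * Cn * r) * ii 0 t r) by exact: L1_exp.
  pose k := Cn ^+ n.+1 * D * 2^-1 ^+ m.
  have k0 : 0 <= k by rewrite !mulr_ge0 ?exprn_ge0 ?invr_ge0.
  rewrite e; apply: (@le_trans _ _ (rI (fun r => k * (expR (2 * Cn * r) * ii 0 t r)))).
    apply: cI_le.
    - by apply: cmM; [exact: cc_cm (HF n.+1).1.1|exact: cm_ii].
    - exact: (L1Z _ Le).
    - move=> r; rewrite n1Mr ger0_norm ?ii_ge0//.
      have [[-> r0 rt]|[-> _]] := ii_case p t r; last first.
        by rewrite mulr0; apply: (mulr_ge0 k0); rewrite mulr_ge0 ?expR_ge0 ?ii_ge0.
      rewrite (ii_in (le_trans (ltW p0) r0) rt) !mulr1; apply: IH => //; exact: le_trans rt tT.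
  rewrite (rIZ _ Le); have C2 : 0 < 2 * Cn by rewrite mulr_gt0.
  apply: le_trans (ler_wpM2l k0 (rI_exp_bound t C2)) _.
  rewrite /k le_eqVlt; apply/orP; left; apply/eqP; rewrite !exprS.
  by field; rewrite gt_eqF.
apply: n1_eq0.
have cv : (fun m : nat => (D * expR (2 * Cn * T)) * 2^-1 ^+ m) @ \oo --> (D * expR (2 * Cn * T)) * 0.
  apply: cvgM; first exact: cvg_cst.
  by apply: cvg_expr; rewrite ger0_norm ?invr_ge0// invf_lt1// ltr1n.
rewrite mulr0 in cv; apply: (closed_cvg (fun y : R => n1 (f T) <= y)) cv; first exact: closed_ge.
apply: nearW => m; have := H m 0%N T pT (lexx T); rewrite expr0 mul1r.
by rewrite mulrAC.
Qed.

End Lam.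
End Ladder.

(** * From the transformed Wronskian identity to psi = 0 *)

Section Liouville.
Context {R : realType}.
Notation RT := (measurableTypeR R).
Notation C := R[i].
Implicit Types (x y t s T : R) (f k : RT -> C).

Lemma nice_shift f (s0 : R) : nice f -> 0 <= s0 -> nice (fun t => f (t - s0)).
Proof.
move=> [m z [M [K [M0 K0 b]]]] h; split.
- have hm : measurable_fun setT (fun t : RT => t - s0 : RT) by exact: measurable_funB.
  exact: (cm_comp m hm).
- by move=> t t0; apply: z; move: t0 h; lra.
- exists M, K; split=> // t; apply: le_trans (b _) _; rewrite ler_wpM2l// ler_expR ler_wpM2l// gerBl//.
Qed.

Lemma rep_shift T F f (s0 : R) : nice f -> 0 <= s0 -> rep T F f ->
  rep (T + s0) (fun y => (expR (- s0 * y))%:C * F y) (fun t => f (t - s0)).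
Proof.
move=> nf h hr; have := decayM (@decay_ex R s0) hr; rewrite addrC.
apply: (decay_near (Y0 := 0)) => y _; rewrite mulrBr; congr (_ - _).
have L := LT_L T y nf.
have [l1 l2] := cI_affine (- s0) (or_introl (erefl (1 : R))) L.
rewrite /LT -l2 -(cIZ _ l1); congr cI; apply/funext => t; rewrite mul1r.
have [h0|h0] := ltP (t - s0) 0; first by rewrite (nice_neg nf h0) !mul0r mulr0.
have -> : ii 0 T (t - s0) = ii 0 (T + s0) t.
  by rewrite /ii h0 lerBlDr (_ : 0 <= t)// ; move: h h0; lra.
rewrite (_ : expR (- y * t) = expR (- s0 * y) * expR (- y * (t - s0))); last by rewrite -expRD; congr expR; ring.
by rewrite -!rCM; move: (f _) _%:C _%:C _%:C => a1 a2 a3 a4; ring.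
Qed.

Lemma rep_inj T F f g : nice f -> nice g -> cc f -> cc g -> rep T F f -> rep T F g ->
  forall t, t < T -> f t = g t.
Proof.
move=> nf ng cf cg rf rg t tT.
have h := repB nf ng rf rg.
have := lerch_rep (niceB nf ng) (ccB cf cg) h _ (lexx T) tT.
move=> /(_ _)/eqP; rewrite subr_eq0 => H; apply/eqP; apply: H.
have : decay (fun _ => 0 : C) T by move=> c' _; exists 0, 0 => y _; rewrite n1_0 mul0r.
by apply: (decay_near (Y0 := 0)) => y _; rewrite subrr.
Qed.

(** Division of a transform by [y] is convolution with [heaviside], that is, integration. *)
Lemma cvl_one k t : nice k -> cL (fun s : RT => k s * ((s <= t)%R%:R : R)%:C) /\
  cvl k heaviside t = cI (fun s : RT => k s * ((s <= t)%R%:R : R)%:C).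
Proof.
move=> nk; have [l1 l2] := cI_affine t (or_intror (erefl (-1 : R))) (cvl_L t nk heaviside_nice).
have E : (fun x : RT => k (t - (-1 * x + t)) * heaviside (-1 * x + t)) = (fun s : RT => k s * ((s <= t)%R%:R : R)%:C).
  apply/funext => s; rewrite mulN1r opprD opprK addrCA subrr addr0 /heaviside; congr (_ * (_%:R)%:C).
  by rewrite addrC subr_ge0.
by rewrite E in l1 l2; split=> //; rewrite /cvl l2.
Qed.

Lemma cvl_one_incr k u t : nice k -> u <= t ->
  cvl k heaviside t - cvl k heaviside u = cI (fun s : RT => k s * (ii u t s)%:C).
Proof.
move=> nk ut; have [l1 ->] := cvl_one t nk; have [l2 ->] := cvl_one u nk.
rewrite -(cIB l1 l2); apply: cI_ae; first exact: cLB.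
  have := cL_ii u t l1; congr cL; apply/funext => s; rewrite -mulrA rCM; congr (_ * _%:C).
  have [[-> us st]|[-> _]] := ii_case u t s; last by rewrite mulr0.
  by rewrite st mulr1.
apply: (ae_imp (ae_neq u)) => s su; rewrite -mulrBr -rCB; congr (_ * _%:C).
rewrite /ii; case: (ltgtP s u) => [h|h|//]; last by rewrite subr0.
by rewrite (ltW (lt_le_trans h ut)) subrr.
Qed.

(** At -y the transform of [g] grows like e^{Ly}; multiplied by e^{-Ly} it becomes the transform of
    the reversed kernel, an ordinary original. *)
Lemma gh_rev (g : RT -> C) L y : cL (fun s : RT => g s * (expR (- (- y) * s))%:C) ->
  (expR (- L * y))%:C * gh g (- y) = gh (fun s => g (L - s)) y.
Proof.
move=> Lg; have [l1 l2] := cI_affine L (or_intror (erefl (-1 : R))) Lg.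
rewrite /gh -l2 -(cIZ _ l1); congr cI; apply/funext => s.
rewrite mulN1r [- s + L]addrC (_ : expR (- y * s) = expR (- L * y) * expR (- (- y) * (L - s))).
  by rewrite -rCM; move: (g _) _%:C _%:C => a1 a2 a3; ring.
by rewrite -expRD; congr expR; ring.
Qed.

Section statement.
Variables (phi W : R -> C) (psi kap g : RT -> C) (c0 : C) (B L s1 del T0 : R).
Hypotheses (mg : cm g) (B0 : 0 <= B) (L0 : 0 <= L) (bg : forall s, n1 (g s) <= B * ii 0 L s).
Hypotheses (d0 : 0 < del) (npsi : nice psi) (cpsi : cc psi).
Hypothesis rpsi : forall T, T0 <= T -> rep T (fun y => (expR (- s1 * y))%:C * phi y) psi.
Hypothesis zpsi : forall t, t < s1 + del -> psi t = 0.
Hypotheses (nkap : nice kap) (ckap : cc kap).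
Hypothesis rkap : forall T, T0 <= T -> rep T (fun y => (expR (- (s1 + L) * y) / y)%:C * W y) kap.
Hypothesis ekap : forall t, s1 + L <= t -> kap t = kap (s1 + L).
Hypothesis hid : exists Y, forall y, Y <= y -> (y%:C - c0 + gh g (- y)) * phi y = - (2^-1 * W y).

Let gr (s : RT) : C := g (L - s).

Let bgr s : n1 (gr s) <= B * ii 0 L s.
Proof.
apply: le_trans (bg _) _; rewrite ler_wpM2l//; have [[-> h1 h2]|[-> _]] := ii_case 0 L (L - s); last exact: ii_ge0.
rewrite ii_in//; [by move: h2; lra|by move: h1; lra].
Qed.

Let mgr : cm gr.
Proof.
have hm : measurable_fun setT (fun t : RT => L - t : RT) by exact: measurable_funB.
exact: (cm_comp mg hm).
Qed.

Let ngr : nice gr := g_nice mgr B0 bgr.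

Let Psi (t : RT) := psi (t - L).
Let k (t : RT) : C := c0 * Psi t - cvl psi gr t.

Let nPsi : nice Psi. Proof. exact: nice_shift. Qed.
Let cPsi : cc Psi.
Proof. by apply: (cc_comp cpsi) => x; apply: cvgB; [exact: cvg_id|exact: cvg_cst]. Qed.
Let nk : nice k. Proof. by apply: niceB; [exact: niceZ|exact: cvl_nice]. Qed.
Let ck : cc k. Proof. by apply: ccB; [exact: ccZ|exact: cvl_cc]. Qed.

(** The identity [hid] multiplied by e^{-(s1 + L)y} / y: the delay [L] turns [psi] into [Psi] and
    [g] into the reversed [gr], and 1/y becomes integration. Both sides are continuous, so equality
    of the transforms is pointwise equality. *)
Let eq1 t : Psi t = cvl k heaviside t - 2^-1 * kap t.
Proof.
pose T := Num.max (Num.max (T0 + L) (t + 1)) L + L.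
have TL : L <= T by rewrite /T lerDr le_max L0 orbT.
have TL0 : T0 <= T - L.
  rewrite /T addrK; apply: (@le_trans _ _ (T0 + L)); first by rewrite lerDl.
  by rewrite !le_max lexx.
have T00 : T0 <= T by apply: le_trans TL0 _; rewrite gerBl.
have tT : t < T.
  rewrite /T; apply: (@lt_le_trans _ _ (t + 1)); first by rewrite ltrDl.
  apply: (@le_trans _ _ (Num.max (Num.max (T0 + L) (t + 1)) L)); last by rewrite lerDl.
  by rewrite !le_max lexx orbT.
have Tp : 0 <= T := le_trans L0 TL.
have rPsi : rep T (fun y => (expR (- L * y))%:C * ((expR (- s1 * y))%:C * phi y)) Psi.
  by have := rep_shift npsi L0 (rpsi TL0); rewrite subrK.
have rg : rep T (fun y => (expR (- L * y))%:C * gh g (- y)) gr.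
  apply: (rep_near (Y0 := 0) _ (gh_rep bgr TL)) => y _; rewrite gh_rev//.
  have := @g_nice R g B L mg B0 bg => ng.
  have := LT_L L (- y) ng; congr cL; apply/funext => s.
  have [[-> _ _]|[_ h]] := ii_case 0 L s; first by rewrite mulr1.
  by rewrite (g_zero bg h) !mul0r.
have rk := repB (niceZ c0 nPsi) (cvl_nice npsi ngr) (repZ c0 nPsi rPsi) (cvl_rep npsi ngr Tp (rpsi T00) rg).
have rk1 := cvl_rep nk heaviside_nice Tp rk (heaviside_rep Tp).
have rr := repB (cvl_nice nk heaviside_nice) (niceZ 2^-1 nkap) rk1 (repZ 2^-1 nkap (rkap T00)).
have nr : nice (fun t => cvl k heaviside t - 2^-1 * kap t) by apply: niceB; [exact: cvl_nice nk heaviside_nice|exact: niceZ].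
have cr : cc (fun t => cvl k heaviside t - 2^-1 * kap t) by apply: ccB; [exact: cvl_cc nk heaviside_nice ck|exact: ccZ].
apply: (rep_inj nPsi nr cPsi cr rPsi _ tT).
have [Y hY] := hid; apply: (rep_near (Y0 := Num.max Y 1) _ rr) => y; rewrite ge_max => /andP[yY y1].
have y0 : y%:C != 0 :> C by rewrite (inj_eq (@complexI R)) gt_eqF// (lt_le_trans ltr01 y1).
have yi : (y^-1)%:C = (y%:C)^-1 :> C by rewrite (fmorphV (real_complex R)).
have -> : (expR (- (s1 + L) * y) / y)%:C = (expR (- L * y))%:C * (expR (- s1 * y))%:C * (y%:C)^-1 :> C.
  by rewrite -yi !rCM -expRD; congr ((expR _ / _)%:C); ring.
rewrite yi; have := hY y yY; move: (gh g (- y)) (phi y) (W y) => a1 a2 a3 e.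
have {}e : a3 = - (2 * ((y%:C - c0 + a1) * a2)) by rewrite e mulrN opprK mulVKf// pnatr_eq0.
by rewrite e; move: y%:C y0 (expR _)%:C (expR _)%:C => b1 h b2 b3; field.
Qed.

(** Past s1 + L the function [kap] is constant, so differences of [eq1] say that [psi], shifted to
    start at [s1], satisfies the integrated equation of [ladder]; [zpsi] supplies the gap of length
    [del]. *)
Lemma liouville t : psi t = 0.
Proof.
pose f (x : RT) : C := psi (s1 + x).
have [_ _ [M [K [M0 K0 bpsi]]]] := npsi.
have cf : cc f by apply: (cc_comp cpsi) => x; apply: cvgD; [exact: cvg_cst|exact: cvg_id].
have bf x : n1 (f x) <= M * expR (K * s1) * expR (K * x).
  by apply: le_trans (bpsi _) _; rewrite -mulrA -expRD mulrDr.
(* The substitution r -> L - r undoes the delay and the reversal together: a convolution looking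
   back becomes an integral looking ahead. *)
have kL x : k (s1 + L + x) = Lam c0 g f x.
  rewrite /k /Psi /Lam (_ : s1 + L + x - L = s1 + x); last by ring.
  congr (_ - _).
  have [_ l2] := cI_affine L (or_intror (erefl (-1 : R))) (cvl_L (s1 + L + x) npsi ngr).
  rewrite /cvl -l2; congr cI; apply/funext => r; rewrite /gr /f mulrC; congr (g _ * psi _); ring.
have hrel s u : 0 <= s -> s <= u -> f u - f s = cI (fun r : RT => Lam c0 g f r * (ii s u r)%:C).
  move=> s0 su.
  have fP x : f x = Psi (s1 + L + x) by rewrite /f /Psi; congr psi; ring.
  have kc x : 0 <= x -> kap (s1 + L + x) = kap (s1 + L) by move=> x0; apply: ekap; rewrite lerDl.
  have su' : s1 + L + s <= s1 + L + u by rewrite lerD2l.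
  rewrite !fP !eq1 !kc//; last exact: le_trans s0 su.
  rewrite opprB addrA subrK (cvl_one_incr nk su').
  have Lk : cL (fun r : RT => k r * (ii (s1 + L + s) (s1 + L + u) r)%:C).
    have [l1 _] := cvl_one (s1 + L + u) nk; have := cL_ii (s1 + L + s) (s1 + L + u) l1.
    congr cL; apply/funext => r; rewrite -mulrA rCM; congr (_ * _%:C).
    have [[-> h1 h2]|[-> _]] := ii_case (s1 + L + s) (s1 + L + u) r; last by rewrite mulr0.
    by rewrite h2 mulr1.
  have [_ l2] := cI_affine (s1 + L) (or_introl (erefl (1 : R))) Lk.
  rewrite -l2; congr cI; apply/funext => r; rewrite mul1r [r + _]addrC kL; congr (_ * _%:C).
  by rewrite /ii !lerD2l.
have f0 : forall x, 0 <= x -> f x = 0.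
  apply: (ladder (c0 := c0) (g := g) (M := M * expR (K * s1)) mg B0 bg K0 d0 _ cf bf hrel).
    by rewrite mulr_ge0 ?expR_ge0.
  by move=> x x0 xd; rewrite /f zpsi// ltrD2l.
have [ts|st] := ltP t s1; first by apply: zpsi; move: ts d0; lra.
have -> : psi t = f (t - s1) by rewrite /f addrC subrK.
by apply: f0; rewrite subr_ge0.
Qed.

End statement.
End Liouville.

(** * Estimates for a single potential *)

Section Pair.
Context {R : realType}.
Notation RT := (measurableTypeR R).
Notation C := R[i].
Implicit Types (x y t s T : R).

Lemma bk_mono (c d S S' : R) (A : RT -> RT -> C) : S <= S' -> bk c d S A -> bk c d S' A.
Proof.
move=> SS [h1 h2 h3]; split=> // x s hs; apply: h3; apply: contra hs => /andP[-> /andP[-> h]] /=.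
by apply: le_trans h _; rewrite lerD2r.
Qed.

(** Since x <= 0 and s >= 0, every jump time S + 2x - s is at most [S]: after [S] all steps have
    been taken. It matters that the interval ends at 0. *)
Lemma kk_const (v : RT -> C) (c S : R) (A : RT -> RT -> C) t : bk c 0 S A -> S <= t ->
  kk v c 0 S A t = kk v c 0 S A S.
Proof.
move=> hA St; congr cI; apply/funext => x.
have [[-> cx x0]|[-> _]] := ii_case c 0 x; last by rewrite !mulr0 !mul0r.
have Sx : S + 2 * x <= S by rewrite gerDl mulr_ge0_le0.
congr (_ * _); rewrite /kap Sx (le_trans Sx St); congr (_ + cI _); apply/funext => s.
have [/andP[s0 sS]|h] := boolP (0 <= s <= S + 2 * x); last by rewrite (bk_zero hA h) !mul0r.
have h1 : S + 2 * x - s <= S by apply: le_trans Sx; rewrite gerBl.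
by rewrite h1 (le_trans h1 St).
Qed.

Lemma gh_neg_decay (g : RT -> C) (B L : R) : cm g -> 0 <= B -> (forall s, n1 (g s) <= B * ii 0 L s) ->
  decay (fun y => gh g (- y)) (- L).
Proof.
move=> mg B0 bg.
have : decay (fun y => (expR (L * y))%:C : C) (- L).
  by move=> c' c'L; exists 1, 0 => y y0; rewrite n1_r mul1r ger0_norm ?expR_ge0// ler_expR ler_wpM2r// lerNr ltW.
apply: decay_mono; exists (rI (fun s => B * ii 0 L s)), 0 => y y0.
rewrite n1_r ger0_norm ?expR_ge0// mulrC -rIZ; last by apply: L1Z; exact: L1_ii1.
apply: cI_le.
- by apply: cmM => //; apply: cm_r; apply: meas_expR; exact: measurable_funM.
- by do 2 apply: L1Z; exact: L1_ii1.
- move=> s; rewrite n1Mr ger0_norm ?expR_ge0// mulrC.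
  have hb := bg s; move: hb; have [[-> s0 sL]|[-> h]] := ii_case 0 L s; last first.
    by rewrite mulr0 => /n1_eq0 ->; rewrite n1_0 !mulr0.
  rewrite mulr1 => hb; apply: ler_pM; rewrite ?expR_ge0 ?n1_ge0// ler_expR opprK mulrC.
  by rewrite ler_wpM2r.
Qed.

Lemma decay_idX (F : R -> C) (c : R) : decay F c -> decay (fun y => y%:C * F y) c.
Proof. by move=> h; have := decayM (@decay_id R) h; rewrite add0r. Qed.

Lemma decayZ k (F : R -> C) (c : R) : decay F c -> decay (fun y => k * F y) c.
Proof. by move=> h; have := decayM (decay_cst k) h; rewrite add0r. Qed.

Section potential.
Variables (a b : R) (V : RT -> C) (X Y : C -> C) (A : RT -> RT -> C).
Hypotheses (a0 : a < 0) (b0 : 0 < b) (LV : cL V) (kA : volterra_kernel V a b A) (XY : scattering_functions a b V X Y).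

Let ab : a < b. Proof. exact: lt_trans b0. Qed.
Let hA : bk a b (- (2 * a)) A. Proof. exact: kernel_bk kA. Qed.
Let Sa : 0 <= - (2 * a) + 2 * a. Proof. by rewrite addrC subrr. Qed.
Let N := rI (fun x => n1 (V x)) + 1.
Let N1 : 1 <= N. Proof. by rewrite lerDr rI_ge0// => x; exact: n1_ge0. Qed.

Lemma pot_X y : N <= y -> X ('i%C * y%:C) = - y%:C - jc a b V + gh (jg a b V A) y.
Proof.
move=> yN; have y0 : 0 < y := lt_le_trans ltr01 (le_trans N1 yN).
apply: (scat_Xg ab LV XY kA); first by rewrite gt_eqF.
by rewrite gtr0_norm//; apply: le_trans yN; rewrite lerDl.
Qed.

Lemma pot_Xm y : N <= y -> X ('i%C * (- y)%:C) = y%:C - jc a b V + gh (jg a b V A) (- y).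
Proof.
move=> yN; have y0 : 0 < y := lt_le_trans ltr01 (le_trans N1 yN).
rewrite (scat_Xg ab LV XY kA); last 2 first.
- by rewrite oppr_eq0 gt_eqF.
- by rewrite normrN gtr0_norm//; apply: le_trans yN; rewrite lerDl.
by congr (_ - _ + _); apply: Ceq; rewrite !reimE ?opprK ?oppr0.
Qed.

Lemma pot_u y : N <= y -> exists u u', [/\ scat_u a b V X Y (- y) u u',
  forall x, a <= x -> x <= b -> u x = (expR (- y * x))%:C * Mk A x (- y) &
  2 * Y ('i%C * (- y)%:C) = Fv V a b A y].
Proof.
move=> yN; have y0 : 0 < y := lt_le_trans ltr01 (le_trans N1 yN).
have ny0 : - y != 0 by rewrite oppr_eq0 gt_eqF.
have nyN : rI (fun x => n1 (V x)) <= `|- y| by rewrite normrN gtr0_norm//; apply: le_trans yN; rewrite lerDl.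
have [u [u' hu]] := scat_sol LV XY ny0; exists u, u'; split=> //; first exact: (scat_M ab LV kA ny0 nyN hu).
rewrite (scat_Y ab LV kA ny0 nyN hu); congr cI; apply/funext => x.
by rewrite mulrN mulNr.
Qed.

(** Written as 2y u(0) - (u'(0) + y u(0)), the first term is bounded through the kernel and the
    second through [sol_E] with s = -y. In both, [Mk_bnd] gives the size e^{-2ay}, since e^{-2yt}
    e^{2y(t-a)} does not depend on t. *)
Lemma pot_at0 : exists2 K, 0 <= K & forall y u u', N <= y -> scat_u a b V X Y (- y) u u' ->
  n1 (y%:C * u 0 - u' 0) <= K * (y * expR (- (2 * a) * y)).
Proof.
have [B B0 hB] := Mk_bnd hA.
pose NV := rI (fun x => n1 (V x)).
have NV0 : 0 <= NV by apply: rI_ge0 => x; exact: n1_ge0.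
exists (2 * B + B * NV); first by rewrite addr_ge0 ?mulr_ge0.
move=> y u u' yN hu; have y1 : 1 <= y := le_trans N1 yN.
have y0 : 0 < y := lt_le_trans ltr01 y1.
have ny0 : - y != 0 by rewrite oppr_eq0 gt_eqF.
have nyN : rI (fun x => n1 (V x)) <= `|- y| by rewrite normrN gtr0_norm//; apply: le_trans yN; rewrite lerDl.
have hM := scat_M ab LV kA ny0 nyN hu.
case: hu => hs _ ic _ _.
have [_ /(_ 0 (ltW a0) (ltW b0))] := sol_E (ltW ab) ny0 erefl (hs _ _ (ltW ab)).
rewrite ic subrr !mulr0 subr0 expR0 mul1r => e.
have Ey : (- y)%:C = - y%:C :> C by apply: Ceq; rewrite !reimE ?oppr0.
have -> : y%:C * u 0 - u' 0 = 2 * y%:C * u 0 - (u' 0 - (- y)%:C * u 0).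
  by rewrite Ey; move: (u 0) (u' 0) y%:C => a1 a2 a3; ring.
rewrite e; apply: le_trans (n1B _ _) _; rewrite [leRHS]mulrDl; apply: lerD.
  have x0 : 0 <= - (2 * a) + 2 * 0 by rewrite mulr0 addr0 oppr_ge0 mulr_ge0_le0// ltW.
  rewrite (hM 0 (ltW a0) (ltW b0)) mulr0 expR0 mul1r (_ : 2 * y%:C = (2 * y)%:C); last first.
    by rewrite -rCM; congr (_ * _); apply: Ceq; rewrite /= ?addr0.
  rewrite n1rM ger0_norm ?mulr_ge0 ?(ltW y0)//.
  have := hB 0 (- y) x0; rewrite normrN (gtr0_norm y0) mulr0 addr0 => h.
  apply: le_trans (ler_wpM2l _ h) _; first by rewrite mulr_ge0 ?(ltW y0).
  by rewrite le_eqVlt; apply/orP; left; apply/eqP; rewrite [y * - _]mulrC; ring.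
rewrite (_ : B * NV * (y * expR (- (2 * a) * y)) = (B * (y * expR (- (2 * a) * y))) * NV); last by ring.
rewrite -(rIZ _ (cL_n1 LV)); have [L _] := sol_E (ltW ab) ny0 erefl (hs _ _ (ltW ab)).
apply: cI_le.
- have := cL_sub (c := a) (d := b) (x := a) (y := 0) (f := fun t => V t * u t * (expR (- y * t))%:C) (lexx a) (ltW b0).
  move=> hsub; have : cL (fun t : RT => V t * u t * (expR (- y * t))%:C * (ii a b t)%:C).
    by move: L; congr cL; apply/funext => t; rewrite -rCM mulrA.
  move=> /hsub /cL_cm; congr cm; apply/funext => t; by rewrite -rCM mulrA.
- by apply: L1Z; exact: cL_n1.
move=> t; have [[-> at0 t0]|[-> _]] := ii_case a 0 t; last first.
  by rewrite mulr0 mulr0 n1_0 !mulr_ge0 ?n1_ge0 ?expR_ge0 ?(ltW y0).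
have tb : t <= b := le_trans t0 (ltW b0).
rewrite mulr1 (hM t at0 tb) mulrA n1Mr ger0_norm ?expR_ge0// mulrC.
apply: le_trans (ler_wpM2l (expR_ge0 _) (n1M _ _)) _; rewrite n1Mr ger0_norm ?expR_ge0//.
have t2 : 0 <= - (2 * a) + 2 * t by rewrite addrC -mulrBr mulr_ge0// subr_ge0.
have := hB t (- y) t2; rewrite normrN (gtr0_norm y0) => h.
rewrite (_ : _ * (_ * expR _ * _) = n1 (V t) * (expR (- y * t) * expR (- y * t) * n1 (Mk A t (- y)))); last by ring.
rewrite mulrC ler_wpM2r ?n1_ge0//; apply: le_trans (ler_wpM2l _ h) _; first by rewrite mulr_ge0 ?expR_ge0.
rewrite mulrCA ler_wpM2l// -!expRD (_ : _ + _ = - (2 * a) * y); last by ring.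
by rewrite ler_peMl// expR_ge0.
Qed.

End potential.
End Pair.

(** * Comparison of the two potentials *)

Section PairOfPotentials.
Context {R : realType}.
Notation mu := (@lebesgue_measure R).
Notation RT := (measurableTypeR R).
Notation C := R[i].
Implicit Types (x y t s T : R).

Variables (a b : R) (V1 V2 : RT -> C) (X1 Y1 X2 Y2 : C -> C) (A1 A2 : RT -> RT -> C).
Hypotheses (a0 : a < 0) (b0 : 0 < b) (hab : - a < b) (LV1 : cL V1) (LV2 : cL V2).
Hypotheses (kA1 : volterra_kernel V1 a b A1) (kA2 : volterra_kernel V2 a b A2).
Hypotheses (XY1 : scattering_functions a b V1 X1 Y1) (XY2 : scattering_functions a b V2 X2 Y2).
Hypothesis det : exists Y0 : R, forall y, Y0 <= y ->
  X1 ('i%C * (- y)%:C) * X2 ('i%C * y%:C) = X2 ('i%C * (- y)%:C) * X1 ('i%C * y%:C).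
Hypothesis eqr : {ae mu, forall x, 0 <= x -> x <= b -> V1 x = V2 x}.
Hypothesis supp : forall d : R, 0 < d -> d <= b -> ~ {ae mu, forall x, b - d <= x -> x <= b -> V1 x = 0}.

Let ab : a < b. Proof. exact: lt_trans b0. Qed.
Let N1 := rI (fun x => n1 (V1 x)) + 1.
Let N2 := rI (fun x => n1 (V2 x)) + 1.
Let x1 y := X1 ('i%C * y%:C).
Let x2 y := X2 ('i%C * y%:C).
Let x1m y := X1 ('i%C * (- y)%:C).
Let x2m y := X2 ('i%C * (- y)%:C).
Let y1m y := Y1 ('i%C * (- y)%:C).
Let y2m y := Y2 ('i%C * (- y)%:C).
(** The coefficient of e^{yx} beyond [b] in x2 u1 - x1 u2, for the solutions at z = -y. The
    coefficient of e^{-yx} is proportional to x1m x2 - x2m x1, which vanishes by [det]. *)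
Let h y := (x2 y * y1m y - x1 y * y2m y) / y%:C.
Let phi y := h y / x2 y.
Let g1 := jg a b V1 A1.
Let g2 := jg a b V2 A2.
Let c1 := jc a b V1.
Let c2 := jc a b V2.
Let L := 2 * (b - a).
Let S := - (2 * a).
Let hA1 : bk a b S A1. Proof. exact: kernel_bk kA1. Qed.
Let hA2 : bk a b S A2. Proof. exact: kernel_bk kA2. Qed.
Let Sa : 0 <= S + 2 * a. Proof. by rewrite /S addrC subrr. Qed.
Let L0 : 0 <= L. Proof. by rewrite mulr_ge0// subr_ge0 ltW. Qed.
Let kk1 := kk V1 a b S A1.
Let kk2 := kk V2 a b S A2.
(** Reflected potential, through which solving from [b] down to 0 becomes solving from [- b] up to
    0. *)
Let q (x : RT) : C := V1 (- x).

Let hX1 y : N1 <= y -> x1 y = - y%:C - c1 + gh g1 y. Proof. exact: (pot_X a0 b0 LV1 kA1 XY1). Qed.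
Let hX2 y : N2 <= y -> x2 y = - y%:C - c2 + gh g2 y. Proof. exact: (pot_X a0 b0 LV2 kA2 XY2). Qed.
Let mg1 : cm g1. Proof. exact: (jg_cm LV1 kA1). Qed.
Let mg2 : cm g2. Proof. exact: (jg_cm LV2 kA2). Qed.

Let x2n0 : exists Y0 : R, forall y, Y0 <= y -> x2 y != 0.
Proof. by have [B B0 bg] := jg_bnd LV2 kA2; exact: (X_neq0 mg2 B0 bg hX2). Qed.

(** phi is (y1m - (x1 / x2) y2m) / y. After multiplication by e^{-Sy}, the Y-terms are represented
    by [kk1] and [kk2] up to the factor 1/2. In x1 / x2 - 1 the leading terms -y cancel, leaving a
    transform [e] divided out by [X_inv_rep]. *)
Let f_rep : exists f : RT -> C, [/\ nice f, cc f &
  forall T, L <= T -> rep T (fun y => (expR (- S * y))%:C * phi y) f].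
Proof.
have [B1 B10 bg1] := jg_bnd LV1 kA1; have [B2 B20 bg2] := jg_bnd LV2 kA2.
have [r nr rr] := X_inv_rep mg2 B20 L0 bg2 hX2.
have ng1 := g_nice mg1 B10 bg1; have ng2 := g_nice mg2 B20 bg2.
pose e t := (c2 - c1) * r t + cvl (fun t => g1 t - g2 t) r t.
have ng : nice (fun t => g1 t - g2 t) by exact: niceB.
have ne : nice e by apply: niceD; [exact: niceZ|exact: cvl_nice].
have n1' : nice kk1 := kk_nice hA1 Sa LV1; have n2' : nice kk2 := kk_nice hA2 Sa LV2.
have k1c : cc kk1 := kk_cc hA1 LV1; have k2c : cc kk2 := kk_cc hA2 LV2.
exists (fun t => 2^-1 * (kk1 t - kk2 t - cvl kk2 e t)); split.
- by apply: niceZ; apply: niceB; [exact: niceB|exact: cvl_nice].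
- by apply: ccZ; apply: ccB; [exact: ccB|exact: cvl_cc].
move=> T LT'; have T0 : 0 <= T := le_trans L0 LT'.
have re : rep T (fun y => (c2 - c1) * (x2 y)^-1 + (gh g1 y - gh g2 y) * (x2 y)^-1) e.
  apply: repD; [exact: niceZ|exact: cvl_nice|exact: repZ (rr T LT')|].
  by apply: (cvl_rep ng nr T0); [exact: repB ng1 ng2 (gh_rep bg1 LT') (gh_rep bg2 LT')|exact: rr].
have r1 := kk_rep hA1 Sa LV1 (T := T); have r2 := kk_rep hA2 Sa LV2 (T := T).
have rt := repZ 2^-1 (niceB (niceB n1' n2') (cvl_nice n2' ne)) (repB (niceB n1' n2') (cvl_nice n2' ne) (repB n1' n2' r1 r2) (cvl_rep n2' ne T0 r2 re)).
have [Yx hYx] := x2n0.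
apply: (rep_near (Y0 := Num.max (Num.max N1 N2) (Num.max Yx 1)) _ rt) => y.
rewrite !ge_max => /andP[/andP[yN1 yN2] /andP[yx y1]].
have [_ [_ [_ _ e1]]] := pot_u a0 b0 LV1 kA1 XY1 yN1.
have [_ [_ [_ _ e2]]] := pot_u a0 b0 LV2 kA2 XY2 yN2.
have y0 : y%:C != 0 :> C by rewrite (inj_eq (@complexI R)) gt_eqF// (lt_le_trans ltr01 y1).
have yi : (y^-1)%:C = (y%:C)^-1 :> C by rewrite (fmorphV (real_complex R)).
have X0 := hYx y yx.
have E : (c2 - c1) / x2 y + (gh g1 y - gh g2 y) / x2 y = x1 y / x2 y - 1.
  have -> : x1 y = x2 y + ((c2 - c1) + (gh g1 y - gh g2 y)).
    by rewrite hX1// hX2//; move: (gh g1 y) (gh g2 y) c1 c2 y%:C => p1 p2 p3 p4 p5; ring.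
  by rewrite [in RHS]mulrDl divff// [1 + _]addrC addrK [RHS]mulrDl.
rewrite E -e1 -e2 -/(y1m y) -/(y2m y) -rCM yi /phi /h.
move: (x1 y) (x2 y) X0 (y1m y) (y2m y) y%:C y0 (expR _)%:C => p1 p2 h2 p3 p4 p5 h5 p6.
by field; rewrite h2 h5.
Qed.

Let x_decay : decay x1 0 /\ decay x2 0.
Proof.
have [B1 B10 bg1] := jg_bnd LV1 kA1; have [B2 B20 bg2] := jg_bnd LV2 kA2.
by split; [exact: (X_decay mg1 B10 bg1 hX1)|exact: (X_decay mg2 B20 bg2 hX2)].
Qed.

Let x2i_decay : decay (fun y => (x2 y)^-1) 0.
Proof. by have [B2 B20 bg2] := jg_bnd LV2 kA2; exact: (X_inv_decay mg2 B20 bg2 hX2). Qed.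

Let Lq : cL q. Proof. exact: (cI_opp LV1).1. Qed.

Variable Aq : RT -> RT -> C.
Hypothesis kAq : volterra_kernel q (- b) 0 Aq.

Let eqC (y : R) : (- y)%:C = - y%:C :> C.
Proof. by apply: Ceq; rewrite !reimE ?oppr0. Qed.

(** For w = x2 u1 - x1 u2 one has w(b) = h e^{yb} and w'(b) = y w(b), which after reflection is the
    initial condition of the kernel [Aq]. Then [sol_E] at 0 identifies h F with y w(0) - w'(0), and
    [pot_at0] bounds this by data from the left of 0. *)
Let mirror_bound : decay (fun y => h y * Fv q (- b) 0 Aq y) (2 * a).
Proof.
have [K1 K10 hK1] := pot_at0 X1 Y1 a0 b0 LV1 kA1; have [K2 K20 hK2] := pot_at0 X2 Y2 a0 b0 LV2 kA2.
have [d1 d2] := x_decay.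
have E0 : decay (fun y => (y * expR (- (2 * a) * y))%:C : C) (2 * a).
  by have := decay_idX (@decay_ex R (2 * a)); apply: (decay_near (Y0 := 0)) => y _; rewrite rCM.
have G1 : decay (fun y => x2 y * (K1 * (y * expR (- (2 * a) * y)))%:C) (2 * a).
  have := decayM d2 (decayZ K1%:C E0); rewrite add0r; apply: (decay_near (Y0 := 0)) => y _.
  by congr (_ * _); rewrite rCM.
have G2 : decay (fun y => x1 y * (K2 * (y * expR (- (2 * a) * y)))%:C) (2 * a).
  have := decayM d1 (decayZ K2%:C E0); rewrite add0r; apply: (decay_near (Y0 := 0)) => y _.
  by congr (_ * _); rewrite rCM.
have [Yd hYd] := det.
pose NN := Num.max (Num.max N1 N2) (Num.max Yd 1).
have key y : NN <= y -> exists w1 w2 : C, [/\ h y * Fv q (- b) 0 Aq y = x2 y * w1 - x1 y * w2,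
   n1 w1 <= K1 * (y * expR (- (2 * a) * y)) & n1 w2 <= K2 * (y * expR (- (2 * a) * y))].
  rewrite /NN !ge_max => /andP[/andP[yN1 yN2] /andP[yd y1]].
  have y0 : 0 < y := lt_le_trans ltr01 y1.
  have [u1 [u1' [hu1 _ _]]] := pot_u a0 b0 LV1 kA1 XY1 yN1.
  have [u2 [u2' [hu2 _ _]]] := pot_u a0 b0 LV2 kA2 XY2 yN2.
  exists (y%:C * u1 0 - u1' 0), (y%:C * u2 0 - u2' 0); split; [|exact: hK1|exact: hK2].
  have yc : y%:C != 0 :> C by rewrite (inj_eq (@complexI R)) gt_eqF.
  case: hu1 => s1 _ _ ub1 ub1'; case: hu2 => s2 _ _ ub2 ub2'.
  have s2' : sol V1 (- y) 0 b u2 u2'.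
    by apply: (sol_ae (ltW b0) LV1 _ (s2 0 b (ltW b0))); apply: (ae_imp eqr) => x hx x0 xb; rewrite hx.
  pose w x := x2 y * u1 x - x1 y * u2 x.
  pose w' x := x2 y * u1' x - x1 y * u2' x.
  have sw : sol q (- y) (- b) 0 (fun x => w (- x)) (fun x => - w' (- x)).
    by have := sol_mirror (sol_lin (x2 y) (x1 y) (s1 0 b (ltW b0)) s2'); rewrite oppr0.
  have Ub1 := ub1 b (lexx b); have Ub2 := ub2 b (lexx b).
  have Ey := eqC y.
  have D := hYd y yd; rewrite -/(x1m y) -/(x2 y) -/(x2m y) -/(x1 y) in D.
  have Ny x : - - y * x = y * x by rewrite opprK.
  rewrite opprK in ub1' ub2'.
  have wb : w b = h y * (expR (y * b))%:C.
    apply: (mulfI yc); rewrite /w /h -/(y1m y) -/(y2m y).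
    have U1 : y%:C * u1 b = x1m y * (expR (- y * b))%:C + y1m y * (expR (y * b))%:C.
      have -> : y%:C * u1 b = - ((- y)%:C * u1 b) by rewrite Ey mulNr opprK.
      by rewrite Ub1 !opprK.
    have U2 : y%:C * u2 b = x2m y * (expR (- y * b))%:C + y2m y * (expR (y * b))%:C.
      have -> : y%:C * u2 b = - ((- y)%:C * u2 b) by rewrite Ey mulNr opprK.
      by rewrite Ub2 !opprK.
    have -> : y%:C * (x2 y * u1 b - x1 y * u2 b) = x2 y * (y%:C * u1 b) - x1 y * (y%:C * u2 b).
      by move: (x2 y) (x1 y) (u1 b) (u2 b) y%:C => p1 p2 p3 p4 p5; ring.
    rewrite U1 U2; move: D yc; move: (x1 y) (x2 y) (x1m y) (x2m y) (y1m y) (y2m y) y%:C (expR _)%:C (expR _)%:C => p1 p2 p3 p4 p5 p6 p7 p8 p9 D yc.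
    transitivity ((p3 * p2 - p4 * p1) * p9 + (p2 * p5 - p1 * p6) * p8); first by ring.
    by rewrite D subrr mul0r add0r; field.
  have wb' : w' b = y%:C * w b.
    rewrite wb /w' ub1' ub2' /h -/(x1m y) -/(x2m y) -/(y1m y) -/(y2m y).
    move: D yc; move: (x1 y) (x2 y) (x1m y) (x2m y) (y1m y) (y2m y) y%:C (expR _)%:C (expR _)%:C => p1 p2 p3 p4 p5 p6 p7 p8 p9 D yc.
    transitivity (- (p3 * p2 - p4 * p1) * p9 + (p2 * p5 - p1 * p6) * p8); first by ring.
    by rewrite D subrr oppr0 mul0r add0r; field.
  have ny0 : - y != 0 by rewrite oppr_eq0 gt_eqF.
  have nb0 : - b <= 0 by rewrite oppr_le0 ltW.
  have ic : - w' (- - b) = (- y)%:C * w (- - b) by rewrite opprK wb' Ey mulNr.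
  have nyN : rI (fun x => n1 (q x)) <= `|- y|.
    have -> : rI (fun x => n1 (q x)) = rI (fun x => n1 (V1 x)).
      have [_ e] := rI_affine 0 (L1_meas (cL_n1 LV1)) (or_intror erefl) (cL_n1 LV1).
      by rewrite -e; congr rI; apply/funext => x; rewrite mulN1r addr0.
    by rewrite normrN gtr0_norm//; apply: le_trans yN1; rewrite /N1 lerDl.
  have hM := sol_M nb0 Lq kAq ny0 nyN sw ic.
  have [_ /(_ 0 nb0 (lexx 0))] := sol_E nb0 ny0 erefl sw.
  rewrite [X in _ - X](_ : _ = 0); last by rewrite ic subrr mulr0.
  rewrite subr0 mulr0 expR0 mul1r oppr0 Ey => e.
  have -> : x2 y * (y%:C * u1 0 - u1' 0) - x1 y * (y%:C * u2 0 - u2' 0) = - w' 0 - - y%:C * w 0.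
    by rewrite /w' /w; move: (x2 y) (x1 y) (u1 0) (u2 0) (u1' 0) (u2' 0) y%:C => p1 p2 p3 p4 p5 p6 p7; ring.
  rewrite e /Fv -cIZ; last first.
    by apply: (Fv_L (kernel_bk kAq) _ Lq); rewrite addrC subrr.
  congr cI; apply/funext => t; have [[-> bt t0]|[-> _]] := ii_case (- b) 0 t; last by rewrite mul0r !mulr0 !mul0r mulr0.
  rewrite (hM t bt t0) opprK wb mulr1 mul1r.
  have -> : expR (- (2 * y * t)) = expR (y * b) * expR (- y * (t + b)) * expR (- y * t).
    by rewrite -!expRD; congr expR; ring.
  rewrite -!rCM; move: (h y) (q t) (Mk _ _ _) (expR _)%:C (expR _)%:C (expR _)%:C => p1 p2 p3 p4 p5 p6; ring.
move=> c' c'a.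
have [C1 [Y1' H1]] := G1 c' c'a; have [C2 [Y2' H2]] := G2 c' c'a.
exists (C1 + C2), (Num.max NN (Num.max Y1' Y2')) => y.
rewrite ge_max => /andP[yN]; rewrite ge_max => /andP[yY1 yY2].
have [w1 [w2 [-> b1 b2]]] := key y yN.
apply: le_trans (n1B _ _) _; rewrite mulrDl; apply: lerD.
  apply: le_trans _ (H1 y yY1); apply: le_trans (n1M _ _) _; rewrite n1Mr ler_wpM2l ?n1_ge0//.
  by apply: le_trans b1 _; exact: ler_norm.
apply: le_trans _ (H2 y yY2); apply: le_trans (n1M _ _) _; rewrite n1Mr ler_wpM2l ?n1_ge0//.
by apply: le_trans b2 _; exact: ler_norm.
Qed.

(** Twice [del] is a + b, what remains of 2b after the stretch of length b - a on which [f] is to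
    vanish. *)
Let del := (b + a) / 2.
Let del0 : 0 < del. Proof. by rewrite divr_gt0// -ltrBlDr sub0r. Qed.
Let kkq := kk q (- b) 0 (2 * b) Aq.
Let hAq : bk (- b) 0 (2 * b) Aq.
Proof. by have := kernel_bk kAq; rewrite mulrN opprK. Qed.
Let Sb : 0 <= 2 * b + 2 * - b. Proof. by rewrite mulrN subrr. Qed.

(** Vanishing of [kkq] before 2 del would mean decay of e^{-2by} F at rate 2 del; [near_zero] would
    then annihilate V1 on [b - del, b], contrary to [supp]. *)
Let q_nonzero : ~ (forall t, t < 2 * del -> kkq t = 0).
Proof.
move=> kz.
have d2 : 2 * del = b + a by rewrite /del mulrC divfK.
have H : decay (fun y => (expR (- (2 * b) * y) / y)%:C * Fv q (- b) 0 Aq y) (2 * del).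
  exact: (rep_decay (kk_nice hAq Sb Lq) (lexx _) kz (kk_rep hAq Sb Lq (T := 2 * del))).
have H2 : decay (fun y => (expR (2 * - b * y))%:C * Fv q (- b) 0 Aq y) (2 * del).
  apply: (decay_near (Y0 := 1) _ (decay_idX H)) => y y1; rewrite mulrA rCM mulrCA divff ?mulr1 ?mulrN//.
  by rewrite gt_eqF// (lt_le_trans ltr01 y1).
have bd : - b + del <= 0.
  by rewrite /del; move: a0 b0; lra.
have := near_zero del0 bd Lq kAq H2 => hz.
have db : del <= b by rewrite /del; move: a0 b0; lra.
apply: (supp del0 db).
have L1' : cL (fun x : RT => V1 x * (ii (b - del) b x)%:C) by exact: cL_ii.
have Ln := cL_n1 L1'.
have [l1 l2] := rI_affine 0 (L1_meas Ln) (or_intror erefl) Ln.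
have I0 : rI (fun x => n1 (V1 x * (ii (b - del) b x)%:C)) = 0.
  rewrite -l2 -[RHS](@rI_0 R); apply: rI_ae => //; first exact: L1_0.
  apply: (ae_imp hz) => x hx; rewrite mulN1r addr0.
  have [[e x1' x2']|[-> _]] := ii_case (b - del) b (- x); last by rewrite mulr0 n1_0.
  have -> : V1 (- x) = 0 by apply: hx; [move: x2'|move: x1']; lra.
  by rewrite mul0r n1_0.
apply: (ae_imp (cI_eq0 L1' I0)) => x hx h1 h2.
by move: hx; rewrite ii_in// mulr1.
Qed.

(** The rates S of e^{-Sy}, 2b of e^{-2by} and 2a of h F add up to 2b. If [f] were nonzero at some
    s0 < b - a, Titchmarsh's theorem would make [kkq] vanish on r < 2b - s0, in particular before a
    + b = 2 del. *)
Let f_zero (f : RT -> C) : nice f -> cc f ->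
  (forall T, L <= T -> rep T (fun y => (expR (- S * y))%:C * phi y) f) ->
  forall t, t < S + (b + a) -> f t = 0.
Proof.
move=> nf cf rf s0 hs; apply/eqP/negPn/negP => fs; apply: q_nonzero => r hr.
have T0 : 0 <= L by [].
have nq : nice kkq := kk_nice hAq Sb Lq; have cq : cc kkq := kk_cc hAq Lq.
have rq := kk_rep hAq Sb Lq (T := L).
have L2b : 2 * b <= L by rewrite /L ler_pM2l// lerBrDr gerDl ltW.
have rc := cvl_rep nf nq T0 (rf L (lexx L)) rq.
have D : decay (fun y => (expR (- S * y))%:C * phi y * ((expR (- (2 * b) * y) / y)%:C * Fv q (- b) 0 Aq y)) (2 * b).
  have D1 := decayM (decayM (@decay_ex R S) x2i_decay) (decayM (decayM (@decay_ex R (2 * b)) (@decay_inv R)) mirror_bound).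
  have e : S + 0 + (2 * b + 0 + 2 * a) = 2 * b by rewrite /S; ring.
  rewrite e in D1; apply: (decay_near (Y0 := 0) _ D1) => y _; rewrite -rCM /phi.
  by move: (h y) (x2 y)^-1 (Fv _ _ _ _ _) (expR _)%:C (expR _)%:C (y^-1)%:C => p1 p2 p3 p4 p5 p6; ring.
have cz := lerch_rep (cvl_nice nf nq) (cvl_cc nf nq cf) rc D L2b.
have b2 : 0 <= 2 * b by rewrite mulr_ge0// ltW.
have := titchmarsh nf nq cf cq b2 cz (r := s0) (s := r).
have d2 : 2 * del = b + a by rewrite /del mulrC divfK.
have -> : s0 + r < 2 * b by move: hs hr; rewrite d2 /S; lra.
by move=> /(_ isT)/eqP; rewrite mulf_eq0 (negbTE fs) => /eqP.
Qed.

Let v (x : RT) : C := V2 x - V1 x.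
Let W y := Fv v a 0 (prodk a A1 A2) y.
Let Lv : cL v. Proof. exact: cLB. Qed.
Let hP : bk a 0 (- (4 * a)) (prodk a A1 A2).
Proof. exact: (prodk_bk hA1 hA2). Qed.

(** The Wronskian vanishes at [a], where both solutions have logarithmic derivative -y. At [b] it is
    2 (x1m y2m - y1m x2m) / y up to sign, and [det] replaces x1m by x2m x1 / x2, which brings out
    phi. The integral runs over [a, 0] only, by [eqr]. *)
Let wronsk : exists Y0 : R, forall y, Y0 <= y -> x2m y * phi y = - (2^-1 * W y).
Proof.
have [Yd hYd] := det; have [Yx hYx] := x2n0.
exists (Num.max (Num.max (Num.max N1 N2) Yd) (Num.max Yx 1)) => y.
rewrite !ge_max => /andP[/andP[/andP[yN1 yN2] yd] /andP[yx y1]].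
have y0 : 0 < y := lt_le_trans ltr01 y1.
have yc : y%:C != 0 :> C by rewrite (inj_eq (@complexI R)) gt_eqF.
have [u1 [u1' [hu1 m1 _]]] := pot_u a0 b0 LV1 kA1 XY1 yN1.
have [u2 [u2' [hu2 m2 _]]] := pot_u a0 b0 LV2 kA2 XY2 yN2.
have Ey := eqC y.
case: hu1 => s1 ua1 ia1 ub1 ub1'; case: hu2 => s2 ua2 ia2 ub2 ub2'.
have := wronskian (ltW ab) (s1 a b (ltW ab)) (s2 a b (ltW ab)).
rewrite [X in _ - X](_ : _ = 0); last by rewrite ia1 ia2; move: (u1 a) (u2 a) (_%:C) => p1 p2 p3; ring.
rewrite subr0.
have eW : cI (fun t : RT => (V1 t - V2 t) * (u1 t * u2 t) * (ii a b t)%:C) = - W y.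
  have hP' := bk_mono (lexx _) hP.
  have S4 : 0 <= - (4 * a) + 2 * a by move: a0; lra.
  have LW := Fv_L hP S4 Lv y.
  rewrite /W /Fv -(cIN LW); apply: cI_ae.
  - have := (acB (acM (ltW ab) (s1 a b (ltW ab)).2 (s2 a b (ltW ab)).1) (acM (ltW ab) (s1 a b (ltW ab)).1 (s2 a b (ltW ab)).2)).1.
    congr cL; apply/funext => t; congr (_ * _).
    by move: (V1 t) (V2 t) (_%:C) (u1 t) (u2 t) (u1' t) (u2' t) => p1 p2 p3 p4 p5 p6 p7; ring.
  - exact: cLN LW.
  - apply: (ae_imp2 eqr (ae_neq 0)) => t ht t0.
    have [[-> at0 tb]|[e1 hn]] := ii_case a b t; last first.
      rewrite e1 mulr0; have [[_ g1' g2']|[-> _]] := ii_case a 0 t; last by rewrite mul0r mulr0 mul0r oppr0.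
      by move: hn; rewrite g1' (le_trans g2' (ltW b0)).
    have [tn|tp] := leP t 0; last first.
      by rewrite /v (ht (ltW tp) tb) !subrr !mul0r oppr0.
    rewrite (ii_in at0 tn) mul1r mulr1 (prodk_Mk hA1 hA2 (- y) at0 tn) m1// m2// /v.
    have -> : expR (- (2 * y * t)) = expR (- y * t) * expR (- y * t) by rewrite -expRD; congr expR; ring.
    by rewrite -rCM; move: (V1 t) (V2 t) (Mk _ _ _) (Mk _ _ _) (expR _)%:C => p1 p2 p3 p4 p5; ring.
rewrite eW => eq0.
have D := hYd y yd; rewrite -/(x1m y) -/(x2 y) -/(x2m y) -/(x1 y) in D.
have Ub (u : RT -> C) (p p' : C) : (- y)%:C * u b = - (p * (expR (- y * b))%:C + p' * (expR (- - y * b))%:C) ->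
    u b = (p * (expR (- y * b))%:C + p' * (expR (y * b))%:C) / y%:C.
  move=> e; apply: (mulfI yc); rewrite [RHS]mulrC divfK//.
  have -> : y%:C * u b = - ((- y)%:C * u b) by rewrite Ey mulNr opprK.
  by rewrite e !opprK.
have U1 := Ub u1 _ _ (ub1 b (lexx b)); have U2 := Ub u2 _ _ (ub2 b (lexx b)).
rewrite opprK in ub1' ub2'.
have ee : (expR (- y * b))%:C * (expR (y * b))%:C = 1 :> C.
  by rewrite rCM -expRD mulNr addNr expR0.
have EW : W y = (2 / y%:C) * (x1m y * y2m y - y1m y * x2m y).
  rewrite -[LHS]opprK -eq0 ub1' ub2' U1 U2 -/(x1m y) -/(x2m y) -/(y1m y) -/(y2m y).
  transitivity ((2 / y%:C) * (x1m y * y2m y - y1m y * x2m y) * ((expR (- y * b))%:C * (expR (y * b))%:C)); last by rewrite ee mulr1.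
  move: yc; move: (x1m y) (x2m y) (y1m y) (y2m y) y%:C (expR _)%:C (expR _)%:C => p1 p2 p3 p4 p5 p6 p7 h5; by field.
rewrite EW /phi /h; move: (hYx y yx) yc D; move: (x1 y) (x2 y) (x1m y) (x2m y) (y1m y) (y2m y) y%:C => p1 p2 p3 p4 p5 p6 p7 h2 h7 D.
have e3 : p3 = p4 * p1 / p2 by rewrite -D mulfK.
by rewrite e3; field; rewrite h2 h7.
Qed.

(** Once f = 0, phi decays faster than every exponential, which outweighs the growth e^{Ly} of x2m
    in [W_id]. So [W] decays at rate 0, twice the right end of [a, 0], and [U_unique] applies to V2
    - V1 with the kernel [prodk]. *)
Lemma pair_unique : {ae mu, forall x, a <= x -> x <= 0 -> V1 x = V2 x}.
Proof.
have [f [nf cf rf]] := f_rep.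
have fz := f_zero nf cf rf.
have [B2 B20 bg2] := jg_bnd LV2 kA2.
have S0 : 0 <= S by rewrite /S oppr_ge0 mulr_ge0_le0// ltW.
have ba : 0 < b + a by rewrite -ltrBlDr sub0r.
have SL : - (4 * a) <= S + L by rewrite /S /L; move: b0; lra.
have hP' := bk_mono SL hP.
have S4 : 0 <= S + L + 2 * a by rewrite /S /L; move: a0 b0; lra.
have W_id : exists Y0 : R, forall y, Y0 <= y -> (y%:C - c2 + gh g2 (- y)) * phi y = - (2^-1 * W y).
  have [Y0 hY] := wronsk; exists (Num.max Y0 N2) => y; rewrite ge_max => /andP[y1 y2].
  by rewrite -(hY y y1) /x2m (pot_Xm a0 b0 LV2 kA2 XY2 y2).
have f0 := liouville mg2 B20 L0 bg2 ba nf cf rf fz (kk_nice hP' S4 Lv) (kk_cc hP' Lv)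
  (fun T _ => kk_rep hP' S4 Lv (T := T)) (fun t => kk_const v hP') W_id.
have dphi T : decay phi T.
  pose T' := Num.max L (T + S).
  have dz : decay (fun y => (expR (- S * y))%:C * phi y) T'.
    apply: (rep_decay nf (lexx T') (fun t _ => f0 t)); apply: rf.
    by rewrite le_max lexx.
  have := decayM (@decay_ex R (- S)) dz => d1.
  have TT : T <= - S + T' by rewrite addrC lerBrDr le_max lexx orbT.
  apply: (decay_near (Y0 := 0) _ (decay_le TT d1)) => y _.
  by rewrite mulrA rCM -expRD -mulrDl addNr mul0r expR0 mul1r.
have dW : decay W (2 * 0).
  rewrite mulr0; have [Y0 hY] := W_id.
  have d1 : decay (fun y => y%:C - c2 + gh g2 (- y)) (- L).
    have L00 : - L <= 0 by rewrite oppr_le0.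
    apply: decayD; last exact: (gh_neg_decay mg2 B20 bg2).
    by apply: (decay_le L00); apply: decayB; [exact: decay_id|exact: decay_cst].
  have := decayZ (-2) (decayM d1 (dphi L)); rewrite addNr.
  apply: (decay_near (Y0 := Y0)) => y yY; rewrite hY//.
  by rewrite mulrNN mulVKf// pnatr_eq0.
have Sv : 0 <= - (4 * a) + 2 * a by move: a0; lra.
have := U_unique hP Sv (ltW a0) Lv dW => hz.
by apply: (ae_imp hz) => x hx ax x0; have /eqP := hx ax x0; rewrite /v subr_eq0 => /eqP.
Qed.

End PairOfPotentials.

(** * Essential support and its convex hull *)

Section EssentialSupport.
Context {R : realType}.
Notation mu := (@lebesgue_measure R).

(** A Lindelöf argument: the complement of the support is covered by the countably many rational
    intervals on which V vanishes almost everywhere. *)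
Lemma ae_ess_support (V : R -> R[i]) : {ae mu, forall x, ~ ess_support V x -> V x = 0}.
Proof.
(* The pair of rationals is coded by [n]. Stating the vanishing as an implication makes [P n] true
   almost everywhere for every interval: if V is not almost everywhere zero there, [P n] says
   nothing. *)
pose P (n : nat) (t : R) := if unpickle n is Some (p, q) then
  {ae mu, forall t, ratr p < t -> t < ratr q -> V t = 0} -> ratr p < t -> t < ratr q -> V t = 0 else True.
have hP n : {ae mu, forall x, P n x}.
  rewrite /P; case: (unpickle n) => [[p q]|]; last by apply: aeW.
  have [h|h] := pselect {ae mu, forall t, ratr p < t -> t < ratr q -> V t = 0}.
    by apply: (ae_imp h) => x hx _; exact: hx.
  by apply: aeW => x /h.
apply: (ae_imp (ae_all hP)) => x hx hn.
have [e e0 he] : exists2 e : R, 0 < e & {ae mu, forall t, ball x e t -> V t = 0}.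
  apply: contra_notP hn => hn e e0 he; apply: hn; by exists e.
have xe1 : x - e < x by rewrite gtrBl.
have xe2 : x < x + e by rewrite ltrDl.
have [p] := rat_in_itvoo xe1.
move=> /[!in_itv]/= /andP[p1 p2].
have [q] := rat_in_itvoo xe2.
move=> /[!in_itv]/= /andP[q1 q2].
have := hx (pickle (p, q)); rewrite /P pickleK; apply => //.
apply: (ae_imp he) => t ht pt tq; apply: ht.
rewrite /ball/= ltr_norml; apply/andP; split.
  by rewrite ltrBrDr addrC ltrBlDr; apply: lt_trans tq _.
by rewrite ltrBlDr -ltrBlDl; apply: lt_trans pt.
Qed.

(** Were V zero on [b - d, b], the support would lie in the half-line up to b - d; this is an
    interval, so the convex hull would lie there too and miss [b]. *)
Lemma hull_not_ae0 (V : R -> R[i]) (a b d : R) : a <= b -> 0 < d ->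
  convex_hull (ess_support V) = `[a, b]%classic ->
  ~ {ae mu, forall x, b - d <= x -> x <= b -> V x = 0}.
Proof.
move=> ab d0 hV h0.
have sub : ess_support V `<=` `[a, b]%classic by rewrite -hV; exact: sub_gen_smallest.
have V0 : {ae mu, forall x, b - d < x -> V x = 0}.
  apply: (ae_imp2 h0 (ae_ess_support V)) => x h1 h2 xd; have [xb|bx] := leP x b; first by apply: h1 => //; exact: ltW.
  by apply: h2 => /sub; rewrite /= in_itv/= => /andP[_]; rewrite leNgt bx.
have sub2 : ess_support V `<=` `]-oo, b - d]%classic.
  move=> x hx; rewrite /= in_itv/= leNgt; apply/negP => xd.
  apply: (hx (x - (b - d))); first by rewrite subr_gt0.
  apply: (ae_imp V0) => t ht; rewrite /ball/= ltr_norml => /andP[_ h]; apply: ht.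
  by move: h; rewrite ltrD2l ltrN2.
have : convex_hull (ess_support V) `<=` `]-oo, b - d]%classic.
  by apply: smallest_sub => //; exact: interval_is_interval.
rewrite hV => /(_ b); rewrite /= !in_itv/= ab lexx => /(_ isT).
by rewrite leNgt ltrBlDr ltrDl d0.
Qed.

End EssentialSupport.

Theorem theorem1p1 (R : realType) (a b : R) (V1 V2 : R -> R[i])
    (X1 Y1 X2 Y2 : R[i] -> R[i])
    (a_lt0 : a < 0) (b_gt0 : 0 < b) (lt_ab : `|a| < `|b|)
    (V1_L1 : cintegrable V1) (V2_L1 : cintegrable V2)
    (V1_supp : convex_hull (ess_support V1) = `[a, b]%classic)
    (V2_supp : convex_hull (ess_support V2) = `[a, b]%classic)
    (XY1 : scattering_functions a b V1 X1 Y1)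
    (XY2 : scattering_functions a b V2 X2 Y2)
    (* equality of meromorphic functions: off the zeros of the denominators *)
    (eq_det : forall k : R[i], X1 k != 0 -> X2 k != 0 ->
       scattering_det X1 k = scattering_det X2 k)
    (eq_right : {ae @lebesgue_measure R, forall x, `[0, b]%classic x -> V1 x = V2 x}) :
  {ae @lebesgue_measure R, forall x, `[a, b]%classic x -> V1 x = V2 x}.
Proof.
have ab : a < b by exact: lt_trans b_gt0.
have [A1 kA1] := kernel_exists a b V1_L1.
have [A2 kA2] := kernel_exists a b V2_L1.
(* The kernel of the reflected potential on [-b, 0], for the passage from [b] down to 0. *)
have [Aq kAq] := kernel_exists (- b) 0 (cI_opp V1_L1).1.
have hab : - a < b by move: lt_ab; rewrite ltr0_norm// gtr0_norm.
have eqr : {ae @lebesgue_measure R, forall x, 0 <= x -> x <= b -> V1 x = V2 x}.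
  by apply: (ae_imp eq_right) => x hx x0 xb; apply: hx; rewrite /= in_itv/= x0.
(* On the imaginary axis, far enough up, neither [X1] nor [X2] vanishes, so the determinants may be
   compared there and cross-multiplied. *)
have det : exists Y0 : R, forall y, Y0 <= y ->
    X1 ('i%C * (- y)%:C) * X2 ('i%C * y%:C) = X2 ('i%C * (- y)%:C) * X1 ('i%C * y%:C).
  have [B1 B10 bg1] := jg_bnd V1_L1 kA1; have [B2 B20 bg2] := jg_bnd V2_L1 kA2.
  have [Z1 h1] := X_neq0 (jg_cm V1_L1 kA1) B10 bg1 (pot_X a_lt0 b_gt0 V1_L1 kA1 XY1).
  have [Z2 h2] := X_neq0 (jg_cm V2_L1 kA2) B20 bg2 (pot_X a_lt0 b_gt0 V2_L1 kA2 XY2).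
  exists (Num.max Z1 Z2) => y; rewrite ge_max => /andP[/h1 n1y /h2 n2y].
  have e : - ('i%C * y%:C) = 'i%C * (- y)%:C.
    by rewrite -mulrN; congr (_ * _); apply: Ceq; rewrite !reimE ?oppr0.
  have := eq_det ('i%C * y%:C) n1y n2y; rewrite /scattering_det e !mulNr => /oppr_inj /eqP.
  by rewrite eqr_div// => /eqP.
have supp d : 0 < d -> d <= b -> ~ {ae @lebesgue_measure R, forall x, b - d <= x -> x <= b -> V1 x = 0}.
  by move=> d0 _; exact: hull_not_ae0 (ltW ab) d0 V1_supp.
have left := pair_unique a_lt0 b_gt0 hab V1_L1 V2_L1 kA1 kA2 XY1 XY2 det eqr supp kAq.
apply: (ae_imp2 left eqr) => x hl hr; rewrite /= in_itv/= => /andP[ax xb].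
by have [x0|x0] := leP x 0; [exact: hl|exact: hr (ltW x0) xb].
Qed.
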